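(* Let $\alpha_0=(1+\sqrt5)/2$. For every real $q$ with $0<q<1$ the following identities hold: \begin{enumerate} \item $\displaystyle\int_0^q \frac{E(t)^5}{E(t^5)}\, r(t)^5\,\frac{dt}{t} = r(q)^5$, and $r(q)^5=\sqrt{\alpha_0^{10}+1}-\alpha_0^5$ when $q=e^{-2\pi/\sqrt5}$; \item $\displaystyle\int_0^q \frac{E(t^2)^8E(t^3)^6}{E(t)^{10}}\,dt = q\frac{E(q^2)E(q^6)^5}{E(q)^5E(q^3)}$, and this equals $\frac{\sqrt2}{12}$, $\frac{\sqrt3-1}{24}$, $\frac{\sqrt6-2}{36}$ when $q=e^{-2\pi/\sqrt6}$, $e^{-2\pi/\sqrt3}$, $e^{-2\pi/\sqrt2}$ respectively; \item $\displaystyle\int_0^q \frac{E(t)^8E(t^6)^6}{E(t^2)^{10}}\,dt = q\frac{E(q)^4E(q^6)^8}{E(q^2)^8E(q^3)^4}$, and this equals $\frac{(\sqrt2-1)^2}{3}$, $\frac{(2-\sqrt3)^2}{3}$, $\frac{(\sqrt6-2)^2}{18}$ when $q=e^{-2\pi/\sqrt6}$, $e^{-2\pi/\sqrt3}$, $e^{-2\pi/\sqrt2}$ respectively; \item $\displaystyle\int_0^q \frac{E(t)^6E(t^6)^8}{E(t^3)^{10}}\,dt = q\frac{E(q)^3E(q^6)^9}{E(q^2)^3E(q^3)^9}$, and this equals $\frac{3\sqrt2-4}{4}$, $\frac{(\sqrt3-1)^3}{16}$, $\frac{(\sqrt6-2)^3}{8}$ when $q=e^{-2\pi/\sqrt6}$,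 $e^{-2\pi/\sqrt3}$, $e^{-2\pi/\sqrt2}$ respectively; \item $\displaystyle\int_0^q \frac{E(t^2)^8E(t^4)^4}{E(t)^{8}}\,dt = q\frac{E(q^2)^2E(q^8)^4}{E(q)^4E(q^4)^2}$, and this equals $\frac{1}{\sqrt{32}}$ when $q=e^{-\pi/\sqrt2}$; \item $\displaystyle\int_0^q \frac{E(t^3)^{10}}{E(t)^{6}}\,dt = q\frac{E(q^9)^3}{E(q)^3}$, and this equals $\frac{1}{3\sqrt3}$ when $q=e^{-2\pi/3}$. \end{enumerate}
   Context: For $|q|<1$, $E(q)=\prod_{j=1}^\infty(1-q^j)$ (Euler's product). The Rogers–Ramanujan continued fraction in product form is $r(q)=q^{1/5}\prod_{j=1}^\infty\frac{(1-q^{5j-4})(1-q^{5j-1})}{(1-q^{5j-3})(1-q^{5j-2})}$ (real positive fifth root for $0<q<1$), so $r(q)^5=q\prod_{j\ge1}\frac{(1-q^{5j-4})^5(1-q^{5j-1})^5}{(1-q^{5j-3})^5(1-q^{5j-2})^5}$. *)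

(* Defs.v *)
From Stdlib Require Import Reals.
From Coquelicot Require Import Coquelicot.
Open Scope R_scope.

Fixpoint prodR (f : nat -> R) (n : nat) : R :=
  match n with
  | O => 1
  | S m => prodR f m * f (S m)
  end.

Definition inf_prod (f : nat -> R) : R := real (Lim_seq (fun n => prodR f n)).

Definition E (q : R) : R := inf_prod (fun j => 1 - q ^ j).

(* r(q)^5 in product form (Rogers--Ramanujan continued fraction, fifth power). *)
Definition r5 (q : R) : R :=
  q * inf_prod (fun j =>
        ((1 - q ^ (5 * j - 4)) ^ 5 * (1 - q ^ (5 * j - 1)) ^ 5) /
        ((1 - q ^ (5 * j - 3)) ^ 5 * (1 - q ^ (5 * j - 2)) ^ 5)).

Definition alpha0 : R := (1 + sqrt 5) / 2.

(* Main.v *)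
(** By Jacobi's triple product, [(x + 1/x) - (y + 1/y)] times the infinite product of
    [(1 - xyQ) (1 - Q/(xy)) (1 - Qx/y) (1 - Qy/x)] over the powers [Q] of the nome has rank two in
    [x] and [y], which is Weierstrass' three-term identity.
    Differentiating it at a double point expresses theta quotients as differences of Weierstrass functions or of their
    primitives; at torsion points these become Lambert series.  Each integrand is the derivative of the right-hand side
    because the logarithmic derivative of an eta quotient is a Lambert series, and the two Lambert series agree.

    The special values follow from [eta(1/t) = sqrt t * eta(t)], applied at those [t] where it relates the factors of the
    eta quotient, together with polynomial relations between the Hauptmoduln of level 6 and Ramanujan's
    [1/y - 11 - y = E(q)^6 / (q E(q^5)^6)] for [y = r(q)^5].  The inversion formula comes from the transformation of
    theta series, obtained as a limit of a finite identity of Polya between binomial coefficients and powers of cosines. *)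
Require Import Defs.
From Stdlib Require Import Reals Lra Lia Psatz ZArith List Permutation.
From Coquelicot Require Import Coquelicot.
Open Scope R_scope.

(** * Infinite products *)

(** Points of the curve enter only through [c = x + 1/x]. This number is real both for [x] on the
    unit circle and for [x] a power of [q], so torsion points in the direction of either period are
    handled by the same real functions, and the origin is [c = 2]. Complex numbers serve only to
    prove the rank-two property and the theta inversion, whose consequences are real. At level 6 one
    Lambert series yields all three integrals, because the reciprocals of the three right-hand sides
    differ by constants. At levels 5, 8 and 9 a root of unity is compared with its Galois conjugate
    or with a power of [q]. Ramanujan's relation for [r(q)^5] comes from evaluating the same two
    Lambert series twice: at the points [q], [q^2] of nome [q^5], and at the fifth roots of unity of
    nome [q]. The multiplicative constant in the theta limit is left undetermined; a functional
    equation under doubling and inverting the argument then fixes it, which replaces Poisson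
    summation and the Gaussian integral. *)

Definition seq_bounded (b : nat -> R) : Prop := exists B, forall n, Rabs (b n) <= B.

(** The convergence criterion for products and Lambert series alike. It is stable under sums, under
    bounded factors and under factors polynomial in [n], so convergence is settled by a closure
    calculus. *)
Definition egeo (a : nat -> R) : Prop :=
  exists M r, 0 <= M /\ 0 <= r < 1 /\ forall n, Rabs (a n) <= M * r ^ n.

Lemma egeo_pos (a : nat -> R) : egeo a ->
  exists M r, 0 < M /\ 0 < r < 1 /\ forall n, Rabs (a n) <= M * r ^ n.
Proof.
  intros (M & r & HM & Hr & H).
  exists (M + 1), (Rmax r (1/2)). split; [lra|]. split.
  - unfold Rmax; destruct Rle_dec; lra.
  - intros n. apply Rle_trans with (1 := H n).
    apply Rmult_le_compat; try lra.
    + apply pow_le; lra.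
    + apply pow_incr. split; [lra|]. apply Rmax_l.
Qed.

(** [prodR] ignores index 0, where terms such as [/ (1 - q ^ n)] degenerate; enlarging the constant
    absorbs that one value. *)
Lemma egeo_from1 (a : nat -> R) (M r : R) : 0 < r < 1 ->
  (forall n, (1 <= n)%nat -> Rabs (a n) <= M * r ^ n) -> egeo a.
Proof.
  intros Hr H.
  exists (Rmax M (Rabs (a 0%nat))), r.
  assert (H0 : 0 <= Rmax M (Rabs (a 0%nat))).
  { apply Rle_trans with (2 := Rmax_r _ _). apply Rabs_pos. }
  split; [exact H0|]. split; [lra|].
  intros [|n].
  - simpl. rewrite Rmult_1_r. apply Rmax_r.
  - apply Rle_trans with (1 := H (S n) ltac:(lia)).
    apply Rmult_le_compat_r; [apply pow_le; lra|apply Rmax_l].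
Qed.

Lemma egeo_ext1 (a b : nat -> R) : (forall n, (1 <= n)%nat -> a n = b n) ->
  egeo a -> egeo b.
Proof.
  intros E H. destruct (egeo_pos a H) as (M & r & HM & Hr & Hb).
  apply egeo_from1 with M r; [exact Hr|].
  intros n Hn. rewrite <- E by exact Hn. apply Hb.
Qed.

Lemma egeo_le (a b : nat -> R) : (forall n, Rabs (a n) <= Rabs (b n)) -> egeo b -> egeo a.
Proof.
  intros H (M & r & HM & Hr & Hb). exists M, r. repeat split; try lra.
  intros n. apply Rle_trans with (1 := H n). apply Hb.
Qed.

Lemma egeo_bounded (a : nat -> R) : egeo a -> seq_bounded a.
Proof.
  intros (M & r & HM & Hr & H). exists M. intros n.
  apply Rle_trans with (1 := H n). rewrite <- (Rmult_1_r M) at 2.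
  apply Rmult_le_compat_l; [lra|]. rewrite <- (pow1 n). apply pow_incr; lra.
Qed.

Lemma egeo_plus (a b : nat -> R) : egeo a -> egeo b -> egeo (fun n => a n + b n).
Proof.
  intros (M & r & HM & Hr & H) (M' & r' & HM' & Hr' & H').
  exists (M + M'), (Rmax r r'). split; [lra|]. split.
  { unfold Rmax; destruct Rle_dec; lra. }
  intros n. apply Rle_trans with (1 := Rabs_triang _ _).
  rewrite Rmult_plus_distr_r. apply Rplus_le_compat.
  - apply Rle_trans with (1 := H n). apply Rmult_le_compat_l; [lra|].
    apply pow_incr. split; [lra|apply Rmax_l].
  - apply Rle_trans with (1 := H' n). apply Rmult_le_compat_l; [lra|].
    apply pow_incr. split; [lra|apply Rmax_r].
Qed.

Lemma egeo_mult_bounded (a b : nat -> R) : egeo a -> seq_bounded b -> egeo (fun n => a n * b n).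
Proof.
  intros (M & r & HM & Hr & H) (B & HB).
  assert (0 <= B) by (apply Rle_trans with (2 := HB 0%nat); apply Rabs_pos).
  exists (M * B), r. split; [apply Rmult_le_pos; lra|]. split; [lra|].
  intros n. rewrite Rabs_mult. replace (M * B * r ^ n) with (M * r ^ n * B) by ring.
  apply Rmult_le_compat; auto using Rabs_pos.
Qed.

Lemma bounded_const (c : R) : seq_bounded (fun _ => c).
Proof. exists (Rabs c). intros; lra. Qed.

Lemma bounded_plus (a b : nat -> R) : seq_bounded a -> seq_bounded b -> seq_bounded (fun n => a n + b n).
Proof.
  intros (A & HA) (B & HB). exists (A + B). intros n.
  apply Rle_trans with (1 := Rabs_triang _ _). apply Rplus_le_compat; auto.
Qed.

Lemma bounded_opp (a : nat -> R) : seq_bounded a -> seq_bounded (fun n => - a n).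
Proof. intros (A & HA). exists A. intros n. rewrite Rabs_Ropp. apply HA. Qed.

Lemma bounded_minus (a b : nat -> R) : seq_bounded a -> seq_bounded b -> seq_bounded (fun n => a n - b n).
Proof. intros. apply (bounded_plus a (fun n => - b n)); auto using bounded_opp. Qed.

Lemma bounded_mult (a b : nat -> R) : seq_bounded a -> seq_bounded b -> seq_bounded (fun n => a n * b n).
Proof.
  intros (A & HA) (B & HB). exists (A * B). intros n. rewrite Rabs_mult.
  apply Rmult_le_compat; auto using Rabs_pos.
Qed.

Lemma bounded_pow (a : nat -> R) (k : nat) : seq_bounded a -> seq_bounded (fun n => a n ^ k).
Proof.
  intros H. induction k; simpl; [apply bounded_const|].
  apply bounded_mult; auto.
Qed.

Ltac solve_seq_bounded :=
  repeat match goal with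
  | |- seq_bounded (fun _ => ?c) => apply (bounded_const c)
  | |- seq_bounded (fun n => @?a n + @?b n) => apply (bounded_plus a b)
  | |- seq_bounded (fun n => @?a n - @?b n) => apply (bounded_minus a b)
  | |- seq_bounded (fun n => @?a n * @?b n) => apply (bounded_mult a b)
  | |- seq_bounded (fun n => - @?a n) => apply (bounded_opp a)
  | |- seq_bounded (fun n => (@?a n) ^ ?k) => apply (bounded_pow a k)
  | H : egeo ?a |- seq_bounded ?a => exact (egeo_bounded a H)
  | |- _ => eassumption
  end.

Lemma egeo_scal (c : R) (a : nat -> R) : egeo a -> egeo (fun n => c * a n).
Proof.
  intros H. apply egeo_le with (fun n => a n * c).
  - intros n. rewrite Rmult_comm. lra.
  - apply egeo_mult_bounded; auto using bounded_const.
Qed.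

Lemma egeo_opp (a : nat -> R) : egeo a -> egeo (fun n => - a n).
Proof. intros H. apply egeo_le with a; auto. intros n. rewrite Rabs_Ropp; lra. Qed.

Lemma egeo_mult (a b : nat -> R) : egeo a -> egeo b -> egeo (fun n => a n * b n).
Proof. intros. apply egeo_mult_bounded; auto using egeo_bounded. Qed.

Lemma egeo_zero : egeo (fun _ => 0).
Proof. exists 0, 0. split; [lra|]. split; [lra|]. intros n. rewrite Rabs_R0. lra. Qed.

Lemma egeo_npow (a : nat -> R) (k : nat) : egeo a -> egeo (fun n => a n ^ S k).
Proof.
  intros H. simpl. apply egeo_mult_bounded; auto. apply bounded_pow, egeo_bounded, H.
Qed.

Lemma egeo_geom (q : R) : Rabs q < 1 -> egeo (fun n => q ^ n).
Proof.
  intros H. exists 1, (Rabs q). split; [lra|]. split; [split; auto using Rabs_pos|].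
  intros n. rewrite RPow_abs. lra.
Qed.

Lemma egeo_shift (a : nat -> R) : egeo a -> egeo (fun n => a (S n)).
Proof.
  intros H. destruct (egeo_pos a H) as (M & r & HM & Hr & Hb).
  exists M, r. repeat split; try lra. intros n. apply Rle_trans with (1 := Hb (S n)).
  simpl. assert (0 < r ^ n) by (apply pow_lt; lra).
  apply Rmult_le_compat_l; nra.
Qed.

Lemma egeo_ex_series (a : nat -> R) : egeo a -> ex_series a.
Proof.
  intros (M & r & HM & Hr & H).
  apply (ex_series_le (V := R_CompleteNormedModule) a (fun n => M * r ^ n)).
  - intros n. apply H.
  - apply (ex_series_scal (V := R_NormedModule) M (fun n => r ^ n)).
    apply ex_series_geom. rewrite Rabs_pos_eq; lra.
Qed.

Lemma egeo_Rabs (a : nat -> R) : egeo a -> egeo (fun n => Rabs (a n)).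
Proof. intros H. apply egeo_le with a; auto. intros n. rewrite Rabs_Rabsolu. lra. Qed.

(** The sum [1 + r + ... + r ^ (n - 1) = (1 - r ^ n) / (1 - r)] has [n] terms, each at least
    [r ^ n]. *)
Lemma bernoulli_pow (r : R) (n : nat) : 0 < r < 1 -> INR n * r ^ n <= / (1 - r).
Proof.
  intros Hr.
  assert (H : INR n * r ^ n * (1 - r) <= 1 - r ^ n).
  { induction n.
    - simpl. lra.
    - rewrite S_INR. simpl. assert (0 < r ^ n) by (apply pow_lt; lra).
      assert (r ^ n <= 1) by (rewrite <- (pow1 n); apply pow_incr; lra).
      assert (Hr1 : r * (INR n * r ^ n * (1 - r)) <= r * (1 - r ^ n)) by (apply Rmult_le_compat_l; lra).
      assert (0 <= (1 - r) * (1 - r * r ^ n)) by (apply Rmult_le_pos; nra).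
      replace ((INR n + 1) * (r * r ^ n) * (1 - r)) with
        (r * (INR n * r ^ n * (1 - r)) + r * r ^ n * (1 - r)) by ring.
      nra. }
  assert (0 < r ^ n) by (apply pow_lt; lra).
  apply Rmult_le_reg_r with (1 - r); [lra|]. rewrite Rinv_l by lra. lra.
Qed.

Lemma egeo_INR_mult (a : nat -> R) : egeo a -> egeo (fun n => INR n * a n).
Proof.
  intros H. destruct (egeo_pos a H) as (M & r & HM & Hr & Hb).
  (* One factor [s ^ n] of [r ^ n] absorbs [n], the other keeps the decay. *)
  set (s := sqrt r).
  assert (Hs : 0 < s < 1).
  { split; [apply sqrt_lt_R0; lra|]. rewrite <- sqrt_1. apply sqrt_lt_1; lra. }
  assert (Hss : r = s * s) by (unfold s; rewrite sqrt_sqrt; lra).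
  exists (M * / (1 - s)), s. split.
  { apply Rmult_le_pos; [lra|]. left. apply Rinv_0_lt_compat. lra. }
  split; [lra|]. intros n. rewrite Rabs_mult, (Rabs_pos_eq (INR n)) by apply pos_INR.
  apply Rle_trans with (INR n * (M * r ^ n)).
  { apply Rmult_le_compat_l; auto using pos_INR. }
  rewrite Hss, Rpow_mult_distr.
  replace (INR n * (M * (s ^ n * s ^ n))) with (M * (INR n * s ^ n) * s ^ n) by ring.
  apply Rmult_le_compat_r; [apply pow_le; lra|].
  apply Rmult_le_compat_l; [lra|]. apply bernoulli_pow, Hs.
Qed.

(** Along a sequence tending to 1 geometrically, avoiding 0 is the same as being bounded away from 0. *)
Lemma bounded_inv (b : nat -> R) : egeo (fun n => b n - 1) ->
  (forall n, (1 <= n)%nat -> b n <> 0) -> seq_bounded (fun n => / b n).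
Proof.
  intros H Hn. destruct (egeo_pos _ H) as (M & r & HM & Hr & Hb).
  (* Beyond [N] the distance to 1 is at most 1/2; the finitely many earlier indices, index 0
     included, are bounded one by one. *)
  destruct (pow_lt_1_zero r ltac:(rewrite Rabs_pos_eq; lra) (/ (2 * M))) as (N & HN).
  { apply Rinv_0_lt_compat. lra. }
  assert (Hbig : forall n, (n >= N)%nat -> Rabs (/ b n) <= 2).
  { intros n Hn'. specialize (HN n Hn'). specialize (Hb n).
    assert (0 < r ^ n) by (apply pow_lt; lra).
    rewrite Rabs_pos_eq in HN by lra.
    assert (Rabs (b n - 1) <= 1 / 2).
    { apply Rle_trans with (1 := Hb). apply Rlt_le.
      replace (1/2) with (M * / (2 * M)) by (field; lra).
      apply Rmult_lt_compat_l; lra. }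
    apply Rabs_le_between in H1.
    rewrite Rabs_pos_eq by (left; apply Rinv_0_lt_compat; lra).
    replace 2 with (/ (1/2)) by field. apply Rinv_le_contravar; lra. }
  assert (Hfin : forall m, exists B, forall n, (n < m)%nat -> Rabs (/ b n) <= B).
  { induction m as [|m (B & HB)].
    - exists 0. intros; lia.
    - exists (Rmax B (Rabs (/ b m))). intros n Hlt.
      destruct (Nat.eq_dec n m) as [->|Hne]; [apply Rmax_r|].
      apply Rle_trans with (2 := Rmax_l _ _). apply HB. lia. }
  destruct (Hfin N) as (B & HB).
  exists (Rmax B 2). intros n. destruct (Nat.lt_ge_cases n N).
  - apply Rle_trans with (2 := Rmax_l _ _). auto.
  - apply Rle_trans with (2 := Rmax_r _ _). auto.
Qed.

Lemma prodR_ext (f g : nat -> R) (n : nat) :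
  (forall j, (1 <= j)%nat -> f j = g j) -> prodR f n = prodR g n.
Proof.
  intros H. induction n; simpl; auto. rewrite IHn, H by lia. reflexivity.
Qed.

Lemma prodR_mult (f g : nat -> R) (n : nat) :
  prodR (fun j => f j * g j) n = prodR f n * prodR g n.
Proof. induction n; simpl; [ring|]. rewrite IHn. ring. Qed.

(** Each factor satisfies [|f j| <= 1 + |f j - 1| <= exp |f j - 1|]. *)
Lemma prodR_bound (f : nat -> R) (n : nat) (S0 : R) :
  (forall m, sum_f_R0 (fun j => Rabs (f (S j) - 1)) m <= S0) -> 0 <= S0 ->
  Rabs (prodR f n) <= exp S0.
Proof.
  intros HS H0.
  assert (H : forall n, Rabs (prodR f (S n)) <= exp (sum_f_R0 (fun j => Rabs (f (S j) - 1)) n)).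
  { intros m. induction m.
    - simpl. rewrite Rmult_1_l.
      apply Rle_trans with (1 + Rabs (f 1%nat - 1)); [|apply exp_ineq1_le].
      replace (f 1%nat) with (1 + (f 1%nat - 1)) at 1 by ring.
      apply Rle_trans with (1 := Rabs_triang _ _). rewrite Rabs_R1. lra.
    - change (prodR f (S (S m))) with (prodR f (S m) * f (S (S m))).
      change (sum_f_R0 (fun j => Rabs (f (S j) - 1)) (S m)) with
        (sum_f_R0 (fun j => Rabs (f (S j) - 1)) m + Rabs (f (S (S m)) - 1)).
      rewrite Rabs_mult, exp_plus. apply Rmult_le_compat; auto using Rabs_pos.
      apply Rle_trans with (1 + Rabs (f (S (S m)) - 1)); [|apply exp_ineq1_le].
      replace (f (S (S m))) with (1 + (f (S (S m)) - 1)) at 1 by ring.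
      apply Rle_trans with (1 := Rabs_triang _ _). rewrite Rabs_R1. lra. }
  destruct n.
  - simpl. rewrite Rabs_R1. rewrite <- exp_0. destruct H0 as [H0|H0].
    + left. apply exp_increasing, H0.
    + rewrite <- H0. lra.
  - apply Rle_trans with (1 := H n). destruct (HS n) as [H1|H1].
    + left. apply exp_increasing, H1.
    + rewrite H1. lra.
Qed.

Lemma egeo_partial_sum (a : nat -> R) : egeo a ->
  exists S0, 0 <= S0 /\ forall m, sum_f_R0 (fun j => Rabs (a j)) m <= S0.
Proof.
  intros (M & r & HM & Hr & H).
  exists (M * / (1 - r)). split.
  { apply Rmult_le_pos; [lra|]. left. apply Rinv_0_lt_compat. lra. }
  intros m. apply Rle_trans with (sum_f_R0 (fun j => r ^ j * M) m).
  { apply sum_Rle. intros n _. rewrite Rmult_comm. apply H. }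
  rewrite <- scal_sum. apply Rmult_le_compat_l; [lra|].
  rewrite tech3 by lra. unfold Rdiv. rewrite <- (Rmult_1_l (/ (1 - r))) at 2.
  apply Rmult_le_compat_r; [left; apply Rinv_0_lt_compat; lra|].
  assert (0 <= r ^ S m) by (apply pow_le; lra). lra.
Qed.

(** Consecutive partial products differ by [prodR f n * (f (S n) - 1)]; as the partial products are
    bounded, these differences decay geometrically and telescope to a convergent series. *)
Lemma inf_prod_lim (f : nat -> R) : egeo (fun n => f n - 1) ->
  is_lim_seq (prodR f) (inf_prod f).
Proof.
  intros H.
  assert (Hs := egeo_shift _ H).
  destruct (egeo_partial_sum _ Hs) as (S0 & H0 & HS).
  assert (Hb := fun n => prodR_bound f n S0 HS H0).
  assert (Hex : ex_series (fun n => prodR f n * (f (S n) - 1))).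
  { apply egeo_ex_series. apply egeo_le with (fun n => (f (S n) - 1) * prodR f n).
    - intros n. rewrite Rmult_comm. lra.
    - apply egeo_mult_bounded; auto. exists (exp S0). auto. }
  destruct Hex as [l Hl].
  assert (Hlim : is_lim_seq (prodR f) (1 + l)).
  { apply is_lim_seq_incr_1.
    apply is_lim_seq_ext with (fun n => 1 + sum_n (fun n => prodR f n * (f (S n) - 1)) n).
    - intros n. induction n.
      + rewrite sum_O. simpl. ring.
      + rewrite sum_Sn. unfold plus; simpl. rewrite <- Rplus_assoc, IHn. simpl. ring.
    - apply is_lim_seq_plus'; [apply is_lim_seq_const|]. exact Hl. }
  unfold inf_prod.
  replace (Lim_seq (fun n => prodR f n)) with (Finite (1 + l)); [exact Hlim|].
  symmetry. apply is_lim_seq_unique. exact Hlim.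
Qed.

Lemma inf_prod_unique (f : nat -> R) (l : R) : is_lim_seq (prodR f) l -> inf_prod f = l.
Proof.
  intros H. unfold inf_prod. apply is_lim_seq_unique in H.
  change (fun n => prodR f n) with (prodR f). rewrite H. reflexivity.
Qed.

Lemma inf_prod_ext (f g : nat -> R) : (forall j, (1 <= j)%nat -> f j = g j) ->
  inf_prod f = inf_prod g.
Proof.
  intros H. unfold inf_prod. f_equal. apply Lim_seq_ext. intros n. apply prodR_ext, H.
Qed.

Lemma egeo_prod (f g : nat -> R) : egeo (fun n => f n - 1) -> egeo (fun n => g n - 1) ->
  egeo (fun n => f n * g n - 1).
Proof.
  intros Hf Hg.
  apply egeo_ext1 with (fun n => (f n - 1) * (g n - 1) + (f n - 1) + (g n - 1)).
  - intros; ring.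
  - apply egeo_plus; auto. apply egeo_plus; auto. apply egeo_mult; auto.
Qed.

Lemma egeo_prod_pow (f : nat -> R) (k : nat) : egeo (fun n => f n - 1) ->
  egeo (fun n => f n ^ k - 1).
Proof.
  intros Hf. induction k; simpl.
  - apply egeo_ext1 with (fun _ => 0); [intros; ring|apply egeo_zero].
  - apply egeo_prod; auto.
Qed.

Lemma inf_prod_mult (f g : nat -> R) : egeo (fun n => f n - 1) -> egeo (fun n => g n - 1) ->
  inf_prod (fun n => f n * g n) = inf_prod f * inf_prod g.
Proof.
  intros Hf Hg. apply inf_prod_unique.
  apply is_lim_seq_ext with (fun n => prodR f n * prodR g n).
  - intros n. symmetry. apply prodR_mult.
  - apply is_lim_seq_mult'; apply inf_prod_lim; auto.
Qed.

Lemma inf_prod_1 : inf_prod (fun _ => 1) = 1.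
Proof.
  apply inf_prod_unique. apply is_lim_seq_ext with (fun _ => 1); [|apply is_lim_seq_const].
  induction n; simpl; lra.
Qed.

Lemma inf_prod_pow (f : nat -> R) (k : nat) : egeo (fun n => f n - 1) ->
  inf_prod (fun n => f n ^ k) = inf_prod f ^ k.
Proof.
  intros Hf. induction k; simpl; [apply inf_prod_1|].
  rewrite inf_prod_mult; auto using egeo_prod_pow. rewrite IHk. reflexivity.
Qed.

Lemma egeo_inv (f : nat -> R) : egeo (fun n => f n - 1) ->
  (forall n, (1 <= n)%nat -> f n <> 0) -> egeo (fun n => / f n - 1).
Proof.
  intros H Hn. apply egeo_ext1 with (fun n => - (f n - 1) * / f n).
  - intros n H1. field. auto.
  - apply egeo_mult_bounded; [apply egeo_opp; auto|]. apply bounded_inv; auto.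
Qed.

(** The product of the inverses converges as well, and the two limits multiply to 1. *)
Lemma inf_prod_neq0 (f : nat -> R) : egeo (fun n => f n - 1) ->
  (forall n, (1 <= n)%nat -> f n <> 0) -> inf_prod f <> 0.
Proof.
  intros H Hn H0.
  assert (H1 := inf_prod_mult f (fun n => / f n) H (egeo_inv f H Hn)).
  rewrite H0, Rmult_0_l in H1.
  rewrite (inf_prod_ext _ (fun _ => 1)) in H1.
  - rewrite inf_prod_1 in H1. lra.
  - intros j Hj. field. auto.
Qed.

Lemma inf_prod_inv (f : nat -> R) : egeo (fun n => f n - 1) ->
  (forall n, (1 <= n)%nat -> f n <> 0) -> inf_prod (fun n => / f n) = / inf_prod f.
Proof.
  intros H Hn.
  assert (H1 := inf_prod_mult f (fun n => / f n) H (egeo_inv f H Hn)).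
  rewrite (inf_prod_ext _ (fun _ => 1)) in H1 by (intros; field; auto).
  rewrite inf_prod_1 in H1.
  apply Rmult_eq_reg_l with (inf_prod f); [|apply inf_prod_neq0; auto].
  rewrite <- H1. field. apply inf_prod_neq0; auto.
Qed.

Lemma inf_prod_div (f g : nat -> R) : egeo (fun n => f n - 1) -> egeo (fun n => g n - 1) ->
  (forall n, (1 <= n)%nat -> g n <> 0) ->
  inf_prod (fun n => f n / g n) = inf_prod f / inf_prod g.
Proof.
  intros Hf Hg Hn. unfold Rdiv.
  rewrite inf_prod_mult; auto using egeo_inv. rewrite inf_prod_inv; auto.
Qed.

Lemma inf_prod_pos (f : nat -> R) : egeo (fun n => f n - 1) ->
  (forall n, (1 <= n)%nat -> 0 < f n) -> 0 < inf_prod f.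
Proof.
  intros H Hn.
  assert (H1 : inf_prod f <> 0).
  { apply inf_prod_neq0; auto. intros n Hle. specialize (Hn n Hle). lra. }
  assert (H2 : Rbar_le 0 (inf_prod f)).
  { apply is_lim_seq_le with (fun _ => 0) (prodR f).
    - intros n. left. induction n; simpl; [lra|]. apply Rmult_lt_0_compat; auto.
      apply Hn. lia.
    - apply is_lim_seq_const.
    - apply inf_prod_lim; auto. }
  simpl in H2. lra.
Qed.

Lemma inf_prod_shift (f : nat -> R) : egeo (fun n => f n - 1) ->
  inf_prod f = f 1%nat * inf_prod (fun n => f (S n)).
Proof.
  intros H. apply inf_prod_unique. apply is_lim_seq_incr_1.
  apply is_lim_seq_ext with (fun n => f 1%nat * prodR (fun n => f (S n)) n).
  - intros n. induction n; simpl; [ring|]. simpl in IHn.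
    rewrite <- Rmult_assoc, IHn. ring.
  - apply (is_lim_seq_scal_l _ (f 1%nat) (Finite _)). apply inf_prod_lim.
    apply (egeo_shift (fun n => f n - 1)). auto.
Qed.

(** The block products have as partial products those of [f] along the multiples of [k], a
    subsequence of a convergent sequence. *)
Lemma inf_prod_block (f : nat -> R) (k : nat) : (1 <= k)%nat -> egeo (fun n => f n - 1) ->
  inf_prod f = inf_prod (fun n => prodR (fun i => f (k * (n - 1) + i)%nat) k).
Proof.
  intros Hk H. symmetry. apply inf_prod_unique.
  assert (Hadd : forall a b, prodR f (a + b) = prodR f a * prodR (fun i => f (a + i)%nat) b).
  { intros a b. induction b; simpl; [rewrite Nat.add_0_r; ring|].
    rewrite Nat.add_succ_r. simpl. rewrite IHb. ring. }
  apply is_lim_seq_ext with (fun n => prodR f (k * n)).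
  - intros n. induction n.
    + rewrite Nat.mul_0_r. reflexivity.
    + rewrite Nat.mul_succ_r, Hadd, IHn. simpl. rewrite Nat.sub_0_r. reflexivity.
  - apply (is_lim_seq_subseq (prodR f) (inf_prod f) (fun n => (k * n)%nat)).
    + apply eventually_subseq. intros n. nia.
    + apply inf_prod_lim; auto.
Qed.

(** Expansion of a finite product to first order with a quadratic remainder. Both bounds go through
    one induction: a new factor [1 + x] adds [(P - 1) * x] to the second error, which the first
    bound controls. *)
Lemma prod_minus_sum_bound (u : nat -> R) (n : nat) :
  let S0 := sum_f_R0 (fun j => Rabs (u (S j))) n in
  Rabs (prodR (fun j => 1 + u j) (S n) - 1) <= S0 * exp S0 /\
  Rabs (prodR (fun j => 1 + u j) (S n) - 1 - sum_f_R0 (fun j => u (S j)) n) <= S0 ^ 2 * exp S0.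
Proof.
  induction n.
  - simpl. set (x := u 1%nat).
    assert (Hx : 0 <= Rabs x) by apply Rabs_pos.
    assert (He : 1 <= exp (Rabs x)).
    { apply Rle_trans with (1 + Rabs x); [lra|apply exp_ineq1_le]. }
    split.
    + replace (1 * (1 + x) - 1) with x by ring.
      rewrite <- (Rmult_1_r (Rabs x)) at 1. apply Rmult_le_compat_l; auto.
    + replace (1 * (1 + x) - 1 - x) with 0 by ring. rewrite Rabs_R0.
      apply Rmult_le_pos; [nra|lra].
  - cbv zeta in *. destruct IHn as [H1 H2].
    change (prodR (fun j => 1 + u j) (S (S n))) with
      (prodR (fun j => 1 + u j) (S n) * (1 + u (S (S n)))).
    change (sum_f_R0 (fun j => Rabs (u (S j))) (S n)) with
      (sum_f_R0 (fun j => Rabs (u (S j))) n + Rabs (u (S (S n)))).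
    change (sum_f_R0 (fun j => u (S j)) (S n)) with
      (sum_f_R0 (fun j => u (S j)) n + u (S (S n))).
    set (T := sum_f_R0 (fun j => Rabs (u (S j))) n) in *.
    set (P := prodR (fun j => 1 + u j) (S n)) in *.
    set (s := sum_f_R0 (fun j => u (S j)) n) in *.
    set (x := u (S (S n))).
    assert (Hx : 0 <= Rabs x) by apply Rabs_pos.
    assert (HT : 0 <= T) by (apply cond_pos_sum; intros; apply Rabs_pos).
    assert (He : 1 + Rabs x <= exp (Rabs x)) by apply exp_ineq1_le.
    assert (HeT : 1 + T <= exp T) by apply exp_ineq1_le.
    rewrite exp_plus. set (A := exp T) in *. set (B := exp (Rabs x)) in *.
    assert (HAB : A <= A * B) by nra.
    assert (0 <= T * A) by nra. assert (0 <= T * T * A) by (apply Rmult_le_pos; nra).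
    split.
    + replace (P * (1 + x) - 1) with ((P - 1) * (1 + x) + x) by ring.
      apply Rle_trans with (1 := Rabs_triang _ _). rewrite Rabs_mult.
      assert (H3 : Rabs (1 + x) <= 1 + Rabs x).
      { apply Rle_trans with (1 := Rabs_triang _ _). rewrite Rabs_R1. lra. }
      assert (H4 : Rabs (P - 1) * Rabs (1 + x) <= (T * A) * B).
      { apply Rmult_le_compat; auto using Rabs_pos. lra. }
      assert (Rabs x <= Rabs x * (A * B)) by nra.
      lra.
    + replace (P * (1 + x) - 1 - (s + x)) with ((P - 1 - s) + (P - 1) * x) by ring.
      apply Rle_trans with (1 := Rabs_triang _ _). rewrite Rabs_mult.
      assert (H3 : Rabs (P - 1) * Rabs x <= T * A * Rabs x).
      { apply Rmult_le_compat_r; auto. }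
      apply Rle_trans with (T ^ 2 * A + T * A * Rabs x); [lra|].
      apply Rle_trans with ((T ^ 2 + T * Rabs x) * (A * B)).
      * replace (T ^ 2 * A + T * A * Rabs x) with ((T ^ 2 + T * Rabs x) * A) by ring.
        apply Rmult_le_compat_l; [nra|lra].
      * apply Rmult_le_compat_r; nra.
Qed.

Lemma Series_shift_lim (a : nat -> R) : egeo a ->
  is_lim_seq (fun n => sum_f_R0 (fun j => a (S j)) n) (Series (fun n => a (S n))).
Proof.
  intros H. apply is_lim_seq_ext with (sum_n (fun n => a (S n))).
  - intros n. apply sum_n_Reals.
  - apply (Series_correct (fun n => a (S n))). apply egeo_ex_series, egeo_shift, H.
Qed.

(** Termwise differentiation of a product normalised to 1 at [d = 0]. Factors with a summable
    quadratic remainder give finite products whose first-order error is at most a fixed constant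
    times [d ^ 2]; the bound passes to the limit and shows differentiability directly. *)
Lemma inf_prod_derive (f : nat -> R -> R) (a b : nat -> R) (r : R) : 0 < r -> egeo a -> egeo b ->
  (forall n d, (1 <= n)%nat -> Rabs d <= r -> Rabs (f n d - 1 - a n * d) <= b n * d ^ 2) ->
  is_derive (fun d => inf_prod (fun n => f n d)) 0 (Series (fun n => a (S n))).
Proof.
  intros Hr Ha Hb Hf.
  assert (Hb0 : forall n, (1 <= n)%nat -> 0 <= b n).
  { intros n Hn. assert (H := Hf n r Hn ltac:(rewrite Rabs_pos_eq; lra)).
    assert (H1 := Rabs_pos (f n r - 1 - a n * r)). assert (0 < r ^ 2) by (apply pow_lt; auto).
    apply Rmult_le_reg_r with (r ^ 2); lra. }
  set (s := Rmin r 1). assert (Hs : 0 < s) by (apply Rmin_pos; lra).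
  assert (Hs1 : s <= 1) by apply Rmin_r. assert (Hsr : s <= r) by apply Rmin_l.
  assert (Hf0 : forall n, (1 <= n)%nat -> f n 0 = 1).
  { intros n Hn. assert (H := Hf n 0 Hn ltac:(rewrite Rabs_R0; lra)).
    replace (b n * 0 ^ 2) with 0 in H by ring. replace (f n 0 - 1 - a n * 0) with (f n 0 - 1) in H by ring.
    assert (H1 := Rabs_pos (f n 0 - 1)). assert (H2 : Rabs (f n 0 - 1) = 0) by lra.
    apply Rabs_eq_0 in H2. lra. }
  set (w := fun n => Rabs (a n) + Rabs (b n)).
  assert (Hw : egeo w) by (apply egeo_plus; apply egeo_Rabs; auto).
  destruct (egeo_partial_sum _ (egeo_shift _ Hw)) as (W & HW0 & HW).
  assert (Hbs : egeo (fun n => b (S n))) by (apply egeo_shift, Hb).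
  destruct (egeo_partial_sum _ Hbs) as (B & HB0 & HB).
  set (sa := Series (fun n => a (S n))).
  assert (Hu : forall n d, (1 <= n)%nat -> Rabs d <= s -> Rabs (f n d - 1) <= Rabs d * w n).
  { intros n d Hn Hd. specialize (Hf n d Hn ltac:(lra)).
    replace (f n d - 1) with ((f n d - 1 - a n * d) + a n * d) by ring.
    apply Rle_trans with (1 := Rabs_triang _ _). rewrite Rabs_mult. unfold w.
    rewrite (Rabs_pos_eq (b n)) by auto.
    assert (P := Rabs_pos d). assert (d ^ 2 = Rabs d * Rabs d) by (rewrite <- Rabs_mult, Rabs_pos_eq; nra).
    specialize (Hb0 n Hn). assert (b n * d ^ 2 <= b n * Rabs d) by (apply Rmult_le_compat_l; [auto|rewrite H; nra]). lra. }
  assert (Hg : forall d, Rabs d <= s -> egeo (fun n => f n d - 1)).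
  { intros d Hd. assert (G := egeo_scal (Rabs d) _ Hw). destruct (egeo_pos _ G) as (M & ro & HM & Hro & K).
    apply egeo_from1 with M ro; auto. intros n Hn. apply Rle_trans with (1 := Hu n d Hn Hd).
    apply Rle_trans with (2 := K n). apply Rle_abs. }
  assert (Hbound : forall d, Rabs d <= s ->
    Rabs (inf_prod (fun n => f n d) - 1 - sa * d) <= ((W ^ 2) * exp W + B) * d ^ 2).
  { intros d Hd.
    apply (is_lim_seq_le
      (fun n => Rabs (prodR (fun n => f n d) (S n) - 1 - sum_f_R0 (fun j => a (S j)) n * d))
      (fun _ => ((W ^ 2) * exp W + B) * d ^ 2) (Finite _) (Finite _)).
    - intros n.
      destruct (prod_minus_sum_bound (fun n => f n d - 1) n) as [_ H].
      replace (prodR (fun j => 1 + (f j d - 1)) (S n)) with (prodR (fun j => f j d) (S n)) in H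
        by (apply prodR_ext; intros; ring).
      set (T := sum_f_R0 (fun j => Rabs (f (S j) d - 1)) n) in H.
      assert (HT : 0 <= T) by (apply cond_pos_sum; intros; apply Rabs_pos).
      assert (Pd := Rabs_pos d).
      assert (HTW : T <= W * Rabs d).
      { apply Rle_trans with (Rabs d * sum_f_R0 (fun j => Rabs (w (S j))) n).
        - rewrite scal_sum. apply sum_Rle. intros j _. rewrite Rmult_comm.
          apply Rle_trans with (1 := Hu (S j) d ltac:(lia) Hd).
          apply Rmult_le_compat_l; auto. apply Rle_abs.
        - rewrite Rmult_comm. apply Rmult_le_compat_r; auto. }
      assert (HTW' : T <= W) by nra.
      assert (Hd2 : d ^ 2 = Rabs d * Rabs d) by (rewrite <- Rabs_mult, Rabs_pos_eq; nra).
      assert (H1 : T ^ 2 * exp T <= (W * Rabs d) ^ 2 * exp W).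
      { apply Rmult_le_compat.
        - apply pow_le; auto.
        - left; apply exp_pos.
        - apply pow_incr; split; auto.
        - destruct HTW' as [H'|H']; [left; apply exp_increasing, H'|rewrite H'; lra]. }
      assert (H2 : Rabs (sum_f_R0 (fun j => f (S j) d - 1) n - sum_f_R0 (fun j => a (S j)) n * d) <= B * d ^ 2).
      { rewrite Rmult_comm, scal_sum, <- minus_sum.
        apply Rle_trans with (sum_f_R0 (fun j => Rabs (f (S j) d - 1 - a (S j) * d)) n);
          [apply sum_f_R0_triangle|].
        apply Rle_trans with (d ^ 2 * sum_f_R0 (fun j => Rabs (b (S j))) n).
        - rewrite scal_sum. apply sum_Rle. intros j _.
          apply Rle_trans with (1 := Hf (S j) d ltac:(lia) ltac:(lra)).
          apply Rmult_le_compat_r; [rewrite Hd2; nra|apply Rle_abs].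
        - rewrite Rmult_comm. apply Rmult_le_compat_r; [rewrite Hd2; nra|apply HB]. }
      set (P := prodR _ _) in *. set (S1 := sum_f_R0 (fun j => f (S j) d - 1) n) in *.
      set (S2 := sum_f_R0 (fun j => a (S j)) n) in *.
      replace (P - 1 - S2 * d) with ((P - 1 - S1) + (S1 - S2 * d)) by ring.
      apply Rle_trans with (1 := Rabs_triang _ _).
      replace ((W * Rabs d) ^ 2 * exp W) with (W ^ 2 * exp W * d ^ 2) in H1 by (rewrite Hd2; ring).
      lra.
    - apply (is_lim_seq_abs _ (Finite _)). apply is_lim_seq_minus'.
      + apply is_lim_seq_minus'; [|apply is_lim_seq_const].
        apply (is_lim_seq_incr_1 (prodR (fun n => f n d))). apply inf_prod_lim, Hg, Hd.
      + apply (is_lim_seq_scal_r _ _ (Finite _)). apply Series_shift_lim; auto.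
    - apply is_lim_seq_const. }
  apply is_derive_Reals. intros eps Heps.
  set (C := W ^ 2 * exp W + B + 1).
  assert (HC : 0 < C).
  { assert (0 <= W ^ 2 * exp W); [|unfold C; lra]. apply Rmult_le_pos; [nra|left; apply exp_pos]. }
  assert (Hdel : 0 < Rmin s (eps / C)) by (apply Rmin_pos; [auto|apply Rdiv_lt_0_compat; auto]).
  exists (mkposreal _ Hdel). intros h Hh Hhd. simpl in Hhd. rewrite Rplus_0_l.
  replace (inf_prod (fun n => f n 0)) with 1.
  2: { symmetry. rewrite (inf_prod_ext _ (fun _ => 1)); [apply inf_prod_1|]. auto. }
  assert (Hh1 : Rabs h < s) by (apply Rlt_le_trans with (1 := Hhd); apply Rmin_l).
  assert (Hh2 : Rabs h < eps / C) by (apply Rlt_le_trans with (1 := Hhd); apply Rmin_r).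
  specialize (Hbound h ltac:(lra)). set (P := inf_prod _) in *. fold sa.
  assert (Hhp : 0 < Rabs h) by (apply Rabs_pos_lt; auto).
  replace ((P - 1) / h - sa) with ((P - 1 - sa * h) / h) by (field; auto).
  unfold Rdiv. rewrite Rabs_mult, Rabs_inv.
  assert (Hd2 : h ^ 2 = Rabs h * Rabs h) by (rewrite <- Rabs_mult, Rabs_pos_eq; nra).
  apply Rle_lt_trans with (C * Rabs h).
  - apply Rmult_le_reg_r with (Rabs h); auto. rewrite Rmult_assoc, Rinv_l, Rmult_1_r by lra.
    apply Rle_trans with (1 := Hbound). rewrite Hd2. unfold C. nra.
  - apply Rmult_lt_compat_l with (r := C) in Hh2; auto.
    replace (C * (eps / C)) with eps in Hh2 by (field; lra). auto.
Qed.

Lemma inf_prod_derive0 (a b : nat -> R) : egeo a -> egeo b ->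
  is_derive (fun d => inf_prod (fun n => 1 + (a n * d + b n * d ^ 2))) 0
    (Series (fun n => a (S n))).
Proof.
  intros Ha Hb. apply inf_prod_derive with (fun n => Rabs (b n)) 1; auto using egeo_Rabs; [lra|].
  intros n d _ _. replace (1 + (a n * d + b n * d ^ 2) - 1 - a n * d) with (b n * d ^ 2) by ring.
  rewrite Rabs_mult, (Rabs_pos_eq (d ^ 2)) by nra. lra.
Qed.

(** * Unconditional sums *)

Fixpoint lsum {I : Type} (f : I -> C) (l : list I) : C :=
  match l with nil => RtoC 0 | i :: l' => (f i + lsum f l')%C end.

Fixpoint rsum {I : Type} (f : I -> R) (l : list I) : R :=
  match l with nil => 0 | i :: l' => f i + rsum f l' end.

Definition eq_decidable (I : Type) := forall x y : I, {x = y} + {x <> y}.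

(** Unconditional summation: [s] is the limit of the finite sums along the directed set of duplicate-free lists. *)
Definition hassum {I : Type} (f : I -> C) (s : C) : Prop :=
  forall eps, 0 < eps -> exists l0, NoDup l0 /\
    forall l, NoDup l -> incl l0 l -> Cmod (lsum f l - s) < eps.

(** Summability of a nonnegative family; it plays the part of the majorant in all the convergence
    theorems below. *)
Definition rbounded {I : Type} (g : I -> R) : Prop :=
  (forall i, 0 <= g i) /\ exists B, forall l, NoDup l -> rsum g l <= B.

Lemma lsum_app {I} (f : I -> C) l m : lsum f (l ++ m) = (lsum f l + lsum f m)%C.
Proof. induction l; simpl; [ring|]. rewrite IHl. ring. Qed.

Lemma rsum_app {I} (f : I -> R) l m : rsum f (l ++ m) = rsum f l + rsum f m.
Proof. induction l; simpl; [ring|]. rewrite IHl. ring. Qed.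

Lemma lsum_perm {I} (f : I -> C) l m : Permutation l m -> lsum f l = lsum f m.
Proof.
  induction 1; simpl; try congruence.
  ring.
Qed.

Lemma rsum_perm {I} (f : I -> R) l m : Permutation l m -> rsum f l = rsum f m.
Proof.
  induction 1; simpl; try congruence.
  ring.
Qed.

Lemma lsum_ext {I} (f g : I -> C) l : (forall i, f i = g i) -> lsum f l = lsum g l.
Proof. intros H. induction l; simpl; congruence. Qed.

Lemma rsum_nonneg {I} (f : I -> R) l : (forall i, 0 <= f i) -> 0 <= rsum f l.
Proof. intros H. induction l; simpl; [lra|]. specialize (H a). lra. Qed.

Lemma rsum_le {I} (f g : I -> R) l : (forall i, f i <= g i) -> rsum f l <= rsum g l.
Proof. intros H. induction l; simpl; [lra|]. specialize (H a). lra. Qed.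

Lemma lsum_Cmod {I} (f : I -> C) l : Cmod (lsum f l) <= rsum (fun i => Cmod (f i)) l.
Proof.
  induction l; simpl; [rewrite Cmod_0; lra|].
  apply Rle_trans with (1 := Cmod_triangle _ _). lra.
Qed.

Lemma incl_perm {I} (dec : eq_decidable I) (l0 l : list I) : NoDup l0 -> NoDup l -> incl l0 l ->
  exists r, Permutation l (l0 ++ r) /\ NoDup r /\ forall i, In i r -> ~ In i l0.
Proof.
  intros H0 H Hi.
  set (r := filter (fun i => if in_dec dec i l0 then false else true) l).
  assert (Hr : forall i, In i r <-> In i l /\ ~ In i l0).
  { intros i. unfold r. rewrite filter_In. destruct (in_dec dec i l0); intuition congruence. }
  exists r. split; [|split].
  - apply NoDup_Permutation; auto.
    + apply NoDup_app; auto.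
      * apply NoDup_filter; auto.
      * intros i Hi1 Hi2. apply Hr in Hi2. tauto.
    + intros i. rewrite in_app_iff, Hr. destruct (in_dec dec i l0); intuition.
  - apply NoDup_filter; auto.
  - intros i Hi1. apply Hr in Hi1. tauto.
Qed.

Lemma rsum_incl {I} (dec : eq_decidable I) (g : I -> R) (l0 l : list I) :
  (forall i, 0 <= g i) -> NoDup l0 -> NoDup l -> incl l0 l -> rsum g l0 <= rsum g l.
Proof.
  intros Hg H0 H Hi. destruct (incl_perm dec l0 l H0 H Hi) as (r & Hp & _).
  rewrite (rsum_perm g _ _ Hp), rsum_app.
  assert (0 <= rsum g r) by (apply rsum_nonneg; auto). lra.
Qed.

(** Take [l0] whose sum is within [eps] of the supremum of all finite sums: a list disjoint from it
    can add less than [eps]. *)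
Lemma rbounded_tail {I} (g : I -> R) : rbounded g ->
  forall eps, 0 < eps -> exists l0, NoDup l0 /\
    forall l, NoDup l -> (forall i, In i l -> ~ In i l0) -> rsum g l < eps.
Proof.
  intros (Hg & B & HB) eps Heps.
  destruct (completeness (fun x => exists l, NoDup l /\ x = rsum g l)) as (m & Hm1 & Hm2).
  - exists B. intros x (l & Hl & ->). auto.
  - exists 0, nil. split; [constructor|reflexivity].
  - assert (Hex : exists l0, NoDup l0 /\ m - eps < rsum g l0).
    { destruct (Classical_Prop.classic (exists l0, NoDup l0 /\ m - eps < rsum g l0)) as [H|H]; auto.
      exfalso. assert (m <= m - eps); [|lra]. apply Hm2. intros x (l & Hl & ->).
      apply Rnot_lt_le. intros Hlt. apply H. exists l. auto. }
    destruct Hex as (l0 & Hl0 & Hlt). exists l0. split; auto.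
    intros l Hl Hd. assert (rsum g (l0 ++ l) <= m).
    { apply Hm1. exists (l0 ++ l). split; auto. apply NoDup_app; auto.
      intros i H1 H2. apply (Hd i H2 H1). }
    rewrite rsum_app in H. lra.
Qed.

Lemma hassum_ext {I} (f g : I -> C) s : (forall i, f i = g i) -> hassum f s -> hassum g s.
Proof.
  intros E H eps Heps. destruct (H eps Heps) as (l0 & H0 & H1). exists l0. split; auto.
  intros l Hl Hi. rewrite <- (lsum_ext f g l E). auto.
Qed.

Lemma Cmod_small_eq (z : C) : (forall eps, 0 < eps -> Cmod z < eps) -> z = RtoC 0.
Proof.
  intros H. apply Cmod_eq_0. destruct (Req_dec (Cmod z) 0) as [E|E]; auto.
  assert (Hp := Cmod_ge_0 z). specialize (H (Cmod z) ltac:(lra)). lra.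
Qed.

Lemma hassum_unique {I} (dec : eq_decidable I) (f : I -> C) s t : hassum f s -> hassum f t -> s = t.
Proof.
  intros Hs Ht.
  assert (H : (s - t)%C = RtoC 0).
  { apply Cmod_small_eq. intros eps Heps.
    destruct (Hs (eps/2) ltac:(lra)) as (l1 & _ & H1).
    destruct (Ht (eps/2) ltac:(lra)) as (l2 & _ & H2).
    set (l := nodup dec (l1 ++ l2)).
    assert (Hl : NoDup l) by apply NoDup_nodup.
    specialize (H1 l Hl). specialize (H2 l Hl).
    assert (Hi1 : incl l1 l) by (apply nodup_incl, incl_appl, incl_refl).
    assert (Hi2 : incl l2 l) by (apply nodup_incl, incl_appr, incl_refl).
    replace (s - t)%C with ((lsum f l - t) + - (lsum f l - s))%C by ring.
    apply Rle_lt_trans with (1 := Cmod_triangle _ _). rewrite Cmod_opp.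
    specialize (H1 Hi1). specialize (H2 Hi2). lra. }
  replace s with (s - t + t)%C by ring. rewrite H. ring.
Qed.

Lemma hassum_plus {I} (dec : eq_decidable I) (f g : I -> C) s t : hassum f s -> hassum g t ->
  hassum (fun i => f i + g i)%C (s + t)%C.
Proof.
  intros Hs Ht eps Heps.
  destruct (Hs (eps/2) ltac:(lra)) as (l1 & N1 & H1).
  destruct (Ht (eps/2) ltac:(lra)) as (l2 & N2 & H2).
  exists (nodup dec (l1 ++ l2)). split; [apply NoDup_nodup|].
  intros l Hl Hi.
  assert (Hi1 : incl l1 l).
  { apply incl_tran with (2 := Hi). apply nodup_incl, incl_appl, incl_refl. }
  assert (Hi2 : incl l2 l).
  { apply incl_tran with (2 := Hi). apply nodup_incl, incl_appr, incl_refl. }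
  specialize (H1 l Hl Hi1). specialize (H2 l Hl Hi2).
  replace (lsum (fun i => f i + g i)%C l - (s + t))%C with ((lsum f l - s) + (lsum g l - t))%C.
  - apply Rle_lt_trans with (1 := Cmod_triangle _ _). lra.
  - assert (E : lsum (fun i => f i + g i)%C l = (lsum f l + lsum g l)%C).
    { clear. induction l; simpl; [ring|]. rewrite IHl. ring. }
    rewrite E. ring.
Qed.

Lemma hassum_scal {I} (c : C) (f : I -> C) s : hassum f s -> hassum (fun i => c * f i)%C (c * s)%C.
Proof.
  intros Hs eps Heps. assert (Hc := Cmod_ge_0 c).
  destruct (Hs (eps / (Cmod c + 1))) as (l0 & H0 & H1).
  { apply Rdiv_lt_0_compat; lra. }
  exists l0. split; auto. intros l Hl Hi. specialize (H1 l Hl Hi).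
  assert (E : lsum (fun i => c * f i)%C l = (c * lsum f l)%C).
  { clear. induction l; simpl; [ring|]. rewrite IHl. ring. }
  rewrite E. replace (c * lsum f l - c * s)%C with (c * (lsum f l - s))%C by ring.
  rewrite Cmod_mult.
  apply Rle_lt_trans with ((Cmod c) * (eps / (Cmod c + 1))).
  - apply Rmult_le_compat_l; lra.
  - apply Rmult_lt_reg_r with (Cmod c + 1); [lra|].
    replace (Cmod c * (eps / (Cmod c + 1)) * (Cmod c + 1)) with (Cmod c * eps) by (field; lra).
    nra.
Qed.

Lemma hassum_single {I} (f : I -> C) (i0 : I) : (forall i, i <> i0 -> f i = RtoC 0) -> hassum f (f i0).
Proof.
  intros H eps Heps. exists (i0 :: nil). split.
  { constructor; [intros []|constructor]. }
  intros l Hl Hi. assert (In i0 l) by (apply Hi; left; reflexivity).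
  assert (E : lsum f l = f i0).
  { clear Hi. induction l; [destruct H0|]. simpl. inversion Hl as [|x y Hn Hd]; subst.
    destruct H0 as [->|H0].
    - assert (E : lsum f l = RtoC 0).
      { clear - Hn H. induction l; simpl; auto. rewrite H, IHl.
        - ring.
        - intros H1; apply Hn; right; auto.
        - intros ->; apply Hn; left; auto. }
      rewrite E. ring.
    - rewrite IHl by auto. rewrite H; [ring|]. intros ->. auto. }
  rewrite E. replace (f i0 - f i0)%C with (RtoC 0) by ring. rewrite Cmod_0. auto.
Qed.

(** [p] inverts the bijection from [J1 + J2] to [I] formed by [g1] and [g2]. The case of interest is
    a double series over the integers, cut according to parity. *)
Lemma hassum_split {I J1 J2} (f : I -> C) (g1 : J1 -> I) (g2 : J2 -> I) (p : I -> J1 + J2) s1 s2 :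
  (forall j, p (g1 j) = inl j) -> (forall j, p (g2 j) = inr j) ->
  (forall i, match p i with inl j => g1 j | inr j => g2 j end = i) ->
  hassum (fun j => f (g1 j)) s1 -> hassum (fun j => f (g2 j)) s2 -> hassum f (s1 + s2)%C.
Proof.
  intros P1 P2 P3 H1 H2 eps Heps.
  destruct (H1 (eps/2) ltac:(lra)) as (l1 & N1 & K1).
  destruct (H2 (eps/2) ltac:(lra)) as (l2 & N2 & K2).
  exists (map g1 l1 ++ map g2 l2). split.
  { apply NoDup_app.
    - apply FinFun.Injective_map_NoDup; auto. intros x y E.
      apply (f_equal p) in E. rewrite !P1 in E. congruence.
    - apply FinFun.Injective_map_NoDup; auto. intros x y E.
      apply (f_equal p) in E. rewrite !P2 in E. congruence.
    - intros i Hi Hi'. apply in_map_iff in Hi. apply in_map_iff in Hi'.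
      destruct Hi as (j & E & _), Hi' as (j' & E' & _). subst i.
      apply (f_equal p) in E'. rewrite P1, P2 in E'. congruence. }
  intros l Hl Hi.
  (* [q1] and [q2] pull a list in [I] back to the two pieces, so that its sum is the sum over the
     two preimages. *)
  set (q1 := fix q1 (l : list I) := match l with nil => nil | i :: l' =>
     match p i with inl j => j :: q1 l' | inr _ => q1 l' end end).
  set (q2 := fix q2 (l : list I) := match l with nil => nil | i :: l' =>
     match p i with inl _ => q2 l' | inr j => j :: q2 l' end end).
  assert (In1 : forall j l, In j (q1 l) <-> In (g1 j) l).
  { intros j m. induction m as [|i m IH]; simpl; [tauto|].
    assert (Pi := P3 i). destruct (p i) as [k|k] eqn:E; simpl; rewrite IH.
    - assert (k = j <-> i = g1 j); [|tauto]. split; intros A; [congruence|].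
      rewrite A, P1 in E. congruence.
    - assert (i <> g1 j); [|tauto]. intros A. rewrite A, P1 in E. congruence. }
  assert (In2 : forall j l, In j (q2 l) <-> In (g2 j) l).
  { intros j m. induction m as [|i m IH]; simpl; [tauto|].
    assert (Pi := P3 i). destruct (p i) as [k|k] eqn:E; simpl; rewrite IH.
    - assert (i <> g2 j); [|tauto]. intros A. rewrite A, P2 in E. congruence.
    - assert (k = j <-> i = g2 j); [|tauto]. split; intros A; [congruence|].
      rewrite A, P2 in E. congruence. }
  assert (D1 : NoDup (q1 l)).
  { clear Hi. induction Hl as [|i m Hn Hd IH]; simpl; [constructor|].
    assert (Pi := P3 i). destruct (p i) as [k|k] eqn:E; auto. constructor; auto.
    rewrite In1, Pi. auto. }
  assert (D2 : NoDup (q2 l)).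
  { clear Hi D1. induction Hl as [|i m Hn Hd IH]; simpl; [constructor|].
    assert (Pi := P3 i). destruct (p i) as [k|k] eqn:E; auto. constructor; auto.
    rewrite In2, Pi. auto. }
  assert (Es : lsum f l = (lsum (fun j => f (g1 j)) (q1 l) + lsum (fun j => f (g2 j)) (q2 l))%C).
  { clear - P3. induction l as [|i m IH]; simpl; [ring|].
    rewrite IH. assert (Pi := P3 i). destruct (p i) as [k|k]; simpl; rewrite Pi; ring. }
  specialize (K1 (q1 l) D1). specialize (K2 (q2 l) D2).
  assert (incl l1 (q1 l)).
  { intros j Hj. apply In1, Hi. apply in_app_iff. left. apply in_map; auto. }
  assert (incl l2 (q2 l)).
  { intros j Hj. apply In2, Hi. apply in_app_iff. right. apply in_map; auto. }
  specialize (K1 H). specialize (K2 H0).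
  rewrite Es.
  match goal with |- Cmod (?a + ?b - (?c + ?d))%C < _ =>
    replace (a + b - (c + d))%C with ((a - c) + (b - d))%C by ring end.
  apply Rle_lt_trans with (1 := Cmod_triangle _ _). lra.
Qed.

Lemma hassum_reindex {I J} (f : I -> C) (g : J -> I) (h : I -> J) s :
  (forall j, h (g j) = j) -> (forall i, g (h i) = i) ->
  hassum f s -> hassum (fun j => f (g j)) s.
Proof.
  intros P1 P2 H eps Heps. destruct (H eps Heps) as (l0 & N0 & K).
  exists (map h l0). split.
  { apply FinFun.Injective_map_NoDup; auto. intros x y E.
    apply (f_equal g) in E. rewrite !P2 in E. auto. }
  intros l Hl Hi.
  replace (lsum (fun j => f (g j)) l) with (lsum f (map g l)).
  - apply K.
    + apply FinFun.Injective_map_NoDup; auto. intros x y E.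
      apply (f_equal h) in E. rewrite !P1 in E. auto.
    + intros i Hi'. rewrite <- (P2 i). apply in_map. apply Hi. apply in_map. auto.
  - clear. induction l; simpl; congruence.
Qed.

Lemma lsum_diff_tail {I} (dec : eq_decidable I) (f : I -> C) (g : I -> R) l0 eps :
  (forall i, Cmod (f i) <= g i) -> NoDup l0 ->
  (forall l, NoDup l -> (forall i, In i l -> ~ In i l0) -> rsum g l < eps) ->
  forall l, NoDup l -> incl l0 l -> Cmod (lsum f l - lsum f l0) < eps.
Proof.
  intros Hg H0 Ht l Hl Hi. destruct (incl_perm dec l0 l H0 Hl Hi) as (r & Hp & Hr & Hd).
  rewrite (lsum_perm f _ _ Hp), lsum_app.
  replace (lsum f l0 + lsum f r - lsum f l0)%C with (lsum f r) by ring.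
  apply Rle_lt_trans with (1 := lsum_Cmod f r).
  apply Rle_lt_trans with (rsum g r); [|apply Ht; auto].
  apply rsum_le; auto.
Qed.

Lemma hassum_tail {I} (dec : eq_decidable I) (f : I -> C) (g : I -> R) l0 eps s :
  (forall i, Cmod (f i) <= g i) -> NoDup l0 ->
  (forall l, NoDup l -> (forall i, In i l -> ~ In i l0) -> rsum g l < eps) ->
  hassum f s -> Cmod (s - lsum f l0) <= eps.
Proof.
  intros Hg H0 Ht Hs. apply Rnot_lt_le. intros Hlt.
  destruct (Hs (Cmod (s - lsum f l0) - eps) ltac:(lra)) as (l1 & N1 & K).
  set (l := nodup dec (l0 ++ l1)).
  assert (Hl : NoDup l) by apply NoDup_nodup.
  assert (Hi1 : incl l1 l) by (apply nodup_incl, incl_appr, incl_refl).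
  assert (Hi0 : incl l0 l) by (apply nodup_incl, incl_appl, incl_refl).
  specialize (K l Hl Hi1).
  assert (K0 := lsum_diff_tail dec f g l0 eps Hg H0 Ht l Hl Hi0).
  assert (Cmod (s - lsum f l0) <= Cmod (lsum f l - s) + Cmod (lsum f l - lsum f l0)); [|lra].
  replace (s - lsum f l0)%C with (- (lsum f l - s) + (lsum f l - lsum f l0))%C by ring.
  apply Rle_trans with (1 := Cmod_triangle _ _). rewrite Cmod_opp. lra.
Qed.

(** * Limits of complex sequences, dominated convergence and products of sums *)

Definition Clim (u : nat -> C) (s : C) : Prop :=
  forall eps, 0 < eps -> exists N, forall n, (N <= n)%nat -> Cmod (u n - s) < eps.

Lemma eventually_list {I} (P : nat -> I -> Prop) (l : list I) :
  (forall i, exists N, forall n, (N <= n)%nat -> P n i) ->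
  exists N, forall n, (N <= n)%nat -> forall i, In i l -> P n i.
Proof.
  intros H. induction l as [|i l (N & HN)].
  - exists 0%nat. intros n _ i [].
  - destruct (H i) as (N' & HN'). exists (Nat.max N N'). intros n Hn j [<-|Hj].
    + apply HN'. lia.
    + apply HN; auto. lia.
Qed.

Lemma lsum_Clim {I} (F : nat -> I -> C) (f : I -> C) l :
  (forall i, Clim (fun n => F n i) (f i)) -> Clim (fun n => lsum (F n) l) (lsum f l).
Proof.
  intros H. induction l as [|i l IH]; simpl.
  - intros eps Heps. exists 0%nat. intros. replace (RtoC 0 - RtoC 0)%C with (RtoC 0) by ring.
    rewrite Cmod_0. auto.
  - intros eps Heps. destruct (H i (eps/2) ltac:(lra)) as (N & HN).
    destruct (IH (eps/2) ltac:(lra)) as (N' & HN').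
    exists (Nat.max N N'). intros n Hn. specialize (HN n ltac:(lia)). specialize (HN' n ltac:(lia)).
    replace (F n i + lsum (F n) l - (f i + lsum f l))%C with
      ((F n i - f i) + (lsum (F n) l - lsum f l))%C by ring.
    apply Rle_lt_trans with (1 := Cmod_triangle _ _). lra.
Qed.

(** Tannery's theorem. *)
Lemma hassum_dominated {I} (dec : eq_decidable I) (F : nat -> I -> C) (f : I -> C) (g : I -> R)
  (S : nat -> C) (s : C) :
  (forall n i, Cmod (F n i) <= g i) -> rbounded g ->
  (forall i, Clim (fun n => F n i) (f i)) ->
  (forall n, hassum (F n) (S n)) -> hassum f s -> Clim S s.
Proof.
  intros HF Hg Hlim HS Hs eps Heps.
  destruct (rbounded_tail g Hg (eps/4) ltac:(lra)) as (l0 & N0 & Ht).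
  assert (Hf : forall i, Cmod (f i) <= g i).
  { intros i. apply Rnot_lt_le. intros Hlt.
    destruct (Hlim i (Cmod (f i) - g i) ltac:(lra)) as (N & HN).
    specialize (HN N (le_n _)). specialize (HF N i).
    assert (Cmod (f i) <= Cmod (F N i) + Cmod (F N i - f i)); [|lra].
    replace (f i) with (F N i + - (F N i - f i))%C at 1 by ring.
    apply Rle_trans with (1 := Cmod_triangle _ _). rewrite Cmod_opp. lra. }
  destruct (lsum_Clim F f l0 Hlim (eps/4) ltac:(lra)) as (N & HN).
  exists N. intros n Hn. specialize (HN n Hn).
  assert (A := hassum_tail dec (F n) g l0 (eps/4) (S n) (HF n) N0 Ht (HS n)).
  assert (B := hassum_tail dec f g l0 (eps/4) s Hf N0 Ht Hs).
  replace (S n - s)%C with ((S n - lsum (F n) l0) + ((lsum (F n) l0 - lsum f l0) + - (s - lsum f l0)))%C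
    by ring.
  apply Rle_lt_trans with (1 := Cmod_triangle _ _).
  assert (C := Cmod_triangle (lsum (F n) l0 - lsum f l0) (- (s - lsum f l0))).
  rewrite Cmod_opp in C. lra.
Qed.

Lemma Cauchy_Clim (u : nat -> C) :
  (forall eps, 0 < eps -> exists N, forall n m, (N <= n)%nat -> (N <= m)%nat -> Cmod (u n - u m) < eps) ->
  exists s, Clim u s.
Proof.
  intros H.
  assert (Hre : ex_finite_lim_seq (fun n => fst (u n))).
  { apply ex_lim_seq_cauchy_corr. intros eps. destruct (H eps (cond_pos eps)) as (N & HN).
    exists N. intros n m Hn Hm. apply Rle_lt_trans with (2 := HN n m Hn Hm).
    apply Rle_trans with (2 := Rmax_Cmod _). simpl. apply Rmax_l. }
  assert (Him : ex_finite_lim_seq (fun n => snd (u n))).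
  { apply ex_lim_seq_cauchy_corr. intros eps. destruct (H eps (cond_pos eps)) as (N & HN).
    exists N. intros n m Hn Hm. apply Rle_lt_trans with (2 := HN n m Hn Hm).
    apply Rle_trans with (2 := Rmax_Cmod _). simpl. apply Rmax_r. }
  destruct Hre as (x & Hx). destruct Him as (y & Hy).
  exists (x, y). intros eps Heps.
  assert (Hs : 0 < eps / 2) by lra.
  apply is_lim_seq_spec in Hx. apply is_lim_seq_spec in Hy.
  destruct (Hx (mkposreal _ Hs)) as (N & HN). destruct (Hy (mkposreal _ Hs)) as (N' & HN').
  exists (Nat.max N N'). intros n Hn. specialize (HN n ltac:(lia)). specialize (HN' n ltac:(lia)).
  simpl in HN, HN'.
  apply Rle_lt_trans with (1 := Cmod_2Rmax _). simpl.
  assert (Hm : Rmax (Rabs (fst (u n) + - x)) (Rabs (snd (u n) + - y)) < eps / 2).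
  { apply Rmax_lub_lt; auto. }
  assert (H2 : sqrt 2 <= 2).
  { rewrite <- (sqrt_square 2) at 2 by lra. apply sqrt_le_1_alt. lra. }
  assert (H0 : 0 <= Rmax (Rabs (fst (u n) + - x)) (Rabs (snd (u n) + - y))).
  { apply Rle_trans with (2 := Rmax_l _ _). apply Rabs_pos. }
  apply Rle_lt_trans with (2 * Rmax (Rabs (fst (u n) + - x)) (Rabs (snd (u n) + - y))); [|lra].
  apply Rmult_le_compat_r; auto.
Qed.

(** [ls] is any exhaustion by finite lists: the majorant makes the sums along it Cauchy, and its
    small tails carry the limit over to the whole directed set of lists. *)
Lemma hassum_exists {I} (dec : eq_decidable I) (f : I -> C) (g : I -> R) (ls : nat -> list I) :
  (forall i, Cmod (f i) <= g i) -> rbounded g -> (forall n, NoDup (ls n)) ->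
  (forall i, exists N, forall n, (N <= n)%nat -> In i (ls n)) -> exists s, hassum f s.
Proof.
  intros Hf Hg Hls Hex.
  assert (Key : forall eps, 0 < eps -> exists l0 N, NoDup l0 /\
     (forall l, NoDup l -> incl l0 l -> Cmod (lsum f l - lsum f l0) < eps) /\
     forall n, (N <= n)%nat -> incl l0 (ls n)).
  { intros eps Heps. destruct (rbounded_tail g Hg eps Heps) as (l0 & N0 & Ht).
    destruct (eventually_list (fun n i => In i (ls n)) l0 Hex) as (N & HN).
    exists l0, N. split; auto. split; [|intros n Hn i; apply HN; auto].
    apply lsum_diff_tail with g; auto. }
  destruct (Cauchy_Clim (fun n => lsum f (ls n))) as (s & Hs).
  { intros eps Heps. destruct (Key (eps/2) ltac:(lra)) as (l0 & N & N0 & K & Hi).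
    exists N. intros n m Hn Hm.
    assert (K1 := K (ls n) (Hls n) (Hi n Hn)). assert (K2 := K (ls m) (Hls m) (Hi m Hm)).
    replace (lsum f (ls n) - lsum f (ls m))%C with
      ((lsum f (ls n) - lsum f l0) + - (lsum f (ls m) - lsum f l0))%C by ring.
    apply Rle_lt_trans with (1 := Cmod_triangle _ _). rewrite Cmod_opp. lra. }
  exists s. intros eps Heps.
  destruct (Key (eps/3) ltac:(lra)) as (l0 & N & N0 & K & Hi).
  exists l0. split; auto. intros l Hl Hil.
  destruct (Hs (eps/3) ltac:(lra)) as (N' & HN').
  set (n := Nat.max N N').
  assert (K1 := K (ls n) (Hls n) (Hi n ltac:(lia))). assert (K2 := K l Hl Hil).
  specialize (HN' n ltac:(lia)).
  replace (lsum f l - s)%C with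
    ((lsum f l - lsum f l0) + (- (lsum f (ls n) - lsum f l0) + (lsum f (ls n) - s)))%C by ring.
  apply Rle_lt_trans with (1 := Cmod_triangle _ _).
  assert (T := Cmod_triangle (- (lsum f (ls n) - lsum f l0)) (lsum f (ls n) - s)).
  rewrite Cmod_opp in T. lra.
Qed.

Lemma NoDup_list_prod {A B} (l : list A) (m : list B) : NoDup l -> NoDup m -> NoDup (list_prod l m).
Proof.
  intros Hl Hm. induction Hl as [|a l Hn Hd IH]; simpl; [constructor|].
  apply NoDup_app; auto.
  - apply FinFun.Injective_map_NoDup; auto. intros x y E. congruence.
  - intros (x, y) H1 H2. apply in_map_iff in H1. destruct H1 as (b & E & _).
    apply in_prod_iff in H2. inversion E; subst. tauto.
Qed.

Lemma rsum_list_prod {A B} (f : A -> R) (g : B -> R) l m :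
  rsum (fun ij => f (fst ij) * g (snd ij)) (list_prod l m) = rsum f l * rsum g m.
Proof.
  induction l; simpl; [ring|]. rewrite rsum_app, IHl.
  replace (rsum (fun ij => f (fst ij) * g (snd ij)) (map (fun y => (a, y)) m)) with (f a * rsum g m).
  - ring.
  - clear. induction m; simpl; [ring|]. rewrite <- IHm. ring.
Qed.

Lemma lsum_list_prod {A B} (f : A -> C) (g : B -> C) l m :
  lsum (fun ij => f (fst ij) * g (snd ij))%C (list_prod l m) = (lsum f l * lsum g m)%C.
Proof.
  induction l; simpl; [ring|]. rewrite lsum_app, IHl.
  replace (lsum (fun ij => f (fst ij) * g (snd ij))%C (map (fun y => (a, y)) m)) with (f a * lsum g m)%C.
  - ring.
  - clear. induction m; simpl; [ring|]. rewrite <- IHm. ring.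
Qed.

(** Against the sum over the rectangle [lf] by [lg], the remaining pairs of a large list have a
    coordinate outside [lf] or outside [lg], and the majorant of such pairs is a small tail times a
    bounded sum. *)
Lemma hassum_mult {I J} (decI : eq_decidable I) (decJ : eq_decidable J)
  (f : I -> C) (g : J -> C) (F : I -> R) (G : J -> R) s t :
  (forall i, Cmod (f i) <= F i) -> rbounded F -> (forall j, Cmod (g j) <= G j) -> rbounded G ->
  hassum f s -> hassum g t -> hassum (fun ij => f (fst ij) * g (snd ij))%C (s * t)%C.
Proof.
  intros HF bF HG bG Hs Ht.
  set (dec := fun x y : I * J => ltac:(decide equality) : {x = y} + {x <> y}).
  destruct (bF) as (F0 & A & HA). destruct (bG) as (G0 & B & HB).
  assert (HA0 : 0 <= A) by exact (HA nil (NoDup_nil _)).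
  assert (HB0 : 0 <= B) by exact (HB nil (NoDup_nil _)).
  intros eps Heps.
  (* The total error will be at most [d * (2 * A + 2 * B + 1)]; [d <= 1] takes care of the product
     of the two tails. *)
  set (d := Rmin 1 (eps / (3 * (A + B + 1)))).
  assert (Hd : 0 < d).
  { apply Rmin_pos; [lra|]. apply Rdiv_lt_0_compat; lra. }
  assert (Hd' : d * (A + B + 1) <= eps / 3).
  { apply Rle_trans with (eps / (3 * (A + B + 1)) * (A + B + 1)).
    - apply Rmult_le_compat_r; [lra|apply Rmin_r].
    - right. field. lra. }
  destruct (rbounded_tail F bF d Hd) as (lf & Nf & Tf).
  destruct (rbounded_tail G bG d Hd) as (lg & Ng & Tg).
  assert (Sf := hassum_tail decI f F lf d s HF Nf Tf Hs).
  assert (Sg := hassum_tail decJ g G lg d t HG Ng Tg Ht).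
  exists (list_prod lf lg). split; [apply NoDup_list_prod; auto|].
  intros l Hl Hi.
  destruct (incl_perm dec (list_prod lf lg) l (NoDup_list_prod _ _ Nf Ng) Hl Hi) as (r & Hp & Nr & Dr).
  rewrite (lsum_perm _ _ _ Hp), lsum_app, lsum_list_prod.
  set (w := fun ij : I * J => F (fst ij) * G (snd ij)).
  assert (Hw : forall ij, 0 <= w ij) by (intros; apply Rmult_le_pos; auto).
  assert (Hr : rsum w r <= d * B + A * d).
  (* [r2] collects the pairs whose first coordinate lies outside [lf]; in [r1] it lies inside, so
     the second one must lie outside [lg]. *)
  { set (P := fun ij : I * J => if in_dec decI (fst ij) lf then true else false).
    set (r1 := filter P r). set (r2 := filter (fun x => negb (P x)) r).
    assert (Er : rsum w r = rsum w r1 + rsum w r2).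
    { unfold r1, r2. clear. induction r as [|x r IH]; simpl; [ring|].
      destruct (P x); simpl; rewrite IH; ring. }
    set (X := nodup decI (map fst r)). set (Y := nodup decJ (map snd r)).
    assert (HX : NoDup X) by apply NoDup_nodup. assert (HY : NoDup Y) by apply NoDup_nodup.
    set (X' := filter (fun i => if in_dec decI i lf then false else true) X).
    set (Y' := filter (fun i => if in_dec decJ i lg then false else true) Y).
    assert (HX' : NoDup X') by (apply NoDup_filter; auto).
    assert (HY' : NoDup Y') by (apply NoDup_filter; auto).
    assert (In1 : forall x, In x r -> In (fst x) X) by (intros; apply nodup_In, in_map; auto).
    assert (In2 : forall x, In x r -> In (snd x) Y) by (intros; apply nodup_In, in_map; auto).
    assert (R2 : rsum w r2 <= d * B).
    { apply Rle_trans with (rsum w (list_prod X' Y)).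
      - apply rsum_incl; auto.
        + apply NoDup_filter; auto.
        + apply NoDup_list_prod; auto.
        + intros (i, j) Hx. apply filter_In in Hx. destruct Hx as (Hx & Hn).
          apply in_prod; [|apply (In2 _ Hx)]. apply filter_In. split; [apply (In1 _ Hx)|].
          unfold P in Hn. simpl in Hn. destruct (in_dec decI i lf); auto.
      - unfold w. rewrite rsum_list_prod. apply Rmult_le_compat; auto using rsum_nonneg.
        left. apply Tf; auto. intros i Hx. apply filter_In in Hx.
        destruct Hx as (_ & Hx). destruct (in_dec decI i lf); congruence. }
    assert (R1 : rsum w r1 <= A * d).
    { apply Rle_trans with (rsum w (list_prod X Y')).
      - apply rsum_incl; auto.
        + apply NoDup_filter; auto.
        + apply NoDup_list_prod; auto.
        + intros (i, j) Hx. apply filter_In in Hx. destruct Hx as (Hx & Hn).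
          apply in_prod; [apply (In1 _ Hx)|]. apply filter_In. split; [apply (In2 _ Hx)|].
          unfold P in Hn. simpl in Hn. destruct (in_dec decI i lf) as [Hf|]; [|congruence].
          destruct (in_dec decJ j lg) as [Hg|]; auto.
          exfalso. apply (Dr _ Hx). apply in_prod; auto.
      - unfold w. rewrite rsum_list_prod. apply Rmult_le_compat; auto using rsum_nonneg.
        left. apply Tg; auto. intros i Hx. apply filter_In in Hx.
        destruct Hx as (_ & Hx). destruct (in_dec decJ i lg); congruence. }
    lra. }
  assert (Hlr : Cmod (lsum (fun ij => f (fst ij) * g (snd ij))%C r) <= d * B + A * d).
  { apply Rle_trans with (1 := lsum_Cmod _ _). apply Rle_trans with (2 := Hr).
    apply rsum_le. intros ij. rewrite Cmod_mult.
    apply Rmult_le_compat; auto using Cmod_ge_0. }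
  assert (Hlg : Cmod (lsum g lg) <= B).
  { apply Rle_trans with (1 := lsum_Cmod _ _). apply Rle_trans with (rsum G lg); auto.
    apply rsum_le; auto. }
  assert (Hlf : Cmod (lsum f lf) <= A).
  { apply Rle_trans with (1 := lsum_Cmod _ _). apply Rle_trans with (rsum F lf); auto.
    apply rsum_le; auto. }
  replace (lsum f lf * lsum g lg + lsum (fun ij => f (fst ij) * g (snd ij)) r - s * t)%C with
    (lsum (fun ij => f (fst ij) * g (snd ij)) r +
      (- (s - lsum f lf) * lsum g lg + (- (t - lsum g lg) * lsum f lf + - ((s - lsum f lf) * (t - lsum g lg)))))%C
    by ring.
  assert (T1 := Cmod_triangle (- (t - lsum g lg) * lsum f lf) (- ((s - lsum f lf) * (t - lsum g lg)))).
  assert (T2 := Cmod_triangle (- (s - lsum f lf) * lsum g lg)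
     (- (t - lsum g lg) * lsum f lf + - ((s - lsum f lf) * (t - lsum g lg)))).
  apply Rle_lt_trans with (1 := Cmod_triangle _ _).
  rewrite Cmod_opp, !Cmod_mult, !Cmod_opp in T1. rewrite Cmod_mult, Cmod_opp in T2.
  assert (d <= 1) by apply Rmin_l.
  assert (M1 : Cmod (s - lsum f lf) * Cmod (lsum g lg) <= d * B)
    by (apply Rmult_le_compat; auto using Cmod_ge_0).
  assert (M2 : Cmod (t - lsum g lg) * Cmod (lsum f lf) <= d * A)
    by (apply Rmult_le_compat; auto using Cmod_ge_0).
  assert (M3 : Cmod (s - lsum f lf) * Cmod (t - lsum g lg) <= d * 1).
  { apply Rmult_le_compat; auto using Cmod_ge_0. lra. }
  nra.
Qed.

(** * Jacobi's triple product *)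

Definition zpow (z : C) (n : Z) : C :=
  if Z_le_dec 0 n then (z ^ Z.to_nat n)%C else ((/ z) ^ Z.to_nat (- n))%C.

Lemma zpow_0 (z : C) : zpow z 0 = RtoC 1.
Proof. reflexivity. Qed.

Lemma zpow_nat (z : C) (k : nat) : zpow z (Z.of_nat k) = (z ^ k)%C.
Proof. unfold zpow. destruct Z_le_dec; [|lia]. rewrite Nat2Z.id. reflexivity. Qed.

Lemma zpow_succ (z : C) (n : Z) : z <> 0 -> zpow z (n + 1) = (z * zpow z n)%C.
Proof.
  intros Hz. unfold zpow. destruct (Z_le_dec 0 (n + 1)), (Z_le_dec 0 n); try lia.
  - rewrite Z2Nat.inj_add by lia. rewrite Nat.add_comm. reflexivity.
  - replace n with (-1)%Z by lia. simpl. field. auto.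
  - replace (Z.to_nat (- n)) with (S (Z.to_nat (- (n + 1)))) by lia. simpl. field. auto.
Qed.

Lemma zpow_add (z : C) (n m : Z) : z <> 0 -> zpow z (n + m) = (zpow z n * zpow z m)%C.
Proof.
  intros Hz. revert n. induction m using Z.peano_ind; intros n.
  - rewrite Z.add_0_r, zpow_0. ring.
  - replace (n + Z.succ m)%Z with (n + m + 1)%Z by lia.
    replace (Z.succ m) with (m + 1)%Z by lia. rewrite !zpow_succ, IHm by auto. ring.
  - assert (H1 := zpow_succ z (n + Z.pred m) Hz). assert (H2 := zpow_succ z (Z.pred m) Hz).
    replace (n + Z.pred m + 1)%Z with (n + m)%Z in H1 by lia.
    replace (Z.pred m + 1)%Z with m in H2 by lia.
    rewrite IHm, H2 in H1.
    replace (zpow z (n + Z.pred m)) with (/ z * (z * zpow z (n + Z.pred m)))%C by (field; auto).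
    rewrite <- H1. field. auto.
Qed.

Lemma zpow_mult (u v : C) (n : Z) : u <> 0 -> v <> 0 -> zpow (u * v) n = (zpow u n * zpow v n)%C.
Proof.
  intros Hu Hv. unfold zpow. destruct Z_le_dec; [apply Cpow_mult_l|].
  rewrite <- Cpow_mult_l. f_equal. field. auto.
Qed.

Lemma zpow_nz (z : C) (n : Z) : z <> 0 -> zpow z n <> 0.
Proof.
  intros Hz. unfold zpow. destruct Z_le_dec; apply Cpow_nz; auto.
  intros H. apply (f_equal (Cmult z)) in H. rewrite Cinv_r, Cmult_0_r in H by auto.
  apply RtoC_inj in H. lra.
Qed.

Lemma zpow_zpow (z : C) (n m : Z) : z <> 0 -> zpow (zpow z n) m = zpow z (n * m).
Proof.
  intros Hz. assert (Hn := zpow_nz z n Hz). induction m using Z.peano_ind.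
  - rewrite Z.mul_0_r, !zpow_0. reflexivity.
  - replace (Z.succ m) with (m + 1)%Z by lia. rewrite zpow_succ, IHm by auto.
    replace (n * (m + 1))%Z with (n + n * m)%Z by lia. rewrite zpow_add by auto. reflexivity.
  - assert (H1 := zpow_succ (zpow z n) (Z.pred m) Hn).
    replace (Z.pred m + 1)%Z with m in H1 by lia. rewrite IHm in H1.
    replace (n * m)%Z with (n + n * Z.pred m)%Z in H1 by lia. rewrite zpow_add in H1 by auto.
    replace (zpow (zpow z n) (Z.pred m)) with
      (/ zpow z n * (zpow z n * zpow (zpow z n) (Z.pred m)))%C by (field; auto).
    rewrite <- H1. field. auto.
Qed.

Definition tri (n : Z) : Z := (n * (n - 1) / 2)%Z.

Lemma tri_double (n : Z) : (2 * tri n = n * (n - 1))%Z.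
Proof.
  unfold tri. symmetry. apply Z_div_exact_2; [lia|].
  rewrite Z.mul_mod by lia. assert (H := Z.mod_pos_bound n 2 ltac:(lia)).
  rewrite (Zminus_mod n 1). assert (E : (n mod 2 = 0 \/ n mod 2 = 1)%Z) by lia.
  destruct E as [-> | ->]; reflexivity.
Qed.

Lemma tri_succ (n : Z) : (tri (n + 1) = tri n + n)%Z.
Proof. assert (H := tri_double n). assert (H' := tri_double (n + 1)). nia. Qed.

(** General term of Jacobi's theta series in the normalisation [p^(n(n-1)/2) w^n], in which
    consecutive terms have ratio [p^n w]. *)
Definition th (p : R) (w : C) (n : Z) : C := (zpow (RtoC p) (tri n) * zpow w n)%C.

Lemma RtoC_neq0 (x : R) : x <> 0 -> RtoC x <> 0.
Proof. intros H E. apply RtoC_inj in E. auto. Qed.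

Lemma th_succ (p : R) (w : C) (n : Z) : p <> 0 -> w <> 0 ->
  th p w (n + 1) = (zpow (RtoC p) n * w * th p w n)%C.
Proof.
  intros Hp Hw. unfold th. rewrite tri_succ, zpow_add, zpow_succ by (auto using RtoC_neq0). ring.
Qed.

(** The ratio [Y * p ^ k] of consecutive terms falls below 1/2 after [K] steps; only the earlier
    steps can make [b k * 2 ^ k] grow, each by a factor of at most [m]. *)
Lemma superexp_bound (b : nat -> R) (p Y : R) : 0 < p < 1 -> 0 < Y ->
  (forall k, 0 <= b k) -> (forall k, b (S k) = b k * (Y * p ^ k)) ->
  exists M, 0 <= M /\ forall k, b k <= M * (1/2) ^ k.
Proof.
  intros Hp HY Hb Hs.
  destruct (pow_lt_1_zero p ltac:(rewrite Rabs_pos_eq; lra) (/ (2 * Y))) as (K & HK).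
  { apply Rinv_0_lt_compat. lra. }
  set (m := Rmax 1 (2 * Y)).
  assert (Hm1 : 1 <= m) by apply Rmax_l. assert (Hm2 : 2 * Y <= m) by apply Rmax_r.
  assert (H : forall k, b k * 2 ^ k <= b 0%nat * m ^ (Nat.min k K)).
  { induction k.
    - simpl. lra.
    - rewrite Hs. simpl (2 ^ S k).
      assert (Hpk : 0 < p ^ k) by (apply pow_lt; lra).
      assert (Hpk1 : p ^ k <= 1) by (rewrite <- (pow1 k); apply pow_incr; lra).
      assert (H2k : 0 < 2 ^ k) by (apply pow_lt; lra).
      replace (b k * (Y * p ^ k) * (2 * 2 ^ k)) with ((b k * 2 ^ k) * (2 * Y * p ^ k)) by ring.
      assert (Hbk : 0 <= b k * 2 ^ k) by (apply Rmult_le_pos; [auto|lra]).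
      destruct (Nat.lt_ge_cases k K).
      + replace (Nat.min (S k) K) with (S (Nat.min k K)) by lia.
        simpl. replace (b 0%nat * (m * m ^ Nat.min k K)) with (b 0%nat * m ^ Nat.min k K * m) by ring.
        apply Rmult_le_compat; auto.
        * apply Rmult_le_pos; lra.
        * apply Rle_trans with (2 * Y * 1); [|lra]. apply Rmult_le_compat_l; lra.
      + replace (Nat.min (S k) K) with (Nat.min k K) by lia.
        apply Rle_trans with (2 := IHk). rewrite <- (Rmult_1_r (b k * 2 ^ k)) at 2.
        apply Rmult_le_compat_l; auto.
        specialize (HK k H). rewrite Rabs_pos_eq in HK by lra.
        apply Rle_trans with (2 * Y * / (2 * Y)); [|right; field; lra].
        apply Rmult_le_compat_l; lra. }
  exists (b 0%nat * m ^ K). split.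
  { apply Rmult_le_pos; auto. apply pow_le; lra. }
  intros k. specialize (H k).
  assert (H2k : 0 < 2 ^ k) by (apply pow_lt; lra).
  assert (m ^ Nat.min k K <= m ^ K) by (apply Rle_pow; [auto|lia]).
  apply Rmult_le_reg_r with (2 ^ k); auto. rewrite Rmult_assoc, <- Rpow_mult_distr.
  replace (1 / 2 * 2) with 1 by field. rewrite pow1, Rmult_1_r.
  apply Rle_trans with (1 := H). apply Rmult_le_compat_l; auto.
Qed.

(** The window [-K <= n < K], cut at 0 for inductions on either side. Besides exhausting the
    integers, its [2 K] elements index the angles in [filter_sum], which is why it is half open. *)
Definition zlist (K : nat) : list Z :=
  map Z.of_nat (seq 0 K) ++ map (fun k => (-1 - Z.of_nat k)%Z) (seq 0 K).

Lemma zlist_In (K : nat) (n : Z) : In n (zlist K) <-> (- Z.of_nat K <= n < Z.of_nat K)%Z.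
Proof.
  unfold zlist. rewrite in_app_iff, !in_map_iff. split.
  - intros [(k & <- & Hk) | (k & <- & Hk)]; apply in_seq in Hk; lia.
  - intros H. destruct (Z_le_dec 0 n).
    + left. exists (Z.to_nat n). split; [lia|]. apply in_seq. lia.
    + right. exists (Z.to_nat (-1 - n)). split; [lia|]. apply in_seq. lia.
Qed.

Lemma zlist_NoDup (K : nat) : NoDup (zlist K).
Proof.
  apply NoDup_app.
  - apply FinFun.Injective_map_NoDup; [intros x y; lia|apply seq_NoDup].
  - apply FinFun.Injective_map_NoDup; [intros x y; lia|apply seq_NoDup].
  - intros n H1 H2. apply in_map_iff in H1. apply in_map_iff in H2.
    destruct H1 as (a & <- & _), H2 as (b & E & _). lia.
Qed.

Lemma zlist_incl (l : list Z) : exists K, incl l (zlist K).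
Proof.
  induction l as [|n l (K & HK)].
  - exists 0%nat. intros i [].
  - exists (Nat.max K (S (Z.to_nat (Z.abs n)))). intros i [<-|Hi].
    + apply zlist_In. lia.
    + apply HK in Hi. apply zlist_In in Hi. apply zlist_In. lia.
Qed.

Lemma rsum_map {I J} (f : I -> R) (h : J -> I) l : rsum f (map h l) = rsum (fun j => f (h j)) l.
Proof. induction l; simpl; congruence. Qed.

Lemma rbounded_Z (g : Z -> R) (M : R) : (forall n, 0 <= g n) -> 0 <= M ->
  (forall k, g (Z.of_nat k) <= M * (1/2) ^ k) -> (forall k, g (-1 - Z.of_nat k)%Z <= M * (1/2) ^ k) ->
  rbounded g.
Proof.
  intros Hg HM H1 H2. split; auto. exists (4 * M). intros l Hl.
  destruct (zlist_incl l) as (K & HK).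
  apply Rle_trans with (rsum g (zlist K)).
  { apply rsum_incl; auto using zlist_NoDup. exact Z.eq_dec. }
  unfold zlist. rewrite rsum_app, !rsum_map.
  assert (Hgeo : rsum (fun k => M * (1/2) ^ k) (seq 0 K) <= 2 * M).
  { assert (E : rsum (fun k => M * (1/2) ^ k) (seq 0 K) = 2 * M - 2 * M * (1/2) ^ K).
    { clear HK. induction K; [simpl; ring|]. rewrite seq_S, rsum_app, IHK. simpl. field. }
    rewrite E. assert (0 <= (1/2) ^ K) by (apply pow_le; lra). nra. }
  apply Rle_trans with (2 * M + 2 * M); [|lra].
  apply Rplus_le_compat; apply Rle_trans with (2 := Hgeo); apply rsum_le; auto.
Qed.

Lemma Cmod_pos_R (p : R) : 0 < p -> Cmod (RtoC p) = p.
Proof. intros. rewrite Cmod_R, Rabs_pos_eq; lra. Qed.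

Lemma Cmod_zpow_nat (p : R) (k : nat) : 0 < p -> Cmod (zpow (RtoC p) (Z.of_nat k)) = p ^ k.
Proof. intros. rewrite zpow_nat, Cmod_pow, Cmod_pos_R; auto. Qed.

Lemma th_rbounded (p : R) (w : C) : 0 < p < 1 -> w <> 0 -> rbounded (fun n => Cmod (th p w n)).
Proof.
  intros Hp Hw. assert (HW : 0 < Cmod w) by (apply Cmod_gt_0; auto).
  destruct (superexp_bound (fun k => Cmod (th p w (Z.of_nat k))) p (Cmod w)) as (M1 & HM1 & H1); auto.
  { intros; apply Cmod_ge_0. }
  { intros k. replace (Z.of_nat (S k)) with (Z.of_nat k + 1)%Z by lia.
    rewrite th_succ by (auto; lra). rewrite !Cmod_mult, Cmod_zpow_nat by lra. ring. }
  (* Going down from index [-1 - k] to [-2 - k] multiplies the term by [p ^ (k + 2) / w], whence the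
     constant [p ^ 2 / Cmod w]. *)
  destruct (superexp_bound (fun k => Cmod (th p w (-1 - Z.of_nat k))) p (p ^ 2 / Cmod w))
    as (M2 & HM2 & H2); auto.
  { apply Rdiv_lt_0_compat; auto. apply pow_lt; lra. }
  { intros; apply Cmod_ge_0. }
  { intros k. replace (-1 - Z.of_nat k)%Z with (-1 - Z.of_nat (S k) + 1)%Z by lia.
    rewrite th_succ by (auto; lra). rewrite !Cmod_mult.
    assert (E : Cmod (zpow (RtoC p) (-1 - Z.of_nat (S k))) * p ^ S (S k) = 1).
    { rewrite <- Cmod_zpow_nat, <- Cmod_mult, <- zpow_add by (try apply RtoC_neq0; lra).
      replace (-1 - Z.of_nat (S k) + Z.of_nat (S (S k)))%Z with 0%Z by lia.
      rewrite zpow_0. apply Cmod_1. }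
    set (P := Cmod (zpow (RtoC p) (-1 - Z.of_nat (S k)))) in *.
    replace (p ^ 2 / Cmod w * p ^ k) with (p ^ S (S k) / Cmod w) by (simpl; field; lra).
    replace (P * Cmod w * Cmod (th p w (-1 - Z.of_nat (S k))) * (p ^ S (S k) / Cmod w)) with
      (P * p ^ S (S k) * Cmod (th p w (-1 - Z.of_nat (S k)))) by (field; lra).
    rewrite E. ring. }
  apply rbounded_Z with (M1 + M2).
  - intros; apply Cmod_ge_0.
  - lra.
  - intros k. apply Rle_trans with (1 := H1 k). apply Rmult_le_compat_r; [apply pow_le; lra|lra].
  - intros k. apply Rle_trans with (1 := H2 k). apply Rmult_le_compat_r; [apply pow_le; lra|lra].
Qed.

Lemma th_hassum_exists (p : R) (w : C) : 0 < p < 1 -> w <> 0 -> exists s, hassum (th p w) s.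
Proof.
  intros Hp Hw. apply (hassum_exists Z.eq_dec _ (fun n => Cmod (th p w n)) zlist).
  - intros; lra.
  - apply th_rbounded; auto.
  - apply zlist_NoDup.
  - intros n. exists (S (Z.to_nat (Z.abs n))). intros K HK. apply zlist_In. lia.
Qed.

(** * The finite triple product and its limit *)

Definition qfac (p : R) (m : nat) : R := prodR (fun j => 1 - p ^ j) m.

(** The extension by zero to negative [m] makes the recurrence [qfac_inv_pred] valid for every
    integer, since the factor [1 - p ^ 0] vanishes at [m = 0]; boundary terms then need no case
    distinction. *)
Definition qfac_inv (p : R) (m : Z) : R := if Z_le_dec 0 m then / qfac p (Z.to_nat m) else 0.

Lemma pow_lt_1 (p : R) (j : nat) : 0 < p < 1 -> (1 <= j)%nat -> 0 < p ^ j < 1.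
Proof.
  intros Hp Hj. split; [apply pow_lt; lra|]. apply pow_lt_1_compat; [lra|lia].
Qed.

Lemma qfac_pos (p : R) (m : nat) : 0 < p < 1 -> 0 < qfac p m.
Proof.
  intros Hp. induction m; [unfold qfac; simpl; lra|].
  change (qfac p (S m)) with (qfac p m * (1 - p ^ S m)).
  apply Rmult_lt_0_compat; auto. assert (H := pow_lt_1 p (S m) Hp ltac:(lia)). lra.
Qed.

Lemma qfac_le1 (p : R) (m : nat) : 0 < p < 1 -> qfac p m <= 1.
Proof.
  intros Hp. induction m; [unfold qfac; simpl; lra|].
  change (qfac p (S m)) with (qfac p m * (1 - p ^ S m)).
  assert (H := pow_lt_1 p (S m) Hp ltac:(lia)). assert (H1 := qfac_pos p m Hp). nra.
Qed.

Lemma egeo_1mpow (p : R) : 0 < p < 1 -> egeo (fun n => (1 - p ^ n) - 1).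
Proof.
  intros Hp. apply egeo_ext1 with (fun n => - p ^ n); [intros; ring|].
  apply egeo_opp, egeo_geom. rewrite Rabs_pos_eq; lra.
Qed.

Lemma E_lim (p : R) : 0 < p < 1 -> is_lim_seq (qfac p) (E p).
Proof. intros Hp. apply inf_prod_lim, egeo_1mpow, Hp. Qed.

Lemma E_pos (p : R) : 0 < p < 1 -> 0 < E p.
Proof.
  intros Hp. apply inf_prod_pos; [apply egeo_1mpow, Hp|].
  intros n Hn. assert (H := pow_lt_1 p n Hp Hn). lra.
Qed.

Lemma E_le_qfac (p : R) (m : nat) : 0 < p < 1 -> E p <= qfac p m.
Proof.
  intros Hp. apply (is_lim_seq_decr_compare (qfac p)); [apply E_lim, Hp|].
  intros n. change (qfac p (S n)) with (qfac p n * (1 - p ^ S n)).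
  assert (H := pow_lt_1 p (S n) Hp ltac:(lia)). assert (H1 := qfac_pos p n Hp). nra.
Qed.

Lemma qfac_inv_pred (p : R) (m : Z) : 0 < p < 1 ->
  RtoC (qfac_inv p (m - 1)) = ((1 - zpow (RtoC p) m) * RtoC (qfac_inv p m))%C.
Proof.
  intros Hp. unfold qfac_inv. destruct (Z_le_dec 0 (m - 1)), (Z_le_dec 0 m); try lia.
  - replace m with (Z.of_nat (S (Z.to_nat (m - 1)))) at 2 3 by lia.
    rewrite zpow_nat, Nat2Z.id, <- RtoC_pow.
    change (qfac p (S (Z.to_nat (m - 1)))) with
      (qfac p (Z.to_nat (m - 1)) * (1 - p ^ S (Z.to_nat (m - 1)))).
    assert (H1 := qfac_pos p (Z.to_nat (m - 1)) Hp).
    assert (H := pow_lt_1 p (S (Z.to_nat (m - 1))) Hp ltac:(lia)).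
    rewrite <- RtoC_minus, <- RtoC_mult. f_equal. field. lra.
  - replace m with 0%Z by lia. rewrite zpow_0. ring.
  - ring.
Qed.

(** The Gaussian binomial coefficient of [2 N] over [N + n] in base [p]. *)
Definition jcoef (p : R) (N : nat) (n : Z) : R :=
  qfac p (2 * N) * (qfac_inv p (Z.of_nat N + n) * qfac_inv p (Z.of_nat N - n)).

Fixpoint jprod (p : R) (u : C) (N : nat) : C :=
  match N with
  | O => RtoC 1
  | S M => (jprod p u M * ((1 + u * RtoC p ^ M) * (1 + RtoC p ^ S M / u)))%C
  end.

(** The Pascal rule in base [p] applied twice. By [qfac_inv_pred] all coefficients are multiples of
    a single product, and what remains is polynomial given [p ^ a * p ^ b = p ^ (2 N + 2)]. *)
Lemma jcoef_rec (p : R) (N : nat) (n : Z) : 0 < p < 1 ->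
  RtoC (jcoef p (S N) n) =
  ((1 + RtoC p ^ (2 * N + 1)) * RtoC (jcoef p N n) +
   zpow (RtoC p) (Z.of_nat N + 1 - n) * RtoC (jcoef p N (n - 1)) +
   zpow (RtoC p) (Z.of_nat N + 1 + n) * RtoC (jcoef p N (n + 1)))%C.
Proof.
  intros Hp. unfold jcoef. set (a := (Z.of_nat N + 1 + n)%Z). set (b := (Z.of_nat N + 1 - n)%Z).
  assert (Hp0 : RtoC p <> 0) by (apply RtoC_neq0; lra).
  replace (Z.of_nat (S N) + n)%Z with a by lia. replace (Z.of_nat (S N) - n)%Z with b by lia.
  replace (Z.of_nat N + n)%Z with (a - 1)%Z by lia. replace (Z.of_nat N - n)%Z with (b - 1)%Z by lia.
  replace (Z.of_nat N + (n - 1))%Z with (a - 1 - 1)%Z by lia.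
  replace (Z.of_nat N - (n - 1))%Z with b by lia.
  replace (Z.of_nat N + (n + 1))%Z with a by lia.
  replace (Z.of_nat N - (n + 1))%Z with (b - 1 - 1)%Z by lia.
  rewrite !RtoC_mult, !qfac_inv_pred by auto.
  replace (2 * S N)%nat with (S (S (2 * N))) by lia.
  change (qfac p (S (S (2 * N)))) with (qfac p (2 * N) * (1 - p ^ S (2 * N)) * (1 - p ^ S (S (2 * N)))).
  assert (HA := zpow_succ (RtoC p) (a - 1) Hp0). assert (HB := zpow_succ (RtoC p) (b - 1) Hp0).
  replace (a - 1 + 1)%Z with a in HA by lia. replace (b - 1 + 1)%Z with b in HB by lia.
  assert (HAB : (zpow (RtoC p) a * zpow (RtoC p) b)%C = (RtoC p * RtoC p ^ (2 * N + 1))%C).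
  { rewrite <- zpow_add by auto. replace (a + b)%Z with (Z.of_nat (S (2 * N + 1))) by lia.
    rewrite zpow_nat. reflexivity. }
  rewrite !RtoC_mult, !RtoC_minus, !RtoC_pow.
  replace (S (S (2 * N))) with (S (2 * N + 1)) by lia. replace (S (2 * N)) with (2 * N + 1)%nat by lia.
  rewrite Cpow_S, <- HAB. rewrite HA, HB in *.
  set (x := zpow (RtoC p) (a - 1)) in *. set (y := zpow (RtoC p) (b - 1)) in *.
  replace (RtoC p ^ (2 * N + 1))%C with (RtoC p * x * y)%C.
  - ring.
  - replace (RtoC p ^ (2 * N + 1))%C with (/ RtoC p * (RtoC p * RtoC p ^ (2 * N + 1)))%C by (field; auto).
    rewrite <- HAB. field. auto.
Qed.

(** Finite form of the triple product: a q-binomial expansion, proved by shifting indices. *)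
Lemma jprod_hassum (p : R) (u : C) (N : nat) : 0 < p < 1 -> u <> 0 ->
  hassum (fun n => RtoC (jcoef p N n) * th p u n)%C (jprod p u N).
Proof.
  intros Hp Hu. assert (Hp0 : RtoC p <> 0) by (apply RtoC_neq0; lra). induction N.
  - replace (jprod p u 0) with (RtoC (jcoef p 0 0) * th p u 0)%C.
    + apply (hassum_single (fun n => RtoC (jcoef p 0 n) * th p u n)%C 0%Z).
      intros n Hn. unfold jcoef, qfac_inv.
      destruct (Z_le_dec 0 (Z.of_nat 0 + n)), (Z_le_dec 0 (Z.of_nat 0 - n)); try lia;
        rewrite ?Rmult_0_l, ?Rmult_0_r; ring.
    + unfold jcoef, th, qfac_inv, qfac. simpl.
      replace (1 * (/ 1 * / 1)) with 1 by field. rewrite zpow_0. unfold tri. simpl. rewrite zpow_0. ring.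
  - simpl jprod. set (f := fun n => (RtoC (jcoef p N n) * th p u n)%C) in *.
    replace (jprod p u N * ((1 + u * RtoC p ^ N) * (1 + RtoC p * RtoC p ^ N / u)))%C with
      ((1 + RtoC p ^ (2 * N + 1)) * jprod p u N + u * RtoC p ^ N * jprod p u N +
       RtoC p ^ (N + 1) / u * jprod p u N)%C.
    2: { replace (2 * N + 1)%nat with (N + (N + 1))%nat by lia.
         rewrite !Cpow_add_r, Cpow_1_r. field. auto. }
    assert (Hm : hassum (fun n => f (n - 1)%Z) (jprod p u N)).
    { apply (hassum_reindex f (fun n => (n - 1)%Z) (fun n => (n + 1)%Z)); auto; intros; lia. }
    assert (Hq : hassum (fun n => f (n + 1)%Z) (jprod p u N)).
    { apply (hassum_reindex f (fun n => (n + 1)%Z) (fun n => (n - 1)%Z)); auto; intros; lia. }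
    apply hassum_ext with (fun n => (1 + RtoC p ^ (2 * N + 1)) * f n +
       u * RtoC p ^ N * f (n - 1)%Z + RtoC p ^ (N + 1) / u * f (n + 1)%Z)%C.
    + intros n. unfold f. rewrite jcoef_rec by auto.
      assert (H1 := th_succ p u (n - 1) ltac:(lra) Hu).
      replace (n - 1 + 1)%Z with n in H1 by lia.
      rewrite th_succ by (auto; lra). rewrite H1.
      replace (Z.of_nat N + 1 - n)%Z with (Z.of_nat N + - (n - 1))%Z by lia.
      replace (Z.of_nat N + 1 + n)%Z with (Z.of_nat (N + 1) + n)%Z by lia.
      rewrite !zpow_add, !zpow_nat by auto.
      assert (H2 : (zpow (RtoC p) (- (n - 1)) * zpow (RtoC p) (n - 1))%C = RtoC 1).
      { rewrite <- zpow_add by auto. replace (- (n - 1) + (n - 1))%Z with 0%Z by lia. reflexivity. }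
      set (A := zpow (RtoC p) (- (n - 1))) in *. set (B := zpow (RtoC p) (n - 1)) in *.
      set (D := zpow (RtoC p) n). set (t := th p u (n - 1)).
      transitivity ((1 + RtoC p ^ (2 * N + 1)) * (RtoC (jcoef p N n) * (B * u * t)) +
        u * RtoC p ^ N * (RtoC (jcoef p N (n - 1)) * ((A * B) * t)) +
        RtoC p ^ (N + 1) * D * RtoC (jcoef p N (n + 1)) * (B * u * t))%C.
      * rewrite H2. field. auto.
      * ring.
    + apply (hassum_plus Z.eq_dec); [apply (hassum_plus Z.eq_dec)|]; apply hassum_scal; auto.
Qed.

Lemma Clim_RtoC (u : nat -> R) (l : R) : is_lim_seq u l -> Clim (fun n => RtoC (u n)) (RtoC l).
Proof.
  intros H eps Heps. apply is_lim_seq_spec in H. destruct (H (mkposreal _ Heps)) as (N & HN).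
  exists N. intros n Hn. rewrite <- RtoC_minus, Cmod_R. apply HN, Hn.
Qed.

Lemma Clim_ext_loc (u v : nat -> C) s : (exists N, forall n, (N <= n)%nat -> u n = v n) ->
  Clim u s -> Clim v s.
Proof.
  intros (N & HN) H eps Heps. destruct (H eps Heps) as (N' & HN').
  exists (Nat.max N N'). intros n Hn. rewrite <- HN by lia. apply HN'. lia.
Qed.

Lemma Clim_unique (u : nat -> C) s t : Clim u s -> Clim u t -> s = t.
Proof.
  intros Hs Ht. assert (H : (s - t)%C = RtoC 0).
  { apply Cmod_small_eq. intros eps Heps.
    destruct (Hs (eps/2) ltac:(lra)) as (N & HN). destruct (Ht (eps/2) ltac:(lra)) as (N' & HN').
    specialize (HN (Nat.max N N') ltac:(lia)). specialize (HN' (Nat.max N N') ltac:(lia)).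
    set (x := u (Nat.max N N')) in *.
    replace (s - t)%C with (- (x - s) + (x - t))%C by ring.
    apply Rle_lt_trans with (1 := Cmod_triangle _ _). rewrite Cmod_opp. lra. }
  replace s with (s - t + t)%C by ring. rewrite H. ring.
Qed.

Lemma Clim_mult (u v : nat -> C) s t : Clim u s -> Clim v t -> Clim (fun n => u n * v n)%C (s * t)%C.
Proof.
  intros Hs Ht eps Heps.
  assert (Ps := Cmod_ge_0 s). assert (Pt := Cmod_ge_0 t).
  set (d := Rmin 1 (eps / (3 * (Cmod s + Cmod t + 1)))).
  assert (Hd : 0 < d).
  { apply Rmin_pos; [lra|]. apply Rdiv_lt_0_compat; lra. }
  assert (Hd1 : d <= 1) by apply Rmin_l.
  assert (Hd' : d * (Cmod s + Cmod t + 1) <= eps / 3).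
  { apply Rle_trans with (eps / (3 * (Cmod s + Cmod t + 1)) * (Cmod s + Cmod t + 1)).
    - apply Rmult_le_compat_r; [lra|apply Rmin_r].
    - right. field. lra. }
  destruct (Hs d Hd) as (N & HN). destruct (Ht d Hd) as (N' & HN').
  exists (Nat.max N N'). intros n Hn. specialize (HN n ltac:(lia)). specialize (HN' n ltac:(lia)).
  replace (u n * v n - s * t)%C with
    ((u n - s) * (v n - t) + (s * (v n - t) + t * (u n - s)))%C by ring.
  apply Rle_lt_trans with (1 := Cmod_triangle _ _).
  assert (T := Cmod_triangle (s * (v n - t)) (t * (u n - s))).
  rewrite !Cmod_mult in T. rewrite Cmod_mult.
  assert (A := Cmod_ge_0 (u n - s)). assert (B := Cmod_ge_0 (v n - t)).
  assert (Cmod (u n - s) * Cmod (v n - t) <= d * 1) by (apply Rmult_le_compat; lra).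
  assert (Cmod s * Cmod (v n - t) <= Cmod s * d) by (apply Rmult_le_compat_l; lra).
  assert (Cmod t * Cmod (u n - s) <= Cmod t * d) by (apply Rmult_le_compat_l; lra).
  nra.
Qed.

Lemma Clim_const (c : C) : Clim (fun _ => c) c.
Proof.
  intros eps Heps. exists 0%nat. intros. replace (c - c)%C with (RtoC 0) by ring.
  rewrite Cmod_0. auto.
Qed.

Lemma jcoef_bound (p : R) (N : nat) (n : Z) : 0 < p < 1 -> Rabs (jcoef p N n) <= / E p * / E p.
Proof.
  intros Hp. assert (HE := E_pos p Hp).
  assert (Hi : forall m, 0 <= qfac_inv p m <= / E p).
  { intros m. unfold qfac_inv. assert (0 < / E p) by (apply Rinv_0_lt_compat; auto).
    destruct Z_le_dec; [|lra]. assert (H1 := qfac_pos p (Z.to_nat m) Hp). split.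
    - left. apply Rinv_0_lt_compat; auto.
    - apply Rinv_le_contravar; auto. apply E_le_qfac; auto. }
  unfold jcoef. assert (H0 := qfac_pos p (2 * N) Hp). assert (H1 := qfac_le1 p (2 * N) Hp).
  assert (H2 := Hi (Z.of_nat N + n)%Z). assert (H3 := Hi (Z.of_nat N - n)%Z).
  assert (H4 : 0 <= qfac_inv p (Z.of_nat N + n) * qfac_inv p (Z.of_nat N - n)) by (apply Rmult_le_pos; lra).
  assert (H5 : qfac_inv p (Z.of_nat N + n) * qfac_inv p (Z.of_nat N - n) <= / E p * / E p)
    by (apply Rmult_le_compat; lra).
  rewrite Rabs_pos_eq by (apply Rmult_le_pos; lra). nra.
Qed.

Lemma jcoef_lim (p : R) (n : Z) : 0 < p < 1 -> is_lim_seq (fun N => jcoef p N n) (/ E p).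
Proof.
  intros Hp. assert (HE := E_pos p Hp).
  assert (Hsub : forall a : nat -> nat, (forall K, exists N, forall m, (N <= m)%nat -> (K <= a m)%nat) ->
     is_lim_seq (fun N => qfac p (a N)) (E p)).
  { intros a Ha. apply (is_lim_seq_subseq (qfac p) (E p) a); [|apply E_lim, Hp].
    intros P (K & HK). destruct (Ha K) as (N & HN). exists N. intros m Hm. apply HK, HN, Hm. }
  assert (Hi : forall k : Z, is_lim_seq (fun N => qfac_inv p (Z.of_nat N + k)) (/ E p)).
  { intros k. apply is_lim_seq_ext_loc with (fun N => / qfac p (Z.to_nat (Z.of_nat N + k))).
    - exists (Z.to_nat (Z.abs k)). intros N HN. unfold qfac_inv. destruct Z_le_dec; [auto|lia].
    - apply (is_lim_seq_inv _ (E p)).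
      + apply Hsub. intros K. exists (K + Z.to_nat (Z.abs k))%nat. intros; lia.
      + intros H. inversion H. lra. }
  replace (/ E p) with (E p * (/ E p * / E p)) by (field; lra).
  unfold jcoef. apply is_lim_seq_mult'; [|apply is_lim_seq_mult'].
  - apply Hsub. intros K. exists K. intros; lia.
  - apply Hi.
  - apply (Hi (- n)%Z).
Qed.

(** In the finite form [jprod_hassum] every coefficient tends to [/ E p] and is bounded by
    [/ E p * / E p], so the limit may be taken under the sum. *)
Theorem jacobi_triple_product (p : R) (u S : C) : 0 < p < 1 -> u <> 0 ->
  hassum (th p u) S -> Clim (jprod p u) (S / RtoC (E p))%C.
Proof.
  intros Hp Hu HS. assert (HE := E_pos p Hp).
  apply (hassum_dominated Z.eq_dec (fun N n => RtoC (jcoef p N n) * th p u n)%C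
    (fun n => RtoC (/ E p) * th p u n)%C
    (fun n => / E p * / E p * Cmod (th p u n))).
  - intros N n. rewrite Cmod_mult, Cmod_R. apply Rmult_le_compat_r; [apply Cmod_ge_0|].
    apply jcoef_bound, Hp.
  - destruct (th_rbounded p u Hp Hu) as (H0 & B & HB). split.
    + intros n. apply Rmult_le_pos; auto. left. apply Rmult_lt_0_compat; apply Rinv_0_lt_compat; auto.
    + exists (/ E p * / E p * B). intros l Hl.
      replace (rsum (fun n => / E p * / E p * Cmod (th p u n)) l) with
        (/ E p * / E p * rsum (fun n => Cmod (th p u n)) l).
      * apply Rmult_le_compat_l; auto. left. apply Rmult_lt_0_compat; apply Rinv_0_lt_compat; auto.
      * clear. induction l; simpl; [ring|]. rewrite <- IHl. ring.
  - intros n. apply Clim_mult; [|apply Clim_const]. apply Clim_RtoC, jcoef_lim, Hp.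
  - intros N. apply jprod_hassum; auto.
  - replace (S / RtoC (E p))%C with (RtoC (/ E p) * S)%C.
    + apply hassum_scal, HS.
    + rewrite RtoC_inv by lra. unfold Cdiv. ring.
Qed.

(** [quad p c d n] is [(1-xyQ)(1-Q/(xy))(1-xQ/y)(1-yQ/x)] for [Q = p^n], [c = x+1/x], [d = y+1/y]. *)
Definition quad (p c d : R) (n : nat) : R :=
  (1 + (p ^ n) ^ 2) ^ 2 - (1 + (p ^ n) ^ 2) * p ^ n * c * d + (p ^ n) ^ 2 * (c ^ 2 + d ^ 2 - 4).

Definition qprod (p c d : R) : R := inf_prod (quad p c d).

(** The factor [c - d = x (1 - 1/(xy)) (1 - y/x)] stands for the remaining theta factors at [n = 0].
    Thus this is [sigma(u+v) sigma(u-v)] up to normalisation, antisymmetric in [c] and [d]. *)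
Definition qdet (p c d : R) : R := (c - d) * qprod p c d.

Lemma egeo_geom01 (p : R) : 0 < p < 1 -> egeo (fun n => p ^ n).
Proof. intros Hp. apply egeo_geom. rewrite Rabs_pos_eq; lra. Qed.

Lemma egeo_quad (p c d : R) : 0 < p < 1 -> egeo (fun n => quad p c d n - 1).
Proof.
  intros Hp. assert (H := egeo_geom01 p Hp). assert (B := egeo_bounded _ H).
  apply egeo_ext1 with (fun n => p ^ n * (2 * p ^ n + (p ^ n) ^ 3 - (1 + (p ^ n) ^ 2) * (c * d) +
    p ^ n * (c ^ 2 + d ^ 2 - 4))).
  - intros n _. unfold quad. ring.
  - apply egeo_mult_bounded; auto.
    solve_seq_bounded.
Qed.

Lemma zpow_sq_split (x y : C) (i j : Z) : x <> 0 -> y <> 0 ->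
  (zpow (- (x * y)) (i + j) * zpow (- (x / y)) (i - j))%C = (zpow (x * x) i * zpow (y * y) j)%C.
Proof.
  intros Hx Hy.
  assert (H1 : (- (x * y))%C <> 0).
  { intros H. apply (f_equal Cmod) in H. rewrite Cmod_opp, Cmod_mult, Cmod_0 in H.
    apply Cmod_gt_0 in Hx. apply Cmod_gt_0 in Hy. nra. }
  assert (H2 : (- (x / y))%C <> 0).
  { intros H. apply H1. replace (- (x * y))%C with (- (x / y) * (y * y))%C by (field; auto).
    rewrite H. ring. }
  replace (zpow (x * x) i) with (zpow (- (x * y)) i * zpow (- (x / y)) i)%C.
  2: { rewrite <- zpow_mult by auto. f_equal. field. auto. }
  replace (i - j)%Z with (i + - j)%Z by lia.
  rewrite !zpow_add by auto.
  assert (E : (zpow (y * y) j * zpow (- (x / y)) j)%C = zpow (- (x * y)) j).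
  { rewrite <- zpow_mult; auto.
    - f_equal. field. auto.
    - apply Cmult_neq_0; auto. }
  rewrite <- E.
  assert (E2 : (zpow (- (x / y)) j * zpow (- (x / y)) (- j))%C = RtoC 1).
  { rewrite <- zpow_add by auto. replace (j + - j)%Z with 0%Z by lia. reflexivity. }
  transitivity (zpow (- (x * y)) i * zpow (- (x / y)) i * zpow (y * y) j *
    (zpow (- (x / y)) j * zpow (- (x / y)) (- j)))%C; [ring|]. rewrite E2. ring.
Qed.

Lemma th_square (p : R) (w : C) (n : Z) : 0 < p -> w <> 0 ->
  th (p ^ 2) w n = (zpow (RtoC p) (2 * tri n) * zpow w n)%C.
Proof.
  intros Hp Hw. unfold th. f_equal.
  replace (RtoC (p ^ 2)) with (zpow (RtoC p) 2).
  - apply zpow_zpow. apply RtoC_neq0; lra.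
  - change 2%Z with (Z.of_nat 2). rewrite zpow_nat, RtoC_pow. reflexivity.
Qed.

(** Splitting the double series of a product of two theta series according to the parity of [m + n]. *)
Lemma theta_product_split (p : R) (x y Sx Sy A1 A2 B1 B2 : C) : 0 < p < 1 -> x <> 0 -> y <> 0 ->
  hassum (th p (- (x * y))) Sx -> hassum (th p (- (x / y))) Sy ->
  hassum (th (p ^ 2) (RtoC (p ^ 2) * (x * x))) A1 -> hassum (th (p ^ 2) (RtoC p * (x * x))) B1 ->
  hassum (th (p ^ 2) (RtoC (p ^ 2) * (y * y))) A2 -> hassum (th (p ^ 2) (RtoC p * (y * y))) B2 ->
  (Sx * Sy = x * ((x * A1) * B2 - B1 * (y * A2)))%C.
Proof.
  intros Hp Hx Hy HSx HSy HA1 HB1 HA2 HB2.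
  assert (Hp0 : RtoC p <> 0) by (apply RtoC_neq0; lra).
  assert (Hp2 : 0 < p ^ 2 < 1) by (apply pow_lt_1; [auto|lia]).
  assert (Hp20 : RtoC (p ^ 2) <> 0) by (apply RtoC_neq0; lra).
  assert (Hxy : (- (x * y))%C <> 0).
  { intros H. apply (f_equal Cmod) in H. rewrite Cmod_opp, Cmod_mult, Cmod_0 in H.
    apply Cmod_gt_0 in Hx. apply Cmod_gt_0 in Hy. nra. }
  assert (Hxdy : (- (x / y))%C <> 0).
  { intros H. apply Hxy. replace (- (x * y))%C with (- (x / y) * (y * y))%C by (field; auto).
    rewrite H. ring. }
  assert (Hxx : (x * x)%C <> 0) by (apply Cmult_neq_0; auto).
  assert (Hyy : (y * y)%C <> 0) by (apply Cmult_neq_0; auto).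
  set (decZZ := fun a b : Z * Z => ltac:(decide equality; apply Z.eq_dec) : {a = b} + {a <> b}).
  assert (Hleft := hassum_mult Z.eq_dec Z.eq_dec _ _ _ _ _ _
    (fun n => Rle_refl (Cmod (th p (- (x * y)) n))) (th_rbounded p _ Hp Hxy)
    (fun n => Rle_refl (Cmod (th p (- (x / y)) n))) (th_rbounded p _ Hp Hxdy) HSx HSy).
  apply (hassum_unique decZZ _ _ _ Hleft).
  replace (x * (x * A1 * B2 - B1 * (y * A2)))%C with
    ((x * x * A1) * B2 + (- (x * y)) * (B1 * A2))%C by ring.
  (* Pairs with even sum are [(i + j, i - j)], the others [(i + j + 1, i - j)]; in both cases the
     double series separates into a series in [i] times one in [j]. *)
  apply (hassum_split _ (fun ij : Z * Z => (fst ij + snd ij, fst ij - snd ij)%Z)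
    (fun ij : Z * Z => (fst ij + snd ij + 1, fst ij - snd ij)%Z)
    (fun mn : Z * Z => if Z.even (fst mn + snd mn)
       then inl ((fst mn + snd mn) / 2, (fst mn - snd mn) / 2)%Z
       else inr ((fst mn + snd mn - 1) / 2, (fst mn - snd mn - 1) / 2)%Z)).
  - intros (i, j). simpl fst; simpl snd. replace (i + j + (i - j))%Z with (2 * i)%Z by lia.
    rewrite Z.even_mul. simpl orb. cbv iota. f_equal. f_equal.
    + rewrite (Z.mul_comm 2 i), Z.div_mul; lia.
    + replace (i + j - (i - j))%Z with (j * 2)%Z by lia. rewrite Z.div_mul; lia.
  - intros (i, j). simpl fst; simpl snd. replace (i + j + 1 + (i - j))%Z with (2 * i + 1)%Z by lia.
    rewrite Z.even_add, Z.even_mul. simpl orb. simpl Bool.eqb. cbv iota. f_equal. f_equal.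
    + replace (2 * i + 1 - 1)%Z with (i * 2)%Z by lia. rewrite Z.div_mul; lia.
    + replace (i + j + 1 - (i - j) - 1)%Z with (j * 2)%Z by lia. rewrite Z.div_mul; lia.
  - intros (m, n). simpl fst; simpl snd. destruct (Z.even (m + n)) eqn:Ev.
    + apply Z.even_spec in Ev. destruct Ev as (k & Hk).
      replace (m + n)%Z with (k * 2)%Z by lia. replace (m - n)%Z with ((k - n) * 2)%Z by lia.
      rewrite !Z.div_mul by lia. simpl. f_equal; lia.
    + assert (Od : Z.odd (m + n) = true) by (rewrite <- Z.negb_even, Ev; reflexivity).
      apply Z.odd_spec in Od. destruct Od as (k & Hk).
      replace (m + n - 1)%Z with (k * 2)%Z by lia. replace (m - n - 1)%Z with ((k - n) * 2)%Z by lia.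
      rewrite !Z.div_mul by lia. simpl. f_equal; lia.
  (* Shifting the index by one trades the base [p^2 x^2] for [x^2] at the price of the factor
     [x^2]. *)
  - assert (HA : hassum (th (p ^ 2) (x * x)) (x * x * A1)%C).
    { apply hassum_ext with (fun n => (x * x) * th (p ^ 2) (RtoC (p ^ 2) * (x * x)) (n - 1))%C.
      - intros n. replace n with (n - 1 + 1)%Z at 2 by lia. rewrite th_succ by (auto; lra).
        unfold th. rewrite zpow_mult by auto. ring.
      - apply hassum_scal. apply (hassum_reindex _ (fun n => (n - 1)%Z) (fun n => (n + 1)%Z)); auto;
          intros; lia. }
    assert (HH := hassum_mult Z.eq_dec Z.eq_dec _ _ _ _ _ _
      (fun n => Rle_refl (Cmod (th (p ^ 2) (x * x) n))) (th_rbounded _ _ Hp2 Hxx)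
      (fun n => Rle_refl (Cmod (th (p ^ 2) (RtoC p * (y * y)) n)))
      (th_rbounded _ _ Hp2 (Cmult_neq_0 _ _ Hp0 Hyy)) HA HB2).
    revert HH. apply hassum_ext. intros (i, j). simpl fst; simpl snd.
    rewrite !th_square by (auto using Cmult_neq_0; lra). unfold th.
    rewrite (zpow_mult (RtoC p)) by auto.
    transitivity ((zpow (RtoC p) (2 * tri i) * zpow (RtoC p) (2 * tri j) * zpow (RtoC p) j) *
      (zpow (x * x) i * zpow (y * y) j))%C; [ring|].
    rewrite <- zpow_sq_split by auto. rewrite <- !zpow_add by auto.
    transitivity (zpow (RtoC p) (tri (i + j)) * zpow (RtoC p) (tri (i - j)) *
      (zpow (- (x * y)) (i + j) * zpow (- (x / y)) (i - j)))%C; [|ring].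
    rewrite <- zpow_add by auto. f_equal. f_equal.
    assert (T1 := tri_double i). assert (T2 := tri_double j).
    assert (T3 := tri_double (i + j)). assert (T4 := tri_double (i - j)). nia.
  - assert (HH := hassum_mult Z.eq_dec Z.eq_dec _ _ _ _ _ _
      (fun n => Rle_refl (Cmod (th (p ^ 2) (RtoC p * (x * x)) n)))
      (th_rbounded _ _ Hp2 (Cmult_neq_0 _ _ Hp0 Hxx))
      (fun n => Rle_refl (Cmod (th (p ^ 2) (RtoC (p ^ 2) * (y * y)) n)))
      (th_rbounded _ _ Hp2 (Cmult_neq_0 _ _ Hp20 Hyy)) HB1 HA2).
    apply (hassum_scal (- (x * y))%C) in HH.
    revert HH. apply hassum_ext. intros (i, j). simpl fst; simpl snd.
    rewrite !th_square by (auto using Cmult_neq_0; lra). unfold th.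
    rewrite (zpow_mult (RtoC p)), (zpow_mult (RtoC (p ^ 2))) by auto.
    replace (RtoC (p ^ 2)) with (zpow (RtoC p) 2).
    2: { change 2%Z with (Z.of_nat 2). rewrite zpow_nat, RtoC_pow. reflexivity. }
    rewrite zpow_zpow by auto.
    transitivity ((zpow (RtoC p) (2 * tri i) * zpow (RtoC p) i * (zpow (RtoC p) (2 * tri j) *
      zpow (RtoC p) (2 * j))) * (- (x * y) * (zpow (x * x) i * zpow (y * y) j)))%C; [ring|].
    rewrite <- zpow_sq_split by auto. rewrite <- !zpow_add by auto.
    transitivity (zpow (RtoC p) (tri (i + j + 1)) * zpow (RtoC p) (tri (i - j)) *
      (zpow (- (x * y)) (i + j + 1) * zpow (- (x / y)) (i - j)))%C; [|ring].
    rewrite <- zpow_add by auto. rewrite (zpow_succ _ (i + j)) by auto.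
    assert (T1 := tri_double i). assert (T2 := tri_double j).
    assert (T3 := tri_double (i + j + 1)). assert (T4 := tri_double (i - j)).
    replace (2 * tri i + i + (2 * tri j + 2 * j))%Z with (tri (i + j + 1) + tri (i - j))%Z by nia.
    ring.
Qed.

(** The roots of [x^2 - c x + 1] are real when [c ^ 2 >= 4] and otherwise conjugate on the unit
    circle; the roots of unity needed later are of the second kind. *)
Lemma sum_inverse_exists (c : R) : exists x : C, x <> 0 /\ (x + / x)%C = RtoC c.
Proof.
  destruct (Rle_dec 0 (c ^ 2 - 4)) as [H|H].
  - assert (Hs := sqrt_sqrt _ H). set (s := sqrt (c ^ 2 - 4)) in *. clearbody s.
    set (x := (c + s) / 2). assert (Hx : x <> 0).
    { intros E. assert (Ec : c = - s) by (unfold x in E; lra).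
      assert (c * c = s * s) by (rewrite Ec; ring). simpl in Hs. lra. }
    exists (RtoC x). split; [apply RtoC_neq0, Hx|].
    rewrite <- RtoC_inv, <- RtoC_plus by auto. f_equal.
    apply Rmult_eq_reg_l with x; auto. rewrite Rmult_plus_distr_l, Rinv_r by auto.
    unfold x. nra.
  - set (s := sqrt (4 - c ^ 2)). assert (Hs : s * s = 4 - c ^ 2) by (apply sqrt_sqrt; lra).
    set (x := (c / 2, s / 2) : C).
    set (x' := (c / 2, - s / 2) : C). assert (Hn : (x * x')%C = RtoC 1).
    { unfold x, x', Cmult, RtoC. simpl. f_equal; nra. }
    assert (Hx : x <> 0).
    { intros E. rewrite E, Cmult_0_l in Hn. apply RtoC_inj in Hn. lra. }
    exists x. split; auto.
    replace (/ x)%C with x'.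
    + unfold x, x', Cplus, RtoC. simpl. f_equal; field.
    + transitivity (/ x * (x * x'))%C; [field; auto|]. rewrite Hn. ring.
Qed.

(** The factors of the two finite products regroup into [quad], except for those at [n = 0], which
    form [c - d], and the last two, which tend to 1. *)
Lemma jprod_pair (p : R) (x y : C) (c d : R) (N : nat) : x <> 0 -> y <> 0 ->
  (x + / x)%C = RtoC c -> (y + / y)%C = RtoC d ->
  (jprod p (- (x * y)) (S N) * jprod p (- (x / y)) (S N))%C =
  (x * RtoC ((c - d) * prodR (quad p c d) N) *
   ((1 - RtoC p ^ S N / (x * y)) * (1 - RtoC p ^ S N * y / x)))%C.
Proof.
  intros Hx Hy Hc Hd. induction N.
  - simpl. rewrite Rmult_1_r, RtoC_minus, <- Hc, <- Hd. field. auto.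
  - change (jprod p (- (x * y)) (S (S N))) with
      (jprod p (- (x * y)) (S N) * ((1 + - (x * y) * RtoC p ^ S N) * (1 + RtoC p ^ S (S N) / - (x * y))))%C.
    change (jprod p (- (x / y)) (S (S N))) with
      (jprod p (- (x / y)) (S N) * ((1 + - (x / y) * RtoC p ^ S N) * (1 + RtoC p ^ S (S N) / - (x / y))))%C.
    transitivity ((jprod p (- (x * y)) (S N) * jprod p (- (x / y)) (S N)) *
      ((1 - x * y * RtoC p ^ S N) * (1 - x / y * RtoC p ^ S N) *
       ((1 - RtoC p ^ S (S N) / (x * y)) * (1 - RtoC p ^ S (S N) * y / x))))%C.
    { field. auto. }
    rewrite IHN. simpl (prodR (quad p c d) (S N)).
    replace (RtoC ((c - d) * (prodR (quad p c d) N * quad p c d (S N)))) with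
      (RtoC ((c - d) * prodR (quad p c d) N) * RtoC (quad p c d (S N)))%C.
    2: { rewrite <- RtoC_mult. f_equal. ring. }
    set (F := RtoC ((c - d) * prodR (quad p c d) N)).
    unfold quad. set (Q := (p ^ S N)).
    repeat first [rewrite RtoC_plus | rewrite RtoC_minus | rewrite RtoC_mult | rewrite RtoC_pow].
    rewrite <- Hc, <- Hd. unfold Q. rewrite RtoC_pow.
    set (q := (RtoC p ^ S N)%C). set (q' := (RtoC p ^ S (S N))%C).
    field. auto.
Qed.

(** A 2 by 2 determinant with rows [(x A1, B1)] and [(y A2, B2)], each depending on one variable
    only: this is the rank-two property. It results from computing the limit of the paired finite
    products in two ways, by the triple product and by [jprod_pair]. *)
Lemma qdet_theta (p c d : R) (x y A1 A2 B1 B2 : C) : 0 < p < 1 -> x <> 0 -> y <> 0 ->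
  (x + / x)%C = RtoC c -> (y + / y)%C = RtoC d ->
  hassum (th (p ^ 2) (RtoC (p ^ 2) * (x * x))) A1 -> hassum (th (p ^ 2) (RtoC p * (x * x))) B1 ->
  hassum (th (p ^ 2) (RtoC (p ^ 2) * (y * y))) A2 -> hassum (th (p ^ 2) (RtoC p * (y * y))) B2 ->
  (RtoC (qdet p c d) * (RtoC (E p) * RtoC (E p)) = (x * A1) * B2 - B1 * (y * A2))%C.
Proof.
  intros Hp Hx Hy Hc Hd HA1 HB1 HA2 HB2.
  assert (HE : RtoC (E p) <> 0) by (assert (H := E_pos p Hp); apply RtoC_neq0; lra).
  assert (Hxy : (- (x * y))%C <> 0).
  { intros H. apply (f_equal Cmod) in H. rewrite Cmod_opp, Cmod_mult, Cmod_0 in H.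
    apply Cmod_gt_0 in Hx. apply Cmod_gt_0 in Hy. nra. }
  assert (Hxdy : (- (x / y))%C <> 0).
  { intros H. apply Hxy. replace (- (x * y))%C with (- (x / y) * (y * y))%C by (field; auto).
    rewrite H. ring. }
  destruct (th_hassum_exists p _ Hp Hxy) as (Sx & HSx).
  destruct (th_hassum_exists p _ Hp Hxdy) as (Sy & HSy).
  assert (Hsp := theta_product_split p x y Sx Sy A1 A2 B1 B2 Hp Hx Hy HSx HSy HA1 HB1 HA2 HB2).
  assert (L1 := jacobi_triple_product p _ Sx Hp Hxy HSx).
  assert (L2 := jacobi_triple_product p _ Sy Hp Hxdy HSy).
  assert (L := Clim_mult _ _ _ _ L1 L2).
  assert (Hp0 : forall z, Clim (fun n => 1 - RtoC p ^ n * z)%C 1).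
  { intros z eps Heps. assert (Hz := Cmod_ge_0 z).
    destruct (pow_lt_1_zero p ltac:(rewrite Rabs_pos_eq; lra) (eps / (Cmod z + 1))) as (N & HN).
    { apply Rdiv_lt_0_compat; lra. }
    exists N. intros n Hn. specialize (HN n Hn).
    replace (1 - RtoC p ^ n * z - 1)%C with (- (RtoC p ^ n * z))%C by ring.
    rewrite Cmod_opp, Cmod_mult, Cmod_pow, Cmod_R, RPow_abs.
    apply Rle_lt_trans with (Rabs (p ^ n) * (Cmod z + 1)).
    - apply Rmult_le_compat_l; [apply Rabs_pos|lra].
    - apply Rmult_lt_compat_r with (r := Cmod z + 1) in HN; [|lra].
      replace (eps / (Cmod z + 1) * (Cmod z + 1)) with eps in HN by (field; lra). auto. }
  assert (R : Clim (fun N => jprod p (- (x * y)) N * jprod p (- (x / y)) N)%C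
     (x * RtoC (qdet p c d) * (1 * 1))%C).
  { apply Clim_ext_loc with (fun N => x * RtoC ((c - d) * prodR (quad p c d) (N - 1)) *
      ((1 - RtoC p ^ N * (/ (x * y))) * (1 - RtoC p ^ N * (y / x))))%C.
    - exists 1%nat. intros n Hn. destruct n; [lia|]. rewrite (jprod_pair p x y c d) by auto.
      rewrite Nat.sub_succ, Nat.sub_0_r. unfold Cdiv. rewrite !Cmult_assoc. reflexivity.
    - repeat apply Clim_mult; auto using Clim_const.
      apply Clim_RtoC. apply is_lim_seq_mult'; [apply is_lim_seq_const|].
      apply (is_lim_seq_incr_1 (fun N => prodR (quad p c d) (N - 1))).
      apply is_lim_seq_ext with (prodR (quad p c d)).
      + intros n. rewrite Nat.sub_succ, Nat.sub_0_r. reflexivity.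
      + apply inf_prod_lim, egeo_quad, Hp. }
  assert (Eq := Clim_unique _ _ _ L R).
  assert (Eq2 : (Sx * Sy)%C = (x * RtoC (qdet p c d) * (RtoC (E p) * RtoC (E p)))%C).
  { transitivity (Sx / RtoC (E p) * (Sy / RtoC (E p)) * (RtoC (E p) * RtoC (E p)))%C; [field; auto|].
    rewrite Eq. ring. }
  rewrite Hsp in Eq2.
  transitivity (/ x * (x * RtoC (qdet p c d) * (RtoC (E p) * RtoC (E p))))%C; [field; auto|].
  rewrite <- Eq2. field. auto.
Qed.

(** [qdet] has rank two: this is Weierstrass' three-term identity for theta functions. *)
Theorem qdet_plucker (p c1 c2 c3 c4 : R) : 0 < p < 1 ->
  qdet p c1 c2 * qdet p c3 c4 - qdet p c1 c3 * qdet p c2 c4 + qdet p c1 c4 * qdet p c2 c3 = 0.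
Proof.
  intros Hp.
  assert (Hp2 : 0 < p ^ 2 < 1) by (apply pow_lt_1; [auto|lia]).
  assert (HE : RtoC (E p) <> 0) by (assert (H := E_pos p Hp); apply RtoC_neq0; lra).
  assert (Hex : forall c : R, exists x A B : C, x <> 0 /\ (x + / x)%C = RtoC c /\
    hassum (th (p ^ 2) (RtoC (p ^ 2) * (x * x))) A /\ hassum (th (p ^ 2) (RtoC p * (x * x))) B).
  { intros c. destruct (sum_inverse_exists c) as (x & Hx & Hc).
    destruct (th_hassum_exists (p ^ 2) (RtoC (p ^ 2) * (x * x))) as (A & HA); auto.
    { repeat apply Cmult_neq_0; auto. apply RtoC_neq0; lra. }
    destruct (th_hassum_exists (p ^ 2) (RtoC p * (x * x))) as (B & HB); auto.
    { repeat apply Cmult_neq_0; auto. apply RtoC_neq0; lra. }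
    exists x, A, B. auto. }
  destruct (Hex c1) as (x1 & A1 & B1 & N1 & K1 & HA1 & HB1).
  destruct (Hex c2) as (x2 & A2 & B2 & N2 & K2 & HA2 & HB2).
  destruct (Hex c3) as (x3 & A3 & B3 & N3 & K3 & HA3 & HB3).
  destruct (Hex c4) as (x4 & A4 & B4 & N4 & K4 & HA4 & HB4).
  assert (D12 := qdet_theta p c1 c2 _ _ _ _ _ _ Hp N1 N2 K1 K2 HA1 HB1 HA2 HB2).
  assert (D13 := qdet_theta p c1 c3 _ _ _ _ _ _ Hp N1 N3 K1 K3 HA1 HB1 HA3 HB3).
  assert (D14 := qdet_theta p c1 c4 _ _ _ _ _ _ Hp N1 N4 K1 K4 HA1 HB1 HA4 HB4).
  assert (D23 := qdet_theta p c2 c3 _ _ _ _ _ _ Hp N2 N3 K2 K3 HA2 HB2 HA3 HB3).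
  assert (D24 := qdet_theta p c2 c4 _ _ _ _ _ _ Hp N2 N4 K2 K4 HA2 HB2 HA4 HB4).
  assert (D34 := qdet_theta p c3 c4 _ _ _ _ _ _ Hp N3 N4 K3 K4 HA3 HB3 HA4 HB4).
  apply RtoC_inj. rewrite RtoC_plus, RtoC_minus, !RtoC_mult.
  set (e := (RtoC (E p) * RtoC (E p))%C) in *.
  assert (He : e <> 0) by (apply Cmult_neq_0; auto).
  set (d12 := RtoC (qdet p c1 c2)) in *. set (d13 := RtoC (qdet p c1 c3)) in *.
  set (d14 := RtoC (qdet p c1 c4)) in *. set (d23 := RtoC (qdet p c2 c3)) in *.
  set (d24 := RtoC (qdet p c2 c4)) in *. set (d34 := RtoC (qdet p c3 c4)) in *.
  (* Each term [d * e] is a minor of one 2 by 4 matrix; the claim is the Pluecker relation between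
     its six minors. *)
  transitivity (((d12 * e) * (d34 * e) - (d13 * e) * (d24 * e) + (d14 * e) * (d23 * e)) / (e * e))%C.
  { field. auto. }
  rewrite D12, D13, D14, D23, D24, D34. field. auto.
Qed.

(** * Weierstrass' identity and its derivatives *)

(** This is [(1 - xQ)(1 - Q/x)] for [Q = p ^ n] and [c = x + 1/x]. At [d = 2], that is [y = 1], the
    quadruple product [quad] is its square. *)
Definition quad1 (p c : R) (n : nat) : R := 1 - c * p ^ n + (p ^ n) ^ 2.

Definition gprod (p c : R) : R := inf_prod (quad1 p c).

Lemma egeo_quad1 (p c : R) : 0 < p < 1 -> egeo (fun n => quad1 p c n - 1).
Proof.
  intros Hp. assert (H := egeo_geom01 p Hp).
  apply egeo_ext1 with (fun n => p ^ n * (p ^ n - c)).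
  - intros n _. unfold quad1. ring.
  - apply egeo_mult_bounded; auto. solve_seq_bounded.
Qed.

Lemma quad_2 (p c : R) (n : nat) : quad p c 2 n = quad1 p c n ^ 2.
Proof. unfold quad, quad1. ring. Qed.

Lemma quad_sym (p c d : R) (n : nat) : quad p c d n = quad p d c n.
Proof. unfold quad. ring. Qed.

Lemma qprod_sym (p c d : R) : qprod p c d = qprod p d c.
Proof. apply inf_prod_ext. intros; apply quad_sym. Qed.

Lemma qprod_2 (p c : R) : 0 < p < 1 -> qprod p c 2 = gprod p c ^ 2.
Proof.
  intros Hp. unfold qprod, gprod. rewrite <- inf_prod_pow by (apply egeo_quad1, Hp).
  apply inf_prod_ext. intros; apply quad_2.
Qed.

Lemma qprod_22 (p : R) : 0 < p < 1 -> qprod p 2 2 = E p ^ 4.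
Proof.
  intros Hp. unfold qprod, E. rewrite <- inf_prod_pow by (apply egeo_1mpow, Hp).
  apply inf_prod_ext. intros. unfold quad. ring.
Qed.

Lemma bounded_inv_quad (p c d : R) : 0 < p < 1 -> (forall n, (1 <= n)%nat -> quad p c d n <> 0) ->
  seq_bounded (fun n => / quad p c d n).
Proof. intros Hp H. apply bounded_inv; auto. apply egeo_quad, Hp. Qed.

(** The logarithmic derivative of [quad p d v n] in [v] at [v = c]. *)
Definition dquad (p d c : R) (n : nat) : R :=
  (2 * (p ^ n) ^ 2 * c - (1 + (p ^ n) ^ 2) * p ^ n * d) / quad p d c n.

Lemma egeo_dquad (p d c : R) : 0 < p < 1 -> (forall n, (1 <= n)%nat -> quad p d c n <> 0) ->
  egeo (dquad p d c).
Proof.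
  intros Hp H. assert (G := egeo_geom01 p Hp). assert (B := bounded_inv_quad p d c Hp H).
  apply egeo_ext1 with (fun n => p ^ n * ((2 * p ^ n * c - (1 + (p ^ n) ^ 2) * d) * / quad p d c n)).
  - intros n _. unfold dquad, Rdiv. ring.
  - apply egeo_mult_bounded; auto. solve_seq_bounded.
Qed.

(** [quad] is quadratic in [v], so its expansion around [c] is exact and [inf_prod_derive0] applies
    to the quotient by the value at [c]. *)
Lemma qprod_derive (p d c : R) : 0 < p < 1 -> (forall n, (1 <= n)%nat -> quad p d c n <> 0) ->
  is_derive (fun v => qprod p d v) c (qprod p d c * Series (fun n => dquad p d c (S n))).
Proof.
  intros Hp H.
  assert (G := egeo_geom01 p Hp). assert (B := bounded_inv_quad p d c Hp H).
  assert (Ha := egeo_dquad p d c Hp H).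
  assert (Hb : egeo (fun n => (p ^ n) ^ 2 * / quad p d c n)).
  { apply egeo_mult_bounded; auto. apply egeo_npow, G. }
  assert (D := inf_prod_derive0 _ _ Ha Hb).
  apply is_derive_ext with (fun v => qprod p d c *
    inf_prod (fun n => 1 + (dquad p d c n * (v - c) + (p ^ n) ^ 2 * / quad p d c n * (v - c) ^ 2))).
  - intros v. unfold qprod at 1. rewrite <- inf_prod_mult.
    + apply inf_prod_ext. intros n Hn. unfold dquad. specialize (H n Hn).
      transitivity (quad p d c n + (2 * (p ^ n) ^ 2 * c - (1 + (p ^ n) ^ 2) * p ^ n * d) * (v - c) +
        (p ^ n) ^ 2 * (v - c) ^ 2); [field; auto|]. unfold quad. ring.
    + apply egeo_quad, Hp.
    + apply egeo_ext1 with (fun n => (v - c) * dquad p d c n + (v - c) ^ 2 * ((p ^ n) ^ 2 * / quad p d c n)).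
      * intros; ring.
      * apply egeo_plus; apply egeo_scal; auto.
  - set (f := fun x => inf_prod (fun n => 1 + (dquad p d c n * x + (p ^ n) ^ 2 * / quad p d c n * x ^ 2))) in *.
    set (l := Series _) in *.
    assert (D2 : is_derive (fun v => f (v - c)) c (1 * l)).
    { apply (is_derive_comp f (fun v => v - c) c l 1).
      - replace (c - c) with 0 by ring. exact D.
      - auto_derive; auto. }
    rewrite Rmult_1_l in D2.
    apply (is_derive_scal (fun v => f (v - c)) c (qprod p d c) l). exact D2.
Qed.

Lemma qdet_derive (p d c : R) : 0 < p < 1 -> (forall n, (1 <= n)%nat -> quad p d c n <> 0) ->
  is_derive (fun v => qdet p d v) c
    (- qprod p d c + (d - c) * (qprod p d c * Series (fun n => dquad p d c (S n)))).
Proof.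
  intros Hp H. assert (D := qprod_derive p d c Hp H). unfold qdet.
  evar_last.
  - apply (is_derive_mult (fun v => d - v) (fun v => qprod p d v) c (-1)).
    + auto_derive; auto.
    + exact D.
    + intros; apply Rmult_comm.
  - unfold plus, mult; simpl. ring.
Qed.

Lemma is_derive_zero_eq (f : R -> R) (x l : R) : (forall v, f v = 0) -> is_derive f x l -> l = 0.
Proof.
  intros H D. assert (D0 : is_derive f x 0).
  { apply is_derive_ext with (fun _ => 0); [intros; symmetry; apply H|]. apply @is_derive_const. }
  rewrite <- (is_derive_unique _ _ _ D). apply is_derive_unique, D0.
Qed.

(** The Weierstrass function up to scaling and an additive constant: [/ (c - 2)] is [x / (1 - x)^2],
    and each summand contributes the same expression at [xQ] and at [Q/x]. *)
Definition wp (p c : R) : R := / (c - 2) - Series (fun n => dquad p c 2 (S n)).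

Lemma is_derive_3 (f g h : R -> R) (a b e x df dg dh : R) :
  is_derive f x df -> is_derive g x dg -> is_derive h x dh ->
  is_derive (fun v => a * f v + b * g v + e * h v) x (a * df + b * dg + e * dh).
Proof.
  intros Hf Hg Hh. apply (is_derive_plus (fun v => a * f v + b * g v) (fun v => e * h v)).
  - apply (is_derive_plus (fun v => a * f v) (fun v => b * g v)); apply is_derive_scal; auto.
  - apply is_derive_scal; auto.
Qed.

(** Differentiating the three-term identity at the double point [2], i.e. at the origin of the curve. *)
Theorem wp_difference (p c d : R) : 0 < p < 1 -> c <> 2 -> d <> 2 ->
  (forall n, (1 <= n)%nat -> quad1 p c n <> 0) -> (forall n, (1 <= n)%nat -> quad1 p d n <> 0) ->
  (c - d) / ((c - 2) * (d - 2)) * (qprod p c d * E p ^ 4 / (gprod p c ^ 2 * gprod p d ^ 2))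
  = wp p d - wp p c.
Proof.
  intros Hp Hc Hd Hcn Hdn.
  assert (Q : forall c, (forall n, (1 <= n)%nat -> quad1 p c n <> 0) ->
     forall n, (1 <= n)%nat -> quad p c 2 n <> 0).
  { intros e H n Hn. rewrite quad_2. apply pow_nonzero. auto. }
  assert (Dc := qdet_derive p c 2 Hp (Q c Hcn)). assert (Dd := qdet_derive p d 2 Hp (Q d Hdn)).
  assert (D2 : is_derive (fun v => qdet p 2 v) 2 (- E p ^ 4)).
  { evar_last; [apply (qdet_derive p 2 2 Hp)|].
    - intros n Hn. rewrite quad_2. apply pow_nonzero. unfold quad1.
      assert (H := pow_lt_1 p n Hp Hn). nra.
    - rewrite qprod_22 by auto. ring. }
  assert (D := is_derive_3 _ _ _ (qdet p c d) (- qdet p c 2) (qdet p d 2) 2 _ _ _ D2 Dd Dc).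
  apply is_derive_zero_eq in D.
  2: { intros v. assert (H := qdet_plucker p c d 2 v Hp). lra. }
  assert (Gc : gprod p c <> 0) by (apply inf_prod_neq0; auto; apply egeo_quad1, Hp).
  assert (Gd : gprod p d <> 0) by (apply inf_prod_neq0; auto; apply egeo_quad1, Hp).
  unfold wp. unfold qdet in D. rewrite !qprod_2 in D by auto.
  set (sc := Series (fun n => dquad p c 2 (S n))) in *.
  set (sd := Series (fun n => dquad p d 2 (S n))) in *.
  assert (Hc' : c - 2 <> 0) by lra. assert (Hd' : d - 2 <> 0) by lra.
  apply Rmult_eq_reg_l with ((c - 2) * (d - 2) * (gprod p c ^ 2 * gprod p d ^ 2)).
  2: { repeat apply Rmult_integral_contrapositive_currified; auto. }
  transitivity ((c - d) * qprod p c d * E p ^ 4); [field; auto|].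
  transitivity ((c - d) * gprod p c ^ 2 * gprod p d ^ 2 +
     (c - 2) * (d - 2) * gprod p c ^ 2 * gprod p d ^ 2 * (sc - sd)); [lra|field; auto].
Qed.

(** Differentiating the three-term identity at the double point [c]. *)
Theorem zeta_sum (p c d : R) : 0 < p < 1 -> c <> 2 -> d <> c ->
  (forall n, (1 <= n)%nat -> quad1 p c n <> 0) ->
  (forall n, (1 <= n)%nat -> quad p d c n <> 0) ->
  (forall n, (1 <= n)%nat -> quad p c c n <> 0) ->
  (d - 2) * gprod p d ^ 2 * qprod p c c / ((d - c) * qprod p d c * ((c - 2) * gprod p c ^ 2)) =
  / (c - 2) + / (d - c) +
  Series (fun n => - (2 * p ^ S n / quad1 p c (S n) + dquad p d c (S n))).
Proof.
  intros Hp Hc Hdc Hcn Hd Hcc.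
  assert (H2 : forall n, (1 <= n)%nat -> quad p 2 c n <> 0).
  { intros n Hn. rewrite quad_sym, quad_2. apply pow_nonzero. auto. }
  assert (D1 := qdet_derive p c c Hp Hcc). assert (D2 := qdet_derive p 2 c Hp H2).
  assert (D3 := qdet_derive p d c Hp Hd).
  assert (D := is_derive_3 _ _ _ (qdet p d 2) (- qdet p d c) (qdet p 2 c) c _ _ _ D1 D2 D3).
  apply is_derive_zero_eq in D.
  2: { intros v. assert (H := qdet_plucker p d 2 c v Hp). lra. }
  assert (Gc : gprod p c <> 0) by (apply inf_prod_neq0; auto; apply egeo_quad1, Hp).
  assert (Gd : qprod p d c <> 0) by (apply inf_prod_neq0; auto; apply egeo_quad, Hp).
  assert (Hs : Series (fun n => - (2 * p ^ S n / quad1 p c (S n) + dquad p d c (S n))) =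
     Series (fun n => dquad p 2 c (S n)) - Series (fun n => dquad p d c (S n))).
  { rewrite <- Series_minus.
    - apply Series_ext. intros n. specialize (Hcn (S n) ltac:(lia)). specialize (Hd (S n) ltac:(lia)).
      unfold dquad at 2. rewrite quad_sym, quad_2.
      replace (2 * (p ^ S n) ^ 2 * c - (1 + (p ^ S n) ^ 2) * p ^ S n * 2) with
        (- (2 * p ^ S n) * quad1 p c (S n)) by (unfold quad1; ring).
      field. auto.
    - apply egeo_ex_series. apply (egeo_shift (dquad p 2 c)), egeo_dquad; auto.
    - apply egeo_ex_series. apply (egeo_shift (dquad p d c)), egeo_dquad; auto. }
  rewrite Hs. unfold qdet in D. rewrite (qprod_sym p 2 c), !qprod_2 in D by auto.
  set (s2 := Series (fun n => dquad p 2 c (S n))) in *.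
  set (sd := Series (fun n => dquad p d c (S n))) in *.
  assert (Hc' : c - 2 <> 0) by lra. assert (Hd' : d - c <> 0) by lra.
  apply Rmult_eq_reg_l with ((d - c) * qprod p d c * ((c - 2) * gprod p c ^ 2)).
  2: { repeat apply Rmult_integral_contrapositive_currified; auto. }
  transitivity ((d - 2) * gprod p d ^ 2 * qprod p c c); [field; auto|].
  transitivity ((d - c) * qprod p d c * gprod p c ^ 2 + qprod p d c * (c - 2) * gprod p c ^ 2 +
    (d - c) * qprod p d c * (c - 2) * gprod p c ^ 2 * (s2 - sd)); [lra|field; auto].
Qed.

(** * Lambert series *)

(** The factor [rho ^ 2] on the left avoids the exponent [e - 2]. The polynomial factor [INR e ^ 2]
    is harmless when summing over exponents [e] in an arithmetic progression. *)
Lemma pow_taylor (t d rho : R) (e : nat) : Rabs t <= rho -> Rabs (t + d) <= rho ->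
  rho ^ 2 * Rabs ((t + d) ^ e - t ^ e - INR e * t ^ (e - 1) * d) <= INR e ^ 2 * rho ^ e * d ^ 2.
Proof.
  intros H1 H2. assert (Hr : 0 <= rho) by (apply Rle_trans with (2 := H1); apply Rabs_pos).
  induction e as [|e IH].
  - simpl. replace (1 - 1 - 0 * 1 * d) with 0 by ring. rewrite Rabs_R0. lra.
  - assert (E : (t + d) ^ S e - t ^ S e - INR (S e) * t ^ (S e - 1) * d =
      (t + d) * ((t + d) ^ e - t ^ e - INR e * t ^ (e - 1) * d) + INR e * t ^ (e - 1) * d ^ 2).
    { destruct e; [simpl; ring|]. replace (S (S e) - 1)%nat with (S e) by lia.
      replace (S e - 1)%nat with e by lia. rewrite (S_INR (S e)). simpl pow. ring. }
    rewrite E. clear E.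
    set (X := (t + d) ^ e - t ^ e - INR e * t ^ (e - 1) * d) in *.
    assert (He : 0 <= INR e) by apply pos_INR.
    assert (Hre : 0 <= rho ^ e) by (apply pow_le; auto).
    assert (Hd : 0 <= d ^ 2) by nra.
    apply Rle_trans with (rho ^ 2 * (rho * Rabs X + INR e * Rabs (t ^ (e - 1)) * d ^ 2)).
    + apply Rmult_le_compat_l; [nra|]. apply Rle_trans with (1 := Rabs_triang _ _).
      rewrite !Rabs_mult. rewrite (Rabs_pos_eq (INR e)), (Rabs_pos_eq (d ^ 2)) by auto.
      apply Rplus_le_compat_r. apply Rmult_le_compat_r; auto using Rabs_pos.
    + assert (Y : rho ^ 2 * (INR e * Rabs (t ^ (e - 1)) * d ^ 2) <= INR e * rho ^ S e * d ^ 2).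
      { destruct e; [simpl; lra|]. replace (S e - 1)%nat with e by lia. rewrite <- RPow_abs.
        assert (Rabs t ^ e <= rho ^ e) by (apply pow_incr; split; auto using Rabs_pos).
        replace (INR (S e) * rho ^ S (S e) * d ^ 2) with (rho ^ 2 * (INR (S e) * rho ^ e * d ^ 2))
          by (simpl; ring).
        apply Rmult_le_compat_l; [nra|]. apply Rmult_le_compat_r; auto. apply Rmult_le_compat_l; auto. }
      assert (Z : rho ^ 2 * (rho * Rabs X) <= rho * (INR e ^ 2 * rho ^ e * d ^ 2)) by nra.
      rewrite S_INR.
      assert (0 <= rho ^ S e * d ^ 2) by (apply Rmult_le_pos; [apply pow_le|]; auto).
      replace (rho * (INR e ^ 2 * rho ^ e * d ^ 2)) with (INR e ^ 2 * (rho ^ S e * d ^ 2)) in Z by (simpl; ring).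
      replace (INR e * rho ^ S e * d ^ 2) with (INR e * (rho ^ S e * d ^ 2)) in Y by ring.
      replace ((INR e + 1) ^ 2 * rho ^ S e * d ^ 2) with ((INR e + 1) ^ 2 * (rho ^ S e * d ^ 2)) by ring.
      nra.
Qed.

Definition aexp (a k j : nat) : nat := (k * (j - 1) + a)%nat.

(** The q-Pochhammer symbol [(t^a; t^k)] with infinitely many factors: the exponents are [a],
    [a + k], [a + 2 k] and so on. *)
Definition aprod (a k : nat) (t : R) : R := inf_prod (fun j => 1 - t ^ aexp a k j).

Lemma E_aprod (t : R) : E t = aprod 1 1 t.
Proof. apply inf_prod_ext. intros j Hj. unfold aexp. do 2 f_equal. lia. Qed.

Lemma aexp_ge (a k j : nat) : (1 <= a)%nat -> (1 <= k)%nat -> (1 <= j)%nat -> (j <= aexp a k j)%nat.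
Proof. unfold aexp. nia. Qed.

Lemma pow_anti (t : R) (m n : nat) : 0 <= t <= 1 -> (m <= n)%nat -> t ^ n <= t ^ m.
Proof.
  intros Ht H. replace n with (m + (n - m))%nat by lia. rewrite pow_add.
  rewrite <- (Rmult_1_r (t ^ m)) at 2. apply Rmult_le_compat_l; [apply pow_le; lra|].
  rewrite <- (pow1 (n - m)). apply pow_incr; lra.
Qed.

Lemma egeo_apow (a k : nat) (t : R) : (1 <= a)%nat -> (1 <= k)%nat -> Rabs t < 1 ->
  egeo (fun j => t ^ aexp a k j).
Proof.
  intros Ha Hk Ht. destruct (egeo_pos _ (egeo_geom t Ht)) as (M & r & HM & Hr & H).
  assert (P := Rabs_pos t).
  set (s := Rmax (Rabs t) (1/2)).
  assert (Hs : 0 < s < 1) by (unfold s, Rmax; destruct Rle_dec; lra).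
  apply egeo_from1 with 1 s; auto. intros n Hn. rewrite <- RPow_abs, Rmult_1_l.
  apply Rle_trans with (Rabs t ^ n).
  - apply pow_anti; [lra|]. apply aexp_ge; auto.
  - apply pow_incr. split; auto. apply Rmax_l.
Qed.

Lemma egeo_aexp_pow (a k i : nat) (t : R) : (1 <= a)%nat -> (1 <= k)%nat -> Rabs t < 1 ->
  egeo (fun j => INR (aexp a k j) ^ i * t ^ aexp a k j).
Proof.
  intros Ha Hk Ht. induction i.
  - apply egeo_ext1 with (fun j => t ^ aexp a k j); [intros; simpl; ring|]. apply egeo_apow; auto.
  - apply egeo_ext1 with (fun j => (INR k * INR j + (INR a - INR k)) *
      (INR (aexp a k j) ^ i * t ^ aexp a k j)).
    + intros n Hn. replace (INR k * INR n + (INR a - INR k)) with (INR (aexp a k n)).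
      * simpl. ring.
      * unfold aexp. rewrite plus_INR, mult_INR, minus_INR by auto. simpl. ring.
    + apply egeo_ext1 with (fun j => INR k * (INR j * (INR (aexp a k j) ^ i * t ^ aexp a k j)) +
        (INR a - INR k) * (INR (aexp a k j) ^ i * t ^ aexp a k j)); [intros; ring|].
      apply egeo_plus; apply egeo_scal; auto. apply egeo_INR_mult; auto.
Qed.

Lemma aexp_neq1 (a k n : nat) (t : R) : (1 <= a)%nat -> (1 <= k)%nat -> (1 <= n)%nat ->
  Rabs t < 1 -> 1 - t ^ aexp a k n <> 0.
Proof.
  intros Ha Hk Hn Ht E. assert (H := aexp_ge a k n Ha Hk Hn).
  assert (P := Rabs_pos t).
  assert (Rabs (t ^ aexp a k n) < 1).
  { rewrite <- RPow_abs. destruct (Req_dec (Rabs t) 0) as [->|Hz].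
    - rewrite pow_i by lia. lra.
    - apply pow_lt_1_compat; [lra|lia]. }
  apply Rabs_lt_between in H0. lra.
Qed.

Lemma egeo_1mapow (a k : nat) (t : R) : (1 <= a)%nat -> (1 <= k)%nat -> Rabs t < 1 ->
  egeo (fun n => (1 - t ^ aexp a k n) - 1).
Proof.
  intros Ha Hk Ht. apply egeo_ext1 with (fun n => - t ^ aexp a k n); [intros; ring|].
  apply egeo_opp, egeo_apow; auto.
Qed.

(** Dividing each factor by its value at [t] normalises the product as [inf_prod_derive] requires,
    and [pow_taylor] bounds the remainders. *)
Lemma aprod_derive (a k : nat) (t : R) : (1 <= a)%nat -> (1 <= k)%nat -> Rabs t < 1 ->
  is_derive (aprod a k) t (aprod a k t *
    Series (fun j => - (INR (aexp a k (S j)) * t ^ (aexp a k (S j) - 1)) / (1 - t ^ aexp a k (S j)))).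
Proof.
  intros Ha Hk Ht. assert (P := Rabs_pos t).
  (* A radius strictly between [|t|] and 1: perturbations up to [rho - |t|] stay inside it, and
     powers of [rho] are still summable. *)
  set (rho := (1 + Rabs t) / 2). assert (Hrho : 0 < rho < 1) by (unfold rho; lra).
  assert (Hrt : Rabs t < rho) by (unfold rho; lra).
  set (r := rho - Rabs t). assert (Hr : 0 < r) by (unfold r; lra).
  assert (Hrabs : Rabs rho < 1) by (rewrite Rabs_pos_eq; lra).
  assert (Binv : seq_bounded (fun n => / (1 - t ^ aexp a k n))).
  { apply bounded_inv; [apply egeo_1mapow; auto|]. intros n Hn. apply aexp_neq1; auto. }
  set (e := aexp a k).
  assert (Gb : egeo (fun n => / rho ^ 2 * (INR (e n) ^ 2 * rho ^ e n) * Rabs (/ (1 - t ^ e n)))).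
  { apply egeo_mult_bounded.
    - apply egeo_scal. apply egeo_aexp_pow; auto.
    - destruct Binv as (B & HB). exists B. intros n. rewrite Rabs_Rabsolu. apply HB. }
  assert (Ga : egeo (fun n => - (INR (e n) * t ^ (e n - 1)) / (1 - t ^ e n))).
  { unfold Rdiv. apply egeo_mult_bounded; auto. apply egeo_opp.
    assert (G := egeo_scal (/ rho) _ (egeo_aexp_pow a k 1 rho Ha Hk Hrabs)).
    destruct (egeo_pos _ G) as (M & s & HM & Hs & K). apply egeo_from1 with M s; auto.
    intros n Hn. apply Rle_trans with (2 := K n). unfold e.
    assert (He := aexp_ge a k n Ha Hk Hn). set (m := aexp a k n) in *.
    assert (Hm := pos_INR m).
    rewrite !Rabs_mult, pow_1, (Rabs_pos_eq (INR m)) by auto.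
    rewrite (Rabs_pos_eq (/ rho)) by (left; apply Rinv_0_lt_compat; lra).
    rewrite (Rabs_pos_eq (rho ^ m)) by (apply pow_le; lra).
    replace (/ rho * (INR m * rho ^ m)) with (INR m * rho ^ (m - 1)).
    - apply Rmult_le_compat_l; auto. rewrite <- RPow_abs. apply pow_incr; lra.
    - assert (Em : rho ^ m = rho * rho ^ (m - 1)).
      { change (rho ^ m = rho ^ S (m - 1)). f_equal. lia. }
      rewrite Em. field. lra. }
  assert (D := inf_prod_derive (fun n d => (1 - (t + d) ^ e n) / (1 - t ^ e n)) _ _ r Hr Ga Gb).
  assert (Hne : forall n, (1 <= n)%nat -> 1 - t ^ e n <> 0) by (intros; apply aexp_neq1; auto).
  assert (Hd : forall d, Rabs d <= r -> Rabs (t + d) <= rho).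
  { intros d Hd. apply Rle_trans with (1 := Rabs_triang _ _). unfold r in Hd. lra. }
  assert (D' : is_derive (fun d => inf_prod (fun n => (1 - (t + d) ^ e n) / (1 - t ^ e n))) 0
    (Series (fun j => - (INR (e (S j)) * t ^ (e (S j) - 1)) / (1 - t ^ e (S j))))).
  { apply D. intros n d Hn Hdr. specialize (Hne n Hn).
    assert (T := pow_taylor t d rho (e n) ltac:(lra) (Hd d Hdr)).
    set (X := (t + d) ^ e n - t ^ e n - INR (e n) * t ^ (e n - 1) * d) in *.
    replace ((1 - (t + d) ^ e n) / (1 - t ^ e n) - 1 -
      - (INR (e n) * t ^ (e n - 1)) / (1 - t ^ e n) * d) with (- X * / (1 - t ^ e n))
      by (unfold X; field; auto).
    rewrite Rabs_mult, Rabs_Ropp.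
    replace (/ rho ^ 2 * (INR (e n) ^ 2 * rho ^ e n) * Rabs (/ (1 - t ^ e n)) * d ^ 2) with
      (/ rho ^ 2 * (INR (e n) ^ 2 * rho ^ e n * d ^ 2) * Rabs (/ (1 - t ^ e n))) by ring.
    apply Rmult_le_compat_r; [apply Rabs_pos|].
    assert (0 < rho ^ 2) by (apply pow_lt; lra).
    apply Rmult_le_reg_l with (rho ^ 2); auto.
    rewrite <- Rmult_assoc, Rinv_r, Rmult_1_l by lra. exact T. }
  clear D.
  set (l := Series _) in *.
  apply is_derive_ext_loc with
    (fun v => aprod a k t * inf_prod (fun n => (1 - (t + (v - t)) ^ e n) / (1 - t ^ e n))).
  - enough (K : forall v : R, Rabs (v - t) < r -> aprod a k t *
      inf_prod (fun n => (1 - (t + (v - t)) ^ e n) / (1 - t ^ e n)) = aprod a k v).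
    { exists (mkposreal r Hr). intros v Hv. apply K, Hv. }
    intros v Hv. unfold aprod. fold e. replace (t + (v - t)) with v by ring.
    assert (Hv1 : Rabs v < 1).
    { replace v with (t + (v - t)) by ring. apply Rle_lt_trans with rho; [|lra]. apply Hd. lra. }
    rewrite inf_prod_div.
    + field. apply inf_prod_neq0; auto. apply egeo_1mapow; auto.
    + apply egeo_1mapow; auto.
    + apply egeo_1mapow; auto.
    + auto.
  - assert (D2 : is_derive (fun v => (fun d => inf_prod (fun n => (1 - (t + d) ^ e n) / (1 - t ^ e n))) (v - t)) t (1 * l)).
    { apply (is_derive_comp (fun d => inf_prod (fun n => (1 - (t + d) ^ e n) / (1 - t ^ e n)))
        (fun v => v - t) t l 1).
      - assert (Ett : t - t = 0) by ring. rewrite Ett. exact D'.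
      - auto_derive; auto. }
    rewrite Rmult_1_l in D2.
    apply (is_derive_scal (fun v => inf_prod (fun n => (1 - (t + (v - t)) ^ e n) / (1 - t ^ e n))) t
      (aprod a k t) l D2).
Qed.

(** * Exchange of summations and Lambert series *)

Lemma sum_n_le_Series (a : nat -> R) (N : nat) : (forall n, 0 <= a n) -> ex_series a ->
  sum_n a N <= Series a.
Proof.
  intros H Hex. apply (is_lim_seq_incr_compare (sum_n a)).
  - apply (Series_correct a Hex).
  - intros n. rewrite sum_Sn. unfold plus; simpl. specialize (H (S n)). lra.
Qed.

(** Half of Tonelli's theorem: a finite sum of rows is a series of partial column sums, each at most
    the full column by nonnegativity. The other half exchanges rows and columns. *)
Lemma Series_swap_le (a : nat -> nat -> R) : (forall j m, 0 <= a j m) ->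
  (forall j, ex_series (a j)) -> (forall m, ex_series (fun j => a j m)) ->
  ex_series (fun j => Series (a j)) -> ex_series (fun m => Series (fun j => a j m)) ->
  Series (fun j => Series (a j)) <= Series (fun m => Series (fun j => a j m)).
Proof.
  intros Ha Hr Hc HR HC.
  apply (is_lim_seq_le (sum_n (fun j => Series (a j))) (fun _ => Series (fun m => Series (fun j => a j m)))
    (Finite _) (Finite _)).
  - intros N.
    assert (E : ex_series (fun m => sum_n (fun j => a j m) N) /\
      sum_n (fun j => Series (a j)) N = Series (fun m => sum_n (fun j => a j m) N)).
    { induction N as [|N (IH1 & IH2)].
      - split.
        + apply ex_series_ext with (a 0%nat); [intros; rewrite sum_O; auto|apply Hr].
        + rewrite sum_O. apply Series_ext. intros; rewrite sum_O; auto.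
      - split.
        + apply ex_series_ext with (fun m => sum_n (fun j => a j m) N + a (S N) m).
          * intros m. rewrite sum_Sn. reflexivity.
          * apply (ex_series_plus (V := R_NormedModule) _ _ IH1 (Hr (S N))).
        + rewrite sum_Sn, IH2. unfold plus; simpl. rewrite <- Series_plus by auto.
          apply Series_ext. intros m. rewrite sum_Sn. reflexivity. }
    rewrite (proj2 E). apply Series_le; auto. intros m. split.
    + apply Rle_trans with (sum_n (fun _ => 0) N).
      * right. symmetry. rewrite sum_n_const. ring.
      * apply sum_n_m_le. intros; auto.
    + apply (sum_n_le_Series (fun j => a j m)); auto.
  - apply (Series_correct _ HR).
  - apply is_lim_seq_const.
Qed.

Lemma Series_swap (a : nat -> nat -> R) : (forall j m, 0 <= a j m) ->
  (forall j, ex_series (a j)) -> (forall m, ex_series (fun j => a j m)) ->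
  ex_series (fun j => Series (a j)) -> ex_series (fun m => Series (fun j => a j m)) ->
  Series (fun j => Series (a j)) = Series (fun m => Series (fun j => a j m)).
Proof.
  intros. apply Rle_antisym; [apply Series_swap_le; auto|].
  apply (Series_swap_le (fun m j => a j m)); auto.
Qed.

Lemma is_series_geom1 (x : R) : Rabs x < 1 -> is_series (fun n => x ^ S n) (x / (1 - x)).
Proof.
  intros Hx. apply is_series_ext with (fun n => x * x ^ n); [intros; reflexivity|].
  replace (x / (1 - x)) with (x * (/ (1 - x))) by (unfold Rdiv; ring).
  apply (is_series_scal (V := R_NormedModule) x). apply is_series_geom; auto.
Qed.

Lemma egeo_is_series (a : nat -> R) : egeo a -> is_series a (Series a).
Proof. intros H. apply (Series_correct a). apply egeo_ex_series, H. Qed.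

Lemma Series_INR_pow (x : R) : 0 < x < 1 -> Series (fun n => INR n * x ^ n) = x / (1 - x) ^ 2.
Proof.
  intros Hx. assert (G := egeo_geom01 x Hx). assert (G1 := egeo_INR_mult _ G).
  (* Splitting off index 0 and writing [INR (S n)] as [INR n + 1] gives a linear equation for the
     sum. *)
  assert (E : Series (fun n => INR n * x ^ n) = x * Series (fun n => INR n * x ^ n) + x * / (1 - x)).
  { rewrite (Series_incr_1 (fun n => INR n * x ^ n)) at 1 by (apply egeo_ex_series, G1).
    rewrite <- (Series_geom x) by (rewrite Rabs_pos_eq; lra).
    rewrite <- !Series_scal_l, <- Series_plus.
    - simpl (INR 0). rewrite Rmult_0_l, Rplus_0_l. apply Series_ext. intros n. rewrite S_INR. simpl. ring.
    - apply egeo_ex_series, egeo_scal, G1.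
    - apply egeo_ex_series, egeo_scal, G. }
  set (s := Series _) in *.
  apply Rmult_eq_reg_r with (1 - x); [|lra].
  transitivity (x * / (1 - x)); [lra|field; lra].
Qed.

Lemma Series_aexp (a k : nat) (x : R) : (1 <= k)%nat -> 0 < x < 1 ->
  Series (fun j => x ^ aexp a k (S j)) = x ^ a / (1 - x ^ k).
Proof.
  intros Hk Hx. assert (Hxk := pow_lt_1 x k Hx Hk).
  rewrite (Series_ext _ (fun j => x ^ a * (x ^ k) ^ j)).
  - rewrite Series_scal_l, Series_geom by (rewrite Rabs_pos_eq; lra). reflexivity.
  - intros j. unfold aexp. rewrite Nat.sub_succ, Nat.sub_0_r, pow_add, pow_mult. ring.
Qed.

Lemma Series_aexp_weighted (a k : nat) (x : R) : (1 <= k)%nat -> 0 < x < 1 ->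
  Series (fun j => INR (aexp a k (S j)) * x ^ aexp a k (S j)) =
  x ^ a * (INR a + (INR k - INR a) * x ^ k) / (1 - x ^ k) ^ 2.
Proof.
  intros Hk Hx. assert (Hxk := pow_lt_1 x k Hx Hk).
  assert (G := egeo_geom01 _ Hxk). assert (G1 := egeo_INR_mult _ G).
  rewrite (Series_ext _ (fun j => INR k * x ^ a * (INR j * (x ^ k) ^ j) + INR a * x ^ a * (x ^ k) ^ j)).
  - rewrite Series_plus, !Series_scal_l, Series_geom, Series_INR_pow; auto.
    + field. lra.
    + rewrite Rabs_pos_eq; lra.
    + apply egeo_ex_series, egeo_scal, G1.
    + apply egeo_ex_series, egeo_scal, G.
  - intros j. unfold aexp. rewrite Nat.sub_succ, Nat.sub_0_r, pow_add, pow_mult, plus_INR, mult_INR. ring.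
Qed.

(** Expand [1/(1-t^m)] geometrically and exchange the two summations. *)
Lemma lambert_swap (a k : nat) (t : R) (i : nat) : (1 <= a)%nat -> (1 <= k)%nat -> 0 < t < 1 ->
  Series (fun j => INR (aexp a k (S j)) ^ i * t ^ aexp a k (S j) / (1 - t ^ aexp a k (S j))) =
  Series (fun m => Series (fun j => INR (aexp a k (S j)) ^ i * (t ^ S m) ^ aexp a k (S j))) /\
  egeo (fun m => Series (fun j => INR (aexp a k (S j)) ^ i * (t ^ m) ^ aexp a k (S j))).
Proof.
  intros Ha Hk Ht.
  assert (Habs : forall m, (1 <= m)%nat -> Rabs (t ^ m) < 1).
  { intros m Hm. assert (H := pow_lt_1 t m Ht Hm). rewrite Rabs_pos_eq; lra. }
  assert (Hcol : forall m, (1 <= m)%nat -> egeo (fun j => INR (aexp a k (S j)) ^ i * (t ^ m) ^ aexp a k (S j))).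
  { intros m Hm. apply (egeo_shift (fun j => INR (aexp a k j) ^ i * (t ^ m) ^ aexp a k j)).
    apply egeo_aexp_pow; auto. }
  assert (Hpos : forall j m, 0 <= INR (aexp a k (S j)) ^ i * (t ^ m) ^ aexp a k (S j)).
  { intros. apply Rmult_le_pos; [apply pow_le, pos_INR|]. apply pow_le, pow_le. lra. }
  assert (Hcols : egeo (fun m => Series (fun j => INR (aexp a k (S j)) ^ i * (t ^ m) ^ aexp a k (S j)))).
  (* For exponents [e, m >= 1] one has [m e >= (m - 1) + e], which bounds column [m] by
     [t ^ (m - 1)] times the first column. *)
  { set (s1 := Series (fun j => INR (aexp a k (S j)) ^ i * (t ^ 1) ^ aexp a k (S j))).
    apply egeo_from1 with (/ t * s1) t; auto. intros m Hm.
    assert (H0 : 0 <= Series (fun j => INR (aexp a k (S j)) ^ i * (t ^ m) ^ aexp a k (S j))).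
    { apply Rle_trans with (2 := sum_n_le_Series _ 0 (fun j => Hpos j m) (egeo_ex_series _ (Hcol m Hm))).
      rewrite sum_O. apply Hpos. }
    rewrite Rabs_pos_eq by auto.
    replace (/ t * s1 * t ^ m) with (t ^ (m - 1) * s1).
    2: { replace m with (S (m - 1)) at 2 by lia. simpl. field. lra. }
    unfold s1. rewrite <- Series_scal_l. apply Series_le.
    - intros j. split; [apply Hpos|].
      replace (t ^ (m - 1) * (INR (aexp a k (S j)) ^ i * (t ^ 1) ^ aexp a k (S j))) with
        (INR (aexp a k (S j)) ^ i * (t ^ (m - 1) * t ^ aexp a k (S j))) by (rewrite pow_1; ring).
      apply Rmult_le_compat_l; [apply pow_le, pos_INR|].
      rewrite <- pow_mult, <- pow_add. apply pow_anti; [lra|].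
      assert (H := aexp_ge a k (S j) Ha Hk ltac:(lia)). nia.
    - apply egeo_ex_series, egeo_scal, Hcol. lia. }
  split; auto.
  assert (Hrow : forall j, is_series (fun m => INR (aexp a k (S j)) ^ i * (t ^ S m) ^ aexp a k (S j))
     (INR (aexp a k (S j)) ^ i * t ^ aexp a k (S j) / (1 - t ^ aexp a k (S j)))).
  { intros j. set (e := aexp a k (S j)).
    assert (He : (1 <= e)%nat) by (assert (H := aexp_ge a k (S j) Ha Hk ltac:(lia)); unfold e; lia).
    apply is_series_ext with (fun m => INR e ^ i * (t ^ e) ^ S m).
    - intros m. rewrite <- !pow_mult. do 2 f_equal. lia.
    - unfold Rdiv. rewrite Rmult_assoc.
      apply (is_series_scal (V := R_NormedModule) (INR e ^ i) (fun m => (t ^ e) ^ S m)).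
      apply is_series_geom1. apply Habs, He. }
  rewrite (Series_ext _ (fun j => Series (fun m => INR (aexp a k (S j)) ^ i * (t ^ S m) ^ aexp a k (S j)))).
  2: { intros j. symmetry. apply is_series_unique, Hrow. }
  apply Series_swap.
  - intros; apply Hpos.
  - intros j. eexists; apply Hrow.
  - intros m. apply egeo_ex_series, Hcol. lia.
  - apply ex_series_ext with (fun j => INR (aexp a k (S j)) ^ i * t ^ aexp a k (S j) / (1 - t ^ aexp a k (S j))).
    + intros j. symmetry. apply is_series_unique, Hrow.
    + apply egeo_ex_series.
      apply (egeo_shift (fun j => INR (aexp a k j) ^ i * t ^ aexp a k j / (1 - t ^ aexp a k j))).
      unfold Rdiv. apply egeo_mult_bounded.
      * apply egeo_aexp_pow; auto. rewrite Rabs_pos_eq; lra.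
      * apply bounded_inv; [apply egeo_1mapow|intros; apply aexp_neq1]; auto; rewrite Rabs_pos_eq; lra.
  - apply egeo_ex_series. apply (egeo_shift (fun m => Series (fun j => INR (aexp a k (S j)) ^ i * (t ^ m) ^ aexp a k (S j)))).
    apply Hcols.
Qed.

(** The summands are the rational functions of [Q = t^m] obtained by summing over [j] in [lambert_swap]. *)
Definition lam0_term (a k : nat) (x : R) : R := x ^ a / (1 - x ^ k).

Definition lam1_term (a k : nat) (x : R) : R :=
  x ^ a * (INR a + (INR k - INR a) * x ^ k) / (1 - x ^ k) ^ 2.

Lemma lam0_swap (a k : nat) (t : R) : (1 <= a)%nat -> (1 <= k)%nat -> 0 < t < 1 ->
  Series (fun j => t ^ aexp a k (S j) / (1 - t ^ aexp a k (S j))) =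
  Series (fun m => lam0_term a k (t ^ S m)) /\ egeo (fun m => lam0_term a k (t ^ m)).
Proof.
  intros Ha Hk Ht. destruct (lambert_swap a k t 0 Ha Hk Ht) as (H1 & H2). split.
  - rewrite (Series_ext _ (fun j => INR (aexp a k (S j)) ^ 0 * t ^ aexp a k (S j) / (1 - t ^ aexp a k (S j)))).
    + rewrite H1. apply Series_ext. intros m. unfold lam0_term.
      rewrite <- Series_aexp; auto.
      * apply Series_ext. intros j. simpl. ring.
      * apply pow_lt_1; auto; lia.
    + intros j. simpl. unfold Rdiv. ring.
  - revert H2. apply egeo_ext1. intros m Hm. unfold lam0_term.
    rewrite <- Series_aexp; auto.
    * apply Series_ext. intros j. simpl. ring.
    * apply pow_lt_1; auto; lia.
Qed.

Lemma lam1_swap (a k : nat) (t : R) : (1 <= a)%nat -> (1 <= k)%nat -> 0 < t < 1 ->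
  Series (fun j => INR (aexp a k (S j)) * t ^ aexp a k (S j) / (1 - t ^ aexp a k (S j))) =
  Series (fun m => lam1_term a k (t ^ S m)) /\ egeo (fun m => lam1_term a k (t ^ m)).
Proof.
  intros Ha Hk Ht. destruct (lambert_swap a k t 1 Ha Hk Ht) as (H1 & H2). split.
  - rewrite (Series_ext _ (fun j => INR (aexp a k (S j)) ^ 1 * t ^ aexp a k (S j) / (1 - t ^ aexp a k (S j)))).
    + rewrite H1. apply Series_ext. intros m. unfold lam1_term.
      rewrite <- Series_aexp_weighted; auto.
      * apply Series_ext. intros j. rewrite pow_1. reflexivity.
      * apply pow_lt_1; auto; lia.
    + intros j. rewrite pow_1. reflexivity.
  - revert H2. apply egeo_ext1. intros m Hm. unfold lam1_term.
    rewrite <- Series_aexp_weighted; auto.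
    * apply Series_ext. intros j. rewrite pow_1. reflexivity.
    * apply pow_lt_1; auto; lia.
Qed.

(** [l] is the logarithmic derivative [t f'(t) / f(t)], written without division by [f t]. It is
    additive on products, and replacing [t] by [t ^ k] multiplies it by [k]. *)
Definition is_dlog (f : R -> R) (t l : R) : Prop := is_derive f t (f t / t * l).

Lemma dlog_id (t : R) : t <> 0 -> is_dlog (fun t => t) t 1.
Proof. intros Ht. unfold is_dlog. replace (t / t * 1) with 1 by (field; auto). apply @is_derive_id. Qed.

Lemma dlog_mult (f g : R -> R) (t l m : R) : is_dlog f t l -> is_dlog g t m ->
  is_dlog (fun t => f t * g t) t (l + m).
Proof.
  unfold is_dlog. intros Hf Hg. evar_last.
  - apply (is_derive_mult f g t); eauto. intros; apply Rmult_comm.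
  - unfold plus, mult; simpl. unfold Rdiv. ring.
Qed.

Lemma dlog_inv (f : R -> R) (t l : R) : f t <> 0 -> is_dlog f t l -> is_dlog (fun t => / f t) t (- l).
Proof.
  unfold is_dlog. intros Hn Hf. evar_last.
  - apply is_derive_inv; eauto.
  - unfold Rdiv. generalize (/ t). intros u. simpl. field. auto.
Qed.

Lemma dlog_div (f g : R -> R) (t l m : R) : g t <> 0 -> is_dlog f t l -> is_dlog g t m ->
  is_dlog (fun t => f t / g t) t (l - m).
Proof. intros Hn Hf Hg. apply (dlog_mult f (fun t => / g t)); auto using dlog_inv. Qed.

Lemma dlog_pow (f : R -> R) (n : nat) (t l : R) : is_dlog f t l -> is_dlog (fun t => f t ^ n) t (INR n * l).
Proof.
  intros Hf. induction n.
  - unfold is_dlog. simpl. replace (1 / t * (0 * l)) with 0 by (unfold Rdiv; ring). apply @is_derive_const.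
  - rewrite S_INR. replace ((INR n + 1) * l) with (l + INR n * l) by ring. simpl.
    apply (dlog_mult f (fun t => f t ^ n)); auto.
Qed.

Lemma dlog_comp_pow (f : R -> R) (k : nat) (t l : R) : (1 <= k)%nat -> t <> 0 -> is_dlog f (t ^ k) l ->
  is_dlog (fun t => f (t ^ k)) t (INR k * l).
Proof.
  unfold is_dlog. intros Hk Ht Hf. evar_last.
  - apply (is_derive_comp f (fun t => t ^ k) t (f (t ^ k) / t ^ k * l) (INR k * t ^ (k - 1))); [exact Hf|].
    auto_derive; auto. rewrite Nat.sub_1_r. ring.
  - unfold scal; simpl; unfold mult; simpl.
    assert (E : t ^ k = t * t ^ (k - 1)) by (change (t ^ k = t ^ S (k - 1)); f_equal; lia).
    rewrite E. field. split; auto. apply pow_nonzero; auto.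
Qed.

Lemma dlog_ext (f g : R -> R) (t l : R) : (forall x, f x = g x) -> is_dlog f t l -> is_dlog g t l.
Proof. unfold is_dlog. intros H Hf. rewrite <- H. apply is_derive_ext with f; auto. Qed.

Lemma dlog_aprod (a k : nat) (t : R) : (1 <= a)%nat -> (1 <= k)%nat -> 0 < t < 1 ->
  is_dlog (aprod a k) t (- Series (fun m => lam1_term a k (t ^ S m))).
Proof.
  intros Ha Hk Ht. unfold is_dlog. evar_last.
  - apply aprod_derive; auto. rewrite Rabs_pos_eq; lra.
  - destruct (lam1_swap a k t Ha Hk Ht) as (H & _). rewrite <- H.
    match goal with |- _ * ?x = _ / _ * - ?y => assert (Exy : x = / t * - y) end.
    2: { rewrite Exy. unfold Rdiv. ring. }
    rewrite <- Series_opp, <- Series_scal_l. apply Series_ext. intros j.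
    set (e := aexp a k (S j)).
    assert (He : (1 <= e)%nat) by (assert (Hj := aexp_ge a k (S j) Ha Hk ltac:(lia)); unfold e; lia).
    assert (Ee : t ^ e = t * t ^ (e - 1)) by (change (t ^ e = t ^ S (e - 1)); f_equal; lia).
    assert (Hlt := pow_lt_1 t e Ht He). rewrite Ee in *. field. lra.
Qed.

Definition phi (x : R) : R := x / (1 - x) ^ 2.

(** As a power series this is the sum of [sigma(n) t^(kn)], that is [(1 - E_2(t^k)) / 24] with the
    Eisenstein series of weight 2. *)
Definition lamb (k : nat) (t : R) : R := Series (fun m => phi ((t ^ S m) ^ k)).

Lemma is_series_lamb (k : nat) (t : R) : (1 <= k)%nat -> 0 < t < 1 ->
  is_series (fun m => phi ((t ^ S m) ^ k)) (lamb k t).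
Proof.
  intros Hk Ht. apply (Series_correct (fun m => phi ((t ^ S m) ^ k))).
  apply egeo_ex_series, (egeo_shift (fun m => phi ((t ^ m) ^ k))).
  destruct (lam1_swap 1 1 (t ^ k) (le_n _) (le_n _) (pow_lt_1 t k Ht Hk)) as (_ & H).
  revert H. apply egeo_ext1. intros m _. unfold lam1_term, phi.
  rewrite <- !pow_mult, Nat.mul_comm. rewrite !Nat.mul_1_r. simpl (INR 1). unfold Rdiv. ring.
Qed.

Lemma dlog_E_pow (k : nat) (t : R) : (1 <= k)%nat -> 0 < t < 1 ->
  is_dlog (fun t => E (t ^ k)) t (- INR k * lamb k t).
Proof.
  intros Hk Ht. replace (- INR k * lamb k t) with (INR k * - lamb k t) by ring.
  apply dlog_comp_pow; [auto|lra|]. apply dlog_ext with (aprod 1 1); [intros; symmetry; apply E_aprod|].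
  replace (lamb k t) with (Series (fun m => lam1_term 1 1 ((t ^ k) ^ S m))).
  - apply dlog_aprod; auto. apply pow_lt_1; auto.
  - apply Series_ext. intros m. unfold lam1_term, phi.
    rewrite <- !pow_mult, Nat.mul_comm. rewrite !Nat.mul_1_r. simpl (INR 1). unfold Rdiv. ring.
Qed.

Lemma dlog_E (t : R) : 0 < t < 1 -> is_dlog E t (- lamb 1 t).
Proof.
  intros Ht. apply dlog_ext with (fun t => E (t ^ 1)); [intros; rewrite pow_1; auto|].
  replace (- lamb 1 t) with (- INR 1 * lamb 1 t) by (simpl; ring). apply dlog_E_pow; auto.
Qed.

Lemma ex_derive_aprod (a k : nat) (t : R) : (1 <= a)%nat -> (1 <= k)%nat -> Rabs t < 1 ->
  ex_derive (aprod a k) t.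
Proof. intros. eexists. apply aprod_derive; auto. Qed.

Lemma ex_derive_E (t : R) : 0 <= t < 1 -> ex_derive E t.
Proof.
  intros Ht. apply ex_derive_ext with (aprod 1 1); [intros; symmetry; apply E_aprod|].
  apply ex_derive_aprod; auto. rewrite Rabs_pos_eq; lra.
Qed.

Lemma pow_in_01 (t : R) (k : nat) : 0 <= t < 1 -> (1 <= k)%nat -> 0 <= t ^ k < 1.
Proof.
  intros Ht Hk. destruct (Req_dec t 0) as [->|Hn].
  - rewrite pow_i by lia. lra.
  - assert (H := pow_lt_1 t k ltac:(lra) Hk). lra.
Qed.

Lemma ex_derive_E_pow (k : nat) (t : R) : (1 <= k)%nat -> 0 <= t < 1 -> ex_derive E (t ^ k).
Proof. intros Hk Ht. apply ex_derive_E, pow_in_01; auto. Qed.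

Lemma aprod_0 (a k : nat) : (1 <= a)%nat -> (1 <= k)%nat -> aprod a k 0 = 1.
Proof.
  intros Ha Hk. unfold aprod. rewrite (inf_prod_ext _ (fun _ => 1)); [apply inf_prod_1|].
  intros j Hj. assert (H := aexp_ge a k j Ha Hk Hj). rewrite pow_i by lia. ring.
Qed.

Lemma E_0 : E 0 = 1.
Proof. rewrite E_aprod. apply aprod_0; lia. Qed.

Lemma aprod_pos (a k : nat) (t : R) : (1 <= a)%nat -> (1 <= k)%nat -> 0 <= t < 1 -> 0 < aprod a k t.
Proof.
  intros Ha Hk Ht. apply inf_prod_pos.
  - apply egeo_1mapow; auto. rewrite Rabs_pos_eq; lra.
  - intros n Hn. assert (H := aexp_ge a k n Ha Hk Hn).
    assert (H1 := pow_in_01 t (aexp a k n) Ht ltac:(lia)). lra.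
Qed.

Lemma E_pos0 (t : R) : 0 <= t < 1 -> 0 < E t.
Proof. intros. rewrite E_aprod. apply aprod_pos; auto; lia. Qed.

Lemma E_pow_pos (k : nat) (t : R) : (1 <= k)%nat -> 0 <= t < 1 -> 0 < E (t ^ k).
Proof. intros. apply E_pos0, pow_in_01; auto. Qed.

(** The antiderivative is [t * G t]. For [t > 0] its derivative is read off from the logarithmic
    derivative; at 0, where that form divides by zero, the derivative is [G 0], hence the hypothesis
    [G 0 = F 0]. *)
Lemma is_RInt_dlog (G F : R -> R) (l : R -> R) (q : R) : 0 < q < 1 ->
  (forall t, 0 <= t < 1 -> ex_derive G t) -> (forall t, 0 <= t < 1 -> ex_derive F t) ->
  G 0 = F 0 ->
  (forall t, 0 < t < 1 -> is_dlog (fun t => t * G t) t (l t) /\ G t * l t = F t) ->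
  is_RInt F 0 q (q * G q).
Proof.
  intros Hq HG HF H0 Hl.
  replace (q * G q) with (minus (q * G q) (0 * G 0)) by (unfold minus, plus, opp; simpl; ring).
  apply (is_RInt_derive (fun t => t * G t) F).
  - rewrite Rmin_left, Rmax_right by lra. intros t Ht.
    destruct (Req_dec t 0) as [->|Hn].
    + destruct (HG 0 ltac:(lra)) as (g & Hg). evar_last.
      * apply (is_derive_mult (fun t => t) G 0 1 g); auto; [apply @is_derive_id|].
        intros; apply Rmult_comm.
      * unfold plus, mult; simpl. rewrite H0. ring.
    + destruct (Hl t ltac:(lra)) as (D & E). unfold is_dlog in D. evar_last; [exact D|].
      rewrite <- E. field. auto.
  - rewrite Rmin_left, Rmax_right by lra. intros t Ht.
    apply (ex_derive_continuous F). apply HF. lra.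
Qed.

(** * Level 6 *)

(** Convergence and value are bundled so that an identity between infinite products reduces, via
    [has_prod_unique], to an identity of factors, rational in [q ^ n]. *)
Definition has_prod (f : nat -> R) (l : R) : Prop := egeo (fun n => f n - 1) /\ inf_prod f = l.

Lemma has_prod_mult (f g : nat -> R) (a b : R) : has_prod f a -> has_prod g b ->
  has_prod (fun n => f n * g n) (a * b).
Proof.
  intros (Gf & <-) (Gg & <-). split; [apply egeo_prod; auto|apply inf_prod_mult; auto].
Qed.

Lemma has_prod_pow (f : nat -> R) (k : nat) (a : R) : has_prod f a -> has_prod (fun n => f n ^ k) (a ^ k).
Proof. intros (Gf & <-). split; [apply egeo_prod_pow; auto|apply inf_prod_pow; auto]. Qed.

Lemma has_prod_unique (f g : nat -> R) (a b : R) : has_prod f a -> has_prod g b ->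
  (forall n, (1 <= n)%nat -> f n = g n) -> a = b.
Proof. intros (_ & <-) (_ & <-) H. apply inf_prod_ext; auto. Qed.

Lemma has_prod_ext (f g : nat -> R) (a : R) : (forall n, (1 <= n)%nat -> f n = g n) ->
  has_prod f a -> has_prod g a.
Proof.
  intros H (G & <-). split.
  - revert G. apply egeo_ext1. intros n Hn. rewrite H; auto.
  - symmetry. apply inf_prod_ext; auto.
Qed.

Lemma has_prod_E (k : nat) (q : R) : (1 <= k)%nat -> 0 < q < 1 -> has_prod (fun n => 1 - (q ^ n) ^ k) (E (q ^ k)).
Proof.
  intros Hk Hq. apply has_prod_ext with (fun n => 1 - (q ^ k) ^ n).
  - intros n _. rewrite <- !pow_mult. do 2 f_equal. lia.
  - split; [|reflexivity]. apply egeo_1mpow, pow_lt_1; auto.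
Qed.

Lemma has_prod_E1 (q : R) : 0 < q < 1 -> has_prod (fun n => 1 - q ^ n) (E q).
Proof. intros Hq. split; [|reflexivity]. apply egeo_1mpow, Hq. Qed.

Lemma has_prod_gprod (p c : R) : 0 < p < 1 -> has_prod (quad1 p c) (gprod p c).
Proof. intros Hp. split; [apply egeo_quad1, Hp|reflexivity]. Qed.

Lemma has_prod_qprod (p c d : R) : 0 < p < 1 -> has_prod (quad p c d) (qprod p c d).
Proof. intros Hp. split; [apply egeo_quad, Hp|reflexivity]. Qed.

Lemma has_prod_aprod (a k : nat) (q : R) : (1 <= a)%nat -> (1 <= k)%nat -> 0 < q < 1 ->
  has_prod (fun n => 1 - q ^ aexp a k n) (aprod a k q).
Proof. intros. split; [|reflexivity]. apply egeo_1mapow; auto. rewrite Rabs_pos_eq; lra. Qed.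

(** [aprod_up] and [aprod_down] give the products of [1 - xQ] and [1 - Q/x] at [x = q^a] and nome
    [q^k]. The first starts one step late, hence the division by [1 - q ^ a]. *)
Lemma aprod_up (a k : nat) (q : R) : (1 <= a)%nat -> (1 <= k)%nat -> 0 < q < 1 ->
  has_prod (fun n => 1 - q ^ a * (q ^ k) ^ n) (aprod a k q / (1 - q ^ a)).
Proof.
  intros Ha Hk Hq. assert (Hqa := pow_lt_1 q a Hq Ha).
  destruct (has_prod_aprod a k q Ha Hk Hq) as (G & _).
  split.
  - apply egeo_ext1 with (fun n => (1 - q ^ aexp a k (S n)) - 1).
    + intros n _. unfold aexp. rewrite Nat.sub_succ, Nat.sub_0_r, pow_add, pow_mult. ring.
    + apply (egeo_shift (fun n => (1 - q ^ aexp a k n) - 1)), G.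
  - unfold aprod. rewrite (inf_prod_shift (fun n => 1 - q ^ aexp a k n)) by exact G.
    replace (aexp a k 1) with a by (unfold aexp; lia).
    rewrite (inf_prod_ext (fun n => 1 - q ^ aexp a k (S n)) (fun n => 1 - q ^ a * (q ^ k) ^ n)).
    + field. lra.
    + intros n _. unfold aexp. rewrite Nat.sub_succ, Nat.sub_0_r, pow_add, pow_mult. ring.
Qed.

Lemma aprod_down (a k : nat) (q : R) : (a < k)%nat -> 0 < q < 1 ->
  has_prod (fun n => 1 - (q ^ k) ^ n / q ^ a) (aprod (k - a) k q).
Proof.
  intros Ha Hq. apply has_prod_ext with (fun n => 1 - q ^ aexp (k - a) k n).
  - intros n Hn. f_equal. apply Rmult_eq_reg_r with (q ^ a); [|apply pow_nonzero; lra].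
    unfold Rdiv. rewrite Rmult_assoc, Rinv_l, Rmult_1_r by (apply pow_nonzero; lra).
    rewrite <- pow_add, <- pow_mult. f_equal. unfold aexp. nia.
  - apply has_prod_aprod; auto; lia.
Qed.

Lemma aprod_scale (a k m : nat) (q : R) : aprod (m * a) (m * k) q = aprod a k (q ^ m).
Proof.
  apply inf_prod_ext. intros j _. rewrite <- pow_mult. do 2 f_equal. unfold aexp. nia.
Qed.

Lemma E_block (k : nat) (q : R) : (1 <= k)%nat -> 0 < q < 1 -> E q = prodR (fun a => aprod a k q) k.
Proof.
  intros Hk Hq. unfold E. rewrite (inf_prod_block _ k Hk (egeo_1mpow q Hq)).
  assert (H : forall m, has_prod (fun n => prodR (fun i => 1 - q ^ (k * (n - 1) + i)) m)
    (prodR (fun a => aprod a k q) m)).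
  { induction m; simpl.
    - split; [|apply inf_prod_1]. apply egeo_ext1 with (fun _ => 0); [intros; ring|apply egeo_zero].
    - apply has_prod_mult; auto. apply (has_prod_aprod (S m) k q); auto; lia. }
  apply H.
Qed.

Lemma aprod_self (k : nat) (q : R) : aprod k k q = E (q ^ k).
Proof. replace k with (k * 1)%nat at 1 2 by lia. rewrite aprod_scale. symmetry. apply E_aprod. Qed.

Lemma E_block2 (q : R) : 0 < q < 1 -> E q = aprod 1 2 q * E (q ^ 2).
Proof. intros Hq. rewrite (E_block 2 q) by (auto; lia). simpl prodR. rewrite (aprod_self 2). ring. Qed.

Lemma E_block3 (q : R) : 0 < q < 1 -> E q = aprod 1 3 q * aprod 2 3 q * E (q ^ 3).
Proof. intros Hq. rewrite (E_block 3 q) by (auto; lia). simpl prodR. rewrite (aprod_self 3). ring. Qed.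

Lemma E_block5 (q : R) : 0 < q < 1 ->
  E q = aprod 1 5 q * aprod 2 5 q * aprod 3 5 q * aprod 4 5 q * E (q ^ 5).
Proof. intros Hq. rewrite (E_block 5 q) by (auto; lia). simpl prodR. rewrite (aprod_self 5). ring. Qed.

Lemma E_block6 (q : R) : 0 < q < 1 ->
  E q = aprod 1 6 q * aprod 2 6 q * aprod 3 6 q * aprod 4 6 q * aprod 5 6 q * E (q ^ 6).
Proof. intros Hq. rewrite (E_block 6 q) by (auto; lia). simpl prodR. rewrite (aprod_self 6). ring. Qed.

Ltac has_prod_tac :=
  repeat first
  [ apply has_prod_pow | apply has_prod_mult
  | apply has_prod_E; [lia|assumption]
  | apply has_prod_E1; assumption
  | apply has_prod_gprod; assumption | apply has_prod_qprod; assumption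
  | eassumption ].

Lemma is_seriesR_plus (a b : nat -> R) (x y : R) : is_series a x -> is_series b y ->
  is_series (fun n => a n + b n) (x + y).
Proof. intros H1 H2. exact (is_series_plus a b x y H1 H2). Qed.

Lemma is_seriesR_scal (c : R) (a : nat -> R) (x : R) : is_series a x ->
  is_series (fun n => c * a n) (c * x).
Proof. intros H. exact (is_series_scal c a x H). Qed.

(** At [c = 1, -1, -2, 0] the point [x] is a primitive root of unity of order 6, 3, 2, 4, and
    [quad1] is the cyclotomic polynomial of that order, squared for order 2. *)
Lemma gprod_1 (q : R) : 0 < q < 1 -> gprod q 1 * (E (q ^ 2) * E (q ^ 3)) = E q * E (q ^ 6).
Proof.
  intros Hq.
  eapply has_prod_unique; [has_prod_tac|has_prod_tac|].
  intros n _. unfold quad1. ring.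
Qed.

Lemma gprod_m1 (q : R) : 0 < q < 1 -> gprod q (-1) * E q = E (q ^ 3).
Proof.
  intros Hq.
  eapply has_prod_unique; [has_prod_tac|has_prod_tac|].
  intros n _. unfold quad1. ring.
Qed.

Lemma gprod_m2 (q : R) : 0 < q < 1 -> gprod q (-2) * E q ^ 2 = E (q ^ 2) ^ 2.
Proof.
  intros Hq.
  eapply has_prod_unique; [has_prod_tac|has_prod_tac|].
  intros n _. unfold quad1. ring.
Qed.

Lemma gprod_0 (q : R) : 0 < q < 1 -> gprod q 0 * E (q ^ 2) = E (q ^ 4).
Proof.
  intros Hq.
  eapply has_prod_unique; [has_prod_tac|has_prod_tac|].
  intros n _. unfold quad1. ring.
Qed.

(** For two such roots of unity [x] and [y], [xy] and [x/y] are again roots of unity of order 6, 3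
    or 2, so [quad] factors into values of [quad1]. *)
Lemma qprod_1_m2 (q : R) : 0 < q < 1 -> qprod q 1 (-2) = gprod q (-1) ^ 2.
Proof.
  intros Hq. eapply has_prod_unique; [has_prod_tac|has_prod_tac|].
  intros n _. unfold quad, quad1. ring.
Qed.

Lemma qprod_1_m1 (q : R) : 0 < q < 1 -> qprod q 1 (-1) = gprod q (-2) * gprod q 1.
Proof.
  intros Hq. eapply has_prod_unique; [has_prod_tac|has_prod_tac|].
  intros n _. unfold quad, quad1. ring.
Qed.

Lemma qprod_m1_m2 (q : R) : 0 < q < 1 -> qprod q (-1) (-2) = gprod q 1 ^ 2.
Proof.
  intros Hq. eapply has_prod_unique; [has_prod_tac|has_prod_tac|].
  intros n _. unfold quad, quad1. ring.
Qed.

Lemma quad1_pos (p c : R) (n : nat) : 0 < p < 1 -> Rabs c <= 2 -> (1 <= n)%nat -> quad1 p c n <> 0.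
Proof.
  intros Hp Hc Hn. assert (H := pow_lt_1 p n Hp Hn). unfold quad1. apply Rabs_le_between in Hc. nra.
Qed.

Lemma quad_2_neq0 (p c : R) : (forall n, (1 <= n)%nat -> quad1 p c n <> 0) ->
  forall n, (1 <= n)%nat -> quad p c 2 n <> 0.
Proof. intros H n Hn. rewrite quad_2. apply pow_nonzero. auto. Qed.

(** The left-hand side is minus the sum of [zx / (1 - zx)^2] over the primitive sixth roots of unity
    [z]; by Moebius inversion that sum is the sum of [mu(6/d) d^2 phi(x^d)] over [d] dividing 6. The
    next three lemmas are the cases of order 3, 2 (counted twice) and 4. *)
Lemma phi_1 (x : R) : 0 < x < 1 ->
  (2 * x ^ 2 * 2 - (1 + x ^ 2) * x * 1) / (1 - 1 * x + x ^ 2) ^ 2 =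
  - 1 * phi (x ^ 1) + 4 * phi (x ^ 2) + 9 * phi (x ^ 3) + - 36 * phi (x ^ 6).
Proof.
  intros Hx. unfold phi.
  replace (1 - x ^ 2) with ((1 - x) * (1 + x)) by ring.
  replace (1 - x ^ 3) with ((1 - x) * (1 + x + x ^ 2)) by ring.
  replace (1 - x ^ 6) with ((1 - x) * (1 + x) * (1 + x + x ^ 2) * (1 - x + x ^ 2)) by ring.
  field. repeat split; nra.
Qed.

Lemma phi_m1 (x : R) : 0 < x < 1 ->
  (2 * x ^ 2 * 2 - (1 + x ^ 2) * x * -1) / (1 - -1 * x + x ^ 2) ^ 2 = phi (x ^ 1) + - 9 * phi (x ^ 3).
Proof.
  intros Hx. unfold phi.
  replace (1 - x ^ 3) with ((1 - x) * (1 + x + x ^ 2)) by ring.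
  field. repeat split; nra.
Qed.

Lemma phi_m2 (x : R) : 0 < x < 1 ->
  (2 * x ^ 2 * 2 - (1 + x ^ 2) * x * -2) / (1 - -2 * x + x ^ 2) ^ 2 = 2 * phi (x ^ 1) + - 8 * phi (x ^ 2).
Proof.
  intros Hx. unfold phi.
  replace (1 - x ^ 2) with ((1 - x) * (1 + x)) by ring.
  field. repeat split; nra.
Qed.

Lemma phi_0 (x : R) : 0 < x < 1 ->
  (2 * x ^ 2 * 2 - (1 + x ^ 2) * x * 0) / (1 - 0 * x + x ^ 2) ^ 2 = 4 * phi (x ^ 2) + - 16 * phi (x ^ 4).
Proof.
  intros Hx. unfold phi.
  replace (1 - x ^ 4) with ((1 - x ^ 2) * (1 + x ^ 2)) by ring.
  field. repeat split; nra.
Qed.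

Ltac series_lin :=
  repeat lazymatch goal with
  | |- is_series _ (_ + _) => apply is_seriesR_plus
  | |- is_series _ (_ * _) => apply is_seriesR_scal
  end.

Lemma Series_eq (a b : nat -> R) (l : R) : is_series a l -> (forall n, a n = b n) -> Series b = l.
Proof. intros H E. rewrite <- (Series_ext _ _ E). apply is_series_unique, H. Qed.

(** Sixth roots of unity on the curve of nome [q]. *)
Lemma level6_lambert (q : R) : 0 < q < 1 ->
  E q ^ 4 * E (q ^ 3) ^ 4 / (E (q ^ 2) ^ 2 * E (q ^ 6) ^ 2) =
  1 - 4 * lamb 1 q + 16 * lamb 2 q + 12 * lamb 3 q - 48 * lamb 6 q.
Proof.
  intros Hq.
  assert (N1 : forall n, (1 <= n)%nat -> quad1 q 1 n <> 0).
  { intros. apply quad1_pos; auto. rewrite Rabs_pos_eq; lra. }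
  assert (N2 : forall n, (1 <= n)%nat -> quad1 q (-2) n <> 0).
  { intros. apply quad1_pos; auto. rewrite Rabs_left; lra. }
  assert (W := wp_difference q 1 (-2) Hq ltac:(lra) ltac:(lra) N1 N2).
  unfold wp in W.
  assert (S1 : Series (fun n => dquad q 1 2 (S n)) =
     - 1 * lamb 1 q + 4 * lamb 2 q + 9 * lamb 3 q + - 36 * lamb 6 q).
  { eapply Series_eq; [series_lin; apply is_series_lamb; auto; lia|].
    intros n. cbv beta. symmetry. unfold dquad. rewrite quad_2.
    apply phi_1. apply pow_lt_1; auto; lia. }
  assert (S2 : Series (fun n => dquad q (-2) 2 (S n)) = 2 * lamb 1 q + - 8 * lamb 2 q).
  { eapply Series_eq; [series_lin; apply is_series_lamb; auto; lia|].
    intros n. cbv beta. symmetry. unfold dquad. rewrite quad_2.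
    apply phi_m2. apply pow_lt_1; auto; lia. }
  rewrite S1, S2, qprod_1_m2 in W by auto.
  assert (G1 := gprod_1 q Hq). assert (Gm1 := gprod_m1 q Hq). assert (Gm2 := gprod_m2 q Hq).
  assert (E1 := E_pos q Hq). assert (E2 := E_pow_pos 2 q ltac:(lia) ltac:(lra)).
  assert (E3 := E_pow_pos 3 q ltac:(lia) ltac:(lra)). assert (E6 := E_pow_pos 6 q ltac:(lia) ltac:(lra)).
  replace (gprod q 1) with (E q * E (q ^ 6) / (E (q ^ 2) * E (q ^ 3))) in W by (rewrite <- G1; field; lra).
  replace (gprod q (-1)) with (E (q ^ 3) / E q) in W by (rewrite <- Gm1; field; lra).
  replace (gprod q (-2)) with (E (q ^ 2) ^ 2 / E q ^ 2) in W by (rewrite <- Gm2; field; lra).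
  (* [3 / 4] is the coefficient [(c - d) / ((c - 2) * (d - 2))] at [c = 1], [d = -2]. *)
  transitivity (4 / 3 * (3 / 4 * (E q ^ 4 * E (q ^ 3) ^ 4 / (E (q ^ 2) ^ 2 * E (q ^ 6) ^ 2)))); [field; lra|].
  transitivity (4 / 3 * ((1 - -2) / ((1 - 2) * (-2 - 2)) *
    ((E (q ^ 3) / E q) ^ 2 * E q ^ 4 /
     ((E q * E (q ^ 6) / (E (q ^ 2) * E (q ^ 3))) ^ 2 * (E (q ^ 2) ^ 2 / E q ^ 2) ^ 2)))).
  { f_equal. field. lra. }
  rewrite W. field.
Qed.

(** Theta value at the point [q^a] of the curve of nome [q^k]. *)
Definition tprod (k a : nat) (q : R) : R := aprod a k q * aprod (k - a) k q.

(** The parameter [c] of the point [x = q^i]; for nome [q^k] this is a torsion point of order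
    dividing [k] in the direction of the imaginary period. *)
Definition cpow (q : R) (i : nat) : R := q ^ i + / q ^ i.

Lemma tprod_sym (k a : nat) (q : R) : (a <= k)%nat -> tprod k (k - a) q = tprod k a q.
Proof. intros H. unfold tprod. replace (k - (k - a))%nat with a by lia. ring. Qed.

Lemma tprod_pos (k a : nat) (q : R) : (1 <= a < k)%nat -> 0 < q < 1 -> 0 < tprod k a q.
Proof. intros H Hq. apply Rmult_lt_0_compat; apply aprod_pos; try lia; lra. Qed.

Lemma has_prod_tprod (k a : nat) (q : R) : (1 <= a < k)%nat -> 0 < q < 1 ->
  has_prod (fun n => (1 - q ^ a * (q ^ k) ^ n) * (1 - (q ^ k) ^ n / q ^ a)) (tprod k a q / (1 - q ^ a)).
Proof.
  intros H Hq. replace (tprod k a q / (1 - q ^ a)) with (aprod a k q / (1 - q ^ a) * aprod (k - a) k q)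
    by (unfold tprod, Rdiv; ring).
  apply has_prod_mult; [apply aprod_up|apply aprod_down]; auto; lia.
Qed.

Lemma gprod_cpow (k i : nat) (q : R) : (1 <= i < k)%nat -> 0 < q < 1 ->
  gprod (q ^ k) (cpow q i) = tprod k i q / (1 - q ^ i).
Proof.
  intros H Hq. assert (Hk : 0 < q ^ k < 1) by (apply pow_lt_1; [auto|lia]).
  eapply has_prod_unique; [apply has_prod_gprod; auto|apply has_prod_tprod; auto|].
  intros n Hn. unfold quad1, cpow. field. apply pow_nonzero; lra.
Qed.

Lemma qprod_cpow (k i j : nat) (q : R) : (1 <= i < j)%nat -> (i + j < k)%nat -> 0 < q < 1 ->
  qprod (q ^ k) (cpow q i) (cpow q j) =
  tprod k (i + j) q * tprod k (j - i) q / ((1 - q ^ (i + j)) * (1 - q ^ (j - i))).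
Proof.
  intros H Hk Hq. assert (Hqk : 0 < q ^ k < 1) by (apply pow_lt_1; [auto|lia]).
  assert (Hij := pow_lt_1 q (i + j) Hq ltac:(lia)). assert (Hji := pow_lt_1 q (j - i) Hq ltac:(lia)).
  replace (tprod k (i + j) q * tprod k (j - i) q / ((1 - q ^ (i + j)) * (1 - q ^ (j - i)))) with
    (tprod k (i + j) q / (1 - q ^ (i + j)) * (tprod k (j - i) q / (1 - q ^ (j - i)))) by (field; lra).
  eapply has_prod_unique; [apply has_prod_qprod; auto|apply has_prod_mult; apply has_prod_tprod; auto; lia|].
  intros n Hn. unfold quad, cpow.
  replace (q ^ j) with (q ^ i * q ^ (j - i)) by (rewrite <- pow_add; f_equal; lia).
  rewrite pow_add. replace (q ^ j) with (q ^ i * q ^ (j - i)) by (rewrite <- pow_add; f_equal; lia).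
  field. split; apply pow_nonzero; lra.
Qed.

Lemma qdet_cpow (k i j : nat) (q : R) : (1 <= i < j)%nat -> (i + j < k)%nat -> 0 < q < 1 ->
  qdet (q ^ k) (cpow q i) (cpow q j) = - (tprod k (i + j) q * tprod k (j - i) q / q ^ j).
Proof.
  intros H Hk Hq. unfold qdet. rewrite qprod_cpow by auto.
  assert (Hij := pow_lt_1 q (i + j) Hq ltac:(lia)). assert (Hji := pow_lt_1 q (j - i) Hq ltac:(lia)).
  unfold cpow.
  rewrite pow_add in *. replace (q ^ j) with (q ^ i * q ^ (j - i)) in * by (rewrite <- pow_add; f_equal; lia).
  field. assert (q ^ i <> 0) by (apply pow_nonzero; lra). repeat split; lra.
Qed.

Lemma qdet_cpow_2 (k j : nat) (q : R) : (1 <= j < k)%nat -> 0 < q < 1 ->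
  qdet (q ^ k) 2 (cpow q j) = - (tprod k j q ^ 2 / q ^ j).
Proof.
  intros H Hq. assert (Hqk : 0 < q ^ k < 1) by (apply pow_lt_1; [auto|lia]).
  unfold qdet. rewrite qprod_sym, qprod_2, gprod_cpow by auto.
  assert (Hj := pow_lt_1 q j Hq ltac:(lia)). unfold cpow. field. lra.
Qed.

Lemma tprod_6_2 (q : R) : 0 < q < 1 -> tprod 6 2 q = E (q ^ 2) / E (q ^ 6).
Proof.
  intros Hq. unfold tprod. simpl Nat.sub.
  change 6%nat with (2 * 3)%nat at 1 2. change 2%nat with (2 * 1)%nat at 1. change 4%nat with (2 * 2)%nat.
  rewrite !aprod_scale. assert (H2 := pow_lt_1 q 2 Hq ltac:(lia)).
  rewrite (E_block3 (q ^ 2)) by auto. rewrite <- pow_mult. simpl Nat.mul.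
  assert (E6 := E_pow_pos 6 q ltac:(lia) ltac:(lra)). field. lra.
Qed.

Lemma aprod_3_6 (q : R) : 0 < q < 1 -> aprod 3 6 q = E (q ^ 3) / E (q ^ 6).
Proof.
  intros Hq. change 6%nat with (3 * 2)%nat at 1. change 3%nat with (3 * 1)%nat at 1.
  rewrite aprod_scale. assert (H3 := pow_lt_1 q 3 Hq ltac:(lia)).
  rewrite (E_block2 (q ^ 3)) by auto. rewrite <- pow_mult. simpl Nat.mul.
  assert (E6 := E_pow_pos 6 q ltac:(lia) ltac:(lra)). field. lra.
Qed.

Lemma tprod_6_1 (q : R) : 0 < q < 1 -> tprod 6 1 q = E q * E (q ^ 6) / (E (q ^ 2) * E (q ^ 3)).
Proof.
  intros Hq. assert (H := E_block6 q Hq). assert (H2 := tprod_6_2 q Hq). assert (H3 := aprod_3_6 q Hq).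
  unfold tprod in *. simpl Nat.sub in *.
  assert (E2 := E_pow_pos 2 q ltac:(lia) ltac:(lra)). assert (E3 := E_pow_pos 3 q ltac:(lia) ltac:(lra)).
  assert (E6 := E_pow_pos 6 q ltac:(lia) ltac:(lra)).
  replace (aprod 1 6 q * aprod 2 6 q * aprod 3 6 q * aprod 4 6 q * aprod 5 6 q * E (q ^ 6)) with
    ((aprod 1 6 q * aprod 5 6 q) * ((aprod 2 6 q * aprod 4 6 q) * aprod 3 6 q * E (q ^ 6))) in H by ring.
  rewrite H2, H3 in H. rewrite H. field. lra.
Qed.

Lemma cpow_neq_2 (q : R) (i : nat) : (1 <= i)%nat -> 0 < q < 1 -> cpow q i <> 2.
Proof.
  intros Hi Hq H. assert (Hqi := pow_lt_1 q i Hq Hi). unfold cpow in H.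
  assert (E0 : (q ^ i + / q ^ i) * q ^ i = 2 * q ^ i) by (rewrite H; ring).
  rewrite Rmult_plus_distr_r, Rinv_l in E0 by lra. nra.
Qed.

(** Two linear relations between the three eta quotients are solved. [R1] is the three-term identity
    at the points of order 6, 3, 2 and 1 on the unit circle, for nome [q]; [R2] is the same identity
    at [1, q, q^2, q^3], for nome [q^6]. *)
Lemma level6_hauptmoduln (q : R) : 0 < q < 1 ->
  let X := E q ^ 5 * E (q ^ 3) / (q * (E (q ^ 2) * E (q ^ 6) ^ 5)) in
  E (q ^ 2) ^ 8 * E (q ^ 3) ^ 4 / (q * (E q ^ 4 * E (q ^ 6) ^ 8)) = X + 9 /\
  E (q ^ 2) ^ 3 * E (q ^ 3) ^ 9 / (q * (E q ^ 3 * E (q ^ 6) ^ 9)) = X + 8.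
Proof.
  intros Hq X.
  assert (E1 := E_pos q Hq). assert (E2 := E_pow_pos 2 q ltac:(lia) ltac:(lra)).
  assert (E3 := E_pow_pos 3 q ltac:(lia) ltac:(lra)). assert (E6 := E_pow_pos 6 q ltac:(lia) ltac:(lra)).
  assert (R1 : 9 * (E (q ^ 3) ^ 4 / E q ^ 4) =
    8 * (E (q ^ 2) ^ 5 * E (q ^ 6) / (E q ^ 5 * E (q ^ 3))) +
    E q ^ 4 * E (q ^ 6) ^ 4 / (E (q ^ 2) ^ 4 * E (q ^ 3) ^ 4)).
  { assert (P := qdet_plucker q 1 (-1) (-2) 2 Hq). unfold qdet in P.
    rewrite !qprod_2, qprod_1_m1, qprod_1_m2, qprod_m1_m2 in P by auto.
    assert (G1 := gprod_1 q Hq). assert (Gm1 := gprod_m1 q Hq). assert (Gm2 := gprod_m2 q Hq).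
    replace (gprod q 1) with (E q * E (q ^ 6) / (E (q ^ 2) * E (q ^ 3))) in P by (rewrite <- G1; field; lra).
    replace (gprod q (-1)) with (E (q ^ 3) / E q) in P by (rewrite <- Gm1; field; lra).
    replace (gprod q (-2)) with (E (q ^ 2) ^ 2 / E q ^ 2) in P by (rewrite <- Gm2; field; lra).
    match type of P with ?x = 0 => transitivity (x + 8 * (E (q ^ 2) ^ 5 * E (q ^ 6) / (E q ^ 5 * E (q ^ 3))) +
    E q ^ 4 * E (q ^ 6) ^ 4 / (E (q ^ 2) ^ 4 * E (q ^ 3) ^ 4)) end.
    - field. lra.
    - rewrite P. ring. }
  assert (R2 : E (q ^ 2) ^ 4 / E (q ^ 6) ^ 4 = q * (E q ^ 4 * E (q ^ 6) ^ 4 / (E (q ^ 2) ^ 4 * E (q ^ 3) ^ 4)) +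
     E (q ^ 3) ^ 5 * E q / (E (q ^ 6) ^ 5 * E (q ^ 2))).
  { assert (Hq6 := pow_lt_1 q 6 Hq ltac:(lia)).
    assert (P := qdet_plucker (q ^ 6) 2 (cpow q 1) (cpow q 2) (cpow q 3) Hq6).
    rewrite !qdet_cpow_2, !qdet_cpow in P by (auto; lia). simpl Nat.add in P. simpl Nat.sub in P.
    replace (tprod 6 5 q) with (tprod 6 1 q) in P by (rewrite <- (tprod_sym 6 1) by lia; reflexivity).
    replace (tprod 6 4 q) with (tprod 6 2 q) in P by (rewrite <- (tprod_sym 6 2) by lia; reflexivity).
    rewrite (tprod_6_1 q), (tprod_6_2 q) in P by auto.
    replace (tprod 6 3 q) with ((E (q ^ 3) / E (q ^ 6)) ^ 2) in P.
    2: { unfold tprod. simpl Nat.sub. rewrite aprod_3_6 by auto. ring. }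
    match type of P with ?x = 0 => transitivity (- q ^ 5 * x + (q * (E q ^ 4 * E (q ^ 6) ^ 4 / (E (q ^ 2) ^ 4 * E (q ^ 3) ^ 4)) +
     E (q ^ 3) ^ 5 * E q / (E (q ^ 6) ^ 5 * E (q ^ 2)))) end.
    - field. lra.
    - rewrite P. ring. }
  set (Y3 := E (q ^ 2) ^ 8 * E (q ^ 3) ^ 4 / (q * (E q ^ 4 * E (q ^ 6) ^ 8))).
  set (Y4 := E (q ^ 2) ^ 3 * E (q ^ 3) ^ 9 / (q * (E q ^ 3 * E (q ^ 6) ^ 9))).
  assert (K1 : 9 * Y4 = 8 * Y3 + X).
  { transitivity (E (q ^ 2) ^ 3 * E (q ^ 3) ^ 5 * E q / (q * E (q ^ 6) ^ 9) * (9 * (E (q ^ 3) ^ 4 / E q ^ 4))).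
    - unfold Y4. field. lra.
    - rewrite R1. unfold Y3, X. field. lra. }
  assert (K2 : Y3 = 1 + Y4).
  { transitivity (E (q ^ 2) ^ 4 * E (q ^ 3) ^ 4 / (q * (E q ^ 4 * E (q ^ 6) ^ 4)) * (E (q ^ 2) ^ 4 / E (q ^ 6) ^ 4)).
    - unfold Y3. field. lra.
    - rewrite R2. unfold Y4. field. lra. }
  lra.
Qed.

Lemma dlog_ext_loc (f g : R -> R) (t l : R) : 0 < t < 1 -> (forall x, 0 < x < 1 -> f x = g x) ->
  is_dlog f t l -> is_dlog g t l.
Proof.
  unfold is_dlog. intros Ht H Hf. rewrite <- H by auto. apply is_derive_ext_loc with f; auto.
  assert (Hd : 0 < Rmin t (1 - t)) by (apply Rmin_pos; lra).
  enough (K : forall v : R, Rabs (v - t) < Rmin t (1 - t) -> f v = g v).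
  { exists (mkposreal _ Hd). intros v Hv. apply K, Hv. }
  intros v Hv. apply H. assert (H1 := Rmin_l t (1 - t)). assert (H2 := Rmin_r t (1 - t)).
  apply Rabs_lt_between in Hv. lra.
Qed.

(** The new function has reciprocal [1 / f - c]; this passes between Hauptmoduln whose reciprocals
    differ by a constant. *)
Lemma dlog_mobius (f : R -> R) (c t l : R) : 1 - c * f t <> 0 -> is_dlog f t l ->
  is_dlog (fun t => f t / (1 - c * f t)) t (l / (1 - c * f t)).
Proof.
  unfold is_dlog. intros Hn Hf. evar_last.
  - apply (is_derive_div f (fun t => 1 - c * f t) t (f t / t * l) (- c * (f t / t * l))); auto.
    evar_last.
    + apply (is_derive_minus (fun _ => 1) (fun t => c * f t) t 0); [apply @is_derive_const|].
      apply is_derive_scal, Hf.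
    + unfold minus, plus, opp; simpl. ring.
  - unfold Rdiv. generalize (/ t). intros u. simpl. field. auto.
Qed.

Lemma level6_dlog (t : R) : 0 < t < 1 ->
  is_dlog (fun t => t * (E t ^ 4 * E (t ^ 6) ^ 8 / (E (t ^ 2) ^ 8 * E (t ^ 3) ^ 4))) t
    (E t ^ 4 * E (t ^ 3) ^ 4 / (E (t ^ 2) ^ 2 * E (t ^ 6) ^ 2)).
Proof.
  intros Ht. rewrite level6_lambert by auto.
  replace (1 - 4 * lamb 1 t + 16 * lamb 2 t + 12 * lamb 3 t - 48 * lamb 6 t) with
    (1 + ((INR 4 * - lamb 1 t + INR 8 * (- INR 6 * lamb 6 t)) -
     (INR 8 * (- INR 2 * lamb 2 t) + INR 4 * (- INR 3 * lamb 3 t)))) by (simpl; ring).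
  assert (E2 := E_pow_pos 2 t ltac:(lia) ltac:(lra)). assert (E3 := E_pow_pos 3 t ltac:(lia) ltac:(lra)).
  apply dlog_mult; [apply dlog_id; lra|]. apply dlog_div.
  - apply Rgt_not_eq. apply Rmult_lt_0_compat; apply pow_lt; auto.
  - apply dlog_mult; [apply (dlog_pow E), dlog_E; auto|].
    apply (dlog_pow (fun t => E (t ^ 6))), dlog_E_pow; auto; lia.
  - apply dlog_mult.
    + apply (dlog_pow (fun t => E (t ^ 2))), dlog_E_pow; auto; lia.
    + apply (dlog_pow (fun t => E (t ^ 3))), dlog_E_pow; auto; lia.
Qed.

Lemma ex_deriveR_mult (f g : R -> R) (x : R) : ex_derive f x -> ex_derive g x ->
  ex_derive (fun t => f t * g t) x.
Proof. intros. apply ex_derive_mult; auto. Qed.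

Lemma ex_deriveR_div (f g : R -> R) (x : R) : ex_derive f x -> ex_derive g x -> g x <> 0 ->
  ex_derive (fun t => f t / g t) x.
Proof. intros. apply ex_derive_div; auto. Qed.

Lemma ex_deriveR_pow (f : R -> R) (n : nat) (x : R) : ex_derive f x -> ex_derive (fun t => f t ^ n) x.
Proof. intros. apply ex_derive_pow; auto. Qed.

Lemma ex_derive_E_comp (k : nat) (x : R) : (1 <= k)%nat -> 0 <= x < 1 -> ex_derive (fun t => E (t ^ k)) x.
Proof.
  intros Hk Hx. apply (ex_derive_comp E (fun t => t ^ k)); [apply ex_derive_E_pow; auto|].
  apply ex_derive_pow. apply @ex_derive_id.
Qed.

Ltac E_neq0 :=
  apply Rgt_not_eq; unfold Rgt;
  repeat lazymatch goal with
  | |- 0 < _ * _ => apply Rmult_lt_0_compat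
  | |- 0 < _ ^ _ => apply pow_lt
  | |- 0 < E (_ ^ _) => apply E_pow_pos; [lia|lra]
  | |- 0 < E _ => apply E_pos0; lra
  end.

Ltac E_ex_derive :=
  repeat lazymatch goal with
  | |- ex_derive (fun t => @?f t / @?g t) _ => apply (ex_deriveR_div f g); [| |E_neq0]
  | |- ex_derive (fun t => @?f t * @?g t) _ => apply (ex_deriveR_mult f g)
  | |- ex_derive (fun t => (@?f t) ^ ?n) _ => apply (ex_deriveR_pow f n)
  | |- ex_derive (fun t => E (t ^ ?k)) _ => apply (ex_derive_E_comp k); [lia|lra]
  | |- ex_derive (fun t => E t) _ => apply ex_derive_E; lra
  | |- ex_derive E _ => apply ex_derive_E; lra
  end.

Ltac E_at_0 := rewrite !pow_i, E_0 by lia; field.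

Lemma integral_level6_b (q : R) : 0 < q < 1 ->
  is_RInt (fun t => E t ^ 8 * E (t ^ 6) ^ 6 / E (t ^ 2) ^ 10) 0 q
    (q * (E q ^ 4 * E (q ^ 6) ^ 8) / (E (q ^ 2) ^ 8 * E (q ^ 3) ^ 4)).
Proof.
  intros Hq.
  replace (q * (E q ^ 4 * E (q ^ 6) ^ 8) / (E (q ^ 2) ^ 8 * E (q ^ 3) ^ 4)) with
    (q * (E q ^ 4 * E (q ^ 6) ^ 8 / (E (q ^ 2) ^ 8 * E (q ^ 3) ^ 4))) by (unfold Rdiv; ring).
  apply (is_RInt_dlog (fun t => E t ^ 4 * E (t ^ 6) ^ 8 / (E (t ^ 2) ^ 8 * E (t ^ 3) ^ 4)) _
    (fun t => E t ^ 4 * E (t ^ 3) ^ 4 / (E (t ^ 2) ^ 2 * E (t ^ 6) ^ 2))); auto.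
  - intros t Ht. E_ex_derive.
  - intros t Ht. E_ex_derive.
  - E_at_0.
  - intros t Ht. split; [apply level6_dlog; auto|].
    assert (E2 := E_pow_pos 2 t ltac:(lia) ltac:(lra)). assert (E3 := E_pow_pos 3 t ltac:(lia) ltac:(lra)).
    assert (E6 := E_pow_pos 6 t ltac:(lia) ltac:(lra)). field. lra.
Qed.

(** [1/(y^{-1} - c)] for the Hauptmodul [y] of [level6_dlog]. *)
Lemma level6_shift_dlog (X : R -> R) (c t : R) : 0 < t < 1 ->
  (forall x, 0 < x < 1 -> 0 < X x /\
     E (x ^ 2) ^ 8 * E (x ^ 3) ^ 4 / (x * (E x ^ 4 * E (x ^ 6) ^ 8)) = X x + c) ->
  is_dlog (fun x => / X x) t (E (t ^ 2) ^ 6 * E (t ^ 3) ^ 8 / (t * E (t ^ 6) ^ 10) / X t).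
Proof.
  intros Ht H.
  set (y := fun t => t * (E t ^ 4 * E (t ^ 6) ^ 8 / (E (t ^ 2) ^ 8 * E (t ^ 3) ^ 4))).
  assert (Pos : forall x, 0 < x < 1 -> 0 < E x /\ 0 < E (x ^ 2) /\ 0 < E (x ^ 3) /\ 0 < E (x ^ 6)).
  { intros x Hx. repeat split; [apply E_pos; auto|apply E_pow_pos|apply E_pow_pos|apply E_pow_pos]; lia || lra. }
  assert (Hy : forall x, 0 < x < 1 -> y x = / (X x + c) /\ X x + c <> 0).
  { intros x Hx. destruct (Pos x Hx) as (E1 & E2 & E3 & E6). destruct (H x Hx) as (Xp & HX).
    rewrite <- HX. split; [unfold y; field; lra|]. apply Rgt_not_eq.
    apply Rdiv_lt_0_compat; repeat apply Rmult_lt_0_compat; try apply pow_lt; auto; lra. }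
  assert (D : is_dlog y t (E t ^ 4 * E (t ^ 3) ^ 4 / (E (t ^ 2) ^ 2 * E (t ^ 6) ^ 2)))
    by (apply level6_dlog; auto).
  assert (H1 : forall x, 0 < x < 1 -> 1 - c * y x = X x / (X x + c)).
  { intros x Hx. destruct (Hy x Hx) as (-> & Hn). field. auto. }
  destruct (Hy t Ht) as (_ & Hn). destruct (H t Ht) as (Xp & HX).
  assert (D2 := fun Hne => dlog_mobius y c t _ Hne D).
  replace (E (t ^ 2) ^ 6 * E (t ^ 3) ^ 8 / (t * E (t ^ 6) ^ 10) / X t) with
    (E t ^ 4 * E (t ^ 3) ^ 4 / (E (t ^ 2) ^ 2 * E (t ^ 6) ^ 2) / (1 - c * y t)).
  - eapply dlog_ext_loc; [exact Ht| |apply D2].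
    + intros x Hx. cbv beta. destruct (Hy x Hx) as (Ey & Hnx). rewrite H1, Ey by auto.
      destruct (H x Hx) as (Xxp & _). field. lra.
    + rewrite H1 by auto. apply Rmult_integral_contrapositive_currified; [lra|].
      apply Rinv_neq_0_compat. auto.
  - rewrite H1, <- HX by auto. destruct (Pos t Ht) as (E1 & E2 & E3 & E6). field. lra.
Qed.

Lemma E_pos_1236 (x : R) : 0 < x < 1 -> 0 < E x /\ 0 < E (x ^ 2) /\ 0 < E (x ^ 3) /\ 0 < E (x ^ 6).
Proof.
  intros Hx. repeat split; [apply E_pos; auto|apply E_pow_pos|apply E_pow_pos|apply E_pow_pos]; lia || lra.
Qed.

Lemma integral_level6_a (q : R) : 0 < q < 1 ->
  is_RInt (fun t => E (t ^ 2) ^ 8 * E (t ^ 3) ^ 6 / E t ^ 10) 0 q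
    (q * (E (q ^ 2) * E (q ^ 6) ^ 5) / (E q ^ 5 * E (q ^ 3))).
Proof.
  intros Hq.
  replace (q * (E (q ^ 2) * E (q ^ 6) ^ 5) / (E q ^ 5 * E (q ^ 3))) with
    (q * (E (q ^ 2) * E (q ^ 6) ^ 5 / (E q ^ 5 * E (q ^ 3)))) by (unfold Rdiv; ring).
  apply (is_RInt_dlog (fun t => E (t ^ 2) * E (t ^ 6) ^ 5 / (E t ^ 5 * E (t ^ 3))) _
    (fun t => E (t ^ 2) ^ 7 * E (t ^ 3) ^ 7 / (E t ^ 5 * E (t ^ 6) ^ 5))); auto.
  - intros t Ht. E_ex_derive.
  - intros t Ht. E_ex_derive.
  - E_at_0.
  - intros t Ht. destruct (E_pos_1236 t Ht) as (E1 & E2 & E3 & E6). split; [|field; lra].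
    set (X := fun t => E t ^ 5 * E (t ^ 3) / (t * (E (t ^ 2) * E (t ^ 6) ^ 5))).
    replace (E (t ^ 2) ^ 7 * E (t ^ 3) ^ 7 / (E t ^ 5 * E (t ^ 6) ^ 5)) with
      (E (t ^ 2) ^ 6 * E (t ^ 3) ^ 8 / (t * E (t ^ 6) ^ 10) / X t) by (unfold X; field; lra).
    (* The reciprocal of the function in [level6_dlog] is [X + 9] by [level6_hauptmoduln]. *)
    eapply dlog_ext_loc; [exact Ht| |apply (level6_shift_dlog X 9 t Ht)].
    + intros x Hx. destruct (E_pos_1236 x Hx) as (F1 & F2 & F3 & F6). unfold X. field. lra.
    + intros x Hx. destruct (E_pos_1236 x Hx) as (F1 & F2 & F3 & F6). split.
      * apply Rdiv_lt_0_compat; repeat apply Rmult_lt_0_compat; try apply pow_lt; auto; lra.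
      * apply level6_hauptmoduln; auto.
Qed.

Lemma integral_level6_c (q : R) : 0 < q < 1 ->
  is_RInt (fun t => E t ^ 6 * E (t ^ 6) ^ 8 / E (t ^ 3) ^ 10) 0 q
    (q * (E q ^ 3 * E (q ^ 6) ^ 9) / (E (q ^ 2) ^ 3 * E (q ^ 3) ^ 9)).
Proof.
  intros Hq.
  replace (q * (E q ^ 3 * E (q ^ 6) ^ 9) / (E (q ^ 2) ^ 3 * E (q ^ 3) ^ 9)) with
    (q * (E q ^ 3 * E (q ^ 6) ^ 9 / (E (q ^ 2) ^ 3 * E (q ^ 3) ^ 9))) by (unfold Rdiv; ring).
  apply (is_RInt_dlog (fun t => E t ^ 3 * E (t ^ 6) ^ 9 / (E (t ^ 2) ^ 3 * E (t ^ 3) ^ 9)) _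
    (fun t => E t ^ 3 * E (t ^ 2) ^ 3 / (E (t ^ 3) * E (t ^ 6)))); auto.
  - intros t Ht. E_ex_derive.
  - intros t Ht. E_ex_derive.
  - E_at_0.
  - intros t Ht. destruct (E_pos_1236 t Ht) as (E1 & E2 & E3 & E6). split; [|field; lra].
    set (X := fun t => E (t ^ 2) ^ 3 * E (t ^ 3) ^ 9 / (t * (E t ^ 3 * E (t ^ 6) ^ 9))).
    replace (E t ^ 3 * E (t ^ 2) ^ 3 / (E (t ^ 3) * E (t ^ 6))) with
      (E (t ^ 2) ^ 6 * E (t ^ 3) ^ 8 / (t * E (t ^ 6) ^ 10) / X t) by (unfold X; field; lra).
    (* Here the shift is [9 - 8 = 1], the difference of the two constants in
       [level6_hauptmoduln]. *)
    eapply dlog_ext_loc; [exact Ht| |apply (level6_shift_dlog X 1 t Ht)].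
    + intros x Hx. destruct (E_pos_1236 x Hx) as (F1 & F2 & F3 & F6). unfold X. field. lra.
    + intros x Hx. destruct (E_pos_1236 x Hx) as (F1 & F2 & F3 & F6). split.
      * apply Rdiv_lt_0_compat; repeat apply Rmult_lt_0_compat; try apply pow_lt; auto; lra.
      * destruct (level6_hauptmoduln x Hx) as (H1 & H2). unfold X. rewrite H1, H2. ring.
Qed.

(** * Lambert sums over residue classes and the Weierstrass function at powers of the nome *)

Lemma egeo_phi (q : R) : 0 < q < 1 -> egeo (fun n => phi (q ^ n)).
Proof.
  intros Hq. apply egeo_ext1 with (fun n => q ^ n * / (1 - q ^ n) ^ 2); [intros; reflexivity|].
  apply egeo_mult_bounded; [apply egeo_geom01, Hq|]. apply bounded_inv.
  - apply (egeo_prod_pow (fun n => 1 - q ^ n)), egeo_1mpow, Hq.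
  - intros n Hn. apply pow_nonzero. assert (H := pow_lt_1 q n Hq Hn). lra.
Qed.

Definition phi_res (k a : nat) (q : R) : R := Series (fun n => phi (q ^ (k * n + a))).

Lemma egeo_phi_res (k a : nat) (q : R) : (1 <= k)%nat -> (1 <= a)%nat -> 0 < q < 1 ->
  egeo (fun n => phi (q ^ (k * n + a))).
Proof.
  intros Hk Ha Hq. destruct (egeo_pos _ (egeo_phi q Hq)) as (M & r & HM & Hr & H).
  exists M, r. repeat split; try lra. intros n. apply Rle_trans with (1 := H _).
  apply Rmult_le_compat_l; [lra|]. apply pow_anti; [lra|nia].
Qed.

Lemma lamb_phi (k : nat) (q : R) : (1 <= k)%nat -> lamb k q = phi_res k k q.
Proof.
  intros Hk. apply Series_ext. intros n. rewrite <- pow_mult. do 2 f_equal. lia.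
Qed.

Lemma lamb_pow (k m : nat) (q : R) : lamb k (q ^ m) = lamb (m * k) q.
Proof. apply Series_ext. intros n. rewrite <- !pow_mult. do 2 f_equal. lia. Qed.

Lemma lamb_split2 (q : R) : 0 < q < 1 -> lamb 1 q = phi_res 2 1 q + lamb 2 q.
Proof.
  intros Hq. rewrite (lamb_phi 2) by lia. unfold phi_res.
  rewrite <- Series_plus by (apply egeo_ex_series, egeo_phi_res; auto; lia).
  symmetry. apply is_series_unique.
  assert (H : is_lim_seq (sum_n (fun m => phi ((q ^ S m) ^ 1))) (lamb 1 q))
    by (apply (is_series_lamb 1 q); auto).
  apply (is_lim_seq_subseq _ _ (fun n => (2 * n + 1)%nat)) in H;
    [|apply eventually_subseq; intros; lia].
  revert H. apply is_lim_seq_ext. intros n. induction n.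
  - simpl. rewrite sum_Sn, !sum_O. unfold plus; simpl. rewrite !Rmult_1_r. reflexivity.
  - replace (2 * S n + 1)%nat with (S (S (2 * n + 1))) by lia.
    rewrite !sum_Sn, IHn. unfold plus; simpl (AbelianMonoid.plus _ _). rewrite Rplus_assoc.
    rewrite !pow_1. repeat f_equal; lia.
Qed.

Lemma lamb_split3 (q : R) : 0 < q < 1 -> lamb 1 q = phi_res 3 1 q + phi_res 3 2 q + lamb 3 q.
Proof.
  intros Hq. rewrite (lamb_phi 3) by lia. unfold phi_res.
  assert (X : forall a, (1 <= a)%nat -> ex_series (fun n => phi (q ^ (3 * n + a)))).
  { intros a Ha. apply egeo_ex_series, egeo_phi_res; auto; lia. }
  assert (X12 : ex_series (fun n => phi (q ^ (3 * n + 1)) + phi (q ^ (3 * n + 2)))).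
  { apply (ex_series_plus (V := R_NormedModule)); apply X; lia. }
  rewrite <- (Series_plus _ _ (X 1%nat ltac:(lia)) (X 2%nat ltac:(lia))).
  rewrite <- (Series_plus _ _ X12 (X 3%nat ltac:(lia))).
  symmetry. apply is_series_unique.
  assert (H : is_lim_seq (sum_n (fun m => phi ((q ^ S m) ^ 1))) (lamb 1 q))
    by (apply (is_series_lamb 1 q); auto).
  apply (is_lim_seq_subseq _ _ (fun n => (3 * n + 2)%nat)) in H;
    [|apply eventually_subseq; intros; lia].
  revert H. apply is_lim_seq_ext. intros n. induction n.
  - simpl. rewrite !sum_Sn, !sum_O. unfold plus; simpl. rewrite !Rmult_1_r. reflexivity.
  - replace (3 * S n + 2)%nat with (S (S (S (3 * n + 2)))) by lia.
    rewrite !sum_Sn, IHn. unfold plus; simpl (AbelianMonoid.plus _ _). rewrite !Rplus_assoc.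
    rewrite !pow_1. repeat f_equal; lia.
Qed.

Lemma quad1_cpow (q : R) (k i n : nat) : (1 <= i < k)%nat -> (1 <= n)%nat -> 0 < q < 1 ->
  quad1 (q ^ k) (cpow q i) n = (1 - q ^ (k * n + i)) * (1 - q ^ (k * n - i)) /\
  0 < q ^ (k * n + i) < 1 /\ 0 < q ^ (k * n - i) < 1.
Proof.
  intros Hi Hn Hq. assert (H1 : (i < k * n)%nat) by nia. split; [|split; apply pow_lt_1; auto; lia].
  unfold quad1, cpow. rewrite <- pow_mult, pow_add.
  replace (q ^ (k * n)) with (q ^ (k * n - i) * q ^ i) by (rewrite <- pow_add; f_equal; lia).
  field. apply pow_nonzero. lra.
Qed.

Lemma quad1_cpow_neq0 (q : R) (k i : nat) : (1 <= i < k)%nat -> 0 < q < 1 ->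
  forall n, (1 <= n)%nat -> quad1 (q ^ k) (cpow q i) n <> 0.
Proof.
  intros Hi Hq n Hn. destruct (quad1_cpow q k i n Hi Hn Hq) as (-> & H1 & H2).
  apply Rmult_integral_contrapositive_currified; lra.
Qed.

Lemma cpow_m2 (q : R) (i : nat) : 0 < q < 1 -> cpow q i - 2 = (1 - q ^ i) ^ 2 / q ^ i.
Proof. intros Hq. assert (0 < q ^ i) by (apply pow_lt; lra). unfold cpow. field. lra. Qed.

(** At [x = q^i] and nome [q^k] the terms in [xQ] and [Q/x] have exponents [k n + i] and [k n - i];
    the isolated term [/ (cpow q i - 2) = phi (q ^ i)] is the missing [n = 0] of the first class. *)
Lemma wp_cpow (q : R) (k i : nat) : (1 <= i < k)%nat -> 0 < q < 1 ->
  wp (q ^ k) (cpow q i) = phi_res k i q + phi_res k (k - i) q.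
Proof.
  intros Hi Hq. unfold wp, phi_res.
  assert (Hqi := pow_lt_1 q i Hq ltac:(lia)).
  rewrite (Series_incr_1 (fun n => phi (q ^ (k * n + i)))).
  2: { apply egeo_ex_series, egeo_phi_res; auto; lia. }
  rewrite Nat.mul_0_r. simpl (0 + i)%nat.
  replace (/ (cpow q i - 2)) with (phi (q ^ i)).
  2: { rewrite cpow_m2 by auto. unfold phi. field. lra. }
  replace (Series (fun n => dquad (q ^ k) (cpow q i) 2 (S n))) with
    (- (Series (fun n => phi (q ^ (k * S n + i))) + Series (fun n => phi (q ^ (k * n + (k - i)))))); [ring|].
  rewrite <- Series_plus.
  - rewrite <- Series_opp. apply Series_ext. intros n.
    unfold dquad. rewrite quad_2.
    destruct (quad1_cpow q k i (S n) Hi ltac:(lia) Hq) as (-> & H1 & H2).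
    replace (k * n + (k - i))%nat with (k * S n - i)%nat by lia.
    unfold phi, cpow. rewrite <- (pow_mult q k (S n)).
    replace (q ^ (k * S n)) with (q ^ (k * S n - i) * q ^ i) by (rewrite <- pow_add; f_equal; lia).
    replace (q ^ (k * S n + i)) with (q ^ (k * S n - i) * q ^ i * q ^ i) in *
      by (rewrite <- !pow_add; f_equal; lia).
    field. lra.
  - apply egeo_ex_series, (egeo_shift (fun n => phi (q ^ (k * n + i)))), egeo_phi_res; auto; lia.
  - apply egeo_ex_series, egeo_phi_res; auto; lia.
Qed.

Lemma aprod_1_2 (q : R) : 0 < q < 1 -> aprod 1 2 q = E q / E (q ^ 2).
Proof.
  intros Hq. rewrite (E_block2 q) by auto. assert (E2 := E_pow_pos 2 q ltac:(lia) ltac:(lra)). field. lra.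
Qed.

Lemma tprod_3_1 (q : R) : 0 < q < 1 -> tprod 3 1 q = E q / E (q ^ 3).
Proof.
  intros Hq. rewrite (E_block3 q) by auto. assert (E3 := E_pow_pos 3 q ltac:(lia) ltac:(lra)).
  unfold tprod. simpl Nat.sub. field. lra.
Qed.

(** * Levels 8 and 9 *)

(** A quarter period against the half period on the curve of nome [q^2]. *)
Lemma level8_lambert (q : R) : 0 < q < 1 ->
  E (q ^ 2) ^ 6 * E (q ^ 4) ^ 6 / (E q ^ 4 * E (q ^ 8) ^ 4) =
  1 + 4 * lamb 1 q - 4 * lamb 2 q + 8 * lamb 4 q - 32 * lamb 8 q.
Proof.
  intros Hq. assert (Hq2 := pow_lt_1 q 2 Hq ltac:(lia)). assert (Hq4 := pow_lt_1 q 4 Hq ltac:(lia)).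
  assert (Hq8 := pow_lt_1 q 8 Hq ltac:(lia)).
  assert (N1 : forall n, (1 <= n)%nat -> quad1 (q ^ 2) 0 n <> 0).
  { intros. apply quad1_pos; auto. rewrite Rabs_R0; lra. }
  assert (W := wp_difference (q ^ 2) 0 (cpow q 1) Hq2 ltac:(lra) (cpow_neq_2 q 1 ltac:(lia) Hq) N1
    (quad1_cpow_neq0 q 2 1 ltac:(lia) Hq)).
  rewrite wp_cpow in W by (auto; lia). unfold wp in W.
  assert (S1 : Series (fun n => dquad (q ^ 2) 0 2 (S n)) = 4 * lamb 2 (q ^ 2) + - 16 * lamb 4 (q ^ 2)).
  { eapply Series_eq; [series_lin; apply is_series_lamb; auto; lia|]. intros n. cbv beta. symmetry. unfold dquad. rewrite quad_2.
    apply phi_0. apply pow_lt_1; auto; lia. }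
  rewrite S1, !lamb_pow, gprod_cpow in W by (auto; lia). simpl Nat.mul in W. simpl Nat.sub in W.
  assert (L := lamb_split2 q Hq).
  assert (E1 := E_pos q Hq). assert (E2 := E_pow_pos 2 q ltac:(lia) ltac:(lra)).
  assert (E4 := E_pow_pos 4 q ltac:(lia) ltac:(lra)). assert (E8 := E_pow_pos 8 q ltac:(lia) ltac:(lra)).
  assert (A24 : aprod 2 4 q = E (q ^ 2) / E (q ^ 4)).
  { rewrite (aprod_scale 1 2 2), aprod_1_2, <- pow_mult by auto. reflexivity. }
  assert (A48 : aprod 4 8 q = E (q ^ 4) / E (q ^ 8)).
  { rewrite (aprod_scale 1 2 4), aprod_1_2, <- pow_mult by auto. reflexivity. }
  (* At [x = i], [y = q] the quadruple factor is [(1 + q^2 Q^2)(1 + Q^2/q^2)]; multiplying by the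
     same factors with minus signs leaves only products in [Q^4]. *)
  assert (Qp : qprod (q ^ 2) 0 (cpow q 1) * (aprod 2 4 q / (1 - q ^ 2) * aprod (4 - 2) 4 q) =
    aprod 4 8 q / (1 - q ^ 4) * aprod (8 - 4) 8 q).
  { eapply has_prod_unique.
    - apply has_prod_mult; [apply has_prod_qprod; auto|].
      apply has_prod_mult; [apply aprod_up|apply aprod_down]; auto; lia.
    - apply has_prod_mult; [apply aprod_up|apply aprod_down]; auto; lia.
    - intros n _. cbv beta. unfold quad, cpow.
      replace ((q ^ 4) ^ n) with (((q ^ 2) ^ n) ^ 2) by (rewrite <- !pow_mult; f_equal; lia).
      replace ((q ^ 8) ^ n) with (((q ^ 2) ^ n) ^ 4) by (rewrite <- !pow_mult; f_equal; lia).
      field. lra. }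
  simpl Nat.sub in Qp. rewrite A24, A48 in Qp.
  assert (Qv : qprod (q ^ 2) 0 (cpow q 1) = E (q ^ 4) ^ 4 / (E (q ^ 2) ^ 2 * E (q ^ 8) ^ 2) / (1 + q ^ 2)).
  { apply Rmult_eq_reg_r with (E (q ^ 2) / E (q ^ 4) / (1 - q ^ 2) * (E (q ^ 2) / E (q ^ 4))).
    - rewrite Qp. replace (1 - q ^ 4) with ((1 - q ^ 2) * (1 + q ^ 2)) by ring. field. lra.
    - apply Rmult_integral_contrapositive_currified.
      + repeat apply Rmult_integral_contrapositive_currified; try apply Rinv_neq_0_compat; lra.
      + apply Rmult_integral_contrapositive_currified; try apply Rinv_neq_0_compat; lra. }
  assert (G0 := gprod_0 (q ^ 2) Hq2). rewrite <- !pow_mult in G0. simpl Nat.mul in G0.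
  replace (gprod (q ^ 2) 0) with (E (q ^ 8) / E (q ^ 4)) in W by (rewrite <- G0; field; lra).
  rewrite Qv in W. unfold tprod in W. simpl Nat.sub in W. rewrite aprod_1_2 in W by auto.
  transitivity (2 * (phi_res 2 1 q + phi_res 2 1 q - (/ (0 - 2) - (4 * lamb 4 q + - 16 * lamb 8 q)))).
  2: { rewrite L. field. }
  rewrite <- W. rewrite cpow_m2, pow_1 by auto. unfold cpow. rewrite pow_1. field. assert (0 < q ^ 2) by (apply pow_lt; lra). lra.
Qed.

(** A third period against the third of the imaginary period on the curve of nome [q^3]. *)
Lemma level9_lambert (q : R) : 0 < q < 1 ->
  E (q ^ 3) ^ 10 / (E q ^ 3 * E (q ^ 9) ^ 3) = 1 + 3 * lamb 1 q - 27 * lamb 9 q.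
Proof.
  intros Hq. assert (Hq3 := pow_lt_1 q 3 Hq ltac:(lia)). assert (Hq9 := pow_lt_1 q 9 Hq ltac:(lia)).
  assert (N1 : forall n, (1 <= n)%nat -> quad1 (q ^ 3) (-1) n <> 0).
  { intros. apply quad1_pos; auto. rewrite Rabs_left; lra. }
  assert (W := wp_difference (q ^ 3) (-1) (cpow q 1) Hq3 ltac:(lra) (cpow_neq_2 q 1 ltac:(lia) Hq) N1
    (quad1_cpow_neq0 q 3 1 ltac:(lia) Hq)).
  rewrite wp_cpow in W by (auto; lia). unfold wp in W.
  assert (S1 : Series (fun n => dquad (q ^ 3) (-1) 2 (S n)) = lamb 1 (q ^ 3) + - 9 * lamb 3 (q ^ 3)).
  { eapply Series_eq; [series_lin; apply is_series_lamb; auto; lia|]. intros n. cbv beta. symmetry. unfold dquad. rewrite quad_2.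
    apply phi_m1. apply pow_lt_1; auto; lia. }
  rewrite S1, !lamb_pow, gprod_cpow in W by (auto; lia). simpl Nat.mul in W. simpl Nat.sub in W.
  assert (L := lamb_split3 q Hq).
  assert (E1 := E_pos q Hq). assert (E3 := E_pow_pos 3 q ltac:(lia) ltac:(lra)).
  assert (E9 := E_pow_pos 9 q ltac:(lia) ltac:(lra)).
  assert (T93 : tprod 9 3 q = E (q ^ 3) / E (q ^ 9)).
  { unfold tprod. simpl Nat.sub. rewrite (aprod_scale 1 3 3), (aprod_scale 2 3 3).
    change (tprod 3 1 (q ^ 3) = E (q ^ 3) / E (q ^ 9)). rewrite tprod_3_1, <- pow_mult by auto. reflexivity. }
  (* With [x] a cube root of unity and [y = q], the factors [(1 - qQ)(1 - Q/q)] complete the product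
     over all three cube roots, giving [(1 - q^3 Q^3)(1 - Q^3/q^3)]. *)
  assert (Qp : qprod (q ^ 3) (-1) (cpow q 1) * (tprod 3 1 q / (1 - q ^ 1)) = tprod 9 3 q / (1 - q ^ 3)).
  { eapply has_prod_unique.
    - apply has_prod_mult; [apply has_prod_qprod; auto|]. apply has_prod_tprod; auto; lia.
    - apply has_prod_tprod; auto; lia.
    - intros n _. cbv beta. unfold quad, cpow.
      replace ((q ^ 9) ^ n) with (((q ^ 3) ^ n) ^ 3) by (rewrite <- !pow_mult; f_equal; lia).
      field. lra. }
  rewrite T93, tprod_3_1 in Qp by auto.
  assert (Qv : qprod (q ^ 3) (-1) (cpow q 1) = E (q ^ 3) ^ 2 / (E q * E (q ^ 9)) / (1 + q + q ^ 2)).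
  { apply Rmult_eq_reg_r with (E q / E (q ^ 3) / (1 - q ^ 1)).
    - rewrite Qp. replace (1 - q ^ 3) with ((1 - q ^ 1) * (1 + q + q ^ 2)) by ring.
      rewrite pow_1. field. assert (0 < q ^ 2) by (apply pow_lt; lra). lra.
    - rewrite pow_1. repeat apply Rmult_integral_contrapositive_currified; try apply Rinv_neq_0_compat; lra. }
  assert (G0 := gprod_m1 (q ^ 3) Hq3). rewrite <- !pow_mult in G0. simpl Nat.mul in G0.
  replace (gprod (q ^ 3) (-1)) with (E (q ^ 9) / E (q ^ 3)) in W by (rewrite <- G0; field; lra).
  rewrite Qv, tprod_3_1 in W by auto.
  transitivity (3 * (phi_res 3 1 q + phi_res 3 2 q - (/ (-1 - 2) - (lamb 3 q + - 9 * lamb 9 q)))).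
  2: { rewrite L. field. }
  rewrite <- W. rewrite cpow_m2, pow_1 by auto. unfold cpow. rewrite pow_1. field. assert (0 < q ^ 2) by (apply pow_lt; lra). lra.
Qed.

Lemma integral_level8 (q : R) : 0 < q < 1 ->
  is_RInt (fun t => E (t ^ 2) ^ 8 * E (t ^ 4) ^ 4 / E t ^ 8) 0 q
    (q * (E (q ^ 2) ^ 2 * E (q ^ 8) ^ 4) / (E q ^ 4 * E (q ^ 4) ^ 2)).
Proof.
  intros Hq.
  replace (q * (E (q ^ 2) ^ 2 * E (q ^ 8) ^ 4) / (E q ^ 4 * E (q ^ 4) ^ 2)) with
    (q * (E (q ^ 2) ^ 2 * E (q ^ 8) ^ 4 / (E q ^ 4 * E (q ^ 4) ^ 2))) by (unfold Rdiv; ring).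
  apply (is_RInt_dlog (fun t => E (t ^ 2) ^ 2 * E (t ^ 8) ^ 4 / (E t ^ 4 * E (t ^ 4) ^ 2)) _
    (fun t => E (t ^ 2) ^ 6 * E (t ^ 4) ^ 6 / (E t ^ 4 * E (t ^ 8) ^ 4))); auto.
  - intros t Ht. E_ex_derive.
  - intros t Ht. E_ex_derive.
  - E_at_0.
  - intros t Ht. assert (E1 := E_pos t Ht). assert (E4 := E_pow_pos 4 t ltac:(lia) ltac:(lra)).
    assert (E8 := E_pow_pos 8 t ltac:(lia) ltac:(lra)). split; [|field; lra].
    rewrite level8_lambert by auto.
    replace (1 + 4 * lamb 1 t - 4 * lamb 2 t + 8 * lamb 4 t - 32 * lamb 8 t) with
      (1 + ((INR 2 * (- INR 2 * lamb 2 t) + INR 4 * (- INR 8 * lamb 8 t)) -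
       (INR 4 * - lamb 1 t + INR 2 * (- INR 4 * lamb 4 t)))) by (simpl; ring).
    apply dlog_mult; [apply dlog_id; lra|]. apply dlog_div; [E_neq0| |].
    + apply dlog_mult.
      * apply (dlog_pow (fun t => E (t ^ 2))), dlog_E_pow; auto; lia.
      * apply (dlog_pow (fun t => E (t ^ 8))), dlog_E_pow; auto; lia.
    + apply dlog_mult; [apply (dlog_pow E), dlog_E; auto|].
      apply (dlog_pow (fun t => E (t ^ 4))), dlog_E_pow; auto; lia.
Qed.

Lemma integral_level9 (q : R) : 0 < q < 1 ->
  is_RInt (fun t => E (t ^ 3) ^ 10 / E t ^ 6) 0 q (q * E (q ^ 9) ^ 3 / E q ^ 3).
Proof.
  intros Hq.
  replace (q * E (q ^ 9) ^ 3 / E q ^ 3) with (q * (E (q ^ 9) ^ 3 / E q ^ 3)) by (unfold Rdiv; ring).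
  apply (is_RInt_dlog (fun t => E (t ^ 9) ^ 3 / E t ^ 3) _
    (fun t => E (t ^ 3) ^ 10 / (E t ^ 3 * E (t ^ 9) ^ 3))); auto.
  - intros t Ht. E_ex_derive.
  - intros t Ht. E_ex_derive.
  - E_at_0.
  - intros t Ht. assert (E1 := E_pos t Ht). assert (E9 := E_pow_pos 9 t ltac:(lia) ltac:(lra)).
    split; [|field; lra].
    rewrite level9_lambert by auto.
    replace (1 + 3 * lamb 1 t - 27 * lamb 9 t) with
      (1 + (INR 3 * (- INR 9 * lamb 9 t) - INR 3 * - lamb 1 t)) by (simpl; ring).
    apply dlog_mult; [apply dlog_id; lra|]. apply dlog_div; [E_neq0| |].
    + apply (dlog_pow (fun t => E (t ^ 9))), dlog_E_pow; auto; lia.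
    + apply (dlog_pow E), dlog_E; auto.
Qed.

(** * Level 5 *)

(** The two roots of [x^2 + x - 1], i.e. [2 cos (2 PI / 5)] and [2 cos (4 PI / 5)]. *)
Definition conj5 (c d : R) : Prop := c + d = -1 /\ c * d = -1.

Lemma conj5_sym (c d : R) : conj5 c d -> conj5 d c.
Proof. unfold conj5. intros (H1 & H2). split; lra. Qed.

Lemma conj5_sqrt5 : conj5 ((sqrt 5 - 1) / 2) (- (sqrt 5 + 1) / 2).
Proof. assert (H := sqrt_sqrt 5 ltac:(lra)). split; nra. Qed.

Lemma conj5_bound (c d : R) : conj5 c d -> Rabs c < 2 /\ d = -1 - c /\ c ^ 2 = 1 - c /\ d <> c.
Proof.
  unfold conj5. intros (H1 & H2). assert (Hd : d = -1 - c) by lra. subst d.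
  repeat split; [|nra|]. 
  - apply Rabs_lt_between. nra.
  - intros H. assert (c = - 1 / 2) by lra. subst c. lra.
Qed.

(** Let [x] be the fifth root of unity with parameter [c], and [y = x^2], which has parameter [d].
    Then [xy] and [y/x] run through both conjugate pairs, while on the diagonal [x * x = y] and
    [x / x = 1]. *)
Lemma quad_conj5 (q c d : R) (n : nat) : conj5 c d ->
  quad q c d n = 1 + q ^ n + (q ^ n) ^ 2 + (q ^ n) ^ 3 + (q ^ n) ^ 4 /\
  quad q c d n = quad1 q c n * quad1 q d n /\
  quad q c c n = (1 - q ^ n) ^ 2 * quad1 q d n.
Proof.
  intros H. destruct (conj5_bound c d H) as (_ & -> & Hc & _). unfold quad, quad1.
  set (Q := q ^ n).
  repeat split.
  - replace ((1 + Q ^ 2) ^ 2 - (1 + Q ^ 2) * Q * c * (-1 - c) + Q ^ 2 * (c ^ 2 + (-1 - c) ^ 2 - 4)) with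
      ((1 + Q ^ 2) ^ 2 + (1 + Q ^ 2) * Q * (c + c ^ 2) + Q ^ 2 * (2 * (c + c ^ 2) - 3)) by ring.
    rewrite Hc. ring.
  - replace ((1 + Q ^ 2) ^ 2 - (1 + Q ^ 2) * Q * c * (-1 - c) + Q ^ 2 * (c ^ 2 + (-1 - c) ^ 2 - 4)) with
      ((1 + Q ^ 2) ^ 2 + (1 + Q ^ 2) * Q * (c + c ^ 2) + Q ^ 2 * (2 * (c + c ^ 2) - 3)) by ring.
    replace ((1 - c * Q + Q ^ 2) * (1 - (-1 - c) * Q + Q ^ 2)) with
      ((1 + Q ^ 2) ^ 2 + (1 + Q ^ 2) * Q - Q ^ 2 * (c + c ^ 2)) by ring.
    rewrite Hc. ring.
  - replace ((1 + Q ^ 2) ^ 2 - (1 + Q ^ 2) * Q * c * c + Q ^ 2 * (c ^ 2 + c ^ 2 - 4)) with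
      ((1 + Q ^ 2) ^ 2 - (1 + Q ^ 2) * Q * c ^ 2 + Q ^ 2 * (2 * c ^ 2 - 4)) by ring.
    rewrite Hc. ring.
Qed.

Lemma gprod_conj5 (q c d : R) : 0 < q < 1 -> conj5 c d ->
  gprod q c * gprod q d * E q = E (q ^ 5) /\ qprod q c d = gprod q c * gprod q d /\
  qprod q c c = E q ^ 2 * gprod q d.
Proof.
  intros Hq H. split; [|split].
  - eapply has_prod_unique; [has_prod_tac|has_prod_tac|].
    intros n _. cbv beta. destruct (quad_conj5 q c d n H) as (H1 & <- & _). rewrite H1. ring.
  - eapply has_prod_unique; [has_prod_tac|has_prod_tac|].
    intros n _. apply quad_conj5; auto.
  - eapply has_prod_unique; [has_prod_tac|has_prod_tac|].
    intros n _. apply quad_conj5; auto.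
Qed.

Lemma quad1_conj5_neq0 (q c d : R) : 0 < q < 1 -> conj5 c d -> forall n, (1 <= n)%nat -> quad1 q c n <> 0.
Proof. intros Hq H n Hn. apply quad1_pos; auto. left. apply (conj5_bound c d H). Qed.

Definition lam1_sum (a : nat) (q : R) : R := Series (fun m => lam1_term a 5 (q ^ S m)).

Lemma is_series_lam1 (a : nat) (q : R) : (1 <= a)%nat -> 0 < q < 1 ->
  is_series (fun m => lam1_term a 5 (q ^ S m)) (lam1_sum a q).
Proof.
  intros Ha Hq. apply (egeo_is_series (fun m => lam1_term a 5 (q ^ S m))).
  apply (egeo_shift (fun m => lam1_term a 5 (q ^ m))). apply lam1_swap; auto; lia.
Qed.

(** Expanded in powers of [x], the left-hand side has coefficients [-n (z^n + z^(-n))] for the two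
    choices of the root [z]. Their difference is [-(c - d) n] times the Legendre symbol of [n]
    modulo 5, and [lam1_term a 5] sums [n x^n] over the class of [a]. *)
Lemma dquad_conj5 (x c d : R) : 0 < x < 1 -> conj5 c d ->
  (2 * x ^ 2 * 2 - (1 + x ^ 2) * x * c) / (1 - c * x + x ^ 2) ^ 2 -
  (2 * x ^ 2 * 2 - (1 + x ^ 2) * x * d) / (1 - d * x + x ^ 2) ^ 2 =
  - (c - d) * (lam1_term 1 5 x - lam1_term 2 5 x - lam1_term 3 5 x + lam1_term 4 5 x).
Proof.
  intros Hx H. destruct (conj5_bound c d H) as (Hb & -> & Hc & _).
  assert (P1 : 1 - c * x + x ^ 2 <> 0) by (apply Rabs_lt_between in Hb; nra).
  assert (P2 : 1 - (-1 - c) * x + x ^ 2 <> 0).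
  { apply Rabs_lt_between in Hb. assert (-3 < -1 - c < 2) by nra. nra. }
  unfold lam1_term. simpl INR.
  assert (P5 : 1 - x ^ 5 = (1 - x) * ((1 - c * x + x ^ 2) * (1 - (-1 - c) * x + x ^ 2))).
  { replace ((1 - c * x + x ^ 2) * (1 - (-1 - c) * x + x ^ 2)) with
      ((1 + x ^ 2) ^ 2 + (1 + x ^ 2) * x - x ^ 2 * (c + c ^ 2)) by ring. rewrite Hc. ring. }
  rewrite P5.
  set (A := 1 - c * x + x ^ 2) in *. set (B := 1 - (-1 - c) * x + x ^ 2) in *.
  replace (((2 * x ^ 2 * 2 - (1 + x ^ 2) * x * c) / A ^ 2 -
    (2 * x ^ 2 * 2 - (1 + x ^ 2) * x * (-1 - c)) / B ^ 2)) with
    ((1 - x) ^ 2 * ((2 * x ^ 2 * 2 - (1 + x ^ 2) * x * c) * B ^ 2 -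
       (2 * x ^ 2 * 2 - (1 + x ^ 2) * x * (-1 - c)) * A ^ 2) / ((1 - x) * (A * B)) ^ 2)
    by (field; repeat split; lra).
  replace (- (c - (-1 - c)) * (x ^ 1 * (1 + (1 + 1 + 1 + 1 + 1 - 1) * x ^ 5) / ((1 - x) * (A * B)) ^ 2 -
    x ^ 2 * (1 + 1 + (1 + 1 + 1 + 1 + 1 - (1 + 1)) * x ^ 5) / ((1 - x) * (A * B)) ^ 2 -
    x ^ 3 * (1 + 1 + 1 + (1 + 1 + 1 + 1 + 1 - (1 + 1 + 1)) * x ^ 5) / ((1 - x) * (A * B)) ^ 2 +
    x ^ 4 * (1 + 1 + 1 + 1 + (1 + 1 + 1 + 1 + 1 - (1 + 1 + 1 + 1)) * x ^ 5) / ((1 - x) * (A * B)) ^ 2))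
    with (- (2 * c + 1) * (x * (1 + 4 * x ^ 5) - x ^ 2 * (2 + 3 * x ^ 5) - x ^ 3 * (3 + 2 * x ^ 5) +
      x ^ 4 * (4 + x ^ 5)) / ((1 - x) * (A * B)) ^ 2) by (field; repeat split; lra).
  f_equal. unfold A, B. ring [Hc].
Qed.

(** Gauss-sum form of the fifth roots of unity on the curve of nome [q]. *)
Lemma level5_lambert (q : R) : 0 < q < 1 ->
  E q ^ 5 / E (q ^ 5) = 1 - 5 * (lam1_sum 1 q - lam1_sum 2 q - lam1_sum 3 q + lam1_sum 4 q).
Proof.
  intros Hq. set (c := (sqrt 5 - 1) / 2). set (d := - (sqrt 5 + 1) / 2).
  assert (H : conj5 c d) by apply conj5_sqrt5. assert (H' := conj5_sym c d H).
  destruct (conj5_bound c d H) as (Hb & Hd & Hc & Hn). destruct (conj5_bound d c H') as (Hb' & _).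
  apply Rabs_lt_between in Hb. apply Rabs_lt_between in Hb'.
  assert (Nc := quad1_conj5_neq0 q c d Hq H). assert (Nd := quad1_conj5_neq0 q d c Hq H').
  assert (W := wp_difference q c d Hq ltac:(lra) ltac:(lra) Nc Nd). unfold wp in W.
  destruct (gprod_conj5 q c d Hq H) as (G1 & G2 & _). rewrite G2 in W.
  assert (S1 : Series (fun n => dquad q c 2 (S n)) - Series (fun n => dquad q d 2 (S n)) =
    - (c - d) * (lam1_sum 1 q + - 1 * lam1_sum 2 q + - 1 * lam1_sum 3 q + lam1_sum 4 q)).
  { rewrite <- Series_minus.
    - eapply Series_eq.
      + series_lin; apply is_series_lam1; auto; lia.
      + intros n. cbv beta. unfold dquad. rewrite !quad_2. symmetry.
        assert (Hx := pow_lt_1 q (S n) Hq ltac:(lia)).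
        assert (T := dquad_conj5 (q ^ S n) c d Hx H). unfold quad1. rewrite T. ring.
    - apply egeo_ex_series, (egeo_shift (dquad q c 2)), egeo_dquad, quad_2_neq0; auto.
    - apply egeo_ex_series, (egeo_shift (dquad q d 2)), egeo_dquad, quad_2_neq0; auto. }
  assert (E1 := E_pos q Hq). assert (E5 := E_pow_pos 5 q ltac:(lia) ltac:(lra)).
  assert (Gc : gprod q c <> 0) by (apply inf_prod_neq0; auto; apply egeo_quad1, Hq).
  assert (Gd : gprod q d <> 0) by (apply inf_prod_neq0; auto; apply egeo_quad1, Hq).
  set (S0 := Series (fun n => dquad q c 2 (S n))) in *. set (S0' := Series (fun n => dquad q d 2 (S n))) in *.
  set (L := lam1_sum 1 q + - 1 * lam1_sum 2 q + - 1 * lam1_sum 3 q + lam1_sum 4 q) in *.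
  replace (lam1_sum 1 q - lam1_sum 2 q - lam1_sum 3 q + lam1_sum 4 q) with L by (unfold L; ring).
  assert (Ecd : (c - 2) * (d - 2) = 5) by (destruct H; nra).
  rewrite Ecd in W.
  assert (Einv : / (d - 2) - / (c - 2) = (c - d) / 5) by (rewrite <- Ecd; field; lra).
  assert (W2 : (c - d) / 5 * (E q ^ 5 / E (q ^ 5)) = (c - d) / 5 * (1 - 5 * L)).
  { transitivity ((c - d) / 5 * (gprod q c * gprod q d * E q ^ 4 / (gprod q c ^ 2 * gprod q d ^ 2))).
    - f_equal. rewrite <- G1. field. repeat split; auto; lra.
    - rewrite W. lra. }
  apply Rmult_eq_reg_l in W2; auto. apply Rmult_integral_contrapositive_currified; lra.
Qed.

Lemma tprod_5_sym (q : R) : tprod 5 3 q = tprod 5 2 q /\ tprod 5 4 q = tprod 5 1 q.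
Proof. split; [apply (tprod_sym 5 2)|apply (tprod_sym 5 1)]; lia. Qed.

Lemma E_tprod5 (q : R) : 0 < q < 1 -> E q = tprod 5 1 q * tprod 5 2 q * E (q ^ 5).
Proof. intros Hq. rewrite (E_block5 q) by auto. unfold tprod. simpl Nat.sub. ring. Qed.

Lemma r5_tprod (q : R) : 0 <= q < 1 -> r5 q = q * (tprod 5 1 q ^ 5 / tprod 5 2 q ^ 5).
Proof.
  intros Hq. unfold r5. f_equal.
  assert (A : forall a, (1 <= a <= 4)%nat -> egeo (fun n => (1 - q ^ aexp a 5 n) - 1) /\
     (forall n, (1 <= n)%nat -> 1 - q ^ aexp a 5 n <> 0)).
  { intros a Ha. split; [apply egeo_1mapow; try lia; rewrite Rabs_pos_eq; lra|].
    intros n Hn. apply aexp_neq1; try lia. rewrite Rabs_pos_eq; lra. }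
  unfold tprod, aprod. simpl Nat.sub.
  destruct (A 1%nat ltac:(lia)) as (A1 & _). destruct (A 2%nat ltac:(lia)) as (A2 & B2).
  destruct (A 3%nat ltac:(lia)) as (A3 & B3). destruct (A 4%nat ltac:(lia)) as (A4 & _).
  rewrite <- !inf_prod_mult by auto.
  rewrite <- !inf_prod_pow by (apply egeo_prod; auto).
  rewrite <- inf_prod_div.
  - apply inf_prod_ext. intros j Hj. unfold aexp.
    replace (5 * (j - 1) + 1)%nat with (5 * j - 4)%nat by lia.
    replace (5 * (j - 1) + 2)%nat with (5 * j - 3)%nat by lia.
    replace (5 * (j - 1) + 3)%nat with (5 * j - 2)%nat by lia.
    replace (5 * (j - 1) + 4)%nat with (5 * j - 1)%nat by lia.
    rewrite !Rpow_mult_distr. reflexivity.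
  - apply egeo_prod_pow, egeo_prod; auto.
  - apply egeo_prod_pow, egeo_prod; auto.
  - intros n Hn. apply pow_nonzero, Rmult_integral_contrapositive_currified; auto.
Qed.

Lemma tprod_pos0 (k a : nat) (q : R) : (1 <= a < k)%nat -> 0 <= q < 1 -> 0 < tprod k a q.
Proof. intros H Hq. apply Rmult_lt_0_compat; apply aprod_pos; auto; lia. Qed.

Lemma ex_derive_tprod (k a : nat) (q : R) : (1 <= a < k)%nat -> 0 <= q < 1 -> ex_derive (tprod k a) q.
Proof.
  intros H Hq. unfold tprod. apply (ex_deriveR_mult (aprod a k) (aprod (k - a) k)); apply ex_derive_aprod;
    try lia; rewrite Rabs_pos_eq; lra.
Qed.

Lemma integral_level5 (q : R) : 0 < q < 1 -> is_RInt (fun t => E t ^ 5 / E (t ^ 5) * r5 t / t) 0 q (r5 q).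
Proof.
  intros Hq. rewrite r5_tprod by lra.
  (* On the open interval the factor [t] of [r5 t] cancels the division by [t]; what remains is
     regular at 0. *)
  apply is_RInt_ext with (fun t => E t ^ 5 / E (t ^ 5) * (tprod 5 1 t ^ 5 / tprod 5 2 t ^ 5)).
  { rewrite Rmin_left, Rmax_right by lra. intros t Ht. rewrite r5_tprod by lra.
    assert (E5 := E_pow_pos 5 t ltac:(lia) ltac:(lra)). assert (T2 := tprod_pos0 5 2 t ltac:(lia) ltac:(lra)).
    match goal with |- ?a = ?b => change (@eq R a b) end. field. lra. }
  apply (is_RInt_dlog (fun t => tprod 5 1 t ^ 5 / tprod 5 2 t ^ 5) _ (fun t => E t ^ 5 / E (t ^ 5))); auto.
  - intros t Ht. apply (ex_deriveR_div (fun t => tprod 5 1 t ^ 5) (fun t => tprod 5 2 t ^ 5)).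
    + apply (ex_deriveR_pow (tprod 5 1)), ex_derive_tprod; auto; lia.
    + apply (ex_deriveR_pow (tprod 5 2)), ex_derive_tprod; auto; lia.
    + apply pow_nonzero. assert (T2 := tprod_pos0 5 2 t ltac:(lia) Ht). lra.
  - intros t Ht.
    apply (ex_deriveR_mult (fun t => E t ^ 5 / E (t ^ 5)) (fun t => tprod 5 1 t ^ 5 / tprod 5 2 t ^ 5)).
    + E_ex_derive.
    + apply (ex_deriveR_div (fun t => tprod 5 1 t ^ 5) (fun t => tprod 5 2 t ^ 5)).
      * apply (ex_deriveR_pow (tprod 5 1)), ex_derive_tprod; auto; lia.
      * apply (ex_deriveR_pow (tprod 5 2)), ex_derive_tprod; auto; lia.
      * apply pow_nonzero. assert (T2 := tprod_pos0 5 2 t ltac:(lia) Ht). lra.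
  - unfold tprod. simpl Nat.sub. rewrite !aprod_0, !pow_i, E_0 by lia. field.
  - intros t Ht. split; [|ring]. rewrite level5_lambert by auto.
    replace (1 - 5 * (lam1_sum 1 t - lam1_sum 2 t - lam1_sum 3 t + lam1_sum 4 t)) with
      (1 + (INR 5 * (- lam1_sum 1 t + - lam1_sum 4 t) - INR 5 * (- lam1_sum 2 t + - lam1_sum 3 t)))
      by (simpl; ring).
    apply dlog_mult; [apply dlog_id; lra|].
    apply (dlog_div (fun t => tprod 5 1 t ^ 5) (fun t => tprod 5 2 t ^ 5)).
    + apply pow_nonzero. assert (T2 := tprod_pos0 5 2 t ltac:(lia) ltac:(lra)). lra.
    + apply (dlog_pow (tprod 5 1)). apply (dlog_mult (aprod 1 5) (aprod 4 5)); apply dlog_aprod; auto; lia.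
    + apply (dlog_pow (tprod 5 2)). apply (dlog_mult (aprod 2 5) (aprod 3 5)); apply dlog_aprod; auto; lia.
Qed.

(** * Lambert series of weight one and Ramanujan's relation *)

Definition lam (x : R) : R := x / (1 - x).

Definition lam_res (a : nat) (q : R) : R := Series (fun n => lam (q ^ (5 * n + a))).

Lemma is_series_lam_res (a : nat) (q : R) : (1 <= a)%nat -> 0 < q < 1 ->
  is_series (fun n => lam (q ^ (5 * n + a))) (lam_res a q) /\
  is_series (fun n => lam (q ^ (5 * S n + a))) (lam_res a q - lam (q ^ a)) /\
  lam_res a q = Series (fun m => lam0_term a 5 (q ^ S m)).
Proof.
  intros Ha Hq.
  assert (G : egeo (fun n => lam (q ^ aexp a 5 n))).
  { unfold lam, Rdiv. apply egeo_mult_bounded.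
    - apply egeo_apow; try lia. rewrite Rabs_pos_eq; lra.
    - apply bounded_inv; [apply egeo_1mapow|intros; apply aexp_neq1]; try lia; rewrite Rabs_pos_eq; lra. }
  assert (Ea : forall n, aexp a 5 (S n) = (5 * n + a)%nat) by (intros; unfold aexp; lia).
  assert (X : ex_series (fun n => lam (q ^ (5 * n + a)))).
  { apply ex_series_ext with (fun n => lam (q ^ aexp a 5 (S n))); [intros; rewrite Ea; auto|].
    apply egeo_ex_series, (egeo_shift (fun n => lam (q ^ aexp a 5 n))), G. }
  split; [|split].
  - apply (Series_correct _ X).
  - replace (lam_res a q - lam (q ^ a)) with (Series (fun n => lam (q ^ (5 * S n + a)))).
    + apply (Series_correct (fun n => lam (q ^ (5 * S n + a)))).
      apply (ex_series_incr_1 (fun n => lam (q ^ (5 * n + a)))), X.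
    + unfold lam_res. rewrite (Series_incr_1 _ X). rewrite Nat.mul_0_r. simpl (0 + a)%nat. ring.
  - destruct (lam0_swap a 5 q Ha ltac:(lia) Hq) as (<- & _).
    apply Series_ext. intros n. rewrite Ea. reflexivity.
Qed.

(** [rr_sum1] and [rr_sum2] span the weight-one Lambert series attached to the odd characters modulo
    5; every value of [zeta_sum] used below is a constant plus a combination of these two. *)
Definition rr_sum1 (q : R) : R := lam_res 1 q - lam_res 4 q.
Definition rr_sum2 (q : R) : R := lam_res 2 q - lam_res 3 q.

Lemma is_series_lam0 (a : nat) (q : R) : (1 <= a)%nat -> 0 < q < 1 ->
  is_series (fun m => lam0_term a 5 (q ^ S m)) (lam_res a q).
Proof.
  intros Ha Hq. destruct (is_series_lam_res a q Ha Hq) as (_ & _ & ->).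
  apply (egeo_is_series (fun m => lam0_term a 5 (q ^ S m))).
  apply (egeo_shift (fun m => lam0_term a 5 (q ^ m))). apply lam0_swap; auto; lia.
Qed.

(** [zeta_sum] at a fifth root of unity on the curve of nome [q]. *)
Lemma zeta_conj5 (q c d : R) : 0 < q < 1 -> conj5 c d ->
  E q ^ 2 * gprod q d ^ 2 / gprod q c ^ 3 =
  1 - (d - c) * (c - 2) / (d - 2) * ((3 + c) * rr_sum1 q + (3 * c - 1) * rr_sum2 q).
Proof.
  intros Hq H. assert (H' := conj5_sym c d H).
  destruct (conj5_bound c d H) as (Hb & Hd & Hc & Hn). destruct (conj5_bound d c H') as (Hb' & _).
  apply Rabs_lt_between in Hb. apply Rabs_lt_between in Hb'.
  assert (Nc := quad1_conj5_neq0 q c d Hq H). assert (Nd := quad1_conj5_neq0 q d c Hq H').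
  assert (Gc : gprod q c <> 0) by (apply inf_prod_neq0; auto; apply egeo_quad1, Hq).
  assert (Gd : gprod q d <> 0) by (apply inf_prod_neq0; auto; apply egeo_quad1, Hq).
  destruct (gprod_conj5 q c d Hq H) as (_ & G2 & G3).
  assert (Z := zeta_sum q c d Hq ltac:(lra) Hn Nc).
  assert (S1 : Series (fun n => - (2 * q ^ S n / quad1 q c (S n) + dquad q d c (S n))) =
    - (3 + c) * (lam_res 1 q + - 1 * lam_res 4 q) + - (3 * c - 1) * (lam_res 2 q + - 1 * lam_res 3 q)).
  { eapply Series_eq.
    - series_lin; apply is_series_lam0; auto; lia.
    - intros n. cbv beta. assert (Hx := pow_lt_1 q (S n) Hq ltac:(lia)).
      specialize (Nc (S n) ltac:(lia)). specialize (Nd (S n) ltac:(lia)).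
      unfold dquad. rewrite quad_sym. destruct (quad_conj5 q c d (S n) H) as (P1 & P2 & _). rewrite P2 in *.
      unfold quad1 in *. set (x := q ^ S n) in *. unfold lam0_term.
      replace (1 - x ^ 5) with ((1 - x) * ((1 - c * x + x ^ 2) * (1 - d * x + x ^ 2))) by (rewrite P1; ring).
      set (A := 1 - c * x + x ^ 2) in *. set (B := 1 - d * x + x ^ 2) in *.
      replace (- (2 * x / A + (2 * x ^ 2 * c - (1 + x ^ 2) * x * d) / (A * B))) with
        (- ((1 - x) * (2 * x * B + (2 * x ^ 2 * c - (1 + x ^ 2) * x * d))) / ((1 - x) * (A * B)))
        by (field; repeat split; auto; lra).
      match goal with |- ?L = _ => replace L with
        ((- (3 + c) * (x - x ^ 4) - (3 * c - 1) * (x ^ 2 - x ^ 3)) / ((1 - x) * (A * B)))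
        by (field; repeat split; auto; lra) end.
      f_equal. unfold B. rewrite Hd. ring. }
  rewrite S1 in Z.
  replace (- (3 + c) * (lam_res 1 q + -1 * lam_res 4 q) + - (3 * c - 1) * (lam_res 2 q + -1 * lam_res 3 q)) with
    (- ((3 + c) * rr_sum1 q + (3 * c - 1) * rr_sum2 q)) in Z by (unfold rr_sum1, rr_sum2; ring).
  set (L := (3 + c) * rr_sum1 q + (3 * c - 1) * rr_sum2 q) in *.
  transitivity ((d - c) * (c - 2) / (d - 2) * ((d - 2) * gprod q d ^ 2 * qprod q c c /
    ((d - c) * qprod q d c * ((c - 2) * gprod q c ^ 2)))).
  - rewrite (qprod_sym q d c), G2, G3. field. repeat split; auto; lra.
  - rewrite Z.
    + field. lra.
    + intros n Hn'. rewrite quad_sym. destruct (quad_conj5 q c d n H) as (_ & -> & _).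
      apply Rmult_integral_contrapositive_currified; auto.
    + intros n Hn'. destruct (quad_conj5 q c d n H) as (_ & _ & ->).
      apply Rmult_integral_contrapositive_currified; auto.
      apply pow_nonzero. assert (Hx := pow_lt_1 q n Hq Hn'). lra.
Qed.

Lemma cpow_diff (q : R) : 0 < q < 1 ->
  cpow q 2 - cpow q 1 = (1 - q ^ 3) * (1 - q) / q ^ 2.
Proof. intros Hq. unfold cpow. rewrite pow_1. field. lra. Qed.

Lemma qprod_diag_cpow (k i : nat) (q : R) : (1 <= i)%nat -> (2 * i < k)%nat -> 0 < q < 1 ->
  qprod (q ^ k) (cpow q i) (cpow q i) = E (q ^ k) ^ 2 * (tprod k (2 * i) q / (1 - q ^ (2 * i))).
Proof.
  intros Hi Hk Hq. assert (Hqk : 0 < q ^ k < 1) by (apply pow_lt_1; [auto|lia]).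
  eapply has_prod_unique; [apply has_prod_qprod; auto| |].
  - apply has_prod_mult; [apply has_prod_pow, has_prod_E1; auto|apply has_prod_tprod; auto; lia].
  - intros n _. cbv beta. unfold quad, cpow. replace (2 * i)%nat with (i + i)%nat by lia. rewrite pow_add.
    field. apply pow_nonzero; lra.
Qed.

(** All exponents are written relative to [z = q ^ (5 m + 2)], so that the termwise identities
    behind the series become rational in [z] and [q]. *)
Lemma pow_shift5 (q : R) (m : nat) : 0 < q < 1 -> let z := q ^ (5 * m + 2) in
  (q ^ 5) ^ S m = z * q ^ 3 /\ q ^ (5 * S m + 1) = z * q ^ 4 /\ q ^ (5 * S m + 2) = z * q ^ 5 /\
  q ^ (5 * S m + 3) = z * q ^ 6 /\ q ^ (5 * m + 4) = z * q ^ 2 /\ q ^ (5 * m + 3) = z * q /\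
  0 < z < 1 /\ z * q < 1 /\ z * q ^ 2 < 1 /\ z * q ^ 4 < 1 /\ z * q ^ 5 < 1 /\ z * q ^ 6 < 1.
Proof.
  intros Hq z. assert (Hz := pow_lt_1 q (5 * m + 2) Hq ltac:(lia)). fold z in Hz.
  assert (H : forall i, z * q ^ i < 1).
  { intros i. apply Rle_lt_trans with z; [|lra]. rewrite <- (Rmult_1_r z) at 2.
    apply Rmult_le_compat_l; [lra|]. rewrite <- (pow1 i). apply pow_incr; lra. }
  assert (P : forall i j, (j = 5 * m + 2 + i)%nat -> q ^ j = z * q ^ i).
  { intros i j ->. apply pow_add. }
  rewrite <- pow_mult, <- (pow_1 q) at 1.
  assert (H1 := H 1%nat). rewrite pow_1 in H1.
  repeat split; auto; try lra; try (rewrite pow_1; apply P; lia); try (apply P; lia).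
  rewrite <- (pow_1 q) at 2. apply P. lia.
Qed.

Lemma quad_cpow_12 (q Q : R) : 0 < q ->
  (1 + Q ^ 2) ^ 2 - (1 + Q ^ 2) * Q * cpow q 1 * cpow q 2 + Q ^ 2 * (cpow q 1 ^ 2 + cpow q 2 ^ 2 - 4) =
  (1 - Q * q ^ 3) * (1 - Q / q ^ 3) * (1 - Q * q) * (1 - Q / q).
Proof. intros Hq. unfold cpow. field. lra. Qed.

Lemma quad_cpow_diag (q Q : R) (i : nat) : 0 < q ->
  (1 + Q ^ 2) ^ 2 - (1 + Q ^ 2) * Q * cpow q i * cpow q i + Q ^ 2 * (cpow q i ^ 2 + cpow q i ^ 2 - 4) =
  (1 - Q) ^ 2 * (1 - Q * q ^ i * q ^ i) * (1 - Q / q ^ i / q ^ i).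
Proof. intros Hq. unfold cpow. field. apply pow_nonzero. lra. Qed.

Lemma quad_5_12 (q : R) (m : nat) : 0 < q < 1 -> let z := q ^ (5 * m + 2) in
  quad (q ^ 5) (cpow q 1) (cpow q 2) (S m) = (1 - z * q ^ 6) * (1 - z) * (1 - z * q ^ 4) * (1 - z * q ^ 2).
Proof.
  intros Hq z. destruct (pow_shift5 q m Hq) as (HQ & _). fold z in HQ.
  unfold quad. rewrite quad_cpow_12 by lra. rewrite HQ. field. lra.
Qed.

Lemma quad_5_12_neq0 (q : R) : 0 < q < 1 ->
  forall n, (1 <= n)%nat -> quad (q ^ 5) (cpow q 1) (cpow q 2) n <> 0.
Proof.
  intros Hq n Hn. destruct n; [lia|]. rewrite quad_5_12 by auto.
  assert (F := pow_shift5 q n Hq). cbv zeta in F.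
  repeat apply Rmult_integral_contrapositive_currified; lra.
Qed.

Lemma quad_5_diag_neq0 (q : R) (i : nat) : 0 < q < 1 -> (1 <= i <= 2)%nat ->
  forall n, (1 <= n)%nat -> quad (q ^ 5) (cpow q i) (cpow q i) n <> 0.
Proof.
  intros Hq Hi n Hn. unfold quad. rewrite quad_cpow_diag by lra. rewrite <- pow_mult.
  assert (H0 := pow_lt_1 q (5 * n) Hq ltac:(lia)).
  assert (H1 := pow_lt_1 q (5 * n + i + i) Hq ltac:(lia)).
  assert (H2 := pow_lt_1 q (5 * n - i - i) Hq ltac:(lia)).
  assert (Hqi : q ^ i <> 0) by (apply pow_nonzero; lra).
  replace (q ^ (5 * n) * q ^ i * q ^ i) with (q ^ (5 * n + i + i)) by (rewrite !pow_add; ring).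
  replace (q ^ (5 * n) / q ^ i / q ^ i) with (q ^ (5 * n - i - i)).
  2: { replace (q ^ (5 * n)) with (q ^ (5 * n - i - i) * q ^ i * q ^ i) by
         (rewrite <- !pow_add; f_equal; lia). field. auto. }
  repeat apply Rmult_integral_contrapositive_currified; try (apply pow_nonzero); lra.
Qed.

Lemma cpow_12_neq (q : R) : 0 < q < 1 -> cpow q 2 <> cpow q 1.
Proof.
  intros Hq H. assert (D := cpow_diff q Hq). rewrite H in D.
  assert (Hq2 := pow_lt_1 q 2 Hq ltac:(lia)). assert (Hq3 := pow_lt_1 q 3 Hq ltac:(lia)).
  assert (0 < (1 - q ^ 3) * (1 - q) / q ^ 2); [|lra].
  apply Rdiv_lt_0_compat; [apply Rmult_lt_0_compat|]; lra.
Qed.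

(** [zeta_sum] at the points [q] and [q^2] on the curve of nome [q^5]; the values are quotients of Rogers-Ramanujan products. *)
Lemma zeta_cpow_1 (q : R) : 0 < q < 1 ->
  E (q ^ 5) ^ 2 * tprod 5 2 q ^ 2 / tprod 5 1 q ^ 3 = 1 + 3 * rr_sum1 q + rr_sum2 q.
Proof.
  intros Hq. assert (Hq5 := pow_lt_1 q 5 Hq ltac:(lia)).
  assert (Hq2 := pow_lt_1 q 2 Hq ltac:(lia)). assert (Hq3 := pow_lt_1 q 3 Hq ltac:(lia)).
  assert (T1 := tprod_pos 5 1 q ltac:(lia) Hq). assert (T2 := tprod_pos 5 2 q ltac:(lia) Hq).
  assert (N := quad_5_12_neq0 q Hq).
  assert (Z := zeta_sum (q ^ 5) (cpow q 1) (cpow q 2) Hq5 (cpow_neq_2 q 1 ltac:(lia) Hq) (cpow_12_neq q Hq)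
    (quad1_cpow_neq0 q 5 1 ltac:(lia) Hq) (fun n Hn => eq_ind_r (fun x => x <> 0) (N n Hn) (quad_sym _ _ _ n))
    (quad_5_diag_neq0 q 1 Hq ltac:(lia))).
  (* The factors present involve exponents [5 n + 6], [5 n + 8], [5 n + 4] and [5 n + 2]: classes 1
     and 3 begin one period late, so their first terms are removed. *)
  assert (S1 : Series (fun n => - (2 * (q ^ 5) ^ S n / quad1 (q ^ 5) (cpow q 1) (S n) +
      dquad (q ^ 5) (cpow q 2) (cpow q 1) (S n))) =
    q / (1 - q ^ 2) * (3 * ((lam_res 1 q - lam (q ^ 1)) + - 1 * lam_res 4 q) +
      - 1 * ((lam_res 3 q - lam (q ^ 3)) + - 1 * lam_res 2 q))).
  { eapply Series_eq.
    - series_lin; apply is_series_lam_res; auto; lia.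
    - intros n. cbv beta. unfold dquad. rewrite quad_sym, quad_5_12 by auto.
      assert (F := pow_shift5 q n Hq). cbv zeta in F.
      destruct F as (F0 & F1 & F2 & F3 & F4 & F5 & F6 & F7 & F8 & F9 & F10 & F11).
      unfold quad1. rewrite F0, F1, F3, F4. set (z := q ^ (5 * n + 2)) in *.
      replace (1 - cpow q 1 * (z * q ^ 3) + (z * q ^ 3) ^ 2) with ((1 - z * q ^ 4) * (1 - z * q ^ 2))
        by (unfold cpow; field; lra).
      unfold lam, cpow. rewrite pow_1. field. repeat split; lra. }
  rewrite S1, qprod_diag_cpow, !gprod_cpow in Z by (auto; lia).
  rewrite (qprod_sym _ (cpow q 2)), qprod_cpow in Z by (auto; lia). simpl Nat.mul in Z. simpl Nat.add in Z.
  simpl Nat.sub in Z. rewrite (proj1 (tprod_5_sym q)), cpow_diff, !cpow_m2, !pow_1 in Z by auto.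
  transitivity ((1 - q ^ 2) / q * (q / (1 - q ^ 2) * (E (q ^ 5) ^ 2 * tprod 5 2 q ^ 2 / tprod 5 1 q ^ 3))).
  { field. lra. }
  transitivity ((1 - q ^ 2) / q * ((1 - q ^ 2) ^ 2 / q ^ 2 * (tprod 5 2 q / (1 - q ^ 2)) ^ 2 *
     (E (q ^ 5) ^ 2 * (tprod 5 2 q / (1 - q ^ 2))) /
     ((1 - q ^ 3) * (1 - q) / q ^ 2 * (tprod 5 2 q * tprod 5 1 q / ((1 - q ^ 3) * (1 - q))) *
      ((1 - q) ^ 2 / q * (tprod 5 1 q / (1 - q)) ^ 2)))).
  { f_equal. field. lra. }
  rewrite Z. unfold rr_sum1, rr_sum2, lam. field. lra.
Qed.

(** The roles of [q] and [q^2] are exchanged with respect to [zeta_cpow_1]. The polar terms of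
    [zeta_sum] again restore the removed first terms, this time leaving no constant. *)
Lemma zeta_cpow_2 (q : R) : 0 < q < 1 ->
  q * E (q ^ 5) ^ 2 * tprod 5 1 q ^ 2 / tprod 5 2 q ^ 3 = rr_sum1 q - 3 * rr_sum2 q.
Proof.
  intros Hq. assert (Hq5 := pow_lt_1 q 5 Hq ltac:(lia)).
  assert (Hq2 := pow_lt_1 q 2 Hq ltac:(lia)). assert (Hq3 := pow_lt_1 q 3 Hq ltac:(lia)).
  assert (Hq4 := pow_lt_1 q 4 Hq ltac:(lia)).
  assert (T1 := tprod_pos 5 1 q ltac:(lia) Hq). assert (T2 := tprod_pos 5 2 q ltac:(lia) Hq).
  assert (N := quad_5_12_neq0 q Hq).
  assert (Z := zeta_sum (q ^ 5) (cpow q 2) (cpow q 1) Hq5 (cpow_neq_2 q 2 ltac:(lia) Hq)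
    (not_eq_sym (cpow_12_neq q Hq)) (quad1_cpow_neq0 q 5 2 ltac:(lia) Hq) N
    (quad_5_diag_neq0 q 2 Hq ltac:(lia))).
  assert (S1 : Series (fun n => - (2 * (q ^ 5) ^ S n / quad1 (q ^ 5) (cpow q 2) (S n) +
      dquad (q ^ 5) (cpow q 1) (cpow q 2) (S n))) =
    q ^ 2 / (1 - q ^ 4) * (2 * ((lam_res 2 q - lam (q ^ 2)) + - 1 * lam_res 3 q) +
      (- 1 * ((lam_res 3 q - lam (q ^ 3)) + - 1 * lam_res 2 q) +
       - 1 * ((lam_res 1 q - lam (q ^ 1)) + - 1 * lam_res 4 q)))).
  { eapply Series_eq.
    - series_lin; apply is_series_lam_res; auto; lia.
    - intros n. cbv beta. unfold dquad. rewrite quad_5_12 by auto.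
      assert (F := pow_shift5 q n Hq). cbv zeta in F.
      destruct F as (F0 & F1 & F2 & F3 & F4 & F5 & F6 & F7 & F8 & F9 & F10 & F11).
      unfold quad1. rewrite F0, F1, F2, F3, F4, F5. set (z := q ^ (5 * n + 2)) in *.
      replace (1 - cpow q 2 * (z * q ^ 3) + (z * q ^ 3) ^ 2) with ((1 - z * q ^ 5) * (1 - z * q))
        by (unfold cpow; field; lra).
      unfold lam, cpow. rewrite pow_1. field. repeat split; lra. }
  rewrite S1, qprod_diag_cpow, !gprod_cpow in Z by (auto; lia).
  rewrite qprod_cpow in Z by (auto; lia). simpl Nat.mul in Z. simpl Nat.add in Z.
  simpl Nat.sub in Z. rewrite (proj1 (tprod_5_sym q)), (proj2 (tprod_5_sym q)), !cpow_m2, !pow_1 in Z by auto.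
  replace (cpow q 1 - cpow q 2) with (- ((1 - q ^ 3) * (1 - q) / q ^ 2)) in Z
    by (rewrite <- cpow_diff by auto; ring).
  transitivity (- ((1 - q ^ 4) / q ^ 2) * (- (q ^ 2 / (1 - q ^ 4)) *
    (q * E (q ^ 5) ^ 2 * tprod 5 1 q ^ 2 / tprod 5 2 q ^ 3))).
  { field. lra. }
  transitivity (- ((1 - q ^ 4) / q ^ 2) * ((1 - q) ^ 2 / q * (tprod 5 1 q / (1 - q)) ^ 2 *
     (E (q ^ 5) ^ 2 * (tprod 5 1 q / (1 - q ^ 4))) /
     (- ((1 - q ^ 3) * (1 - q) / q ^ 2) * (tprod 5 2 q * tprod 5 1 q / ((1 - q ^ 3) * (1 - q))) *
      ((1 - q ^ 2) ^ 2 / q ^ 2 * (tprod 5 2 q / (1 - q ^ 2)) ^ 2)))).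
  { f_equal. field. lra. }
  rewrite Z.
  replace (/ (cpow q 1 - 2)) with (/ (cpow q 1 - 2)) by reflexivity.
  unfold rr_sum1, rr_sum2, lam. rewrite ?pow_1. replace (1 - q ^ 4) with ((1 - q ^ 2) * (1 + q ^ 2)) by ring.
  field. lra.
Qed.

(** Let [U] and [V] be the values of [zeta_cpow_1] and [zeta_cpow_2]; then [V / U] is [r5 q] and
    [U * V] is an eta quotient. At the two pairs of fifth roots of unity the corresponding values
    are [U + (5c - 3) V] and [U + (5d - 3) V]. Their product is the eta quotient
    [E q ^ 5 / E (q ^ 5)], and equals [U^2 - 11 UV - V^2] because [c + d = cd = -1]. *)
Theorem r5_relation (q : R) : 0 < q < 1 ->
  / r5 q - 11 - r5 q = E q ^ 6 / (q * E (q ^ 5) ^ 6).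
Proof.
  intros Hq. set (c := (sqrt 5 - 1) / 2). set (d := - (sqrt 5 + 1) / 2).
  assert (H : conj5 c d) by apply conj5_sqrt5. assert (H' := conj5_sym c d H).
  destruct (conj5_bound c d H) as (Hb & Hd & Hc & Hn). destruct (conj5_bound d c H') as (Hb' & _ & Hd2 & _).
  apply Rabs_lt_between in Hb. apply Rabs_lt_between in Hb'.
  assert (Nc := quad1_conj5_neq0 q c d Hq H). assert (Nd := quad1_conj5_neq0 q d c Hq H').
  assert (Gc : gprod q c <> 0) by (apply inf_prod_neq0; auto; apply egeo_quad1, Hq).
  assert (Gd : gprod q d <> 0) by (apply inf_prod_neq0; auto; apply egeo_quad1, Hq).
  assert (E1 := E_pos q Hq). assert (E5 := E_pow_pos 5 q ltac:(lia) ltac:(lra)).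
  assert (T1 := tprod_pos 5 1 q ltac:(lia) Hq). assert (T2 := tprod_pos 5 2 q ltac:(lia) Hq).
  destruct (gprod_conj5 q c d Hq H) as (G1 & _ & _).
  assert (Zc := zeta_conj5 q c d Hq H). assert (Zd := zeta_conj5 q d c Hq H').
  assert (ZU := zeta_cpow_1 q Hq). assert (ZV := zeta_cpow_2 q Hq).
  set (U := E (q ^ 5) ^ 2 * tprod 5 2 q ^ 2 / tprod 5 1 q ^ 3) in *.
  set (V := q * E (q ^ 5) ^ 2 * tprod 5 1 q ^ 2 / tprod 5 2 q ^ 3) in *.
  (* Both families of values are affine in the same two Lambert series, which are eliminated
     here. *)
  assert (Lin : forall x y, conj5 x y ->
     1 - (y - x) * (x - 2) / (y - 2) * ((3 + x) * rr_sum1 q + (3 * x - 1) * rr_sum2 q) = U + (5 * x - 3) * V).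
  { intros x y Hxy. destruct (conj5_bound x y Hxy) as (Bx & Ey & Hx & _).
    apply Rabs_lt_between in Bx.
    assert (K : (y - x) * (x - 2) = (y - 2) * (- 5 * x / (3 + x))).
    { rewrite Ey. apply Rmult_eq_reg_r with (3 + x); [|lra].
      transitivity ((-1 - x - 2) * (- 5 * x)); [|field; lra]. ring [Hx]. }
    assert (Hy2 : y - 2 <> 0) by (rewrite Ey; lra).
    rewrite K, ZU, ZV.
    replace ((y - 2) * (- 5 * x / (3 + x)) / (y - 2)) with (- 5 * x / (3 + x)) by (field; split; lra).
    apply Rmult_eq_reg_r with (3 + x); [|lra].
    transitivity (3 + x + 5 * x * ((3 + x) * rr_sum1 q + (3 * x - 1) * rr_sum2 q)); [field; lra|].
    ring [Hx]. }
  rewrite (Lin c d H) in Zc. rewrite (Lin d c H') in Zd.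
  assert (Prod : E q ^ 5 / E (q ^ 5) = U ^ 2 - 11 * U * V - V ^ 2).
  { transitivity (E q ^ 2 * gprod q d ^ 2 / gprod q c ^ 3 * (E q ^ 2 * gprod q c ^ 2 / gprod q d ^ 3)).
    - rewrite <- G1. field. repeat split; auto; lra.
    - rewrite Zc, Zd, Hd. ring [Hc]. }
  rewrite r5_tprod by lra.
  assert (UV : U * V = q * E (q ^ 5) ^ 5 / E q).
  { unfold U, V. rewrite (E_tprod5 q) by auto. field. lra. }
  assert (VU : q * (tprod 5 1 q ^ 5 / tprod 5 2 q ^ 5) = V / U) by (unfold U, V; field; lra).
  assert (PU : 0 < U).
  { apply Rdiv_lt_0_compat; [apply Rmult_lt_0_compat|]; apply pow_lt; auto. }
  assert (PV : 0 < V).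
  { apply Rdiv_lt_0_compat; [|apply pow_lt; auto].
    apply Rmult_lt_0_compat; [apply Rmult_lt_0_compat; [lra|]|]; apply pow_lt; auto. }
  rewrite VU.
  transitivity ((U ^ 2 - 11 * U * V - V ^ 2) / (U * V)); [field; lra|].
  rewrite <- Prod, UV. field. lra.
Qed.

(** * Theta inversion *)

(** The reciprocal factorial, extended by its natural value 0 at negative integers; [ifac_pred] then
    holds throughout, as [qfac_inv_pred] does for the q-analogue. *)
Definition ifac (z : Z) : R := if Z_le_dec 0 z then / INR (fact (Z.to_nat z)) else 0.

Lemma ifac_pred (z : Z) : ifac (z - 1) = IZR z * ifac z.
Proof.
  unfold ifac. destruct (Z_le_dec 0 (z - 1)), (Z_le_dec 0 z); try lia.
  - replace (Z.to_nat z) with (S (Z.to_nat (z - 1))) by lia. rewrite fact_simpl, mult_INR.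
    replace (INR (S (Z.to_nat (z - 1)))) with (IZR z).
    + assert (H := INR_fact_neq_0 (Z.to_nat (z - 1))). field. split; auto. apply not_0_IZR. lia.
    + rewrite INR_IZR_INZ. f_equal. lia.
  - replace z with 0%Z by lia. ring.
  - ring.
Qed.

(** The binomial coefficient [(2m choose m+n)]. *)
Definition cbin (m : nat) (n : Z) : R := INR (fact (2 * m)) * (ifac (Z.of_nat m + n) * ifac (Z.of_nat m - n)).

Lemma cbin_rec (m : nat) (n : Z) : cbin (S m) n = 2 * cbin m n + cbin m (n - 1) + cbin m (n + 1).
Proof.
  unfold cbin. set (a := (Z.of_nat m + 1 + n)%Z). set (b := (Z.of_nat m + 1 - n)%Z).
  replace (Z.of_nat (S m) + n)%Z with a by lia. replace (Z.of_nat (S m) - n)%Z with b by lia.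
  replace (Z.of_nat m + n)%Z with (a - 1)%Z by lia. replace (Z.of_nat m - n)%Z with (b - 1)%Z by lia.
  replace (Z.of_nat m + (n - 1))%Z with (a - 1 - 1)%Z by lia. replace (Z.of_nat m - (n - 1))%Z with b by lia.
  replace (Z.of_nat m + (n + 1))%Z with a by lia. replace (Z.of_nat m - (n + 1))%Z with (b - 1 - 1)%Z by lia.
  rewrite !ifac_pred. replace (2 * S m)%nat with (S (S (2 * m))) by lia.
  rewrite !fact_simpl, !mult_INR.
  replace (INR (S (S (2 * m)))) with (IZR a + IZR b).
  2: { rewrite <- plus_IZR, INR_IZR_INZ. f_equal. lia. }
  replace (INR (S (2 * m))) with (IZR a + IZR b - 1).
  2: { rewrite <- plus_IZR, <- minus_IZR, INR_IZR_INZ. f_equal. lia. }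
  rewrite !minus_IZR. ring.
Qed.

Lemma cbin_sym (m : nat) (n : Z) : cbin m (- n) = cbin m n.
Proof.
  unfold cbin. replace (Z.of_nat m + - n)%Z with (Z.of_nat m - n)%Z by lia.
  replace (Z.of_nat m - - n)%Z with (Z.of_nat m + n)%Z by lia. ring.
Qed.

(** [z + 2 + 1/z] is the square of [z^(1/2) + z^(-1/2)], so this is the binomial theorem for
    exponent [2 m], centred at the middle coefficient. *)
Lemma cbin_hassum (z : C) (m : nat) : z <> 0 ->
  hassum (fun n => RtoC (cbin m n) * zpow z n)%C ((z + 2 + / z) ^ m)%C.
Proof.
  intros Hz. induction m.
  - replace ((z + 2 + / z) ^ 0)%C with (RtoC (cbin 0 0) * zpow z 0)%C.
    + apply (hassum_single (fun n => RtoC (cbin 0 n) * zpow z n)%C 0%Z).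
      intros n Hn. unfold cbin, ifac.
      destruct (Z_le_dec 0 (Z.of_nat 0 + n)), (Z_le_dec 0 (Z.of_nat 0 - n)); try lia;
        rewrite ?Rmult_0_l, ?Rmult_0_r; ring.
    + unfold cbin, ifac. simpl. replace (1 * (/ 1 * / 1)) with 1 by field. rewrite zpow_0. ring.
  - set (f := fun n => (RtoC (cbin m n) * zpow z n)%C) in *. rewrite Cpow_S.
    replace ((z + 2 + / z) * (z + 2 + / z) ^ m)%C with
      (2 * (z + 2 + / z) ^ m + z * (z + 2 + / z) ^ m + / z * (z + 2 + / z) ^ m)%C by ring.
    assert (Hm : hassum (fun n => f (n - 1)%Z) ((z + 2 + / z) ^ m)%C).
    { apply (hassum_reindex f (fun n => (n - 1)%Z) (fun n => (n + 1)%Z)); auto; intros; lia. }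
    assert (Hq : hassum (fun n => f (n + 1)%Z) ((z + 2 + / z) ^ m)%C).
    { apply (hassum_reindex f (fun n => (n + 1)%Z) (fun n => (n - 1)%Z)); auto; intros; lia. }
    apply hassum_ext with (fun n => 2 * f n + z * f (n - 1)%Z + / z * f (n + 1)%Z)%C.
    + intros n. unfold f. rewrite cbin_rec, !RtoC_plus, RtoC_mult.
      assert (H1 := zpow_succ z (n - 1) Hz). replace (n - 1 + 1)%Z with n in H1 by lia.
      rewrite zpow_succ, H1 by auto. field. auto.
    + apply (hassum_plus Z.eq_dec); [apply (hassum_plus Z.eq_dec)|]; apply hassum_scal; auto.
Qed.

(** * Roots of unity and Polya's finite identity *)

Definition cis (x : R) : C := (cos x, sin x).

Lemma cis_add (x y : R) : cis (x + y) = (cis x * cis y)%C.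
Proof. unfold cis, Cmult. simpl. rewrite cos_plus, sin_plus. f_equal; ring. Qed.

Lemma cis_0 : cis 0 = RtoC 1.
Proof. unfold cis. rewrite cos_0, sin_0. reflexivity. Qed.

Lemma cis_neq0 (x : R) : cis x <> 0.
Proof.
  intros H. assert (H1 : (cis x * cis (- x))%C = RtoC 1).
  { rewrite <- cis_add. replace (x + - x) with 0 by ring. apply cis_0. }
  rewrite H, Cmult_0_l in H1. apply RtoC_inj in H1. lra.
Qed.

Lemma cis_inv (x : R) : (/ cis x)%C = cis (- x).
Proof.
  assert (H1 : (cis x * cis (- x))%C = RtoC 1).
  { rewrite <- cis_add. replace (x + - x) with 0 by ring. apply cis_0. }
  transitivity (/ cis x * (cis x * cis (- x)))%C; [rewrite H1; ring|]. field. apply cis_neq0.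
Qed.

Lemma zpow_cis (x : R) (n : Z) : zpow (cis x) n = cis (IZR n * x).
Proof.
  induction n using Z.peano_ind.
  - rewrite zpow_0, Rmult_0_l, cis_0. reflexivity.
  - replace (Z.succ n) with (n + 1)%Z by lia. rewrite zpow_succ, IHn by apply cis_neq0.
    rewrite plus_IZR, <- cis_add. f_equal. ring.
  - assert (H := zpow_succ (cis x) (Z.pred n) (cis_neq0 x)).
    replace (Z.pred n + 1)%Z with n in H by lia. rewrite IHn in H.
    replace (zpow (cis x) (Z.pred n)) with (/ cis x * (cis x * zpow (cis x) (Z.pred n)))%C
      by (field; apply cis_neq0).
    rewrite <- H, cis_inv, <- cis_add. f_equal. replace (Z.pred n) with (n - 1)%Z by lia.
    rewrite minus_IZR. ring.
Qed.

Lemma cis_double_cos (x : R) : (cis (2 * x) + 2 + / cis (2 * x))%C = RtoC ((2 * cos x) ^ 2).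
Proof.
  rewrite cis_inv. unfold cis, RtoC, Cplus. simpl. f_equal.
  - rewrite cos_neg, cos_2a_cos. ring.
  - rewrite sin_neg. ring.
Qed.

Lemma cis_2PI_eq1 (k : Z) (l : nat) : (1 <= l)%nat -> cis (2 * (IZR k * (PI / INR l))) = RtoC 1 ->
  exists j, k = (Z.of_nat l * j)%Z.
Proof.
  intros Hl H. assert (HP := PI_RGT_0). assert (HL : 0 < INR l) by (apply lt_0_INR; lia).
  exists (k / Z.of_nat l)%Z.
  assert (D := Z.div_mod k (Z.of_nat l) ltac:(lia)).
  assert (B := Z.mod_pos_bound k (Z.of_nat l) ltac:(lia)).
  set (j := (k / Z.of_nat l)%Z) in *. set (s := (k mod Z.of_nat l)%Z) in *.
  destruct (Z.eq_dec s 0) as [E|E]; [lia|]. exfalso.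
  assert (Hs : 0 < IZR s < INR l).
  { split; [apply IZR_lt; lia|]. rewrite INR_IZR_INZ. apply IZR_lt; lia. }
  assert (H1 : cis (2 * (IZR s * (PI / INR l))) = RtoC 1).
  { rewrite <- H. assert (P2 : forall m : Z, cis (IZR m * (2 * PI)) = RtoC 1).
    { intros m. rewrite <- zpow_cis. replace (cis (2 * PI)) with (RtoC 1).
      - unfold zpow. destruct Z_le_dec; [apply Cpow_1_l|].
        replace (/ 1)%C with (RtoC 1) by (field; apply RtoC_neq0; lra). apply Cpow_1_l.
      - unfold cis. rewrite cos_2PI, sin_2PI. reflexivity. }
    rewrite D, plus_IZR, mult_IZR, <- INR_IZR_INZ.
    replace (2 * ((INR l * IZR j + IZR s) * (PI / INR l))) with
      (IZR j * (2 * PI) + 2 * (IZR s * (PI / INR l))) by (field; lra).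
    rewrite cis_add, P2. ring. }
  apply (f_equal fst) in H1. unfold cis, RtoC in H1. simpl in H1.
  assert (S : sin (IZR s * (PI / INR l)) = 0).
  { rewrite cos_2a_sin in H1. nra. }
  assert (0 < sin (IZR s * (PI / INR l))); [|lra].
  apply sin_gt_0.
  - apply Rmult_lt_0_compat; [lra|]. apply Rdiv_lt_0_compat; lra.
  - apply Rmult_lt_reg_r with (INR l); auto.
    replace (IZR s * (PI / INR l) * INR l) with (IZR s * PI) by (field; lra). nra.
Qed.

Lemma lsum_scal {I} (c : C) (f : I -> C) l : lsum (fun i => c * f i)%C l = (c * lsum f l)%C.
Proof. induction l; simpl; [ring|]. rewrite IHl. ring. Qed.

Lemma lsum_const {I} (c : C) (l : list I) : lsum (fun _ => c) l = (RtoC (INR (length l)) * c)%C.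
Proof.
  induction l; [simpl; ring|]. cbn [lsum length]. rewrite IHl, S_INR, RtoC_plus. ring.
Qed.

Lemma zlist_length (K : nat) : length (zlist K) = (2 * K)%nat.
Proof. unfold zlist. rewrite length_app, !length_map, length_seq. lia. Qed.

Lemma zlist_telescope (f : Z -> C) (K : nat) :
  lsum (fun j => f (j + 1)%Z - f j)%C (zlist K) = (f (Z.of_nat K) - f (- Z.of_nat K)%Z)%C.
Proof.
  unfold zlist. rewrite lsum_app.
  assert (H1 : lsum (fun j => f (j + 1)%Z - f j)%C (map Z.of_nat (seq 0 K)) = (f (Z.of_nat K) - f 0%Z)%C).
  { induction K; [simpl; ring|]. rewrite seq_S, map_app, lsum_app, IHK. cbn [map lsum].
    rewrite Nat.add_0_l. replace (Z.of_nat K + 1)%Z with (Z.of_nat (S K)) by lia. ring. }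
  assert (H2 : lsum (fun j => f (j + 1)%Z - f j)%C (map (fun k => (-1 - Z.of_nat k)%Z) (seq 0 K)) =
     (f 0%Z - f (- Z.of_nat K)%Z)%C).
  { clear H1. induction K; [simpl; ring|]. rewrite seq_S, map_app, lsum_app, IHK. cbn [map lsum].
    rewrite Nat.add_0_l. replace (-1 - Z.of_nat K + 1)%Z with (- Z.of_nat K)%Z by lia.
    replace (-1 - Z.of_nat K)%Z with (- Z.of_nat (S K))%Z by lia. ring. }
  rewrite H1, H2. ring.
Qed.

Lemma cis_PI_mult (k : Z) : cis (IZR k * PI) = zpow (- (1))%C k.
Proof.
  replace (- (1))%C with (cis PI).
  - rewrite zpow_cis. reflexivity.
  - unfold cis. rewrite cos_PI, sin_PI. unfold RtoC, Copp. simpl. f_equal. ring.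
Qed.

(** Root-of-unity filter on the half-odd multiples of [PI / r]. *)
Lemma filter_sum (r : nat) (n : Z) : (1 <= r)%nat ->
  let S := lsum (fun j => zpow (cis (2 * (IZR (2 * j + 1) * (PI / INR (4 * r))))) n) (zlist r) in
  (forall k, n = (Z.of_nat (2 * r) * k)%Z -> S = (RtoC (INR (2 * r)) * zpow (- (1))%C k)%C) /\
  ((forall k, n <> (Z.of_nat (2 * r) * k)%Z) -> S = RtoC 0).
Proof.
  intros Hr S.
  assert (HR : 0 < INR r) by (apply lt_0_INR; lia).
  set (x := IZR n * (PI / INR (2 * r))).
  assert (ES : S = lsum (fun j => zpow (cis x) (2 * j + 1)) (zlist r)).
  { apply lsum_ext. intros j. rewrite !zpow_cis. f_equal. unfold x.
    rewrite !mult_INR, INR_IZR_INZ. simpl (Z.of_nat 4). rewrite (INR_IZR_INZ 2). simpl (Z.of_nat 2). field. lra. }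
  split.
  - intros k Hk. rewrite ES, (lsum_ext _ (fun j => zpow (- (1))%C k)).
    + rewrite lsum_const, zlist_length. reflexivity.
    + intros j. assert (Ex : x = IZR k * PI).
      { unfold x. rewrite Hk, mult_IZR, <- INR_IZR_INZ. field. rewrite mult_INR. simpl. lra. }
      rewrite Ex, cis_PI_mult.
      assert (H1 : (- (1))%C <> 0).
      { intros H. apply (f_equal Cmod) in H. rewrite Cmod_opp, Cmod_1, Cmod_0 in H. lra. }
      rewrite zpow_zpow by auto. replace (k * (2 * j + 1))%Z with (2 * (k * j) + k)%Z by lia.
      rewrite zpow_add by auto. rewrite <- zpow_zpow by auto.
      replace (zpow (- (1))%C 2) with (RtoC 1).
      * assert (E1 : zpow 1 (k * j) = RtoC 1).
        { rewrite <- cis_0, zpow_cis. f_equal. ring. }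
        rewrite E1. ring.
      * change 2%Z with (Z.of_nat 2). rewrite zpow_nat. simpl. ring.
  - intros Hn. rewrite ES.
    set (u := cis x). assert (Hu : u <> 0) by apply cis_neq0.
    assert (Hu2 : (u * u)%C <> RtoC 1).
    { intros E. unfold u in E. rewrite <- cis_add in E. replace (x + x) with (2 * x) in E by ring.
      unfold x in E. apply cis_2PI_eq1 in E; [|lia]. destruct E as (k & Hk). apply (Hn k Hk). }
    (* Multiplication by [u^2 - 1] telescopes the sum of odd powers; its two ends agree because they
       differ by the factor [cis (2 n PI) = 1]. *)
    assert (T : ((u * u - 1) * lsum (fun j => zpow u (2 * j + 1)) (zlist r))%C = RtoC 0).
    { rewrite <- lsum_scal.
      rewrite (lsum_ext _ (fun j => zpow u (2 * (j + 1) + 1) - zpow u (2 * j + 1))%C).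
      - rewrite (zlist_telescope (fun j => zpow u (2 * j + 1))).
        unfold u. rewrite !zpow_cis.
        replace (IZR (2 * Z.of_nat r + 1) * x) with (IZR (2 * - Z.of_nat r + 1) * x + IZR n * (2 * PI)).
        + rewrite cis_add. replace (cis (IZR n * (2 * PI))) with (RtoC 1); [ring|].
          rewrite <- zpow_cis. replace (cis (2 * PI)) with (cis 0).
          * rewrite zpow_cis, Rmult_0_r, cis_0. reflexivity.
          * unfold cis. rewrite cos_2PI, sin_2PI, cos_0, sin_0. reflexivity.
        + unfold x. rewrite !plus_IZR, !mult_IZR, opp_IZR, <- INR_IZR_INZ, mult_INR. simpl (INR 2). field. lra.
      - intros j. replace (2 * (j + 1) + 1)%Z with (2 * j + 1 + 1 + 1)%Z by lia.
        rewrite (zpow_succ u (2 * j + 1 + 1)), (zpow_succ u (2 * j + 1)) by auto. ring. }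
    assert (Hd : (u * u - 1)%C <> 0).
    { intros E. apply Hu2. replace (u * u)%C with (u * u - 1 + 1)%C by ring. rewrite E. ring. }
    transitivity (/ (u * u - 1) * ((u * u - 1) * lsum (fun j => zpow u (2 * j + 1)) (zlist r)))%C.
    + field. auto.
    + rewrite T. ring.
Qed.

Lemma hassum_lsum {I J} (dec : eq_decidable I) (f : J -> I -> C) (s : J -> C) (l : list J) :
  (forall j, hassum (f j) (s j)) -> hassum (fun i => lsum (fun j => f j i) l) (lsum s l).
Proof.
  intros H. induction l as [|j l IH]; simpl.
  - intros eps Heps. exists nil. split; [constructor|]. intros l _ _.
    replace (lsum (fun _ : I => RtoC 0) l) with (RtoC 0).
    + replace (0 - 0)%C with (RtoC 0) by ring. rewrite Cmod_0. auto.
    + induction l; simpl; [auto|]. rewrite <- IHl. ring.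
  - apply (hassum_plus dec); auto.
Qed.

Lemma hassum_finite {I} (dec : eq_decidable I) (f : I -> C) (l0 : list I) : NoDup l0 ->
  (forall i, ~ In i l0 -> f i = RtoC 0) -> hassum f (lsum f l0).
Proof.
  intros N H eps Heps. exists l0. split; auto. intros l Hl Hi.
  destruct (incl_perm dec l0 l N Hl Hi) as (r & Hp & _ & Hd).
  rewrite (lsum_perm f _ _ Hp), lsum_app.
  assert (E : lsum f r = RtoC 0).
  { clear Hp. induction r; simpl; auto. rewrite H by (apply Hd; left; auto).
    rewrite IHr; [ring|]. intros i Hir. apply Hd. right; auto. }
  rewrite E. replace (lsum f l0 + 0 - lsum f l0)%C with (RtoC 0) by ring. rewrite Cmod_0. auto.
Qed.

(** [h] is the partial inverse of [g]; outside the image of [g] the terms vanish. This keeps only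
    the multiples of [2 r] that survive the filter. *)
Lemma hassum_restrict {I J} (dec : eq_decidable I) (f : I -> C) (g : J -> I) (h : I -> option J) s :
  (forall j, h (g j) = Some j) ->
  (forall i, match h i with Some j => g j = i | None => f i = RtoC 0 end) ->
  hassum f s -> hassum (fun j => f (g j)) s.
Proof.
  intros P1 P2 H eps Heps. destruct (H eps Heps) as (l0 & N0 & K).
  set (q := fix q (l : list I) := match l with nil => nil | i :: l' =>
     match h i with Some j => j :: q l' | None => q l' end end).
  assert (Hin : forall j l, In j (q l) <-> In (g j) l).
  { intros j l. induction l as [|i l IH]; simpl; [tauto|].
    assert (Pi := P2 i). destruct (h i) as [k|] eqn:E; simpl; rewrite IH.
    - assert (k = j <-> i = g j); [|tauto]. split; intros A; [congruence|]. rewrite A, P1 in E. congruence.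
    - assert (i <> g j); [|tauto]. intros A. rewrite A, P1 in E. congruence. }
  assert (Hnd : forall l, NoDup l -> NoDup (q l)).
  { intros l Hl. induction Hl as [|i m Hn Hd IH]; simpl; [constructor|].
    assert (Pi := P2 i). destruct (h i) as [k|] eqn:E; auto. constructor; auto. rewrite Hin, Pi. auto. }
  assert (Hsum : forall l, lsum f l = lsum (fun j => f (g j)) (q l)).
  { induction l as [|i l IH]; simpl; auto. assert (Pi := P2 i). destruct (h i) as [k|]; simpl; rewrite IH.
    - rewrite Pi. reflexivity.
    - rewrite Pi. ring. }
  exists (q l0). split; auto. intros l Hl Hi.
  set (L := nodup dec (map g l ++ l0)).
  assert (HL : NoDup L) by apply NoDup_nodup.
  assert (HP : Permutation (q L) l).
  { apply NoDup_Permutation; auto. intros j. rewrite Hin. unfold L. rewrite nodup_In, in_app_iff. split.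
    - intros [A|A].
      + apply in_map_iff in A. destruct A as (j' & E & A). apply (f_equal h) in E. rewrite !P1 in E. congruence.
      + apply Hi. apply Hin. auto.
    - intros A. left. apply in_map; auto. }
  rewrite <- (lsum_perm _ _ _ HP), <- Hsum. apply K; auto.
  apply nodup_incl, incl_appr, incl_refl.
Qed.

(** Polya: expanding [(2 cos x)^(2m)] and filtering picks every [2r]-th binomial coefficient; letting [r] and [m]
    tend to infinity with [m / r^2] fixed turns both sides into theta series. *)
Lemma polya_identity (r m : nat) : (1 <= r)%nat ->
  hassum (fun k => RtoC (INR (2 * r)) * (zpow (- (1))%C k * RtoC (cbin m (Z.of_nat (2 * r) * k))))%C
    (lsum (fun j => RtoC ((2 * cos (IZR (2 * j + 1) * (PI / INR (4 * r)))) ^ (2 * m))) (zlist r)).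
Proof.
  intros Hr.
  set (x := fun j => IZR (2 * j + 1) * (PI / INR (4 * r))).
  assert (H : hassum (fun n => lsum (fun j => RtoC (cbin m n) * zpow (cis (2 * x j)) n)%C (zlist r))
    (lsum (fun j => RtoC ((2 * cos (x j)) ^ (2 * m))) (zlist r))).
  { apply (hassum_lsum Z.eq_dec). intros j.
    replace (RtoC ((2 * cos (x j)) ^ (2 * m))) with ((cis (2 * x j) + 2 + / cis (2 * x j)) ^ m)%C.
    - apply cbin_hassum, cis_neq0.
    - rewrite cis_double_cos, pow_mult, <- RtoC_pow. reflexivity. }
  apply (hassum_restrict Z.eq_dec _ (fun k => (Z.of_nat (2 * r) * k)%Z)
    (fun n => if Z.eq_dec (n mod Z.of_nat (2 * r)) 0 then Some (n / Z.of_nat (2 * r))%Z else None)) in H.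
  - revert H. apply hassum_ext. intros k. rewrite lsum_scal.
    destruct (filter_sum r (Z.of_nat (2 * r) * k) Hr) as (F & _).
    unfold x. rewrite (F k eq_refl). ring.
  - intros k. rewrite Z.mul_comm, Z.mod_mul, Z.div_mul by lia. reflexivity.
  - intros n. destruct (Z.eq_dec (n mod Z.of_nat (2 * r)) 0) as [E|E].
    + assert (D := Z.div_mod n (Z.of_nat (2 * r)) ltac:(lia)). lia.
    + rewrite lsum_scal. destruct (filter_sum r n Hr) as (_ & F).
      unfold x. rewrite F; [ring|]. intros k ->. apply E. rewrite Z.mul_comm, Z.mod_mul by lia. reflexivity.
Qed.

(** * Gaussian bounds for binomial coefficients and powers of cosines *)

Lemma ifac_nonneg (z : Z) : 0 <= ifac z.
Proof.
  unfold ifac. destruct Z_le_dec; [|lra]. left. apply Rinv_0_lt_compat, INR_fact_lt_0.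
Qed.

Lemma cbin_nonneg (m : nat) (n : Z) : 0 <= cbin m n.
Proof.
  unfold cbin. apply Rmult_le_pos; [apply pos_INR|]. apply Rmult_le_pos; apply ifac_nonneg.
Qed.

Lemma cbin_0_pos (m : nat) : 0 < cbin m 0.
Proof.
  unfold cbin, ifac. rewrite Z.add_0_r, Z.sub_0_r. destruct Z_le_dec; [|lia].
  apply Rmult_lt_0_compat; [apply INR_fact_lt_0|].
  apply Rmult_lt_0_compat; apply Rinv_0_lt_compat, INR_fact_lt_0.
Qed.

Lemma cbin_out (m : nat) (n : Z) : (Z.of_nat m < n)%Z -> cbin m n = 0.
Proof. intros H. unfold cbin, ifac at 2. destruct Z_le_dec; [lia|]. ring. Qed.

Lemma cbin_step (m i : nat) : (i <= m)%nat ->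
  cbin m (Z.of_nat (S i)) = cbin m (Z.of_nat i) * ((INR m - INR i) / (INR m + INR i + 1)).
Proof.
  intros Hi. unfold cbin.
  assert (H1 := ifac_pred (Z.of_nat m + Z.of_nat (S i))). assert (H2 := ifac_pred (Z.of_nat m - Z.of_nat i)).
  replace (Z.of_nat m + Z.of_nat (S i) - 1)%Z with (Z.of_nat m + Z.of_nat i)%Z in H1 by lia.
  replace (Z.of_nat m - Z.of_nat i - 1)%Z with (Z.of_nat m - Z.of_nat (S i))%Z in H2 by lia.
  rewrite H1, H2. rewrite plus_IZR, minus_IZR, <- !INR_IZR_INZ, S_INR.
  assert (P1 := pos_INR m). assert (P2 := pos_INR i). field. lra.
Qed.

Lemma exp_le_inv (y : R) : 0 <= y -> exp (- y) <= / (1 + y).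
Proof.
  intros Hy. rewrite exp_Ropp. apply Rinv_le_contravar; [lra|]. apply exp_ineq1_le.
Qed.

Lemma exp_le_mono (x y : R) : x <= y -> exp x <= exp y.
Proof. intros [H|H]; [left; apply exp_increasing, H|rewrite H; lra]. Qed.

(** The ratio in [cbin_step] is [1 - (2i+1)/(m+i+1)], at most [exp (- (2i+1)/(m+K))]; the odd
    numbers in the exponents add up to a square. *)
Lemma cbin_upper (m K i : nat) : (i <= K)%nat -> (K <= m)%nat ->
  cbin m (Z.of_nat i) <= cbin m 0 * exp (- (INR i ^ 2 / (INR m + INR K))).
Proof.
  intros Hi HK. induction i.
  - simpl INR. replace (- (0 ^ 2 / (INR m + INR K))) with 0 by (unfold Rdiv; ring). rewrite exp_0.
    simpl. lra.
  - specialize (IHi ltac:(lia)). rewrite cbin_step by lia.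
    assert (P1 := pos_INR i). assert (P2 : INR i + 1 <= INR K) by (rewrite <- S_INR; apply le_INR; lia).
    assert (P3 : INR K <= INR m) by (apply le_INR; lia).
    assert (Hx : (INR m - INR i) / (INR m + INR i + 1) <= exp (- ((2 * INR i + 1) / (INR m + INR K)))).
    { apply Rle_trans with (1 + - ((2 * INR i + 1) / (INR m + INR K))); [|apply exp_ineq1_le].
      replace ((INR m - INR i) / (INR m + INR i + 1)) with (1 - (2 * INR i + 1) * / (INR m + INR i + 1))
        by (field; lra).
      assert (/ (INR m + INR K) <= / (INR m + INR i + 1)) by (apply Rinv_le_contravar; lra).
      unfold Rdiv. nra. }
    assert (Hx0 : 0 <= (INR m - INR i) / (INR m + INR i + 1)) by (apply Rdiv_le_0_compat; lra).
    apply Rle_trans with (cbin m 0 * exp (- (INR i ^ 2 / (INR m + INR K))) *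
      exp (- ((2 * INR i + 1) / (INR m + INR K)))).
    + apply Rmult_le_compat; auto. apply cbin_nonneg.
    + right. rewrite Rmult_assoc, <- exp_plus. do 2 f_equal. rewrite S_INR. field. lra.
Qed.

(** Here the same ratio is written as [1 / (1 + (2i+1)/(m-i))], which is at least
    [exp (- (2i+1)/(m-K))]. *)
Lemma cbin_lower (m K i : nat) : (i <= K)%nat -> (K < m)%nat ->
  cbin m 0 * exp (- (INR i ^ 2 / (INR m - INR K))) <= cbin m (Z.of_nat i).
Proof.
  intros Hi HK. induction i.
  - simpl INR. replace (- (0 ^ 2 / (INR m - INR K))) with 0 by (unfold Rdiv; ring). rewrite exp_0.
    simpl. lra.
  - specialize (IHi ltac:(lia)). rewrite cbin_step by lia.
    assert (P1 := pos_INR i). assert (P2 : INR i + 1 <= INR K) by (rewrite <- S_INR; apply le_INR; lia).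
    assert (P3 : INR K < INR m) by (apply lt_INR; lia).
    assert (Hx : exp (- ((2 * INR i + 1) / (INR m - INR K))) <= (INR m - INR i) / (INR m + INR i + 1)).
    { replace ((INR m - INR i) / (INR m + INR i + 1)) with (/ (1 + (2 * INR i + 1) / (INR m - INR i)))
        by (field; lra).
      apply Rle_trans with (exp (- ((2 * INR i + 1) / (INR m - INR i)))).
      - apply exp_le_mono, Ropp_le_contravar. apply Rmult_le_compat_l; [lra|].
        apply Rinv_le_contravar; lra.
      - apply exp_le_inv. apply Rdiv_le_0_compat; lra. }
    apply Rle_trans with (cbin m 0 * exp (- (INR i ^ 2 / (INR m - INR K))) *
      exp (- ((2 * INR i + 1) / (INR m - INR K)))).
    + right. rewrite Rmult_assoc, <- exp_plus. do 2 f_equal. rewrite S_INR. field. lra.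
    + apply Rmult_le_compat; auto; [|left; apply exp_pos].
      apply Rmult_le_pos; [apply cbin_nonneg|left; apply exp_pos].
Qed.

Lemma cos_exp_bounds (x : R) : - PI / 2 <= x <= PI / 2 ->
  1 - x ^ 2 / 2 <= cos x <= exp (- x ^ 2 / 2 + x ^ 4 / 24).
Proof.
  intros (H1 & H2). destruct (cos_bound x 0 H1 H2) as (L & U).
  unfold cos_approx, cos_term in L, U. simpl in L, U. split.
  - apply Rle_trans with (2 := L). right. field.
  - apply Rle_trans with (1 := U). apply Rle_trans with (1 + (- x ^ 2 / 2 + x ^ 4 / 24)); [|apply exp_ineq1_le].
    right. field.
Qed.

Lemma exp_pow (y : R) (n : nat) : exp y ^ n = exp (INR n * y).
Proof.
  induction n.
  - simpl. rewrite Rmult_0_l, exp_0. reflexivity.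
  - rewrite S_INR. simpl. rewrite IHn, <- exp_plus. f_equal. ring.
Qed.

Lemma cos_pow_upper (x : R) (m : nat) : - PI / 2 <= x <= PI / 2 ->
  0 <= cos x ^ (2 * m) <= exp (- (INR m * x ^ 2) + INR m * x ^ 4 / 12) .
Proof.
  intros H. destruct (cos_exp_bounds x H) as (_ & U).
  assert (C0 : 0 <= cos x) by (apply cos_ge_0; lra).
  split; [apply pow_le; auto|].
  apply Rle_trans with (exp (- x ^ 2 / 2 + x ^ 4 / 24) ^ (2 * m)); [apply pow_incr; auto|].
  rewrite exp_pow, mult_INR. right. f_equal. simpl (INR 2). field.
Qed.

Lemma cos_pow_lower (x : R) (m : nat) : Rabs x <= 1 ->
  exp (- (INR m * x ^ 2 / (1 - x ^ 2 / 2))) <= cos x ^ (2 * m).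
Proof.
  intros Hx. apply Rabs_le_between in Hx. assert (P := PI2_3_2).
  destruct (cos_exp_bounds x ltac:(lra)) as (L & _).
  assert (Hx2 : 0 <= x ^ 2 <= 1) by (split; nra).
  set (y := x ^ 2 / 2). assert (Hy : 0 <= y <= 1 / 2) by (unfold y; lra).
  (* This is [1 + w <= exp w] for [w = y / (1 - y)], since [1 + w = 1 / (1 - y)]. *)
  assert (E : exp (- (y / (1 - y))) <= 1 - y).
  { apply Rle_trans with (/ (1 + y / (1 - y))).
    - apply exp_le_inv. apply Rdiv_le_0_compat; lra.
    - right. field. lra. }
  apply Rle_trans with (exp (- (y / (1 - y))) ^ (2 * m)).
  - right. rewrite exp_pow, mult_INR. f_equal. simpl (INR 2). unfold y. field. unfold y in Hy. lra.
  - apply pow_incr. split; [left; apply exp_pos|]. fold y in L. lra.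
Qed.

Lemma gauss_rbounded (c : R) : 0 < c -> rbounded (fun k : Z => exp (- (c * IZR k ^ 2))).
Proof.
  intros Hc.
  assert (Hp : 0 < exp (- (2 * c)) < 1).
  { split; [apply exp_pos|]. rewrite <- exp_0. apply exp_increasing. lra. }
  destruct (superexp_bound (fun k => exp (- (c * INR k ^ 2))) (exp (- (2 * c))) (exp (- c))) as (M & HM & H); auto.
  - apply exp_pos.
  - intros; left; apply exp_pos.
  - intros k. rewrite exp_pow, <- !exp_plus. f_equal. rewrite S_INR. ring.
  - apply rbounded_Z with M; auto.
    + intros; left; apply exp_pos.
    + intros k. rewrite <- INR_IZR_INZ. apply H.
    + intros k. apply Rle_trans with (2 := H k). apply exp_le_mono.
      apply Ropp_le_contravar, Rmult_le_compat_l; [lra|].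
      rewrite minus_IZR, <- INR_IZR_INZ. assert (P := pos_INR k). nra.
Qed.

(** The value [1 / sqrt PI] of the limit is not needed: the argument of [eta_inversion] forces it. *)
Lemma central_binomial_lim : exists lambda : R, is_lim_seq (fun m => sqrt (INR m) * (cbin m 0 / 4 ^ m)) lambda.
Proof.
  set (c := fun m => cbin m 0 / 4 ^ m).
  assert (Hc : forall m, c (S m) = c m * ((2 * INR m + 1) / (2 * INR m + 2))).
  { intros m. unfold c. rewrite cbin_rec. replace (0 - 1)%Z with (- (0 + 1))%Z by lia.
    rewrite cbin_sym. change (0 + 1)%Z with (Z.of_nat 1). rewrite (cbin_step m 0) by lia.
    change (Z.of_nat 0) with 0%Z. simpl INR. assert (P := pos_INR m). simpl. field.
    repeat split; try lra; apply pow_nonzero; lra. }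
  assert (Hpos : forall m, 0 < c m).
  { intros m. apply Rdiv_lt_0_compat; [apply cbin_0_pos|apply pow_lt; lra]. }
  (* [(2m+1) c_m^2] decreases from 1 while [m c_m^2] increases, so the latter has a finite limit. *)
  assert (Hb : forall m, (2 * INR m + 1) * c m ^ 2 <= 1).
  { induction m.
    - unfold c, cbin, ifac. simpl. replace (1 * (/ 1 * / 1)) with 1 by field. lra.
    - rewrite Hc, S_INR. assert (P := pos_INR m). assert (Pm := Hpos m).
      apply Rle_trans with (2 := IHm).
      replace ((2 * (INR m + 1) + 1) * (c m * ((2 * INR m + 1) / (2 * INR m + 2))) ^ 2) with
        ((2 * INR m + 1) * c m ^ 2 * ((2 * INR m + 3) * (2 * INR m + 1) / (2 * INR m + 2) ^ 2)) by (field; lra).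
      rewrite <- (Rmult_1_r ((2 * INR m + 1) * c m ^ 2)) at 2.
      apply Rmult_le_compat_l; [apply Rmult_le_pos; [lra|]; apply pow_le; lra|].
      apply Rmult_le_reg_r with ((2 * INR m + 2) ^ 2); [apply pow_lt; lra|].
      unfold Rdiv. rewrite Rmult_assoc, Rinv_l by (apply pow_nonzero; lra). nra. }
  assert (Hlim : ex_finite_lim_seq (fun m => INR m * c m ^ 2)).
  { apply ex_finite_lim_seq_incr with 1.
    - intros m. rewrite Hc, S_INR. assert (P := pos_INR m). assert (Pm := Hpos m).
      replace ((INR m + 1) * (c m * ((2 * INR m + 1) / (2 * INR m + 2))) ^ 2) with
        (c m ^ 2 * ((2 * INR m + 1) ^ 2 / (4 * (INR m + 1)))) by (field; lra).
      rewrite Rmult_comm. apply Rmult_le_compat_l; [apply pow_le; lra|].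
      apply Rmult_le_reg_r with (4 * (INR m + 1)); [lra|].
      unfold Rdiv. rewrite Rmult_assoc, Rinv_l by lra. nra.
    - intros m. assert (P := pos_INR m). assert (Pm := Hpos m). apply Rle_trans with (2 := Hb m).
      apply Rmult_le_compat_r; [apply pow_le; lra|lra]. }
  destruct Hlim as (l & Hl). exists (sqrt l).
  apply is_lim_seq_ext with (fun m => sqrt (INR m * c m ^ 2)).
  - intros m. rewrite sqrt_mult by (try apply pos_INR; apply pow_le; left; apply Hpos).
    rewrite sqrt_pow2 by (left; apply Hpos). reflexivity.
  - apply (is_lim_seq_continuous sqrt); auto. apply continuity_pt_sqrt.
    apply (is_lim_seq_le (fun _ => 0) (fun m => INR m * c m ^ 2) 0 l); auto.
    + intros m. apply Rmult_le_pos; [apply pos_INR|apply pow_le; left; apply Hpos].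
    + apply is_lim_seq_const.
Qed.

Lemma lsum_ext_in {I} (f g : I -> C) l : (forall i, In i l -> f i = g i) -> lsum f l = lsum g l.
Proof. intros H. induction l; simpl; [reflexivity|]. rewrite IHl, H; auto with datatypes. Qed.

(** Polya's identity is used with [2r], [r = n + 1], sample points and exponent [m n] close to [s r^2]. *)
Section ThetaLimit.
Variables (s : R).
Hypothesis Hs : 0 < s.

Let m (n : nat) : nat := Z.to_nat (up (s * INR (S n) ^ 2)).
(** In terms of [u], which tends to [s], and of the mesh [v], which tends to 0, the bounds on cosine
    powers and binomial coefficients become continuous expressions. *)
Let u (n : nat) : R := INR (m n) / INR (S n) ^ 2.
Let v (n : nat) : R := / INR (S n).

Lemma sample_exponent_bounds (n : nat) : s * INR (S n) ^ 2 < INR (m n) <= s * INR (S n) ^ 2 + 1.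
Proof.
  assert (P : 0 < s * INR (S n) ^ 2) by (apply Rmult_lt_0_compat; [lra|apply pow_lt, lt_0_INR; lia]).
  destruct (archimed (s * INR (S n) ^ 2)) as (H1 & H2). unfold m.
  assert (0 < up (s * INR (S n) ^ 2))%Z by (apply lt_IZR; lra).
  rewrite (INR_IZR_INZ (Z.to_nat _)), Z2Nat.id by lia. lra.
Qed.

Lemma mesh_lim : is_lim_seq v 0.
Proof.
  apply (is_lim_seq_incr_1 (fun n => / INR n)). replace (Finite 0) with (Rbar_inv p_infty) by reflexivity.
  apply is_lim_seq_inv; [apply is_lim_seq_INR|discriminate].
Qed.

Lemma mesh_pos (n : nat) : 0 < v n <= 1.
Proof.
  unfold v. assert (P := pos_INR n). rewrite S_INR. split; [apply Rinv_0_lt_compat; lra|].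
  rewrite <- Rinv_1. apply Rinv_le_contravar; lra.
Qed.

Lemma exponent_ratio_bounds (n : nat) : s <= u n <= s + v n ^ 2.
Proof.
  destruct (sample_exponent_bounds n) as (H1 & H2). unfold u, v.
  assert (P : 0 < INR (S n)) by (apply lt_0_INR; lia).
  assert (P2 : 0 < INR (S n) ^ 2) by (apply pow_lt; auto).
  split; apply Rmult_le_reg_r with (INR (S n) ^ 2); auto.
  - unfold Rdiv. rewrite Rmult_assoc, Rinv_l by lra. lra.
  - unfold Rdiv. rewrite Rmult_assoc, Rinv_l by lra.
    replace ((s + (/ INR (S n)) ^ 2) * INR (S n) ^ 2) with (s * INR (S n) ^ 2 + 1) by (field; lra). lra.
Qed.

Lemma exponent_ratio_lim : is_lim_seq u s.
Proof.
  apply is_lim_seq_le_le with (fun _ => s) (fun n => s + v n ^ 2).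
  - apply exponent_ratio_bounds.
  - apply is_lim_seq_const.
  - replace (Finite s) with (Finite (s + 0 ^ 2)) by (f_equal; ring).
    apply (is_lim_seq_continuous (fun x => s + x ^ 2) v 0); [reg|apply mesh_lim].
Qed.

Lemma exponent_ratio_mesh (n : nat) : INR (m n) = u n / v n ^ 2.
Proof. unfold u, v. assert (P : 0 < INR (S n)) by (apply lt_0_INR; lia). field. lra. Qed.

Let F (n : nat) (j : Z) : C :=
  if in_dec Z.eq_dec j (zlist (S n)) then
    RtoC (cos (IZR (2 * j + 1) * (PI / INR (4 * S n))) ^ (2 * m n)) else RtoC 0.

Let a (j : Z) : R := IZR (2 * j + 1) * (PI / 4).

Lemma sample_angle (n : nat) (j : Z) : IZR (2 * j + 1) * (PI / INR (4 * S n)) = a j * v n.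
Proof.
  unfold a, v. rewrite mult_INR. assert (P : 0 < INR (S n)) by (apply lt_0_INR; lia).
  replace (INR 4) with 4 by (simpl; ring). field. lra.
Qed.

(** Inside the window the angle satisfies [|x| <= PI / 2], so [x^2 <= 4] and the quartic correction
    is at most a third of [m x^2]. Moreover [m x^2 >= s (2j+1)^2 (PI/4)^2 >= (9/16) s j^2], as
    [PI/4 >= 3/4]; and [2/3 * 9/16 = 3/8]. *)
Lemma cosine_term_bound (n : nat) (j : Z) : Cmod (F n j) <= exp (- (3 * s / 8 * IZR j ^ 2)).
Proof.
  unfold F. destruct in_dec as [H|H].
  - rewrite sample_angle. set (x := a j * v n). apply zlist_In in H.
    assert (P : 0 < INR (S n)) by (apply lt_0_INR; lia). assert (HP := PI_RGT_0).
    assert (HP2 := PI2_3_2). assert (HP3 := PI_4).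
    assert (Hx : - PI / 2 <= x <= PI / 2).
    { assert (Hj : - (2 * INR (S n)) <= IZR (2 * j + 1) <= 2 * INR (S n)).
      { rewrite INR_IZR_INZ. rewrite <- mult_IZR, <- opp_IZR. split; apply IZR_le; lia. }
      replace (PI / 2) with ((2 * INR (S n)) * (PI / 4) * v n) by (unfold v; field; lra).
      replace (- PI / 2) with (- (2 * INR (S n)) * (PI / 4) * v n) by (unfold v; field; lra).
      destruct (mesh_pos n). unfold x, a. split; repeat (apply Rmult_le_compat_r; [lra|]); lra. }
    destruct (cos_pow_upper x (m n) Hx) as (H1 & H2).
    rewrite Cmod_R, Rabs_pos_eq by auto. apply Rle_trans with (1 := H2). apply exp_le_mono.
    assert (Hx2 : 0 <= x ^ 2 <= 4) by (split; nra).
    assert (Hm : 9 * s / 16 * IZR j ^ 2 <= INR (m n) * x ^ 2).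
    { rewrite exponent_ratio_mesh. unfold x. replace (u n / v n ^ 2 * (a j * v n) ^ 2) with (u n * a j ^ 2)
        by (field; destruct (mesh_pos n); lra).
      apply Rle_trans with (s * a j ^ 2); [|apply Rmult_le_compat_r; [apply pow2_ge_0|apply exponent_ratio_bounds]].
      assert (Ha : IZR j ^ 2 * (9 / 16) <= a j ^ 2).
      { unfold a. rewrite Rpow_mult_distr. apply Rmult_le_compat; try lra; [apply pow2_ge_0| |nra].
        rewrite !pow_IZR. apply IZR_le. nia. }
      nra. }
    assert (H0 := pos_INR (m n)).
    replace (INR (m n) * x ^ 4 / 12) with (INR (m n) * x ^ 2 * (x ^ 2 / 12)) by field.
    assert (INR (m n) * x ^ 2 * (x ^ 2 / 12) <= INR (m n) * x ^ 2 * / 3) by (apply Rmult_le_compat_l; nra).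
    lra.
  - rewrite Cmod_0. left. apply exp_pos.
Qed.

Lemma cosine_term_lim (j : Z) : Clim (fun n => F n j) (RtoC (exp (- (s * a j ^ 2)))).
Proof.
  apply Clim_ext_loc with (fun n => RtoC (cos (a j * v n) ^ (2 * m n))).
  - exists (S (Z.to_nat (Z.abs j))). intros n Hn. unfold F. destruct in_dec as [H|H].
    + rewrite sample_angle. reflexivity.
    + exfalso. apply H, zlist_In. lia.
  - apply Clim_RtoC.
    apply is_lim_seq_le_le_loc with (fun n => exp (- (u n * a j ^ 2 / (1 - (a j * v n) ^ 2 / 2))))
      (fun n => exp (- (u n * a j ^ 2) + u n * a j ^ 2 * (a j * v n) ^ 2 / 12)).
    + assert (Hv : is_lim_seq (fun n => Rabs (a j * v n)) 0).
      { apply -> is_lim_seq_abs_0. replace (Finite 0) with (Finite (a j * 0)) by (f_equal; ring).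
        apply (is_lim_seq_continuous (fun x => a j * x) v 0); [reg|apply mesh_lim]. }
      apply is_lim_seq_spec in Hv. destruct (Hv (mkposreal 1 Rlt_0_1)) as (N & HN). exists N. intros n Hn.
      specialize (HN n Hn). simpl in HN. rewrite Rminus_0_r, Rabs_Rabsolu in HN.
      assert (E : INR (m n) * (a j * v n) ^ 2 = u n * a j ^ 2).
      { rewrite exponent_ratio_mesh. field. destruct (mesh_pos n). lra. }
      rewrite <- E. split.
      * apply cos_pow_lower. lra.
      * assert (Hb : - PI / 2 <= a j * v n <= PI / 2).
        { apply Rabs_lt_between in HN. assert (P := PI2_3_2). lra. }
        destruct (cos_pow_upper _ (m n) Hb) as (_ & H). apply Rle_trans with (1 := H). right. f_equal. field.
    + assert (Hd : is_lim_seq (fun n => u n * a j ^ 2 / (1 - (a j * v n) ^ 2 / 2))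
                     (s * a j ^ 2 / (1 - (a j * 0) ^ 2 / 2))).
      { apply is_lim_seq_div'.
        - apply (is_lim_seq_continuous (fun x => x * a j ^ 2) u s); [reg|apply exponent_ratio_lim].
        - apply (is_lim_seq_continuous (fun x => 1 - (a j * x) ^ 2 / 2) v 0); [reg|apply mesh_lim].
        - nra. }
      replace (s * a j ^ 2 / (1 - (a j * 0) ^ 2 / 2)) with (s * a j ^ 2) in Hd by field.
      apply (is_lim_seq_continuous (fun x => exp (- x)) _ _); [reg|exact Hd].
    + assert (Hd : is_lim_seq (fun n => - (u n * a j ^ 2) + u n * a j ^ 2 * ((a j * v n) ^ 2 / 12))
                     (- (s * a j ^ 2) + s * a j ^ 2 * ((a j * 0) ^ 2 / 12))).
      { apply is_lim_seq_plus'.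
        - apply (is_lim_seq_continuous (fun x => - (x * a j ^ 2)) u s); [reg|apply exponent_ratio_lim].
        - apply is_lim_seq_mult'.
          + apply (is_lim_seq_continuous (fun x => x * a j ^ 2) u s); [reg|apply exponent_ratio_lim].
          + apply (is_lim_seq_continuous (fun x => (a j * x) ^ 2 / 12) v 0); [reg|apply mesh_lim]. }
      replace (- (s * a j ^ 2) + s * a j ^ 2 * ((a j * 0) ^ 2 / 12)) with (- (s * a j ^ 2)) in Hd by field.
      apply (is_lim_seq_continuous exp) in Hd; [|reg].
      apply is_lim_seq_ext with (2 := Hd). intros n. f_equal. field.
Qed.

Let G (n : nat) (k : Z) : C :=
  (zpow (- (1)) k * RtoC (cbin (m n) (Z.of_nat (2 * S n) * k) / cbin (m n) 0))%C.

Lemma Cmod_zpow_m1 (k : Z) : Cmod (zpow (- (1))%C k) = 1.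
Proof.
  rewrite <- cis_PI_mult. unfold cis, Cmod. simpl fst. simpl snd.
  replace (cos (IZR k * PI) ^ 2 + sin (IZR k * PI) ^ 2) with 1; [apply sqrt_1|].
  rewrite <- (sin2_cos2 (IZR k * PI)). unfold Rsqr. ring.
Qed.

Lemma cbin_abs (M r : nat) (k : Z) :
  cbin M (Z.of_nat (2 * r) * k) = cbin M (Z.of_nat (2 * r * Z.to_nat (Z.abs k))).
Proof.
  destruct (Z.abs_spec k) as [(H & E)|(H & E)]; rewrite E.
  - f_equal. lia.
  - rewrite <- cbin_sym. f_equal. lia.
Qed.

Lemma INR_abs_sq (k : Z) : INR (Z.to_nat (Z.abs k)) ^ 2 = IZR k ^ 2.
Proof. rewrite INR_IZR_INZ, Z2Nat.id, abs_IZR, pow2_abs by lia. reflexivity. Qed.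

(** The index is [i = 2 r |k|] with [r = n + 1], and [m <= (s+1) r^2]; hence
    [i^2 / (2m) >= 2 k^2 / (s+1)] in the bound [cbin_upper] with [K = m]. *)
Lemma binomial_term_bound (n : nat) (k : Z) : Cmod (G n k) <= exp (- (2 / (s + 1) * IZR k ^ 2)).
Proof.
  unfold G. rewrite Cmod_mult, Cmod_zpow_m1, Rmult_1_l, Cmod_R, cbin_abs.
  set (i := (2 * S n * Z.to_nat (Z.abs k))%nat). assert (P0 := cbin_0_pos (m n)).
  rewrite Rabs_pos_eq by (apply Rdiv_le_0_compat; auto; apply cbin_nonneg).
  apply Rmult_le_reg_r with (cbin (m n) 0); auto. unfold Rdiv at 1. rewrite Rmult_assoc, Rinv_l, Rmult_1_r by lra.
  destruct (le_lt_dec i (m n)) as [H|H].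
  - apply Rle_trans with (1 := cbin_upper (m n) (m n) i H (le_n _)). rewrite Rmult_comm.
    apply Rmult_le_compat_r; [lra|]. apply exp_le_mono, Ropp_le_contravar.
    destruct (sample_exponent_bounds n) as (_ & Hm). assert (P : 1 <= INR (S n)) by (rewrite S_INR; assert (Q := pos_INR n); lra).
    replace (INR i ^ 2) with (4 * INR (S n) ^ 2 * IZR k ^ 2).
    + assert (M0 : 0 < INR (m n)) by (destruct (sample_exponent_bounds n); nra).
      assert (H1 : INR (m n) <= (s + 1) * INR (S n) ^ 2) by nra.
      assert (H2 : 2 / (s + 1) <= 4 * INR (S n) ^ 2 / (INR (m n) + INR (m n))).
      { apply Rmult_le_reg_r with ((s + 1) * INR (m n)); [apply Rmult_lt_0_compat; lra|].
        replace (2 / (s + 1) * ((s + 1) * INR (m n))) with (2 * INR (m n)) by (field; lra).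
        replace (4 * INR (S n) ^ 2 / (INR (m n) + INR (m n)) * ((s + 1) * INR (m n))) with
          (2 * ((s + 1) * INR (S n) ^ 2)) by (field; lra). lra. }
      assert (H3 := pow2_ge_0 (IZR k)).
      replace (4 * INR (S n) ^ 2 * IZR k ^ 2 / (INR (m n) + INR (m n))) with
        (4 * INR (S n) ^ 2 / (INR (m n) + INR (m n)) * IZR k ^ 2) by (field; lra).
      apply Rmult_le_compat_r; lra.
    + unfold i. rewrite <- INR_abs_sq, !mult_INR. simpl (INR 2). ring.
  - rewrite cbin_out by lia. apply Rmult_le_pos; [left; apply exp_pos|lra].
Qed.

Lemma binomial_term_lim (k : Z) : Clim (fun n => G n k) (zpow (- (1)) k * RtoC (exp (- (4 / s * IZR k ^ 2))))%C.
Proof.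
  set (b := INR (Z.to_nat (Z.abs k))). assert (Hb : 0 <= b) by apply pos_INR.
  unfold G. apply Clim_mult; [apply Clim_const|]. apply Clim_RtoC.
  (* [e = -1] and [e = 1] describe the lower and the upper Gaussian bound with [K = i]; both have
     the same limit. *)
  assert (L : forall e, is_lim_seq (fun n => exp (- (4 * b ^ 2 / (u n + e * (2 * b) * v n))))
    (exp (- (4 / s * IZR k ^ 2)))).
  { intros e.
    assert (Hd : is_lim_seq (fun n => 4 * b ^ 2 / (u n + e * (2 * b) * v n)) (4 * b ^ 2 / (s + e * (2 * b) * 0))).
    { apply is_lim_seq_div'; [apply is_lim_seq_const| |lra].
      apply is_lim_seq_plus'; [apply exponent_ratio_lim|].
      apply (is_lim_seq_continuous (fun x => e * (2 * b) * x) v 0); [reg|apply mesh_lim]. }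
    replace (4 * b ^ 2 / (s + e * (2 * b) * 0)) with (4 / s * IZR k ^ 2) in Hd
      by (unfold b; rewrite <- INR_abs_sq; field; lra).
    apply (is_lim_seq_continuous (fun x => exp (- x)) _ _); [reg|exact Hd]. }
  apply is_lim_seq_le_le_loc with (2 := L (-1)) (3 := L 1).
  assert (Hw : is_lim_seq (fun n => u n - 2 * b * v n) (s - 2 * b * 0)).
  { apply is_lim_seq_minus'; [apply exponent_ratio_lim|].
    apply (is_lim_seq_continuous (fun x => 2 * b * x) v 0); [reg|apply mesh_lim]. }
  apply is_lim_seq_spec in Hw. destruct (Hw (mkposreal s Hs)) as (N & HN). exists N. intros n Hn.
  specialize (HN n Hn). simpl in HN. apply Rabs_lt_between in HN.
  rewrite cbin_abs. set (i := (2 * S n * Z.to_nat (Z.abs k))%nat).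
  assert (P0 := cbin_0_pos (m n)). destruct (mesh_pos n) as (V0 & _).
  assert (Hi : INR i = 2 * b / v n) by (unfold i, b, v, Rdiv; rewrite !mult_INR, Rinv_inv; simpl (INR 2); ring).
  assert (Him : (i < m n)%nat).
  { apply INR_lt. rewrite Hi, exponent_ratio_mesh. apply Rmult_lt_reg_r with (v n ^ 2); [apply pow_lt; auto|].
    replace (2 * b / v n * v n ^ 2) with (2 * b * v n) by (field; lra).
    replace (u n / v n ^ 2 * v n ^ 2) with (u n) by (field; lra). lra. }
  assert (D : 2 * b * v n < u n) by lra. assert (U0 : 0 < u n) by (destruct (exponent_ratio_bounds n); lra).
  assert (B0 : 0 <= 2 * b * v n) by (repeat apply Rmult_le_pos; lra).
  assert (Q1 : INR i ^ 2 / (INR (m n) - INR i) = 4 * b ^ 2 / (u n + -1 * (2 * b) * v n)).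
  { rewrite Hi, exponent_ratio_mesh. field. repeat split; try lra. }
  assert (Q2 : INR i ^ 2 / (INR (m n) + INR i) = 4 * b ^ 2 / (u n + 1 * (2 * b) * v n)).
  { rewrite Hi, exponent_ratio_mesh. field. repeat split; try lra. }
  rewrite <- Q1, <- Q2. split; apply Rmult_le_reg_r with (cbin (m n) 0); auto;
    replace (cbin (m n) (Z.of_nat i) / cbin (m n) 0 * cbin (m n) 0) with (cbin (m n) (Z.of_nat i))
      by (field; lra); rewrite Rmult_comm.
  - apply cbin_lower; auto.
  - apply cbin_upper; auto. lia.
Qed.

Lemma theta_limit (lambda : R) (SF SG : C) :
  is_lim_seq (fun n => sqrt (INR n) * (cbin n 0 / 4 ^ n)) lambda ->
  hassum (fun j => RtoC (exp (- (s * (IZR (2 * j + 1) * (PI / 4)) ^ 2)))) SF ->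
  hassum (fun k => zpow (- (1)) k * RtoC (exp (- (4 / s * IZR k ^ 2))))%C SG ->
  SF = (SG * RtoC (2 * lambda / sqrt s))%C.
Proof.
  intros Hl HF HG.
  set (SFn := fun n => lsum (F n) (zlist (S n))).
  assert (LF : Clim SFn SF).
  { apply (hassum_dominated Z.eq_dec F _ _ SFn SF cosine_term_bound (gauss_rbounded (3 * s / 8) ltac:(lra)) cosine_term_lim); auto.
    intros n. apply hassum_finite; [exact Z.eq_dec|apply zlist_NoDup|].
    intros j Hj. unfold F. destruct in_dec; tauto. }
  (* Divided by [4 ^ m n], Polya's identity reads [SFn n = rho n] times the sum of the [G n k];
     dominated convergence applies to each side, and [rho] tends to [2 lambda / sqrt s]. *)
  set (rho := fun n => INR (2 * S n) * cbin (m n) 0 / 4 ^ m n).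
  assert (Hrho : forall n, 0 < rho n).
  { intros n. apply Rdiv_lt_0_compat; [|apply pow_lt; lra].
    apply Rmult_lt_0_compat; [apply lt_0_INR; lia|apply cbin_0_pos]. }
  assert (LG : Clim (fun n => SFn n * RtoC (/ rho n))%C SG).
  { apply (hassum_dominated Z.eq_dec G _ _ _ SG binomial_term_bound
      (gauss_rbounded (2 / (s + 1)) ltac:(apply Rdiv_lt_0_compat; lra)) binomial_term_lim); auto.
    intros n. assert (H := polya_identity (S n) (m n) ltac:(lia)).
    apply (hassum_scal (RtoC (/ (INR (2 * S n) * cbin (m n) 0)))) in H.
    assert (P0 := cbin_0_pos (m n)). assert (P1 : 0 < INR (2 * S n)) by (apply lt_0_INR; lia).
    assert (P4 : 0 < 4 ^ m n) by (apply pow_lt; lra).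
    replace (SFn n * RtoC (/ rho n))%C with (RtoC (/ (INR (2 * S n) * cbin (m n) 0)) * lsum
      (fun j => RtoC ((2 * cos (IZR (2 * j + 1) * (PI / INR (4 * S n)))) ^ (2 * m n))) (zlist (S n)))%C.
    - apply hassum_ext with (2 := H). intros k. unfold G.
      rewrite Rinv_mult. unfold Rdiv. rewrite !RtoC_mult.
      transitivity (RtoC (/ INR (2 * S n) * INR (2 * S n)) * (RtoC (/ cbin (m n) 0) *
        (zpow (- (1)) k * RtoC (cbin (m n) (Z.of_nat (2 * S n) * k)))))%C; [rewrite RtoC_mult; ring|].
      rewrite Rinv_l by lra. ring.
    - transitivity (RtoC (/ (INR (2 * S n) * cbin (m n) 0)) * (RtoC (4 ^ m n) * SFn n))%C.
      + f_equal. unfold SFn. rewrite <- lsum_scal. apply lsum_ext_in. intros j Hj. unfold F.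
        destruct in_dec; [|tauto]. rewrite <- RtoC_mult, Rpow_mult_distr, pow_mult.
        replace (2 ^ 2) with 4 by ring. reflexivity.
      + rewrite (Cmult_comm (SFn n)), Cmult_assoc, <- RtoC_mult. do 2 f_equal. unfold rho. field. lra. }
  assert (LR : is_lim_seq rho (2 * lambda / sqrt s)).
  { apply is_lim_seq_ext with (fun n => 2 * (sqrt (INR (m n)) * (cbin (m n) 0 / 4 ^ m n)) / sqrt (u n)).
    - intros n. unfold rho, u. assert (M0 : 0 < INR (m n)).
      { destruct (sample_exponent_bounds n). assert (0 < s * INR (S n) ^ 2); [|lra].
        apply Rmult_lt_0_compat; [lra|apply pow_lt, lt_0_INR; lia]. }
      assert (P : 0 < INR (S n)) by (apply lt_0_INR; lia).
      rewrite sqrt_div by (try apply pow_lt; lra). rewrite sqrt_pow2 by lra. rewrite mult_INR. simpl (INR 2).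
      assert (0 < sqrt (INR (m n))) by (apply sqrt_lt_R0; auto). field.
      repeat split; try lra. apply pow_nonzero. lra.
    - apply is_lim_seq_div'.
      + apply is_lim_seq_mult'; [apply is_lim_seq_const|].
        apply (is_lim_seq_subseq (fun n => sqrt (INR n) * (cbin n 0 / 4 ^ n)) lambda m); auto.
        intros P (N & HN). destruct (INR_unbounded (INR N / s)) as (N' & HN').
        exists N'. intros n Hn. apply HN, INR_le. destruct (sample_exponent_bounds n) as (B & _).
        assert (H1 : INR N' <= INR (S n)) by (apply le_INR; lia).
        assert (H2 : 1 <= INR (S n)) by (rewrite S_INR; assert (Q := pos_INR n); lra).
        assert (H3 : INR N <= s * INR (S n)).
        { replace (INR N) with (s * (INR N / s)) by (field; lra). apply Rmult_le_compat_l; lra. }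
        assert (H4 : s * INR (S n) <= s * INR (S n) ^ 2) by (apply Rmult_le_compat_l; nra). lra.
      + apply (is_lim_seq_continuous sqrt u s); [apply continuity_pt_sqrt; lra|apply exponent_ratio_lim].
      + assert (0 < sqrt s) by (apply sqrt_lt_R0; auto). lra. }
  apply (Clim_unique SFn); auto.
  apply Clim_ext_loc with (fun n => (SFn n * RtoC (/ rho n)) * RtoC (rho n))%C.
  - exists 0%nat. intros n _. rewrite <- Cmult_assoc, <- RtoC_mult, Rinv_l by (specialize (Hrho n); lra). ring.
  - apply Clim_mult; auto. apply Clim_RtoC, LR.
Qed.

End ThetaLimit.

(** * Gauss's product formulas and the inversion of eta *)

Lemma zpow_exp (x : R) (n : Z) : zpow (RtoC (exp x)) n = RtoC (exp (IZR n * x)).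
Proof.
  assert (N : RtoC (exp x) <> 0) by (apply RtoC_neq0; assert (H := exp_pos x); lra).
  induction n using Z.peano_ind.
  - rewrite zpow_0, Rmult_0_l, exp_0. reflexivity.
  - replace (Z.succ n) with (n + 1)%Z by lia. rewrite zpow_succ, IHn by exact N.
    rewrite plus_IZR, <- RtoC_mult, <- exp_plus. do 2 f_equal. ring.
  - assert (H := zpow_succ _ (Z.pred n) N). replace (Z.pred n + 1)%Z with n in H by lia. rewrite IHn in H.
    transitivity (RtoC (exp (- x)) * RtoC (exp (IZR n * x)))%C.
    + rewrite H, Cmult_assoc, <- RtoC_mult, <- exp_plus. replace (- x + x) with 0 by ring. rewrite exp_0. ring.
    + rewrite <- RtoC_mult, <- exp_plus. do 2 f_equal.
      replace (Z.pred n) with (n - 1)%Z by lia. rewrite minus_IZR. ring.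
Qed.

Lemma exp_neg_01 (x : R) : 0 < x -> 0 < exp (- x) < 1.
Proof. intros H. split; [apply exp_pos|]. rewrite <- exp_0. apply exp_increasing. lra. Qed.

(** The series is the sum of [(-1)^n q^(n^2)]. In base [q^2] at [u = -q] both factors of the triple
    product equal [1 - q^(2n-1)]. *)
Lemma theta_alternating (q : R) (S : C) : 0 < q < 1 -> hassum (th (q ^ 2) (RtoC (- q))) S ->
  S = RtoC (E q ^ 2 / E (q ^ 2)).
Proof.
  intros Hq HS. assert (Hq2 := pow_lt_1 q 2 Hq ltac:(lia)).
  assert (P1 := E_pos q Hq). assert (P2 := E_pos _ Hq2).
  assert (J := jacobi_triple_product (q ^ 2) (RtoC (- q)) S Hq2 ltac:(apply RtoC_neq0; lra) HS).
  assert (L : Clim (jprod (q ^ 2) (RtoC (- q))) (RtoC ((E q / E (q ^ 2)) ^ 2))).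
  { apply Clim_ext_loc with (fun N => RtoC (prodR (fun n => (1 - q ^ aexp 1 2 n) ^ 2) N)).
    - exists 0%nat. intros N _. induction N; [reflexivity|]. cbn [prodR jprod].
      rewrite <- IHN, RtoC_mult. f_equal. rewrite <- !RtoC_pow, <- RtoC_div, <- !RtoC_mult, <- !RtoC_plus,
        <- RtoC_mult by lra. f_equal.
      replace (aexp 1 2 (Datatypes.S N)) with (2 * N + 1)%nat by (unfold aexp; lia).
      rewrite <- !pow_mult. replace (2 * Datatypes.S N)%nat with (2 * N + 2)%nat by lia.
      rewrite !pow_add. field. lra.
    - apply Clim_RtoC. rewrite <- aprod_1_2 by auto.
      destruct (has_prod_pow _ 2 _ (has_prod_aprod 1 2 q ltac:(lia) ltac:(lia) Hq)) as (G & <-).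
      apply inf_prod_lim, G. }
  assert (U := Clim_unique _ _ _ J L).
  replace S with (S / RtoC (E (q ^ 2)) * RtoC (E (q ^ 2)))%C by (field; apply RtoC_neq0; lra).
  rewrite U, <- RtoC_mult. f_equal. field. lra.
Qed.

(** The series is the sum of [q^(n(n+1)/2)]. At [u = q] the two families of factors are [1 + q^n],
    one for [1 <= n <= N] twice but for an offset: the extra [1 + q^0 = 2] gives the factor 2, and
    the missing [1 + q^N] tends to 1. *)
Lemma theta_triangular (q : R) (S : C) : 0 < q < 1 -> hassum (th q (RtoC q)) S ->
  S = RtoC (2 * E (q ^ 2) ^ 2 / E q).
Proof.
  intros Hq HS. assert (Hq2 := pow_lt_1 q 2 Hq ltac:(lia)).
  assert (P1 := E_pos q Hq). assert (P2 := E_pos _ Hq2).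
  assert (J := jacobi_triple_product q (RtoC q) S Hq ltac:(apply RtoC_neq0; lra) HS).
  assert (G1 : egeo (fun n => 1 - q ^ n - 1)) by (apply egeo_1mpow; auto).
  destruct (has_prod_E 2 q ltac:(lia) Hq) as (G2 & I2).
  assert (D : forall n, (1 <= n)%nat -> 1 - q ^ n <> 0).
  { intros n Hn. assert (Hn' := pow_lt_1 q n Hq Hn). lra. }
  assert (L : Clim (jprod q (RtoC q)) (RtoC ((E (q ^ 2) / E q) ^ 2 * 2 / (1 + 0)))).
  { apply Clim_ext_loc with (fun N => RtoC (prodR (fun n => (1 - (q ^ n) ^ 2) / (1 - q ^ n)) N ^ 2 * 2 / (1 + q ^ N))).
    - exists 0%nat. intros N _. induction N.
      + simpl. f_equal. field.
      + cbn [jprod]. rewrite <- IHN, <- !RtoC_pow, <- RtoC_div, <- !RtoC_mult, <- !RtoC_plus,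
          <- !RtoC_mult by lra. f_equal. cbn [prodR]. specialize (D (Datatypes.S N) ltac:(lia)).
        assert (A1 : 0 < q ^ N) by (apply pow_lt; lra).
        simpl in *. field. nra.
    - apply Clim_RtoC. apply is_lim_seq_div'.
      + apply (is_lim_seq_continuous (fun x => x ^ 2 * 2) (prodR (fun n => (1 - (q ^ n) ^ 2) / (1 - q ^ n)))); [reg|].
        rewrite <- I2. unfold E. rewrite <- inf_prod_div by auto. apply inf_prod_lim.
        apply (egeo_prod (fun n => 1 - (q ^ n) ^ 2) (fun n => / (1 - q ^ n))); auto. apply egeo_inv; auto.
      + apply is_lim_seq_plus'; [apply is_lim_seq_const|]. apply is_lim_seq_geom. rewrite Rabs_pos_eq; lra.
      + lra. }
  assert (U := Clim_unique _ _ _ J L).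
  replace S with (S / RtoC (E q) * RtoC (E q))%C by (field; apply RtoC_neq0; lra).
  rewrite U, <- RtoC_mult. f_equal. field. lra.
Qed.

(** Dedekind's eta function at the point [i t] of the upper half-plane. *)
Definition eta (t : R) : R := exp (- (PI * t / 12)) * E (exp (- (2 * PI * t))).

Lemma eta_pos (t : R) : 0 < t -> 0 < eta t.
Proof.
  intros Ht. apply Rmult_lt_0_compat; [apply exp_pos|].
  apply E_pos, exp_neg_01. assert (P := PI_RGT_0). nra.
Qed.

Lemma E_eta (k : nat) (t : R) : E (exp (- (2 * PI * t)) ^ k) = exp (PI * (INR k * t) / 12) * eta (INR k * t).
Proof.
  unfold eta. rewrite <- Rmult_assoc, <- exp_plus, exp_pow.
  replace (PI * (INR k * t) / 12 + - (PI * (INR k * t) / 12)) with 0 by ring.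
  rewrite exp_0, Rmult_1_l. do 2 f_equal. ring.
Qed.

(** [theta_limit] at [s = 4 t / PI]: this choice makes the cosine side a series in [exp(-2 PI t)]
    over triangular numbers and the binomial side the alternating series in [exp(-PI/t)], both
    evaluated by the preceding product formulas. *)
Lemma theta_eta (lambda t : R) : 0 < t ->
  is_lim_seq (fun n => sqrt (INR n) * (cbin n 0 / 4 ^ n)) lambda ->
  2 * (eta (2 * t) ^ 2 / eta t) =
  eta (/ t / 2) ^ 2 / eta (/ t) * (2 * lambda / sqrt (4 * t / PI)).
Proof.
  intros Ht Hl. assert (P := PI_RGT_0). set (s := 4 * t / PI).
  assert (Hs : 0 < s) by (apply Rdiv_lt_0_compat; lra).
  set (q := exp (- (PI * / t))). set (Q := exp (- (2 * PI * t))).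
  assert (Hit : 0 < / t) by (apply Rinv_0_lt_compat; auto).
  assert (Hq : 0 < q < 1) by (apply exp_neg_01; nra).
  assert (HQ : 0 < Q < 1) by (apply exp_neg_01; nra).
  destruct (th_hassum_exists (q ^ 2) (RtoC (- q)) (pow_lt_1 q 2 Hq ltac:(lia)) ltac:(apply RtoC_neq0; lra))
    as (SG & HG).
  destruct (th_hassum_exists Q (RtoC Q) HQ ltac:(apply RtoC_neq0; lra)) as (SF & HF).
  assert (VG := theta_alternating q SG Hq HG). assert (VF := theta_triangular Q SF HQ HF).
  assert (T : (RtoC (exp (- (PI * t / 4))) * SF)%C = (SG * RtoC (2 * lambda / sqrt s))%C).
  { apply (theta_limit s Hs lambda); auto.
    - apply (hassum_scal (RtoC (exp (- (PI * t / 4))))) in HF.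
      apply hassum_ext with (2 := HF). intros j. unfold th, Q.
      rewrite !zpow_exp, <- !RtoC_mult, <- !exp_plus. do 2 f_equal.
      assert (D := tri_double j). apply (f_equal IZR) in D. rewrite !mult_IZR, minus_IZR in D.
      rewrite plus_IZR, mult_IZR. unfold s.
      replace (IZR (tri j) * - (2 * PI * t)) with (- (PI * t) * (2 * IZR (tri j))) by ring. rewrite D.
      field. lra.
    - apply hassum_ext with (2 := HG). intros k. unfold th, q.
      replace (RtoC (- exp (- (PI * / t)))) with (- (1) * RtoC (exp (- (PI * / t))))%C
        by (rewrite RtoC_opp; ring).
      rewrite zpow_mult; [| |apply RtoC_neq0; fold q; lra].
      + rewrite exp_pow, !zpow_exp, Cmult_comm, <- Cmult_assoc, <- RtoC_mult, <- exp_plus. do 3 f_equal.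
        assert (D := tri_double k). apply (f_equal IZR) in D. rewrite !mult_IZR, minus_IZR in D. unfold s.
        replace (INR 2) with 2 by (simpl; ring).
        replace (IZR (tri k) * (2 * - (PI * / t))) with (- (PI * / t) * (2 * IZR (tri k))) by ring. rewrite D.
        field. lra.
      + rewrite <- RtoC_opp. apply RtoC_neq0. lra. }
  rewrite VG, VF, <- !RtoC_mult in T. apply RtoC_inj in T.
  assert (Eq : q = exp (- (2 * PI * (/ t / 2)))) by (unfold q; f_equal; field; lra).
  assert (EQ2 := E_eta 2 t). assert (EQ1 := E_eta 1 t).
  assert (Eq2 := E_eta 2 (/ t / 2)). assert (Eq1 := E_eta 1 (/ t / 2)).
  rewrite <- Eq in Eq1, Eq2. fold Q in EQ1, EQ2. rewrite pow_1 in EQ1, Eq1.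
  simpl INR in *. rewrite Rmult_1_l in EQ1, Eq1.
  replace ((1 + 1) * t) with (2 * t) in EQ2 by ring. replace ((1 + 1) * (/ t / 2)) with (/ t) in Eq2 by (field; lra).
  rewrite EQ1, EQ2, Eq1, Eq2 in T.
  assert (N1 := eta_pos t Ht). assert (N2 := eta_pos (/ t) Hit).
  assert (X1 : exp (- (PI * t / 4)) * exp (PI * (2 * t) / 12) ^ 2 / exp (PI * t / 12) = 1).
  { unfold Rdiv at 1. rewrite <- exp_Ropp, exp_pow, <- !exp_plus, <- exp_0. f_equal. simpl INR. field. }
  assert (X2 : exp (PI * (/ t / 2) / 12) ^ 2 / exp (PI * / t / 12) = 1).
  { unfold Rdiv at 1. rewrite <- exp_Ropp, exp_pow, <- !exp_plus, <- exp_0. f_equal. simpl INR. field. lra. }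
  transitivity (exp (- (PI * t / 4)) * exp (PI * (2 * t) / 12) ^ 2 / exp (PI * t / 12) * (2 * (eta (2 * t) ^ 2 / eta t)));
    [rewrite X1; ring|].
  transitivity (exp (PI * (/ t / 2) / 12) ^ 2 / exp (PI * / t / 12) *
    (eta (/ t / 2) ^ 2 / eta (/ t) * (2 * lambda / sqrt s))); [|rewrite X2; ring].
  assert (Y1 := exp_pos (PI * t / 12)). assert (Y2 := exp_pos (PI * / t / 12)).
  assert (Y3 : 0 < sqrt s) by (apply sqrt_lt_R0; auto).
  etransitivity; [|etransitivity; [exact T|]]; field; repeat split; lra.
Qed.

(** [theta_eta] reads [c h(2t)^2 = h(t)] for [h(t) = eta(1/t) / (sqrt t eta(t))], and [h(1/t) = 1 / h(t)] turns this
    into [h(t)^3 = c]; finally [h(1) = 1]. *)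
Theorem eta_inversion (t : R) : 0 < t -> eta (/ t) = sqrt t * eta t.
Proof.
  destruct central_binomial_lim as (lambda & Hl).
  set (h := fun t => eta (/ t) / (sqrt t * eta t)). set (c := lambda * sqrt PI).
  assert (P := PI_RGT_0).
  assert (Hh : forall t, 0 < t -> 0 < h t).
  { intros x Hx. apply Rdiv_lt_0_compat; [apply eta_pos, Rinv_0_lt_compat, Hx|].
    apply Rmult_lt_0_compat; [apply sqrt_lt_R0|apply eta_pos]; auto. }
  assert (H2 : forall t, 0 < t -> c * h (2 * t) ^ 2 = h t).
  { intros x Hx. assert (T := theta_eta lambda x Hx Hl).
    assert (Hix : 0 < / x) by (apply Rinv_0_lt_compat; auto).
    assert (N1 := eta_pos x Hx). assert (N2 := eta_pos (/ x) Hix). assert (N3 := eta_pos (2 * x) ltac:(lra)).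
    assert (S1 : 0 < sqrt x) by (apply sqrt_lt_R0; auto). assert (S2 : 0 < sqrt PI) by (apply sqrt_lt_R0; auto).
    replace (sqrt (4 * x / PI)) with (2 * sqrt x / sqrt PI) in T.
    2: { rewrite sqrt_div, sqrt_mult by lra. replace 4 with (2 * 2) by ring. rewrite sqrt_square; lra. }
    unfold h, c. replace (/ (2 * x)) with (/ x / 2) by (field; lra).
    unfold Rdiv at 1. rewrite Rpow_mult_distr, pow_inv, Rpow_mult_distr, pow2_sqrt by lra.
    assert (Hx' : sqrt x * sqrt x = x) by (apply sqrt_sqrt; lra).
    transitivity (eta (/ x / 2) ^ 2 / eta (/ x) * (2 * lambda / (2 * sqrt x / sqrt PI)) *
      (sqrt x * eta (/ x) / (2 * x * eta (2 * x) ^ 2))).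
    - field. lra.
    - rewrite <- T. assert (Z : sqrt x / x = / sqrt x) by (rewrite <- Hx' at 2; field; lra).
      transitivity (eta (/ x) * / sqrt x * / eta x); [rewrite <- Z|]; field; lra. }
  assert (Hinv : forall t, 0 < t -> h (/ t) * h t = 1).
  { intros x Hx. assert (Hix : 0 < / x) by (apply Rinv_0_lt_compat; auto).
    assert (N1 := eta_pos x Hx). assert (N2 := eta_pos (/ x) Hix).
    assert (S1 : 0 < sqrt x) by (apply sqrt_lt_R0; auto).
    unfold h. rewrite Rinv_inv, sqrt_inv. field. lra. }
  (* The relation at [1/(2x)], inverted, reads [c h(2x) = h(x)^2]; with [c h(2x)^2 = h(x)] it gives
     [h(x)^4 = c h(x)]. *)
  assert (H3 : forall t, 0 < t -> h t ^ 3 = c).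
  { intros x Hx. assert (A := H2 x Hx). assert (A2 := H2 (/ (2 * x)) ltac:(apply Rinv_0_lt_compat; lra)).
    replace (2 * / (2 * x)) with (/ x) in A2 by (field; lra).
    assert (B1 := Hinv x Hx). assert (B2 := Hinv (2 * x) ltac:(lra)).
    assert (Q1 := Hh x Hx). assert (Q2 := Hh (2 * x) ltac:(lra)).
    assert (D : c * h (2 * x) = h x ^ 2).
    { rewrite <- (Rmult_1_l (h x ^ 2)), <- B2, <- A2.
      transitivity (c * h (2 * x) * (h (/ x) * h x) ^ 2); [rewrite B1; ring|ring]. }
    apply Rmult_eq_reg_r with (h x); [|lra]. rewrite <- A at 3.
    transitivity ((h x ^ 2) ^ 2); [ring|]. rewrite <- D. ring. }
  assert (H1 : h 1 = 1).
  { assert (A := Hinv 1 Rlt_0_1). rewrite Rinv_1 in A. assert (B := Hh 1 Rlt_0_1). nra. }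
  intros Ht. assert (A := H3 t Ht). rewrite <- (H3 1 Rlt_0_1), H1 in A.
  assert (B := Hh t Ht). assert (D : h t = 1) by nra.
  assert (N1 := eta_pos t Ht). assert (S1 : 0 < sqrt t) by (apply sqrt_lt_R0; auto).
  replace (eta (/ t)) with (h t * (sqrt t * eta t)) by (unfold h; field; lra). rewrite D. ring.
Qed.

Lemma E_eta_pow (k : nat) (t : R) :
  E (exp (- (2 * PI * t)) ^ k) = exp (PI * t / 12) ^ k * eta (INR k * t).
Proof. rewrite E_eta, exp_pow. do 2 f_equal. field. Qed.

(** With [a = exp (PI * t / 12)] the nome is [a^(-24)], and [E] at its [k]-th power is [a^k] times
    [eta (k t)]; in the quotients below all powers of [a] cancel. *)
Lemma nome_pow (t : R) : exp (- (2 * PI * t)) = / exp (PI * t / 12) ^ 24.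
Proof. rewrite exp_pow, <- exp_Ropp. f_equal. simpl INR. field. Qed.

Lemma eta_swap (x y : R) : 0 < x -> x * y = 1 -> eta y = sqrt x * eta x.
Proof.
  intros Hx H. rewrite <- eta_inversion by auto. f_equal. apply Rmult_eq_reg_l with x; [|lra].
  rewrite H, Rinv_r; lra.
Qed.

(** * Special values *)

Definition haupt6 (q : R) : R := E q ^ 5 * E (q ^ 3) / (q * (E (q ^ 2) * E (q ^ 6) ^ 5)).

Lemma haupt6_inv (q : R) : 0 < q < 1 -> 0 < haupt6 q /\
  q * (E (q ^ 2) * E (q ^ 6) ^ 5) / (E q ^ 5 * E (q ^ 3)) = / haupt6 q /\
  q * (E q ^ 4 * E (q ^ 6) ^ 8) / (E (q ^ 2) ^ 8 * E (q ^ 3) ^ 4) = / (haupt6 q + 9) /\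
  q * (E q ^ 3 * E (q ^ 6) ^ 9) / (E (q ^ 2) ^ 3 * E (q ^ 3) ^ 9) = / (haupt6 q + 8).
Proof.
  intros Hq. destruct (level6_hauptmoduln q Hq) as (H1 & H2).
  fold (haupt6 q) in H1, H2. rewrite <- H1, <- H2.
  assert (P1 := E_pos q Hq). assert (P2 := E_pow_pos 2 q ltac:(lia) ltac:(lra)).
  assert (P3 := E_pow_pos 3 q ltac:(lia) ltac:(lra)). assert (P6 := E_pow_pos 6 q ltac:(lia) ltac:(lra)).
  split; [|split; [|split]].
  - unfold haupt6. apply Rdiv_lt_0_compat; repeat apply Rmult_lt_0_compat; try apply pow_lt; lra.
  - unfold haupt6. field. lra.
  - field. lra.
  - field. lra.
Qed.

Section AtNome.
Variable t : R.
Hypothesis Ht : 0 < t.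
Let q := exp (- (2 * PI * t)).

Lemma nome_01 : 0 < q < 1.
Proof. apply exp_neg_01. assert (P := PI_RGT_0). nra. Qed.

Lemma E_nome (k : nat) : E (q ^ k) = exp (PI * t / 12) ^ k * eta (INR k * t).
Proof. apply E_eta_pow. Qed.

Lemma E_nome1 : E q = exp (PI * t / 12) * eta t.
Proof. rewrite <- (pow_1 q), E_nome. simpl INR. rewrite Rmult_1_l. ring. Qed.

Lemma haupt6_eta :
  haupt6 q = eta t ^ 5 * eta (3 * t) / (eta (2 * t) * eta (6 * t) ^ 5) /\
  haupt6 q + 9 = eta (2 * t) ^ 8 * eta (3 * t) ^ 4 / (eta t ^ 4 * eta (6 * t) ^ 8) /\
  haupt6 q + 8 = eta (2 * t) ^ 3 * eta (3 * t) ^ 9 / (eta t ^ 3 * eta (6 * t) ^ 9).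
Proof.
  assert (Hq := nome_01). destruct (level6_hauptmoduln q Hq) as (H1 & H2).
  fold (haupt6 q) in H1, H2. rewrite <- H1, <- H2. unfold haupt6.
  rewrite !E_nome, E_nome1.
  replace (INR 2) with 2 by (simpl; ring).
  replace (INR 3) with 3 by (simpl; ring). replace (INR 6) with 6 by (simpl; ring).
  unfold q. rewrite nome_pow. assert (A := exp_pos (PI * t / 12)). set (a := exp (PI * t / 12)) in *.
  assert (N1 := eta_pos t Ht). assert (N2 := eta_pos (2 * t) ltac:(lra)).
  assert (N3 := eta_pos (3 * t) ltac:(lra)). assert (N6 := eta_pos (6 * t) ltac:(lra)).
  repeat split; field; lra.
Qed.
End AtNome.

Lemma sqrt_pow4 (x : R) : 0 <= x -> sqrt x ^ 4 = x ^ 2.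
Proof. intros H. rewrite <- (pow2_sqrt x H) at 2. ring. Qed.

Lemma inv_sqrt_pos (x : R) : 0 < x -> 0 < / sqrt x.
Proof. intros H. apply Rinv_0_lt_compat, sqrt_lt_R0, H. Qed.

Lemma inv_sqrt_sq (x : R) : 0 < x -> (/ sqrt x) ^ 2 = / x.
Proof. intros H. rewrite pow_inv, pow2_sqrt by lra. reflexivity. Qed.

(** Since [6 t^2 = 1], inversion exchanges [t] with [6 t] and [2 t] with [3 t], which determines the
    whole quotient. *)
Lemma haupt6_sqrt6 : haupt6 (exp (- (2 * PI * / sqrt 6))) = 6 * sqrt 2.
Proof.
  assert (Ht := inv_sqrt_pos 6 ltac:(lra)). assert (T2 := inv_sqrt_sq 6 ltac:(lra)).
  set (t := / sqrt 6) in *. destruct (haupt6_eta t Ht) as (H & _). rewrite H.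
  rewrite (eta_swap t (6 * t)), (eta_swap (2 * t) (3 * t)) by nra.
  assert (N1 := eta_pos t Ht). assert (N2 := eta_pos (2 * t) ltac:(lra)).
  rewrite sqrt_mult by lra.
  assert (S1 : 0 < sqrt t) by (apply sqrt_lt_R0; auto). assert (S4 := sqrt_pow4 t ltac:(lra)).
  transitivity (sqrt 2 / sqrt t ^ 4); [field; lra|]. rewrite S4, T2. field.
Qed.

(** Inversion only relates [t] and [3 t]. Eliminating the other eta values between the three
    expressions of [haupt6_eta] gives [27 (X+8)^2 = X^2 (X+9)], that is
    [(X^2 - 24 X - 288)(X + 6) = 0], with a single positive root. *)
Lemma haupt6_sqrt3 : haupt6 (exp (- (2 * PI * / sqrt 3))) = 12 + 12 * sqrt 3.
Proof.
  assert (Ht := inv_sqrt_pos 3 ltac:(lra)). assert (T2 := inv_sqrt_sq 3 ltac:(lra)).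
  set (t := / sqrt 3) in *. destruct (haupt6_inv _ (nome_01 t Ht)) as (HX & _).
  destruct (haupt6_eta t Ht) as (H1 & H2 & H3). set (X := haupt6 _) in *. clearbody X.
  rewrite (eta_swap t (3 * t)) in H1, H2, H3 by nra.
  assert (N1 := eta_pos t Ht). assert (N2 := eta_pos (2 * t) ltac:(lra)). assert (N6 := eta_pos (6 * t) ltac:(lra)).
  assert (S1 : 0 < sqrt t) by (apply sqrt_lt_R0; auto).
  assert (S12 : sqrt t ^ 12 = / 27).
  { replace (sqrt t ^ 12) with ((sqrt t ^ 4) ^ 3) by ring. rewrite sqrt_pow4, T2 by lra. field. }
  assert (R : 27 * (X + 8) ^ 2 = X ^ 2 * (X + 9)).
  { transitivity (27 * sqrt t ^ 12 * (X ^ 2 * (X + 9))); [|rewrite S12; field].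
    rewrite H2, H3, H1. field. lra. }
  assert (S3 : sqrt 3 * sqrt 3 = 3) by (apply sqrt_sqrt; lra). assert (S30 := sqrt_lt_R0 3 ltac:(lra)).
  assert (Q : (X - 12 - 12 * sqrt 3) * ((X - 12 + 12 * sqrt 3) * (X + 6)) = 0) by nra.
  apply Rmult_integral in Q. destruct Q as [Q|Q]; [lra|]. exfalso.
  apply Rmult_integral in Q. destruct Q; nra.
Qed.

(** Now [t] and [2 t] are related, and the elimination yields [X^3 (X+8) = 64 (X+9)^3]. This quartic
    factors as [(X^2 - 72 X - 648)(X^2 + 16 X + 72)], again with one positive root. *)
Lemma haupt6_sqrt2 : haupt6 (exp (- (2 * PI * / sqrt 2))) = 36 + 18 * sqrt 6.
Proof.
  assert (Ht := inv_sqrt_pos 2 ltac:(lra)). assert (T2 := inv_sqrt_sq 2 ltac:(lra)).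
  set (t := / sqrt 2) in *. destruct (haupt6_inv _ (nome_01 t Ht)) as (HX & _).
  destruct (haupt6_eta t Ht) as (H1 & H2 & H3). set (X := haupt6 _) in *. clearbody X.
  rewrite (eta_swap t (2 * t)) in H1, H2, H3 by nra.
  assert (N1 := eta_pos t Ht). assert (N3 := eta_pos (3 * t) ltac:(lra)). assert (N6 := eta_pos (6 * t) ltac:(lra)).
  assert (S1 : 0 < sqrt t) by (apply sqrt_lt_R0; auto).
  assert (S24 : sqrt t ^ 24 = / 64).
  { replace (sqrt t ^ 24) with ((sqrt t ^ 4) ^ 6) by ring. rewrite sqrt_pow4, T2 by lra. field. }
  assert (R : X ^ 3 * (X + 8) = 64 * (X + 9) ^ 3).
  { transitivity (64 * (sqrt t ^ 24 * (X ^ 3 * (X + 8)))); [rewrite S24; field|].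
    rewrite H2, H3, H1. field. lra. }
  assert (S6 : sqrt 6 * sqrt 6 = 6) by (apply sqrt_sqrt; lra). assert (S60 := sqrt_lt_R0 6 ltac:(lra)).
  assert (Q : (X - 36 - 18 * sqrt 6) * ((X - 36 + 18 * sqrt 6) * (X ^ 2 + 16 * X + 72)) = 0).
  { transitivity ((X ^ 2 - 72 * X + 1296 - 324 * (sqrt 6 * sqrt 6)) * (X ^ 2 + 16 * X + 72)); [ring|].
    rewrite S6. transitivity (X ^ 3 * (X + 8) - 64 * (X + 9) ^ 3); [ring|lra]. }
  apply Rmult_integral in Q. destruct Q as [Q|Q]; [lra|]. exfalso.
  apply Rmult_integral in Q. destruct Q as [Q|Q]; [|nra].
  assert (sqrt 6 > 2) by nra. nra.
Qed.

(** Inversion exchanges [t] and [5 t], so the right-hand side of [r5_relation] is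
    [t^(-3) = 5 sqrt 5]. As [11 + 5 sqrt 5 = 2 alpha0^5], the value [y] solves
    [y^2 + 2 alpha0^5 y = 1], and completing the square gives its positive root. *)
Lemma r5_sqrt5 : r5 (exp (- (2 * PI * / sqrt 5))) = sqrt (alpha0 ^ 10 + 1) - alpha0 ^ 5.
Proof.
  assert (Ht := inv_sqrt_pos 5 ltac:(lra)).
  assert (T2 := inv_sqrt_sq 5 ltac:(lra)). assert (S5 : sqrt 5 * sqrt 5 = 5) by (apply sqrt_sqrt; lra).
  assert (S50 := sqrt_lt_R0 5 ltac:(lra)).
  assert (Tt : / (/ sqrt 5 * / sqrt 5 * / sqrt 5) = 5 * sqrt 5) 
    by (transitivity (sqrt 5 * sqrt 5 * sqrt 5); [field; lra|rewrite S5; reflexivity]).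
  set (t := / sqrt 5) in *. assert (Hq := nome_01 t Ht).
  assert (Rel := r5_relation _ Hq).
  rewrite E_nome, E_nome1 in Rel. replace (INR 5) with 5 in Rel by (simpl; ring).
  rewrite (eta_swap t (5 * t)) in Rel by nra.
  assert (Hy : 0 < r5 (exp (- (2 * PI * t)))).
  { rewrite r5_tprod by lra. apply Rmult_lt_0_compat; [lra|].
    apply Rdiv_lt_0_compat; apply pow_lt, tprod_pos0; lia || lra. }
  set (y := r5 _) in *. rewrite nome_pow in Rel.
  assert (A := exp_pos (PI * t / 12)). set (a := exp (PI * t / 12)) in *.
  assert (N1 := eta_pos t Ht). assert (S1 : 0 < sqrt t) by (apply sqrt_lt_R0; auto).
  assert (Rel2 : / y - 11 - y = 5 * sqrt 5).
  { rewrite Rel, <- Tt. assert (S2 : sqrt t * sqrt t = t) by (apply sqrt_sqrt; lra).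
    transitivity (/ ((sqrt t * sqrt t) * (sqrt t * sqrt t) * (sqrt t * sqrt t))); [field; lra|].
    rewrite S2. reflexivity. }
  assert (A5 : 2 * alpha0 ^ 5 = 11 + 5 * sqrt 5).
  { unfold alpha0. replace (2 * ((1 + sqrt 5) / 2) ^ 5) with
      ((1 + 5 * sqrt 5 + 10 * (sqrt 5 * sqrt 5) + 10 * (sqrt 5 * sqrt 5) * sqrt 5 +
        5 * (sqrt 5 * sqrt 5) ^ 2 + (sqrt 5 * sqrt 5) ^ 2 * sqrt 5) / 16) by field. rewrite S5. field. }
  replace (alpha0 ^ 10 + 1) with ((y + alpha0 ^ 5) ^ 2).
  - rewrite sqrt_pow2; [ring|]. nra.
  - assert (Y : 1 = y * (2 * alpha0 ^ 5) + y ^ 2).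
    { rewrite A5. rewrite <- (Rinv_r y) by lra. replace (/ y) with (11 + 5 * sqrt 5 + y) by lra. ring. }
    transitivity (alpha0 ^ 10 + (y * (2 * alpha0 ^ 5) + y ^ 2)); [ring|rewrite <- Y; reflexivity].
Qed.

(** The nome is [exp(-PI / sqrt 2)], so [8 t^2 = 1]: inversion exchanges [t] with [8 t] and [2 t]
    with [4 t]. *)
Lemma level8_value (q : R) : q = exp (- (2 * PI * / (2 * sqrt 2))) ->
  q * (E (q ^ 2) ^ 2 * E (q ^ 8) ^ 4) / (E q ^ 4 * E (q ^ 4) ^ 2) = / (4 * sqrt 2).
Proof.
  assert (S2 : sqrt 2 * sqrt 2 = 2) by (apply sqrt_sqrt; lra). assert (S20 := sqrt_lt_R0 2 ltac:(lra)).
  assert (Ht : 0 < / (2 * sqrt 2)) by (apply Rinv_0_lt_compat; lra).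
  assert (T2 : / (2 * sqrt 2) * / (2 * sqrt 2) = / 8).
  { rewrite <- Rinv_mult. f_equal. nra. }
  assert (Tv : / (4 * sqrt 2) = / (2 * sqrt 2) / 2) by (field; lra). rewrite Tv.
  set (t := / (2 * sqrt 2)) in *. intros ->. rewrite !E_nome, E_nome1.
  replace (INR 2) with 2 by (simpl; ring). replace (INR 4) with 4 by (simpl; ring).
  replace (INR 8) with 8 by (simpl; ring).
  rewrite (eta_swap t (8 * t)), (eta_swap (2 * t) (4 * t)) by nra.
  rewrite nome_pow. assert (A := exp_pos (PI * t / 12)). set (a := exp (PI * t / 12)) in *.
  assert (N1 := eta_pos t Ht). assert (N2 := eta_pos (2 * t) ltac:(lra)).
  assert (R2 := pow2_sqrt (2 * t) ltac:(lra)). assert (R4 := sqrt_pow4 t ltac:(lra)).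
  assert (S1 : 0 < sqrt (2 * t)) by (apply sqrt_lt_R0; lra).
  transitivity (sqrt t ^ 4 / sqrt (2 * t) ^ 2); [field; lra|]. rewrite R4, R2. field. lra.
Qed.

Lemma level9_value (q : R) : q = exp (- (2 * PI * / 3)) -> q * E (q ^ 9) ^ 3 / E q ^ 3 = / (3 * sqrt 3).
Proof.
  assert (S3 : sqrt 3 * sqrt 3 = 3) by (apply sqrt_sqrt; lra). assert (S30 := sqrt_lt_R0 3 ltac:(lra)).
  intros ->. rewrite !E_nome, E_nome1. replace (INR 9) with 9 by (simpl; ring).
  rewrite (eta_swap (/ 3) (9 * / 3)) by lra.
  rewrite nome_pow. assert (A := exp_pos (PI * / 3 / 12)). set (a := exp _) in *.
  assert (N1 := eta_pos (/ 3) ltac:(lra)). rewrite sqrt_inv.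
  transitivity (/ (sqrt 3 * sqrt 3 * sqrt 3)); [field; lra|]. rewrite S3. reflexivity.
Qed.

Theorem theorem1 : forall q : R, 0 < q < 1 ->
  (* (1) *)
  (is_RInt (fun t => E t ^ 5 / E (t ^ 5) * r5 t / t) 0 q (r5 q) /\
   (q = exp (- (2 * PI) / sqrt 5) -> r5 q = sqrt (alpha0 ^ 10 + 1) - alpha0 ^ 5)) /\
  (* (2) *)
  (let v := q * (E (q ^ 2) * E (q ^ 6) ^ 5) / (E q ^ 5 * E (q ^ 3)) in
   is_RInt (fun t => E (t ^ 2) ^ 8 * E (t ^ 3) ^ 6 / E t ^ 10) 0 q v /\
   (q = exp (- (2 * PI) / sqrt 6) -> v = sqrt 2 / 12) /\
   (q = exp (- (2 * PI) / sqrt 3) -> v = (sqrt 3 - 1) / 24) /\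
   (q = exp (- (2 * PI) / sqrt 2) -> v = (sqrt 6 - 2) / 36)) /\
  (* (3) *)
  (let v := q * (E q ^ 4 * E (q ^ 6) ^ 8) / (E (q ^ 2) ^ 8 * E (q ^ 3) ^ 4) in
   is_RInt (fun t => E t ^ 8 * E (t ^ 6) ^ 6 / E (t ^ 2) ^ 10) 0 q v /\
   (q = exp (- (2 * PI) / sqrt 6) -> v = (sqrt 2 - 1) ^ 2 / 3) /\
   (q = exp (- (2 * PI) / sqrt 3) -> v = (2 - sqrt 3) ^ 2 / 3) /\
   (q = exp (- (2 * PI) / sqrt 2) -> v = (sqrt 6 - 2) ^ 2 / 18)) /\
  (* (4) *)
  (let v := q * (E q ^ 3 * E (q ^ 6) ^ 9) / (E (q ^ 2) ^ 3 * E (q ^ 3) ^ 9) in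
   is_RInt (fun t => E t ^ 6 * E (t ^ 6) ^ 8 / E (t ^ 3) ^ 10) 0 q v /\
   (q = exp (- (2 * PI) / sqrt 6) -> v = (3 * sqrt 2 - 4) / 4) /\
   (q = exp (- (2 * PI) / sqrt 3) -> v = (sqrt 3 - 1) ^ 3 / 16) /\
   (q = exp (- (2 * PI) / sqrt 2) -> v = (sqrt 6 - 2) ^ 3 / 8)) /\
  (* (5) *)
  (let v := q * (E (q ^ 2) ^ 2 * E (q ^ 8) ^ 4) / (E q ^ 4 * E (q ^ 4) ^ 2) in
   is_RInt (fun t => E (t ^ 2) ^ 8 * E (t ^ 4) ^ 4 / E t ^ 8) 0 q v /\
   (q = exp (- PI / sqrt 2) -> v = 1 / sqrt 32)) /\
  (* (6) *)
  (let v := q * E (q ^ 9) ^ 3 / E q ^ 3 in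
   is_RInt (fun t => E (t ^ 3) ^ 10 / E t ^ 6) 0 q v /\
   (q = exp (- (2 * PI) / 3) -> v = 1 / (3 * sqrt 3))).
Proof.
  intros q Hq.
  destruct (haupt6_inv q Hq) as (HX & V2 & V3 & V4).
  assert (N : forall d, - (2 * PI) / d = - (2 * PI * / d)) by (intros d; unfold Rdiv; ring).
  assert (S2 : sqrt 2 * sqrt 2 = 2) by (apply sqrt_sqrt; lra). assert (S20 := sqrt_lt_R0 2 ltac:(lra)).
  assert (S3 : sqrt 3 * sqrt 3 = 3) by (apply sqrt_sqrt; lra). assert (S30 := sqrt_lt_R0 3 ltac:(lra)).
  assert (S6 : sqrt 6 * sqrt 6 = 6) by (apply sqrt_sqrt; lra). assert (S60 := sqrt_lt_R0 6 ltac:(lra)).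
  (* The level 6 right-hand sides are the reciprocals of [haupt6 q] plus 0, 9 or 8, so a claimed
     value is verified by multiplying it with the known number. *)
  assert (I : forall x y, 0 < x -> x * y = 1 -> / x = y).
  { intros x y Hx Hxy. apply Rmult_eq_reg_l with x; [rewrite Hxy, Rinv_r|]; lra. }
  split; [|split; [|split; [|split; [|split]]]].
  - split; [apply integral_level5, Hq|]. intros ->. rewrite N. apply r5_sqrt5.
  - cbv zeta. split; [apply integral_level6_a, Hq|]. rewrite V2. clear V2 V3 V4. repeat split; intros ->; rewrite N in *.
    + rewrite haupt6_sqrt6. apply I; nra.
    + rewrite haupt6_sqrt3. apply I; nra.
    + rewrite haupt6_sqrt2. apply I; nra.
  - cbv zeta. split; [apply integral_level6_b, Hq|]. rewrite V3. clear V2 V3 V4. repeat split; intros ->; rewrite N in *.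
    + rewrite haupt6_sqrt6. apply I; nra.
    + rewrite haupt6_sqrt3. apply I; nra.
    + rewrite haupt6_sqrt2. apply I; nra.
  - cbv zeta. split; [apply integral_level6_c, Hq|]. rewrite V4. clear V2 V3 V4. repeat split; intros ->; rewrite N in *.
    + rewrite haupt6_sqrt6. apply I; nra.
    + rewrite haupt6_sqrt3. apply I; nra.
    + rewrite haupt6_sqrt2. apply I; nra.
  - cbv zeta. split; [apply integral_level8, Hq|]. intros Eq. rewrite level8_value.
    + replace 32 with (4 * 4 * 2) by ring. rewrite sqrt_mult, sqrt_square by lra. field. lra.
    + rewrite Eq. f_equal. field. lra.
  - cbv zeta. split; [apply integral_level9, Hq|]. intros Eq. rewrite level9_value; [field; lra|]. rewrite Eq. apply f_equal, N.
Qed.
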